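(* Assume that (A1) and (A2) hold and that the Lévy process $\xi$ does not drift to $-\infty$. Then $$\left(\frac{X_n(\lfloor a_n t\rfloor)}{n};\ t\ge 0\right)\ \xrightarrow[n\to\infty]{(d)}\ (Y(t);\ t\ge0)$$ in distribution in $\mathbb D(\mathbb R_+,\mathbb R)$.
   Context: Let $\mathbb N=\{1,2,\dots\}$. For every $n\ge1$ let $(p_{n,k})_{k\ge1}$ be nonnegative reals with $\sum_{k\ge1}p_{n,k}=1$, and let $(X_n(k))_{k\ge0}$ be the discrete-time Markov chain on $\mathbb N$ with $X_n(0)=n$ and $\mathbb P(X_n(k+1)=j\mid X_n(k)=i)=p_{i,j}$. Let $\Pi_n^*(dx)=\sum_{k\ge1}p_{n,k}\,\delta_{\ln k-\ln n}(dx)$ (the law of $\ln(X_n(1)/n)$). Let $(a_n)_{n\ge0}$ be positive reals, regularly varying with index $\gamma>0$, i.e. $a_{\lfloor xn\rfloor}/a_n\to x^\gamma$ for every $x>0$. Let $\Pi$ be a measure on $\mathbb R\setminus\{0\}$ with $\Pi(\{-1,1\})=0$ and $\int(1\wedge x^2)\,\Pi(dx)<\infty$. (A1): for every continuous function $f$ with compact support in $[0,\infty]\setminus\{1\}$, $a_n\,\mathbb E[f(X_n(1)/n)]\to\int_{\mathbb R}f(e^x)\,\Pi(dx)$ as $n\to\infty$ (i.e. $a_n\Pi_n^*\to\Pi$ vaguely on $[-\infty,\infty]\setminus\{0\}$). (A2): there exist $b\in\mathbb R$ and $\sigma^2\ge0$ such that $a_n\int_{-1}^1x\,\Pi_n^*(dx)\to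 b$ and $a_n\int_{-1}^1x^2\,\Pi_n^*(dx)\to\sigma^2+\int_{-1}^1x^2\,\Pi(dx)$. Let $\xi$ be the Lévy process with $\xi(0)=0$ and $\mathbb E[e^{i\lambda\xi(t)}]=e^{t\Phi(\lambda)}$, where $\Phi(\lambda)=-\frac12\sigma^2\lambda^2+ib\lambda+\int_{\mathbb R}(e^{i\lambda x}-1-i\lambda x\mathbb 1_{|x|\le1})\,\Pi(dx)$. We say $\xi$ drifts to $-\infty$ if $\xi(t)\to-\infty$ a.s. Let $I_\infty=\int_0^\infty e^{\gamma\xi(s)}ds\in(0,\infty]$, $\tau(t)=\inf\{u\ge0:\int_0^ue^{\gamma\xi(s)}ds>t\}$ (with $\inf\emptyset=\infty$), and $Y(t)=e^{\xi(\tau(t))}$ for $0\le t<I_\infty$, $Y(t)=0$ for $t\ge I_\infty$ (the Lamperti transform of $\xi$). $\mathbb D(\mathbb R_+,\mathbb R)$ is the space of càdlàg functions with the Skorokhod $J_1$ topology. *)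

(* Defs.v *)
From HB Require Import structures.
From mathcomp Require Import all_boot all_order all_algebra.
From mathcomp Require Import all_classical all_reals all_analysis.
Set Implicit Arguments. Unset Strict Implicit. Unset Printing Implicit Defensive.
Import Order.TTheory GRing.Theory Num.Theory.
Import numFieldNormedType.Exports.
Local Open Scope classical_set_scope.
Local Open Scope ring_scope.

Section Defs.
Variable R : realType.

(** [psum p n h] = \sum_{k >= 1} p_{n,k} h(k)  (expectation of h(X_n(1))). *)
Definition psum (p : nat -> nat -> R) (n : nat) (h : nat -> R) : R :=
  lim ((fun m => \sum_(1 <= k < m) p n k * h k) @ \oo).

Definition logjump (n k : nat) : R := ln (k%:R) - ln (n%:R).

Definition RePhi (Pi : {measure set R -> \bar R}) (sigma2 : R) (lam : R) : R :=
  - (sigma2 / 2) * lam ^+ 2 + Rintegral Pi setT (fun x => cos (lam * x) - 1).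
Definition ImPhi (Pi : {measure set R -> \bar R}) (b : R) (lam : R) : R :=
  b * lam + Rintegral Pi setT
    (fun x => sin (lam * x) - lam * x * (if `|x| <= 1 then 1 else 0)).

Definition cadlag (w : R -> R) : Prop :=
  forall t, 0 <= t ->
    (w x @[x --> t^'+] --> w t) /\ (0 < t -> cvg (w x @[x --> t^'-])).

(** Skorokhod J1 convergence in D(R_+, R) of w_k to w (Jacod-Shiryaev VI.1.14):
    there are time changes lambda_k (continuous strictly increasing bijections
    of [0,oo) onto itself) with sup_t |lambda_k t - t| -> 0 and, for every T,
    sup_{t <= T} |w_k (lambda_k t) - w t| -> 0. *)
Definition time_change (l : R -> R) : Prop :=
  l 0 = 0 /\ {within `[0, +oo[, continuous l} /\
  (forall s t, 0 <= s -> s < t -> l s < l t) /\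
  (forall y, 0 <= y -> exists2 t, 0 <= t & l t = y).

Definition J1_cvg (wk : nat -> R -> R) (w : R -> R) : Prop :=
  exists lk : nat -> R -> R,
    (forall k, time_change (lk k)) /\
    (forall e, 0 < e -> \forall k \near \oo, forall t, 0 <= t -> `|lk k t - t| <= e) /\
    (forall T e, 0 < e ->
       \forall k \near \oo, forall t, 0 <= t <= T -> `|wk k (lk k t) - w t| <= e).

Definition J1_bounded_continuous (F : (R -> R) -> R) : Prop :=
  (exists M, forall w, `|F w| <= M) /\
  (forall w w', (forall t, 0 <= t -> w t = w' t) -> F w = F w') /\
  (forall wk w, (forall k, cadlag (wk k)) -> cadlag w -> J1_cvg wk w ->
     F (wk k) @[k --> \oo] --> F w).

Definition lamperti_I (gamma : R) (w : R -> R) (u : R) : \bar R :=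
  (\int[lebesgue_measure]_(s in `[0%R, u]%classic) (expR (gamma * w s))%:E)%E.
Definition lamperti_Iinf (gamma : R) (w : R -> R) : \bar R :=
  (\int[lebesgue_measure]_(s in `[0%R, +oo[%classic) (expR (gamma * w s))%:E)%E.
Definition lamperti_tau (gamma : R) (w : R -> R) (t : R) : R :=
  inf [set u | 0 <= u /\ (t%:E < lamperti_I gamma w u)%E].
Definition lamperti (gamma : R) (w : R -> R) (t : R) : R :=
  if (t%:E < lamperti_Iinf gamma w)%E then expR (w (lamperti_tau gamma w t))
  else 0.

Definition levy_process d (Om : measurableType d) (Q : probability Om R)
    (xi : R -> Om -> R) (Pi : {measure set R -> \bar R}) (b sigma2 : R) : Prop :=
  (forall t, measurable_fun setT (xi t)) /\
  (forall om, xi 0 om = 0) /\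
  (forall om, cadlag (xi ^~ om)) /\
  (forall (k : nat) (t : nat -> R) (B : nat -> set R),
     0 <= t 0 -> (forall j, (j < k)%N -> t j < t j.+1) ->
     (forall j, measurable (B j)) ->
     fine (Q [set om | forall j, (j < k)%N -> xi (t j.+1) om - xi (t j) om \in B j])
     = \prod_(j < k) fine (Q [set om | xi (t j.+1) om - xi (t j) om \in B j])) /\
  (forall s t (B : set R), 0 <= s -> 0 <= t -> measurable B ->
     Q [set om | xi (t + s) om - xi t om \in B] = Q [set om | xi s om \in B]) /\
  (* E[exp(i lam xi(t))] = exp(t Phi(lam)) *)
  (forall t lam, 0 <= t ->
     (\int[Q]_om (cos (lam * xi t om))%:E =
        (expR (t * RePhi Pi sigma2 lam) * cos (t * ImPhi Pi b lam))%:E)%E /\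
     (\int[Q]_om (sin (lam * xi t om))%:E =
        (expR (t * RePhi Pi sigma2 lam) * sin (t * ImPhi Pi b lam))%:E)%E).

Definition markov_chains d (Om : measurableType d) (P : probability Om R)
    (p : nat -> nat -> R) (X : nat -> nat -> Om -> nat) : Prop :=
  (forall n k i, measurable [set om | X n k om = i]) /\
  (forall n k om, (0 < n)%N -> (0 < X n k om)%N) /\
  (forall n (k : nat) (f : nat -> nat), (0 < n)%N -> (forall j, (0 < f j)%N) ->
     fine (P [set om | forall j, (j <= k)%N -> X n j om = f j])
     = if f 0%N == n then \prod_(j < k) p (f j) (f j.+1) else 0).

End Defs.
Arguments logjump {R}.

(* Main.v *)
(** It is enough to show that liminf E F(Y_n) >= E F(Y) when 0 <= F <= M: this is
applied to B + F and to B - F.  From below, F is replaced by a regularization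
that is Lipschitz for Skorokhod closeness.

Consider the chain in the clock in which a step from x lasts 1 / a_x, and cut
this clock into cells of length h.  The increments of ln (X_n / n) over the cells
converge jointly to independent copies of xi(h).  Indeed, for a trigonometric
polynomial f, the function q(s, x) = E f(x + xi(s)) solves the backward equation
of the chain up to o(1 / a_x) because the characteristic exponent of xi is the
limit of a_n E[exp(i lambda ln (X_n(1) / n)) - 1]; Bernstein polynomials in the
sine function then give all continuous functionals of the increments.

The Lyapunov function z^2 / (1 + z^2) shows that, when h is small, with high
probability the chain performs in every cell at most one displacement larger than
eta.  Then Y_n is Skorokhod close to the step path that takes the sampled values
exp(z_j) during times h exp(gamma z_j), and the Lamperti transform of xi is close
to the step path built in the same way from the values of xi on the grid.

For the latter, the clock I_oo has to be infinite almost surely.  Otherwise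
p = E[(1 - exp(- I_1)) 1{I_oo < oo}] > 0, where I_u is the clock at time u, and the
independence of the increments yields
P(exists t >= m, xi(t) > - K) p <= E[(1 - exp(- c_K (I_oo - I_m))) 1{I_oo < oo}],
which tends to 0 as m -> oo, so that xi drifts to -oo. *)
Require Import Defs.
From HB Require Import structures.
From mathcomp Require Import all_boot all_order all_algebra.
From mathcomp Require Import all_classical all_reals all_analysis.
From mathcomp Require Import measurable_realfun ring lra zify.
Set Implicit Arguments. Unset Strict Implicit. Unset Printing Implicit Defensive.
Import Order.TTheory GRing.Theory Num.Theory.
Import numFieldNormedType.Exports.
Local Open Scope classical_set_scope.
Local Open Scope ring_scope.

(** * Expectations of bounded functions *)

Section Expectation.
Context d (T : measurableType d) (R : realType) (P : probability T R).
Implicit Types f g : T -> R.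

(** In the clock where a step from $x$ lasts $1/a_x$, every position has asymptotically the same
    generator in logarithmic scale, that of $\xi$; in the original clock each step lasts $1/a_n$,
    and the ratio $a_x/a_n\approx e^{\gamma z}$, $z=\ln(x/n)$, is the rate of the Lamperti time
    change. The grid samples do not tell where inside a cell a jump occurs: this costs a time shift
    of at most about one cell, which $J_1$ tolerates for one jump but not for two, hence the count
    of displacements per cell. Lower bounds replace a tightness argument: on runs that leave the
    range or behave badly a nonnegative functional is simply bounded below by 0, and the matching
    bound for $B-F$ shows that no mass was lost. The regularization is taken from below for the same
    reason, and it provides a modulus of continuity although $F$ is only sequentially continuous at
    each path. Trigonometric polynomials enter because the semigroup of $\xi$ is explicit on them;
    polynomials in a sine are of this kind and still separate the points of a compact interval. *)

Definition bounded_mfun f :=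
  measurable_fun setT f /\ exists M, forall x, `|f x| <= M.

Definition Ex f : R := Rintegral P setT f.

Lemma bmfun_integrable f : bounded_mfun f -> P.-integrable setT (EFin \o f).
Proof.
case=> mf [M fM]; apply: measurable_bounded_integrable => //.
  by rewrite [X in (X < _)%E](probability_setT P) ltry.
exists M; split; rewrite ?num_real // => y My x _ /=.
by rewrite (le_trans (fM x)) // ltW.
Qed.

Lemma bmfun_cst c : bounded_mfun (fun=> c).
Proof. by split=> //; exists `|c|. Qed.

Lemma bmfunD f g : bounded_mfun f -> bounded_mfun g ->
  bounded_mfun (fun x => f x + g x).
Proof.
move=> [mf [M fM]] [mg [N gN]]; split; first exact: measurable_funD.
by exists (M + N) => x; rewrite (le_trans (ler_normD _ _)) // lerD.
Qed.

Lemma bmfunM f g : bounded_mfun f -> bounded_mfun g ->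
  bounded_mfun (fun x => f x * g x).
Proof.
move=> [mf [M fM]] [mg [N gN]]; split; first exact: measurable_funM.
by exists (M * N) => x; rewrite normrM ler_pM.
Qed.

Lemma bmfunZ c f : bounded_mfun f -> bounded_mfun (fun x => c * f x).
Proof. by move=> bf; apply: bmfunM => //; exact: bmfun_cst. Qed.

Lemma bmfunN f : bounded_mfun f -> bounded_mfun (fun x => - f x).
Proof.
move=> /(bmfunZ (-1)); rewrite (_ : (fun x => -1 * f x) = (fun x => - f x)) //.
by apply/funext => x; rewrite mulN1r.
Qed.

Lemma bmfunB f g : bounded_mfun f -> bounded_mfun g ->
  bounded_mfun (fun x => f x - g x).
Proof. by move=> bf bg; apply: bmfunD => //; exact: bmfunN. Qed.

Lemma bmfun_sum I (r : seq I) (Q : pred I) (F : I -> T -> R) :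
  (forall i, bounded_mfun (F i)) ->
  bounded_mfun (fun x => \sum_(i <- r | Q i) F i x).
Proof.
move=> bF; elim: r => [|i r IH].
  by under eq_fun do rewrite big_nil; exact: bmfun_cst.
under eq_fun do rewrite big_cons; case: (Q i) => //.
exact: bmfunD.
Qed.

Lemma bmfun_comp (g : R -> R) f M : measurable_fun setT g ->
  (forall y, `|g y| <= M) -> measurable_fun setT f ->
  bounded_mfun (fun x => g (f x)).
Proof.
move=> mg gM mf; split; first exact: measurableT_comp.
by exists M.
Qed.

Lemma bmfun_indic (A : set T) : measurable A -> bounded_mfun (\1_A : T -> R).
Proof.
move=> mA; split; first exact: measurable_indic.
exists 1 => x; rewrite indicE ger0_norm ?ler0n //.
by case: (x \in A).
Qed.

Lemma ExE f : bounded_mfun f -> ((Ex f)%:E = \int[P]_x (f x)%:E)%E.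
Proof.
by move=> bf; rewrite /Ex /Rintegral fineK//; exact: integrable_fin_num (bmfun_integrable bf).
Qed.

Lemma eq_Ex f g : f =1 g -> Ex f = Ex g.
Proof. by move=> /funext ->. Qed.

Lemma Ex_cst c : Ex (fun=> c) = c.
Proof.
by rewrite /Ex Rintegral_cst // [X in fine X](probability_setT P) mulr1.
Qed.

Lemma ExD f g : bounded_mfun f -> bounded_mfun g ->
  Ex (fun x => f x + g x) = Ex f + Ex g.
Proof. by move=> bf bg; rewrite /Ex RintegralD //; exact: bmfun_integrable. Qed.

Lemma ExB f g : bounded_mfun f -> bounded_mfun g ->
  Ex (fun x => f x - g x) = Ex f - Ex g.
Proof. by move=> bf bg; rewrite /Ex RintegralB //; exact: bmfun_integrable. Qed.

Lemma ExZ c f : bounded_mfun f -> Ex (fun x => c * f x) = c * Ex f.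
Proof. by move=> bf; rewrite /Ex RintegralZl //; exact: bmfun_integrable. Qed.

Lemma ExN f : bounded_mfun f -> Ex (fun x => - f x) = - Ex f.
Proof.
move=> bf; rewrite -mulN1r -ExZ //; apply: eq_Ex => x.
by rewrite mulN1r.
Qed.

Lemma Ex_le f g : bounded_mfun f -> bounded_mfun g ->
  (forall x, f x <= g x) -> Ex f <= Ex g.
Proof. by move=> bf bg fg; apply: le_Rintegral => //; exact: bmfun_integrable. Qed.

Lemma Ex_ge0 f : (forall x, 0 <= f x) -> 0 <= Ex f.
Proof. by move=> f0; apply: Rintegral_ge0. Qed.

Lemma Ex_sum I (r : seq I) (Q : pred I) (F : I -> T -> R) :
  (forall i, bounded_mfun (F i)) ->
  Ex (fun x => \sum_(i <- r | Q i) F i x) = \sum_(i <- r | Q i) Ex (F i).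
Proof.
move=> bF; elim: r => [|i r IH].
  by rewrite big_nil -[RHS](Ex_cst 0); apply: eq_Ex => x; rewrite big_nil.
rewrite big_cons -IH; under eq_Ex do rewrite big_cons.
by case: (Q i) => //; rewrite ExD //; exact: bmfun_sum.
Qed.

Lemma bmfun_cvg (f_ : nat -> T -> R) f M :
  (forall n, measurable_fun setT (f_ n)) -> (forall n x, `|f_ n x| <= M) ->
  (forall x, f_ ^~ x @ \oo --> f x) -> bounded_mfun f.
Proof.
move=> mf bf ff; split.
  by apply: (measurable_fun_cvg (h := f_)) => // x _; exact: ff.
exists M => x; have := ff x => /cvg_norm /(@cvg_lim _) <- //.
apply: limr_le; last by apply: nearW.
by apply: is_cvg_norm; apply/cvg_ex; exists (f x); exact: ff.
Qed.

Lemma Ex_cvg (f_ : nat -> T -> R) f M :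
  (forall n, measurable_fun setT (f_ n)) -> (forall n x, `|f_ n x| <= M) ->
  (forall x, f_ ^~ x @ \oo --> f x) -> (fun n => Ex (f_ n)) @ \oo --> Ex f.
Proof.
move=> mf bf ff; have bff := bmfun_cvg mf bf ff.
apply: fine_cvg; rewrite fineK; last exact: integrable_fin_num (bmfun_integrable bff).
apply: (@dominated_cvg _ _ _ P setT measurableT (fun n x => (f_ n x)%:E)
  (fun x => (f x)%:E) (fun=> M%:E)) => //.
- by move=> n; exact/measurable_EFinP.
- move=> x _; apply/fine_cvgP; split; [exact: nearW | exact: ff].
- by apply: bmfun_integrable; exact: bmfun_cst.
- by move=> n x _; rewrite lee_fin.
Qed.

Lemma Ex_indic (A : set T) : measurable A -> Ex (\1_A) = fine (P A).
Proof. by move=> mA; rewrite /Ex /Rintegral integral_indic // setIT. Qed.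

End Expectation.
Arguments bounded_mfun {d T R}.

(** * Averages over one step of the chain *)

Section Psum.
Variables (R : realType) (p : nat -> nat -> R).
Hypothesis p_ge0 : forall i j, 0 <= p i j.
Hypothesis p_sum1 : forall i, (0 < i)%N ->
  (fun m => \sum_(1 <= j < m) p i j) @ \oo --> (1 : R).
Implicit Types (h g : nat -> R) (i : nat).

(** [psum] sums over $k\ge1$ while [series] starts at 0; a zero term in front reconciles them. *)
Let w i h k := if k is 0%N then 0 else p i k * h k.

Let wE i h : (fun m => \sum_(1 <= k < m) p i k * h k) = series (w i h).
Proof.
apply/funext => -[|m]; rewrite /series /=; first by rewrite !big_geq.
rewrite [RHS]big_nat_recl // add0r big_add1 /=.
by apply: eq_big_nat => k _.
Qed.

Lemma psum_cvg i h M : (0 < i)%N -> (forall k, `|h k| <= M) ->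
  (fun m => \sum_(1 <= k < m) p i k * h k) @ \oo --> psum p i h.
Proof.
move=> i0 hM; suff : cvgn (series (w i h)) by rewrite /psum wE.
apply: normed_cvg.
have M0 : 0 <= M := le_trans (normr_ge0 _) (hM 0%N).
apply: (@series_le_cvg _ _ (w i (fun=> M))).
- by move=> n /=.
- by case=> //= k; rewrite mulr_ge0.
- by case=> [|k] /=; rewrite ?normr0 // normrM ger0_norm // ler_wpM2l.
rewrite -wE (_ : (fun m => _) = (fun m => (\sum_(1 <= j < m) p i j) * M)).
  by apply: is_cvgMl; apply/cvg_ex; exists 1; exact: p_sum1.
by apply/funext => m; rewrite mulr_suml.
Qed.

Lemma psum_cst i c : (0 < i)%N -> psum p i (fun=> c) = c.
Proof.
move=> i0; apply/cvg_lim => //.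
rewrite (_ : (fun m => _) = (fun m => (\sum_(1 <= j < m) p i j) * c)).
  by rewrite -[X in _ --> X]mul1r; apply: cvgMl; exact: p_sum1.
by apply/funext => m; rewrite mulr_suml.
Qed.

Lemma psumD i h g M N : (0 < i)%N -> (forall k, `|h k| <= M) ->
  (forall k, `|g k| <= N) -> psum p i (fun k => h k + g k) = psum p i h + psum p i g.
Proof.
move=> i0 hM gN; apply/cvg_lim => //.
rewrite (_ : (fun m => _) = (fun m => (\sum_(1 <= j < m) p i j * h j) + \sum_(1 <= j < m) p i j * g j)).
  by apply: cvgD; exact: psum_cvg.
by apply/funext => m; rewrite -big_split /=; apply: eq_bigr => j _; rewrite mulrDr.
Qed.

Lemma psumZ i h c M : (0 < i)%N -> (forall k, `|h k| <= M) ->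
  psum p i (fun k => c * h k) = c * psum p i h.
Proof.
move=> i0 hM; apply/cvg_lim => //.
rewrite (_ : (fun m => _) = (fun m => c * (\sum_(1 <= j < m) p i j * h j))).
  by apply: cvgMr; exact: psum_cvg.
by apply/funext => m; rewrite mulr_sumr; apply: eq_bigr => j _; rewrite mulrCA.
Qed.

Lemma eq_psum i h g : (forall k, (0 < k)%N -> h k = g k) -> psum p i h = psum p i g.
Proof.
move=> hg; rewrite /psum (_ : (fun m => _) = (fun m => \sum_(1 <= k < m) p i k * g k)) //.
by apply/funext => m; rewrite big_nat_cond [RHS]big_nat_cond; apply: eq_bigr => j /andP[/andP[j0 _] _]; rewrite hg.
Qed.

Lemma psum_le i h g M N : (0 < i)%N -> (forall k, `|h k| <= M) ->
  (forall k, `|g k| <= N) -> (forall k, (0 < k)%N -> h k <= g k) -> psum p i h <= psum p i g.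
Proof.
move=> i0 hM gN hg; have ch := psum_cvg i0 hM; have cg := psum_cvg i0 gN.
rewrite -(cvg_lim _ ch) // -(cvg_lim _ cg) //; apply: ler_lim.
- by apply/cvg_ex; eexists; exact: ch.
- by apply/cvg_ex; eexists; exact: cg.
- apply: nearW => m; rewrite big_nat_cond [leRHS]big_nat_cond; apply: ler_sum => j /andP[/andP[j0 _] _].
  by rewrite ler_wpM2l // hg.
Qed.

Lemma psum_norm i h M : (0 < i)%N -> (forall k, `|h k| <= M) -> `|psum p i h| <= M.
Proof.
move=> i0 hM; rewrite ler_norml -{1}(psum_cst (- M) i0) -{2}(psum_cst M i0).
apply/andP; split; apply: psum_le => //.
- by move=> k _; have := hM k; rewrite ler_norml => /andP[].
- by move=> k _; have := hM k; rewrite ler_norml => /andP[].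
Qed.

Lemma psumN i h M : (0 < i)%N -> (forall k, `|h k| <= M) ->
  psum p i (fun k => - h k) = - psum p i h.
Proof.
move=> i0 hM; rewrite -mulN1r -(psumZ _ i0 hM).
by apply: eq_psum => k _; rewrite mulN1r.
Qed.

Lemma psumB i h g M N : (0 < i)%N -> (forall k, `|h k| <= M) ->
  (forall k, `|g k| <= N) -> psum p i (fun k => h k - g k) = psum p i h - psum p i g.
Proof.
move=> i0 hM gN; rewrite -(psumN i0 gN); apply: (psumD i0 hM (N := N)).
by move=> k; rewrite normrN.
Qed.

End Psum.

(** * Convergence of the rescaled jump measures *)

Section TaylorBounds.
Variable R : realType.
Implicit Types x y lam : R.

Lemma continuous_maxr (f g : R -> R) : continuous f -> continuous g ->
  continuous (fun x => Num.max (f x) (g x)).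
Proof. by move=> cf cg x; exact: (@continuous_max R R f g x (cf x) (cg x)). Qed.

Lemma continuous_minr (f g : R -> R) : continuous f -> continuous g ->
  continuous (fun x => Num.min (f x) (g x)).
Proof. by move=> cf cg x; exact: (@continuous_min R R f g x (cf x) (cg x)). Qed.

Lemma sin_le_norm x : `|sin x| <= `|x|.
Proof.
wlog x0 : x / 0 < x.
  move=> h; have [/h//|x0|<-] := ltgtP 0 x; last by rewrite sin0.
  by have := h (- x); rewrite oppr_gt0 sinN !normrN; exact.
have [c _ h] : exists2 c, c \in `]0, x[%R & sin x - sin 0 = cos c * (x - 0).
  apply: MVT => //.
  by apply: continuous_subspaceT => z; exact: continuous_sin.
move: h; rewrite sin0 !subr0 => ->; rewrite normrM ger_pMl ?normr_gt0 ?gt_eqF //.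
by exact: cos_max.
Qed.

Lemma sin_sub_id x : `|sin x - x| <= `|x| ^+ 3.
Proof.
wlog x0 : x / 0 < x.
  move=> h; have [/h//|x0|<-] := ltgtP 0 x; last by rewrite sin0 subr0 normr0 expr0n.
  by have := h (- x); rewrite oppr_gt0 sinN !normrN -opprD normrN; exact.
have [c c01 h] : exists2 c, c \in `]0, x[%R & (sin x - x) - (sin 0 - 0) = (cos c - 1) * (x - 0).
  apply: (@MVT _ (fun z => sin z - z) (fun z => cos z - 1)) => //.
  apply: continuous_subspaceT => z; apply: cvgB; [exact: continuous_sin|exact: cvg_id].
move: h; rewrite sin0 !subr0 => ->; rewrite normrM exprS mulrC ler_pM2l ?normr_gt0 ?gt_eqF //.
have -> : cos c - 1 = - (2 * sin (c / 2) ^+ 2).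
  rewrite {1}(splitr c) cosD; have := cos2Dsin2 (c / 2); rewrite -!expr2; lra.
rewrite normrN normrM (ger0_norm (ler0n _ 2)) normrX.
have := sin_le_norm (c / 2); have := normr_ge0 (sin (c / 2)).
move: c01; rewrite in_itv/= => /andP[c0 cx].
rewrite (ger0_norm (ltW (_ : 0 < c / 2))) ?divr_gt0 // (ger0_norm (ltW x0)); nra.
Qed.

(** Since $1-\cos x=2\sin^2(x/2)$, the left side is a difference of two squares; [sin_sub_id] bounds
    one factor and [sin_le_norm] the other. *)
Lemma cos_sub_taylor x : `|x| <= 1 -> `|cos x - 1 + x ^+ 2 / 2| <= `|x| ^+ 3.
Proof.
have -> : cos x - 1 + x ^+ 2 / 2 = 2 * ((x / 2 - sin (x / 2)) * (x / 2 + sin (x / 2))).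
  rewrite {1}(splitr x) cosD; have := cos2Dsin2 (x / 2); rewrite -!expr2; lra.
move=> x1; rewrite normrM (ger0_norm (ler0n _ 2)) normrM.
have h1 := sin_sub_id (x / 2); rewrite distrC in h1.
have h2 := ler_normD (x / 2) (sin (x / 2)); have h3 := sin_le_norm (x / 2).
have xE : `|x / 2| = `|x| / 2 by rewrite normrM (ger0_norm (ltW (_ : 0 < 2^-1))).
move: h1 h2 h3; rewrite xE; set t := `|x| in x1 *; have t0 : 0 <= t by exact: normr_ge0.
set A := `|_ - _|; set B := `|_ + _|; set C := `|sin _| => h1 h2 h3.
have B1 : B <= t by lra.
have A0 : 0 <= A by exact: normr_ge0.
have B0 : 0 <= B by exact: normr_ge0.
have : A * B <= (t / 2) ^+ 3 * t by apply: ler_pM.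
rewrite !exprS expr0; nra.
Qed.

End TaylorBounds.

Section JumpMeasure.
Variables (R : realType) (p : nat -> nat -> R) (a : nat -> R).
Variables (Pi : {measure set R -> \bar R}) (b sigma2 : R).
Hypothesis p_ge0 : forall i j, 0 <= p i j.
Hypothesis p_sum1 : forall i, (0 < i)%N ->
  (fun m => \sum_(1 <= j < m) p i j) @ \oo --> (1 : R).
Hypothesis a_gt0 : forall n, 0 < a n.
Hypothesis Pi1 : Pi [set -1; 1] = 0%E.
Hypothesis Pi_fin : (\int[Pi]_x (Num.min 1 (x ^+ 2))%:E < +oo)%E.
Hypothesis A1 : forall f : R -> R,
     {within `[0, +oo[, continuous f} -> cvg (f x @[x --> +oo]) ->
     (exists2 e, 0 < e & forall x, `|x - 1| < e -> f x = 0) ->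
     (fun n => a n * psum p n (fun k => f (k%:R / n%:R))) @ \oo
       --> Rintegral Pi setT (fun x => f (expR x)).
Hypothesis sigma2_ge0 : 0 <= sigma2.
Hypothesis A2b : (fun n => a n * psum p n (fun k =>
       if `|@logjump R n k| <= 1 then @logjump R n k else 0)) @ \oo --> b.
Hypothesis A2s : (fun n => a n * psum p n (fun k =>
       if `|@logjump R n k| <= 1 then @logjump R n k ^+ 2 else 0)) @ \oo
     --> sigma2 + Rintegral Pi `[-1, 1] (fun x => x ^+ 2).
Implicit Types (f g : R -> R) (m n : nat).

(** The integral of [f] against $a_m\Pi_m^*$, where $\Pi_m^*$ is the law of $\ln(X_m(1)/m)$. *)
Definition nu m f : R := a m * psum p m (fun k => f (logjump m k)).

Definition bounded_fct f := exists M, forall x, `|f x| <= M.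

Lemma nuD m f g : (0 < m)%N -> bounded_fct f -> bounded_fct g ->
  nu m (fun x => f x + g x) = nu m f + nu m g.
Proof.
move=> m0 [M fM] [N gN].
by rewrite /nu (psumD p_ge0 p_sum1 m0 (fun k => fM _) (fun k => gN _)) mulrDr.
Qed.

Lemma nuB m f g : (0 < m)%N -> bounded_fct f -> bounded_fct g ->
  nu m (fun x => f x - g x) = nu m f - nu m g.
Proof.
move=> m0 [M fM] [N gN].
by rewrite /nu (psumB p_ge0 p_sum1 m0 (fun k => fM _) (fun k => gN _)) mulrBr.
Qed.

Lemma nuZ m c f : (0 < m)%N -> bounded_fct f -> nu m (fun x => c * f x) = c * nu m f.
Proof.
move=> m0 [M fM].
by rewrite /nu (psumZ p_ge0 p_sum1 c m0 (fun k => fM _)) mulrCA.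
Qed.

Lemma nu_le m f g : (0 < m)%N -> bounded_fct f -> bounded_fct g ->
  (forall x, f x <= g x) -> nu m f <= nu m g.
Proof.
move=> m0 [M fM] [N gN] fg.
by rewrite ler_pM2l // (psum_le p_ge0 p_sum1 m0 (fun k => fM _) (fun k => gN _)).
Qed.

Lemma bounded_fctD f g : bounded_fct f -> bounded_fct g ->
  bounded_fct (fun x => f x + g x).
Proof.
move=> [M fM] [N gN]; exists (M + N) => x.
by rewrite (le_trans (ler_normD _ _)) // lerD.
Qed.

Lemma bounded_fctM f g : bounded_fct f -> bounded_fct g ->
  bounded_fct (fun x => f x * g x).
Proof. by move=> [M fM] [N gN]; exists (M * N) => x; rewrite normrM ler_pM. Qed.

Lemma bounded_fct_cst c : bounded_fct (fun=> c).
Proof. by exists `|c|. Qed.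

Lemma bounded_fctZ c f : bounded_fct f -> bounded_fct (fun x => c * f x).
Proof. exact: bounded_fctM (bounded_fct_cst c). Qed.

Lemma bounded_fctB f g : bounded_fct f -> bounded_fct g ->
  bounded_fct (fun x => f x - g x).
Proof.
move=> [M fM] [N gN]; exists (M + N) => x.
by rewrite (le_trans (ler_normB _ _)) // lerD.
Qed.

Lemma nu_norm_le m f g h : (0 < m)%N -> bounded_fct f -> bounded_fct g -> bounded_fct h ->
  (forall x, `|f x - g x| <= h x) -> `|nu m f - nu m g| <= nu m h.
Proof.
move=> m0 bf bg bh fgh; rewrite -nuB //.
have bfg := bounded_fctB bf bg.
rewrite ler_norml; apply/andP; split.
  rewrite -[leLHS]mulN1r -nuZ //; apply: nu_le => //; first exact: bounded_fctZ.
  by move=> x; rewrite mulN1r; have := fgh x; rewrite ler_norml => /andP[].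
by apply: nu_le => // x; have := fgh x; rewrite ler_norml => /andP[].
Qed.

Definition m1 x : R := Num.min 1 (x ^+ 2).

Lemma m1_ge0 x : 0 <= m1 x.
Proof. by rewrite /m1 le_min ler01 sqr_ge0. Qed.

Lemma measurable_m1 : measurable_fun setT m1.
Proof. by apply: measurable_funrpower || apply: measurable_minr => //; apply: measurable_funX. Qed.

Lemma Pi_integrable f C : measurable_fun setT f -> (forall x, `|f x| <= C * m1 x) ->
  Pi.-integrable setT (EFin \o f).
Proof.
move=> mf fC.
have im1 : Pi.-integrable setT (EFin \o m1).
  apply/integrableP; split; first by apply/measurable_EFinP; exact: measurable_m1.
  apply: le_lt_trans Pi_fin; rewrite le_eqVlt; apply/orP; left; apply/eqP.
  by apply: eq_integral => x _ /=; rewrite /= ger0_norm ?m1_ge0.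
apply: (@le_integrable _ _ _ Pi setT measurableT _ (EFin \o (fun x => C * m1 x))).
- exact/measurable_EFinP.
- move=> x _ /=; rewrite lee_fin (le_trans (fC x)) //; exact: ler_norm.
- rewrite (_ : EFin \o _ = (fun x => C%:E * (EFin \o m1) x)%E) //.
  exact: integrableZl.
Qed.

Lemma tail_test A x : 0 < A ->
  Num.max 0 (1 - expR A * expR x) + Num.min 1 (Num.max 0 (expR (- A) * expR x - 1))
  = 0 :> R \/ A < `|x|.
Proof.
move=> A0; have [h|] := leP `|x| A; last by right.
left; move: h; rewrite ler_norml => /andP[h1 h2].
rewrite -!expRD.
have e1 : 1 <= expR (A + x) by rewrite -expR0 ler_expR; lra.
have e2 : expR (- A + x) <= 1 by rewrite -expR0 ler_expR; lra.
rewrite (max_idPl _) ?subr_le0 // (max_idPl _) ?subr_le0 //.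
by rewrite (min_idPr _) ?addr0 // ler01.
Qed.

(** A smoothed indicator of $|x|>A$: zero on $[-A,A]$ and at least $1/2$ beyond $A+1$. As a function
    of $e^x$ it extends continuously to $[0,\infty]$, so (A1) applies to it and controls the mass of
    $a_n\Pi_n^*$ near infinity. *)
Definition tail A x : R :=
  Num.max 0 (1 - expR A * expR x) + Num.min 1 (Num.max 0 (expR (- A) * expR x - 1)).

Lemma tail_ge0 A x : 0 <= tail A x.
Proof. by rewrite addr_ge0 // ?le_max ?lexx // le_min ler01 le_max lexx. Qed.

Lemma tail_le2 A x : tail A x <= 2.
Proof.
rewrite -[2]/(1 + 1); apply: lerD; last by rewrite ge_min lexx.
by rewrite ge_max ler01 /= gerBl mulr_ge0 // ltW // expR_gt0.
Qed.

Lemma tail_ge A x : A + 1 < `|x| -> 1 <= 2 * tail A x.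
Proof.
move=> h; rewrite /tail -!expRD.
have [x0|x0] := leP 0 x.
  rewrite ger0_norm // in h.
  have e1 : 2 <= expR (- A + x) by apply: le_trans (expR_ge1Dx _); lra.
  have -> : Num.min 1 (Num.max 0 (expR (- A + x) - 1)) = 1.
    by apply/min_idPl; rewrite le_max; apply/orP; right; lra.
  have : 0 <= Num.max 0 (1 - expR (A + x)) by rewrite le_max lexx.
  lra.
rewrite ltr0_norm // in h.
have e1 : expR (A + x) <= 2^-1.
  rewrite -[A + x]opprK expRN lef_pV2 ?posrE ?expR_gt0 //.
  by apply: le_trans (expR_ge1Dx _); lra.
have : 2^-1 <= Num.max 0 (1 - expR (A + x)).
  by rewrite le_max; apply/orP; right; lra.
have : 0 <= Num.min 1 (Num.max 0 (expR (- A + x) - 1)) by rewrite le_min ler01 le_max lexx.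
lra.
Qed.

Lemma tail_bounded A : bounded_fct (tail A).
Proof. by exists 2 => x; rewrite ger0_norm ?tail_ge0 // tail_le2. Qed.

Lemma tail_m1 A x : 1 <= A -> `|tail A x| <= 2 * m1 x.
Proof.
move=> A1'; rewrite ger0_norm ?tail_ge0 //.
have [tE|h] := @tail_test A x ltac:(lra); first by rewrite /tail tE mulr_ge0 // m1_ge0.
have -> : m1 x = 1; last by rewrite mulr1; exact: tail_le2.
apply/min_idPl; rewrite -[x ^+ 2]ger0_norm ?sqr_ge0 // normrX expr_ge1 //.
by rewrite (le_trans A1') // ltW.
Qed.

Lemma measurable_tail A : measurable_fun setT (tail A).
Proof.
have me : measurable_fun setT (@expR R) by exact: measurable_expR.
apply: measurable_funD.
  apply: measurable_maxr => //; apply: measurable_funB => //.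
  exact: measurable_funM.
apply: measurable_minr => //; apply: measurable_maxr => //.
by apply: measurable_funB => //; exact: measurable_funM.
Qed.

Lemma ratio_gt0 n k : (0 < n)%N -> (0 < k)%N -> (0 : R) < k%:R / n%:R.
Proof. by move=> n0 k0; rewrite divr_gt0 // ltr0n. Qed.

Lemma ln_ratio n k : (0 < n)%N -> (0 < k)%N -> ln (k%:R / n%:R) = logjump n k :> R.
Proof. by move=> n0 k0; rewrite ln_div // posrE ltr0n. Qed.

Lemma nu_of_ratio (F : R -> R) f :
  (forall x, F (expR x) = f x) ->
  (fun n => a n * psum p n (fun k => F (k%:R / n%:R))) @ \oo
       --> Rintegral Pi setT (fun x => F (expR x)) ->
  nu n f @[n --> \oo] --> Rintegral Pi setT f.
Proof.
move=> Ff; rewrite (_ : (fun x => F (expR x)) = f); last by apply/funext.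
apply: cvg_trans; apply: near_eq_cvg; near=> n.
have n0 : (0 < n)%N by near: n; exists 1%N.
congr (_ * _); apply: eq_psum => k k0.
by rewrite -Ff -ln_ratio // lnK // posrE ratio_gt0.
Unshelve. all: by end_near. Qed.

Lemma near_one_ln (A : R) y : 0 < A -> `|y - 1| < 1 - expR (- A) -> `|ln y| < A.
Proof.
move=> A0; rewrite ltr_distl => /andP[h1 h2].
have y0 : 0 < y by have := expR_gt0 (- A); lra.
(* This says $1-e^{-A}\le e^A-1$: the distance from 1 to $e^{-A}$ can also be used on the right of
   1. *)
have eA : expR A + expR (- A) >= 2.
  have e0 := expR_gt0 A; have : expR A * expR (- A) = 1 by rewrite -expRD subrr expR0.
  set u := expR A in e0 *; set v := expR (- A) => uv.
  have : 0 <= (u - 1) ^+ 2 by exact: sqr_ge0.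
  have v0 : 0 < v by exact: expR_gt0.
  nra.
rewrite ltr_norml -[X in X < _ < _](expRK (- A)) -[X in _ < _ < X](expRK A).
rewrite !ltr_ln ?posrE ?expR_gt0 //; lra.
Qed.

Lemma nu_tail A : 0 < A -> nu n (tail A) @[n --> \oo] --> Rintegral Pi setT (tail A).
Proof.
move=> A0.
pose F y : R := Num.max 0 (1 - expR A * y) + Num.min 1 (Num.max 0 (expR (- A) * y - 1)).
apply: (@nu_of_ratio F) => //; apply: A1.
- have cl u v : continuous (fun y : R => u * y - v).
    by move=> z; apply: cvgB; [apply: cvgMr; exact: cvg_id|exact: cvg_cst].
  have cl' u v : continuous (fun y : R => u - v * y).
    by move=> z; apply: cvgB; [exact: cvg_cst|apply: cvgMr; exact: cvg_id].
  have c1 : continuous (fun y : R => Num.max 0 (1 - expR A * y)).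
    by apply: (@continuous_maxr _ (fun=> 0)) => // z; exact: cvg_cst.
  have c2 : continuous (fun y : R => Num.min 1 (Num.max 0 (expR (- A) * y - 1))).
    apply: (@continuous_minr _ (fun=> 1)) => z; first exact: cvg_cst.
    by apply: (@continuous_maxr _ (fun=> 0)) => // u; exact: cvg_cst.
  by apply: continuous_subspaceT => y; rewrite /F; apply: cvgD; [exact: c1|exact: c2].
- apply/cvg_ex; exists 1; apply: cvg_near_cst; near=> y.
  have y1 : expR (- A) <= y by near: y; exact: nbhs_pinfty_ge.
  have y2 : 2 * expR A <= y by near: y; exact: nbhs_pinfty_ge.
  have eA : expR A * expR (- A) = 1 by rewrite -expRD subrr expR0.
  have e0 := expR_gt0 A; have e0' := expR_gt0 (- A).
  rewrite /F (max_idPl _); last nra.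
  rewrite add0r; apply/min_idPl; rewrite le_max; apply/orP; right; nra.
- exists (1 - expR (- A)).
    by rewrite subr_gt0 -expR0 ltr_expR; lra.
  move=> y hy; have h := near_one_ln A0 hy.
  have y0 : 0 < y by move: hy; rewrite ltr_distl => /andP[h1 _]; have := expR_gt0 (- A); lra.
  have [//|] := @tail_test A (ln y) A0; first by rewrite lnK ?posrE.
  by move=> /(lt_trans h); rewrite ltxx.
Unshelve. all: by end_near. Qed.

Lemma nu_compact f e A : continuous f -> 0 < e -> (forall x, `|x| < e -> f x = 0) ->
  (forall x, A < `|x| -> f x = 0) -> nu n f @[n --> \oo] --> Rintegral Pi setT f.
Proof.
move=> cf e0 fe fA; apply: (@nu_of_ratio (f \o @ln R) f).
  by move=> x /=; rewrite expRK.
apply: A1.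
- apply: continuous_subspaceT => y.
  have [y0|y0] := ltP 0 y.
    apply: continuous_comp; [exact: continuous_ln|exact: cf].
  (* At $y\le0$ the logarithm takes the value 0, where [f] vanishes; for small $y>0$ it lies below
     the support of [f]. Hence [f \o ln] is zero around $y$. *)
  rewrite /continuous_at /= ln0 // fe ?normr0 //.
  apply: cvg_near_cst; near=> z => /=.
  have [z0|z0] := ltP 0 z; last by rewrite ln0 // fe // normr0.
  have zA : z < expR (- `|A| - 1).
    near: z; apply: lt_nbhsl; exact: le_lt_trans (expR_gt0 _).
  have lz : ln z < - `|A| - 1 by rewrite -ltr_expR lnK ?posrE.
  have nA := normr_ge0 A; have lA := ler_norm A.
  apply: fA; rewrite ltr0_norm; lra.
- apply/cvg_ex; exists 0; apply: cvg_near_cst; near=> y => /=.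
  have y1 : expR (`|A| + 1) <= y by near: y; exact: nbhs_pinfty_ge.
  have y0 : 0 < y by exact: lt_le_trans (expR_gt0 _) y1.
  have : `|A| + 1 <= ln y by rewrite -ler_expR lnK ?posrE.
  move=> h; apply: fA; rewrite ger0_norm; last by have := normr_ge0 A; lra.
  by have := ler_norm A; lra.
- exists (1 - expR (- e)).
    by rewrite subr_gt0 -expR0 ltr_expR; lra.
  by move=> y hy /=; apply: fe; exact: near_one_ln.
Unshelve. all: by end_near. Qed.

Let S2 := sigma2 + Rintegral Pi `[-1, 1] (fun x => x ^+ 2).

Definition sq1 x : R := if `|x| <= 1 then x ^+ 2 else 0.

Lemma sq1_ge0 x : 0 <= sq1 x.
Proof. by rewrite /sq1; case: ifP => // _; exact: sqr_ge0. Qed.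

Lemma sq1_le1 x : sq1 x <= 1.
Proof.
rewrite /sq1; case: ifP => // h; rewrite -[x ^+ 2]ger0_norm ?sqr_ge0 // normrX.
by rewrite expr_le1.
Qed.

Lemma sq1_bounded : bounded_fct sq1.
Proof. by exists 1 => x; rewrite ger0_norm ?sq1_ge0 // sq1_le1. Qed.

Lemma measurable_ball1 : measurable [set x : R | `|x| <= 1].
Proof.
rewrite (_ : [set x | _] = `[-1, 1]%classic); first exact: measurable_itv.
by apply/seteqP; split => x /=; rewrite in_itv/= ler_norml.
Qed.

Lemma measurable_le1 : measurable_fun setT (fun x : R => `|x| <= 1).
Proof.
apply: (measurable_fun_bool true); rewrite setTI.
by rewrite (_ : _ @^-1` _ = [set x : R | `|x| <= 1]) //; exact: measurable_ball1.
Qed.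

Lemma measurable_if1 f g : measurable_fun setT f -> measurable_fun setT g ->
  measurable_fun setT (fun x : R => if `|x| <= 1 then f x else g x).
Proof.
move=> mf mg; apply: measurable_fun_if => //.
- exact: measurable_le1.
- exact: measurable_funTS.
- exact: measurable_funTS.
Qed.

Lemma measurable_sq1 : measurable_fun setT sq1.
Proof. by apply: measurable_if1 => //; apply: measurable_funX. Qed.

Lemma sq1_m1 x : `|sq1 x| <= 1 * m1 x.
Proof.
rewrite mul1r ger0_norm ?sq1_ge0 // /m1 le_min sq1_le1 /= /sq1.
by case: ifP => // _; exact: sqr_ge0.
Qed.

Lemma nu_sq1 : nu n sq1 @[n --> \oo] --> S2.
Proof. exact: A2s. Qed.

Lemma Rintegral_sq1 : Rintegral Pi `[-1, 1] (fun x => x ^+ 2) = Rintegral Pi setT sq1.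
Proof.
rewrite Rintegral_mkcond; congr (Rintegral _ _ _); apply/funext => x.
rewrite patchE /sq1 mem_setE in_itv/= ler_norml.
by [].
Qed.

(** A tent of half-width [d] around $-1$ and $1$, the points where the truncations at $|x|=1$ jump.
    Its integral vanishes with [d] because $\Pi$ does not charge $\{-1,1\}$. *)
Definition bump1 (d x : R) : R := Num.max 0 (1 - `| `|x| - 1| / d).

Lemma bump1_ge0 d x : 0 <= bump1 d x.
Proof. by rewrite le_max lexx. Qed.

Lemma bump1_le1 d x : 0 < d -> bump1 d x <= 1.
Proof. by move=> d0; rewrite ge_max ler01 /= gerBl divr_ge0 // ltW. Qed.

Lemma bump1_bounded d : 0 < d -> bounded_fct (bump1 d).
Proof. by move=> d0; exists 1 => x; rewrite ger0_norm ?bump1_ge0 // bump1_le1. Qed.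

Lemma bump1_0 d x : 0 < d -> d <= `| `|x| - 1| -> bump1 d x = 0.
Proof. by move=> d0 h; apply/max_idPl; rewrite subr_le0 ler_pdivlMr // mul1r. Qed.

Lemma continuous_bump1 d : continuous (bump1 d).
Proof.
apply: (@continuous_maxr R (fun=> 0) (fun x => 1 - `| `|x| - 1| / d)) => x; first exact: cvg_cst.
apply: cvgB; first exact: cvg_cst.
apply: cvgMl; apply: cvg_norm; apply: cvgB; last exact: cvg_cst.
by apply: cvg_norm; exact: cvg_id.
Qed.

Lemma bump1_m1 d x : 0 < d -> d <= 1 / 2 -> `|bump1 d x| <= 4 * m1 x.
Proof.
move=> d0 d1; rewrite ger0_norm ?bump1_ge0 //.
have [h|h] := leP d `| `|x| - 1|; first by rewrite bump1_0 // mulr_ge0 // m1_ge0.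
have x12 : 1 / 2 <= `|x| by move: h; rewrite ltr_norml; lra.
apply: le_trans (bump1_le1 x d0) _.
have : 1 / 4 <= m1 x; last lra.
rewrite /m1 le_min; apply/andP; split; first lra.
rewrite -[x ^+ 2]ger0_norm ?sqr_ge0 // normrX; nra.
Qed.

Lemma nu_bump1 d : 0 < d -> d <= 1 / 2 ->
  nu n (bump1 d) @[n --> \oo] --> Rintegral Pi setT (bump1 d).
Proof.
move=> d0 d1; apply: (@nu_compact (bump1 d) (1 / 2) (3 / 2)) => //.
- exact: continuous_bump1.
- move=> x h; apply: bump1_0 => //; rewrite ltr0_norm; lra.
- move=> x h; apply: bump1_0 => //; rewrite gtr0_norm; lra.
Qed.

(** The offset 2 gives [dlt n <= 1 / 2], so that the tents of [bump1] stay away from 0. *)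
Definition dlt n : R := n.+2%:R^-1.

(* Majorant of the error made when a test function is cut off near 0, near -1
   and 1, and near infinity. *)
Definition cutoff_err C n x : R :=
  C * (bump1 (dlt n) x + 2 * tail n.+1%:R x) + C * dlt n * sq1 x.

Lemma inv2_small n : 0 < dlt n /\ dlt n <= 1 / 2.
Proof.
rewrite /dlt; split; first by rewrite invr_gt0 ltr0n.
by rewrite div1r lef_pV2 ?posrE ?ltr0n // ler_nat.
Qed.

Lemma cutoff_err_bounded C n : bounded_fct (cutoff_err C n).
Proof.
have [h1 h2] := inv2_small n.
apply: bounded_fctD; last by apply: bounded_fctZ; exact: sq1_bounded.
apply: bounded_fctZ; apply: bounded_fctD; first exact: bump1_bounded.
by apply: bounded_fctZ; exact: tail_bounded.
Qed.

Let cutoff_lim C n : R := C * (Rintegral Pi setT (bump1 (dlt n))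
  + 2 * Rintegral Pi setT (tail n.+1%:R)) + C * dlt n * S2.

Lemma nu_cutoff_err C n : nu m (cutoff_err C n) @[m --> \oo] --> cutoff_lim C n.
Proof.
have [h1 h2] := inv2_small n.
have bb := bump1_bounded h1; have tb := tail_bounded n.+1%:R.
apply: (@cvg_trans _ ((fun m => C * (nu m (bump1 (dlt n)) + 2 * nu m (tail n.+1%:R))
    + C * dlt n * nu m sq1) @ \oo)).
  apply: near_eq_cvg; near=> m.
  have m0 : (0 < m)%N by near: m; exists 1%N.
  have t2 := bounded_fctZ 2 tb; have bt := bounded_fctD bb t2.
  rewrite /cutoff_err (nuD m0 (bounded_fctZ C bt) (bounded_fctZ _ sq1_bounded)).
  by rewrite (nuZ _ m0 bt) (nuZ _ m0 sq1_bounded) (nuD m0 bb t2) (nuZ _ m0 tb).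
apply: cvgD; last by apply: cvgMr; exact: nu_sq1.
apply: cvgMr; apply: cvgD; first exact: nu_bump1.
by apply: cvgMr; apply: nu_tail; rewrite ltr0n.
Unshelve. all: by end_near. Qed.

Lemma Rintegral_Pi_cvg (f_ : nat -> R -> R) f C :
  (forall n, measurable_fun setT (f_ n)) ->
  (forall n x, `|f_ n x| <= C * m1 x) ->
  (forall x, f_ ^~ x @ \oo --> f x) ->
  Rintegral Pi setT (f_ n) @[n --> \oo] --> Rintegral Pi setT f.
Proof.
move=> mf fC ff.
have mf' : measurable_fun setT f.
  by apply: (measurable_fun_cvg (h := f_)) => // x _; exact: ff.
have fC' x : `|f x| <= C * m1 x.
  have := ff x => /cvg_norm /(@cvg_lim _) <- //.
  apply: limr_le; last by apply: nearW.
  by apply: is_cvg_norm; apply/cvg_ex; exists (f x); exact: ff.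
apply: fine_cvg; rewrite fineK; last first.
  by apply: integrable_fin_num => //; exact: Pi_integrable fC'.
apply: (@dominated_cvg _ _ _ Pi setT measurableT (fun n x => (f_ n x)%:E)
  (fun x => (f x)%:E) (fun x => (C * m1 x)%:E)) => //.
- by move=> n; exact/measurable_EFinP.
- by move=> x _; apply/fine_cvgP; split; [exact: nearW | exact: ff].
- apply: (@Pi_integrable (fun x => C * m1 x) `|C|).
    by apply: measurable_funM => //; exact: measurable_m1.
  by move=> x; rewrite normrM (ger0_norm (m1_ge0 x)).
- by move=> n x _; rewrite lee_fin.
Qed.

Lemma Rintegral_tail_cvg0 :
  Rintegral Pi setT (tail n.+1%:R) @[n --> \oo] --> Rintegral Pi setT (fun=> 0).
Proof.
apply: (@Rintegral_Pi_cvg _ _ 2).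
- by move=> n; exact: measurable_tail.
- by move=> n x; apply: tail_m1; rewrite ler1n.
move=> x; apply: cvg_near_cst; near=> n.
have [//|h] := @tail_test n.+1%:R x ltac:(by rewrite ltr0n).
exfalso; move: h; apply/negP; rewrite -leNgt.
have : `|x| <= n%:R by near: n; exact: nbhs_infty_ger.
by move=> /le_trans; apply; rewrite ler_nat.
Unshelve. all: by end_near. Qed.

(** The tents converge to the indicator of $\{-1,1\}$, a null set of $\Pi$, the tails converge to 0,
    and the last term carries the factor [dlt n]. *)
Lemma cutoff_lim_cvg0 C : cutoff_lim C n @[n --> \oo] --> 0.
Proof.
have cinv : dlt n @[n --> \oo] --> (0 : R).
  rewrite /dlt.
  by rewrite (cvg_shiftS (@harmonic R)); exact: cvg_harmonic.
rewrite (_ : 0 = C * (Rintegral Pi setT (\1_[set -1; 1] : R -> R) + 2 * Rintegral Pi setT (fun=> 0))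
   + C * 0 * S2); last first.
  rewrite /Rintegral integral_indic //; last by apply: measurableU; exact: measurable_set1.
  by rewrite setIT [X in fine X]Pi1 /= integral0 /=; ring.
apply: cvgD; last by apply: cvgMl; apply: cvgMr.
apply: cvgMr; apply: cvgD.
  apply: (@Rintegral_Pi_cvg _ _ 4).
  - by move=> n; apply: continuous_measurable_fun; exact: continuous_bump1.
  - by move=> n x; have [? ?] := inv2_small n; exact: bump1_m1.
  move=> x; rewrite indicE; have [xE|xE] := boolP (x \in [set -1; 1]).
    have xn : `|x| = 1.
      by move: xE; rewrite inE => -[] ->; rewrite ?normrN normr1.
    rewrite (_ : (fun n => _) = (fun=> 1)); first exact: cvg_cst.
    by apply/funext => n; rewrite /bump1 xn subrr normr0 mul0r subr0; apply/max_idPr.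
  have xn : 0 < `| `|x| - 1|.
    rewrite normr_gt0 subr_eq0; apply: contra xE => /eqP xn; rewrite inE /=.
    have [x0|x0] := leP 0 x; first by right; rewrite -xn ger0_norm.
    by left; rewrite -xn ltr0_norm // opprK.
  apply: cvg_near_cst; near=> n; apply: bump1_0.
    by have [] := inv2_small n.
  near: n; apply: (cvgr_le 0) => //; exact: cinv.
by apply: cvgMr; exact: Rintegral_tail_cvg0.
Unshelve. all: by end_near. Qed.

(** * Test functions of cubic order at 0, continuous off $-1$ and $1$ *)

Section TestFunctions.
Variables (g : R -> R) (C : R).
Hypothesis mg : measurable_fun setT g.
Hypothesis gC : forall x : R, `|g x| <= C.
Hypothesis g3 : forall x : R, `|x| <= 1 -> `|g x| <= C * `|x| ^+ 3.
Hypothesis cg : forall x : R, `|x| != 1 -> {for x, continuous g}.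

Let C0 : 0 <= C := le_trans (normr_ge0 _) (gC 0).

(** The product [cut] vanishes near 0, near infinity and at $\pm1$, the only points where [g] may
    jump. Hence [g * cut] is continuous with compact support off 0, which is what (A1) handles. *)
Let small n (x : R) : R := Num.min 1 (Num.max 0 (2 * `|x| * n.+2%:R - 1)).
Let compact n (x : R) : R := Num.min 1 (Num.max 0 (n.+3%:R - `|x|)).
Let cut n (x : R) : R := (1 - bump1 (dlt n) x) * (small n x * compact n x).
Let f_ n (x : R) : R := g x * cut n x.

Let small01 n x : 0 <= small n x <= 1.
Proof. by rewrite le_min ler01 le_max lexx /= ge_min lexx. Qed.

Let compact01 n x : 0 <= compact n x <= 1.
Proof. by rewrite le_min ler01 le_max lexx /= ge_min lexx. Qed.

Let bump01 n x : 0 <= 1 - bump1 (dlt n) x <= 1.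
Proof.
have [h1 _] := inv2_small n.
by rewrite subr_ge0 bump1_le1 // gerBl bump1_ge0.
Qed.

Let cut01 n x : 0 <= cut n x <= 1.
Proof.
have /andP[a0 a1] := small01 n x; have /andP[b0 b1] := compact01 n x.
have /andP[c0 c1] := bump01 n x; rewrite /cut !mulr_ge0 //=.
by rewrite mulr_ile1 ?mulr_ge0 // mulr_ile1.
Qed.

Let f_norm n x : `|f_ n x| <= C.
Proof.
rewrite /f_ normrM; have /andP[h0 h1] := cut01 n x.
by rewrite (ger0_norm h0) (le_trans _ (gC x)) // ler_piMr.
Qed.

Let continuous_cut n : continuous (cut n).
Proof.
move=> x; apply: cvgM.
  by apply: cvgB; [exact: cvg_cst|exact: continuous_bump1].
have c1 : continuous (fun x : R => 2 * `|x| * n.+2%:R - 1).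
  move=> y; apply: cvgB; last exact: cvg_cst.
  by apply: cvgMl; apply: cvgMr; apply: cvg_norm; exact: cvg_id.
have c2 : continuous (fun x : R => n.+3%:R - `|x|).
  by move=> y; apply: cvgB; [exact: cvg_cst|apply: cvg_norm; exact: cvg_id].
have c3 : continuous (small n).
  apply: (@continuous_minr _ (fun=> 1)) => z; first exact: cvg_cst.
  by apply: (@continuous_maxr _ (fun=> 0)) => // u; exact: cvg_cst.
have c4 : continuous (compact n).
  apply: (@continuous_minr _ (fun=> 1)) => z; first exact: cvg_cst.
  by apply: (@continuous_maxr _ (fun=> 0)) => // u; exact: cvg_cst.
by apply: cvgM; [exact: c3|exact: c4].
Qed.

Let continuous_f n : continuous (f_ n).
Proof.
move=> x; have [x1|x1] := eqVneq `|x| 1; last first.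
  by apply: cvgM; [exact: cg|exact: continuous_cut].
have cx : cut n x = 0.
  by rewrite /cut /bump1 x1 subrr normr0 mul0r subr0 (max_idPr _) // subrr mul0r.
apply/cvgrPdist_le => e e0; rewrite /f_ cx mulr0.
have e1 : 0 < e / (C + 1) by rewrite divr_gt0 // ltr_wpDl.
have /cvgrPdist_le/(_ _ e1) := @continuous_cut n x; rewrite cx.
apply: filterS => y; rewrite !sub0r !normrN => h; rewrite normrM.
apply: le_trans (ler_pM (normr_ge0 _) (normr_ge0 _) (gC y) h) _.
by rewrite mulrCA ger_pMr // ler_pdivrMr ?mul1r ?lerDl // ltr_wpDl.
Qed.

Let g_f_err n x : `|g x - f_ n x| <= cutoff_err C n x.
Proof.
have [h1 h2] := inv2_small n.
have /andP[a0 a1] := small01 n x; have /andP[b0 b1] := compact01 n x.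
have /andP[c0 c1] := bump01 n x.
rewrite (_ : g x - f_ n x = g x * (1 - cut n x)); last by rewrite /f_; ring.
have cut1 : 1 - cut n x <= bump1 (dlt n) x + (1 - small n x) + (1 - compact n x).
  rewrite /cut; move: a0 a1 b0 b1 c0 c1.
  set s := small n x; set c := compact n x; set b' := bump1 _ _ => *.
  have : (1 - b') * (1 - s * c) <= 1 - s * c by apply: ler_piMl => //; nra.
  have : s * (1 - c) <= 1 - c by apply: ler_piMl => //; lra.
  lra.
have cut0 : 0 <= 1 - cut n x by rewrite subr_ge0; have /andP[] := cut01 n x.
rewrite normrM (ger0_norm cut0).
apply: le_trans (ler_wpM2l (normr_ge0 _) cut1) _.
rewrite 2!mulrDr /cutoff_err mulrDr.
have e1 : `|g x| * bump1 (dlt n) x <= C * bump1 (dlt n) x.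
  by rewrite ler_wpM2r // bump1_ge0.
have e2 : `|g x| * (1 - compact n x) <= C * (2 * tail n.+1%:R x).
  apply: ler_pM => //; first by rewrite subr_ge0.
  have [h|h] := leP `|x| (n.+1%:R + 1).
    rewrite (_ : compact n x = 1) ?subrr ?mulr_ge0 ?tail_ge0 //.
    apply/min_idPl; rewrite le_max; apply/orP; right.
    by move: h; rewrite -[n.+3]addn1 -[n.+2]addn1 !natrD; lra.
  by have := tail_ge h; lra.
have e3 : `|g x| * (1 - small n x) <= C * dlt n * sq1 x.
  have [h|h] := leP (dlt n) `|x|.
    rewrite (_ : small n x = 1) ?subrr ?mulr0.
      by rewrite mulr_ge0 ?sq1_ge0 // mulr_ge0 // ltW.
    apply/min_idPl; rewrite le_max; apply/orP; right.
    have : 1 <= `|x| * n.+2%:R by rewrite -ler_pdivrMr ?ltr0n // div1r.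
    by rewrite -(mulrA 2); move: (`|x| * n.+2%:R) => u; lra.
  have x1 : `|x| <= 1 by apply: ltW; apply: (lt_le_trans h); lra.
  have s1 : 1 - small n x <= 1 by rewrite gerBl.
  apply: le_trans (ler_piMr (normr_ge0 _) s1) _.
  apply: (le_trans (g3 x1)); rewrite -mulrA ler_wpM2l // /sq1 x1.
  rewrite exprS -[x ^+ 2]ger0_norm ?sqr_ge0 // normrX.
  by rewrite ler_wpM2r ?exprn_ge0 // ltW.
by move: e1 e2 e3; lra.
Qed.

Let f_compact n : nu m (f_ n) @[m --> \oo] --> Rintegral Pi setT (f_ n).
Proof.
apply: (@nu_compact _ (dlt n / 2) (n.+3%:R)).
- exact: continuous_f.
- by rewrite divr_gt0 //; have [] := inv2_small n.
- move=> x h; rewrite /f_ /cut /small (max_idPl _); last first.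
    have : `|x| * 2 * n.+2%:R <= 1.
      by rewrite -ler_pdivlMr ?ltr0n // -ler_pdivlMr // div1r ltW.
    by rewrite (mulrC 2); move: (`|x| * 2 * n.+2%:R) => u; lra.
  by rewrite (min_idPr _) // mul0r mulr0 mulr0.
- move=> x h; rewrite /f_ /cut /compact [Num.max _ _](max_idPl _); last by rewrite subr_le0 ltW.
  by rewrite [Num.min _ 0](min_idPr _) // !mulr0.
Qed.

Let m1_ge1 x : 1 < `|x| -> m1 x = 1.
Proof.
move=> h; apply/min_idPl; rewrite -[x ^+ 2]ger0_norm ?sqr_ge0 // normrX.
by rewrite expr_ge1 // ltW.
Qed.

Lemma test_m1 x : `|g x| <= C * m1 x.
Proof.
have [x1|x1] := leP `|x| 1; last by rewrite m1_ge1 // mulr1.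
apply: (le_trans (g3 x1)); rewrite ler_wpM2l // /m1 le_min.
rewrite exprn_ile1 //= exprS -[x ^+ 2]ger0_norm ?sqr_ge0 // normrX.
by rewrite ler_piMl // exprn_ge0.
Qed.

Let err_m1 n x : `|cutoff_err C n x| <= (9 * C) * m1 x.
Proof.
have [h1 h2] := inv2_small n.
rewrite /cutoff_err ger0_norm; last first.
  by rewrite addr_ge0 ?mulr_ge0 ?addr_ge0 ?bump1_ge0 ?mulr_ge0 ?tail_ge0 ?sq1_ge0 // ltW.
have := bump1_m1 x h1 h2; rewrite ger0_norm ?bump1_ge0 // => e1.
have := @tail_m1 n.+1%:R x ltac:(by rewrite ler1n); rewrite ger0_norm ?tail_ge0 // => e2.
have := sq1_m1 x; rewrite ger0_norm ?sq1_ge0 // => e3.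
have e4 : C * dlt n * sq1 x <= C * m1 x.
  rewrite -mulrA ler_wpM2l //; rewrite mul1r in e3; apply: le_trans e3.
  by rewrite ler_piMl ?sq1_ge0 // (le_trans h2) //; lra.
have : C * (bump1 (dlt n) x + 2 * tail n.+1%:R x) <= C * (8 * m1 x).
  by rewrite ler_wpM2l //; lra.
lra.
Qed.

Let measurable_err n : measurable_fun setT (cutoff_err C n).
Proof.
apply: measurable_funD; apply: measurable_funM => //; last exact: measurable_sq1.
apply: measurable_funD; last by apply: measurable_funM => //; exact: measurable_tail.
by apply: continuous_measurable_fun; exact: continuous_bump1.
Qed.

(** The limit [cutoff_lim] contains the Gaussian part [sigma2] of the limiting second moment, which
    $\Pi$ does not see; the inequality is $\sigma^2\ge0$. *)
Lemma Rintegral_cutoff_le n :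
  Rintegral Pi setT (cutoff_err C n) <= cutoff_lim C n.
Proof.
have [h1 h2] := inv2_small n.
have ib : Pi.-integrable setT (EFin \o bump1 (dlt n)).
  apply: (@Pi_integrable _ 4); last by move=> x; exact: bump1_m1.
  by apply: continuous_measurable_fun; exact: continuous_bump1.
have it : Pi.-integrable setT (EFin \o tail n.+1%:R).
  by apply: (@Pi_integrable _ 2); [exact: measurable_tail|move=> x; apply: tail_m1; rewrite ler1n].
have is' : Pi.-integrable setT (EFin \o sq1).
  by apply: (@Pi_integrable _ 1); [exact: measurable_sq1|exact: sq1_m1].
have it2 : Pi.-integrable setT (EFin \o (fun x => 2 * tail n.+1%:R x)).
  rewrite (_ : EFin \o _ = (fun x : R => 2%:E * (EFin \o tail n.+1%:R) x)%E) //.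
  exact: integrableZl.
have ibt : Pi.-integrable setT (EFin \o (fun x : R => bump1 (dlt n) x + 2 * tail n.+1%:R x)).
  by apply: (integrableD measurableT ib it2).
have ic1 : Pi.-integrable setT (EFin \o (fun x => C * (bump1 (dlt n) x + 2 * tail n.+1%:R x))).
  rewrite (_ : EFin \o _ = (fun x : R => C%:E * (bump1 (dlt n) x + 2 * tail n.+1%:R x)%:E)%E) //.
  exact: integrableZl.
have ic2 : Pi.-integrable setT (EFin \o (fun x => C * dlt n * sq1 x)).
  rewrite (_ : EFin \o _ = (fun x : R => (C * dlt n)%:E * (EFin \o sq1) x)%E) //.
  exact: integrableZl.
rewrite /cutoff_err RintegralD // RintegralZl // RintegralD // RintegralZl // RintegralZl //.
rewrite lerD2l ler_wpM2l ?mulr_ge0 ?invr_ge0 // /S2 Rintegral_sq1.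
by rewrite lerDr.
Qed.

(** Near 0 the cubic bound gives $|g|\le C\,\delta x^2$ for $|x|\le\delta$, and the truncated second
    moments converge by (A2). The error of the cut-off is therefore small under [nu m] uniformly in
    large [m], as well as under [Pi]. *)
Lemma nu_test : nu m g @[m --> \oo] --> Rintegral Pi setT g.
Proof.
have ig : Pi.-integrable setT (EFin \o g) by apply: Pi_integrable test_m1.
apply/cvgrPdist_le => e e0.
have e6 : 0 < e / 6 by rewrite divr_gt0.
have [n nE] : exists n, cutoff_lim C n <= e / 6.
  have /cvgrPdist_le/(_ _ e6) [N _ /(_ N (leqnn _))] := cutoff_lim_cvg0 C.
  by rewrite sub0r normrN => h; exists N; rewrite (le_trans (ler_norm _)).
have mf : measurable_fun setT (f_ n).
  by apply: continuous_measurable_fun; exact: continuous_f.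
have if_ : Pi.-integrable setT (EFin \o f_ n).
  apply: (@Pi_integrable _ C) => // x; rewrite (le_trans _ (test_m1 x)) // /f_ normrM.
  by have /andP[h0 h1] := cut01 n x; rewrite (ger0_norm h0) ler_piMr.
have ierr : Pi.-integrable setT (EFin \o cutoff_err C n) by apply: Pi_integrable (err_m1 n).
have i1 : `|Rintegral Pi setT g - Rintegral Pi setT (f_ n)| <= e / 6.
  rewrite -RintegralB //; apply: le_trans nE; apply: le_trans (Rintegral_cutoff_le n).
  have idf : Pi.-integrable setT (EFin \o (fun x => g x - f_ n x)).
    exact: (integrableB measurableT ig if_).
  apply: le_trans (le_normr_Rintegral measurableT idf) _.
  by apply: le_Rintegral => //; exact: (integrable_norm idf).
have bg : bounded_fct g by exists C.
have bf : bounded_fct (f_ n) by exists C.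
have be := cutoff_err_bounded C n.
near=> m.
have m0 : (0 < m)%N by near: m; exists 1%N.
have i2 := nu_norm_le m0 bg bf be (g_f_err n).
have i3 : `|Rintegral Pi setT (f_ n) - nu m (f_ n)| <= e / 6.
  by near: m; have /cvgrPdist_le := @f_compact n; exact.
have i4 : `|cutoff_lim C n - nu m (cutoff_err C n)| <= e / 6.
  by near: m; have /cvgrPdist_le := @nu_cutoff_err C n; exact.
move: i1 i2 i3 i4; rewrite !ler_norml => *; lra.
Unshelve. all: by end_near. Qed.

End TestFunctions.

Lemma continuous_if1 f g x : {for x, continuous f} -> {for x, continuous g} ->
  `|x| != 1 -> {for x, continuous (fun x : R => if `|x| <= 1 then f x else g x)}.
Proof.
move=> cf cg x1; rewrite /prop_for /continuous_at.
have [h|h] := leP `|x| 1.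
  have {x1}h : `|x| < 1 by rewrite lt_neqAle x1.
  apply: cvg_trans cf; apply: near_eq_cvg; near=> y.
  rewrite ifT // ltW //; near: y.
  by apply: (cvgr_lt `|x|) => //; apply: cvg_norm; exact: cvg_id.
apply: cvg_trans cg; apply: near_eq_cvg; near=> y.
rewrite ifF //; apply/negbTE; rewrite -ltNge; near: y.
by apply: (cvgr_gt `|x|) => //; apply: cvg_norm; exact: cvg_id.
Unshelve. all: by end_near. Qed.

Definition id1 (x : R) : R := if `|x| <= 1 then x else 0.
Definition out1 (x : R) : R := if `|x| <= 1 then 0 else 1.

Lemma id1_bounded : bounded_fct id1.
Proof. by exists 1 => x; rewrite /id1; case: ifP => // _; rewrite normr0. Qed.

Lemma out1_bounded : bounded_fct out1.
Proof. by exists 1 => x; rewrite /out1; case: ifP; rewrite ?normr0 ?normr1. Qed.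

Lemma nu_id1 : nu n id1 @[n --> \oo] --> b.
Proof. exact: A2b. Qed.

Lemma nu_out1 : nu n out1 @[n --> \oo] --> Rintegral Pi setT out1.
Proof.
apply: (@nu_test _ 1).
- exact: measurable_if1.
- by move=> x; rewrite /out1; case: ifP; rewrite ?normr0 ?normr1.
- by move=> x h; rewrite /out1 h normr0 mul1r exprn_ge0.
- by move=> x h; apply: continuous_if1 => //; exact: cst_continuous.
Qed.

(** Removing the truncated Taylor term, of order 2 for the cosine and of order 1 for the sine,
    leaves a function of cubic order, covered by [nu_test]; the removed term converges by (A2). *)
Let gcos lam (x : R) : R := cos (lam * x) - 1 + lam ^+ 2 / 2 * sq1 x.
Let gsin lam (x : R) : R := sin (lam * x) - lam * id1 x.

Let continuous_lin lam : continuous (fun x : R => lam * x).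
Proof. by move=> x; apply: cvgMr; exact: cvg_id. Qed.

Let continuous_coslin lam : continuous (fun x : R => cos (lam * x)).
Proof.
move=> x; apply: (@continuous_comp _ _ _ (fun x : R => lam * x) cos).
  exact: continuous_lin.
exact: continuous_cos.
Qed.

Let continuous_sinlin lam : continuous (fun x : R => sin (lam * x)).
Proof.
move=> x; apply: (@continuous_comp _ _ _ (fun x : R => lam * x) sin).
  exact: continuous_lin.
exact: continuous_sin.
Qed.

Let gcos_test lam : [/\ measurable_fun setT (gcos lam),
  (forall x, `|gcos lam x| <= 3 * `|lam| ^+ 3 + 2 + lam ^+ 2),
  (forall x, `|x| <= 1 -> `|gcos lam x| <= (3 * `|lam| ^+ 3 + 2 + lam ^+ 2) * `|x| ^+ 3) &
  forall x, `|x| != 1 -> {for x, continuous (gcos lam)}].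
Proof.
have l3 : 0 <= `|lam| ^+ 3 by rewrite exprn_ge0.
have l2 : 0 <= lam ^+ 2 by exact: sqr_ge0.
split.
- apply: measurable_funD; last by apply: measurable_funM => //; exact: measurable_sq1.
  by apply: measurable_funB => //; apply: continuous_measurable_fun; exact: continuous_coslin.
- move=> x; apply: le_trans (ler_normD _ _) _.
  have h1 : `|cos (lam * x) - 1| <= 2.
    by apply: le_trans (ler_normB _ _) _; rewrite normr1; have := cos_max (lam * x); lra.
  have h2 : `|lam ^+ 2 / 2 * sq1 x| <= lam ^+ 2.
    have := sq1_ge0 x; have := sq1_le1 x => s1 s0.
    rewrite ger0_norm; last by rewrite mulr_ge0 // divr_ge0.
    by apply: (@le_trans _ _ (lam ^+ 2 / 2 * 1)); [rewrite ler_wpM2l // divr_ge0|lra].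
  lra.
- move=> x x1; rewrite /gcos /sq1 x1.
  rewrite (_ : lam ^+ 2 / 2 * x ^+ 2 = (lam * x) ^+ 2 / 2); last by rewrite exprMn; ring.
  have le1 : `|cos (lam * x) - 1 + (lam * x) ^+ 2 / 2| <= 3 * `|lam * x| ^+ 3.
    have [y1|y1] := leP `|lam * x| 1.
      apply: le_trans (cos_sub_taylor y1) _.
      by rewrite ler_peMl ?exprn_ge0 //; lra.
    apply: le_trans (ler_normD _ _) _.
    have h1 : `|cos (lam * x) - 1| <= 2.
      by apply: le_trans (ler_normB _ _) _; rewrite normr1; have := cos_max (lam * x); lra.
    rewrite (ger0_norm (_ : 0 <= (lam * x) ^+ 2 / 2)) ?divr_ge0 ?sqr_ge0 //.
    rewrite -[(lam * x) ^+ 2]ger0_norm ?sqr_ge0 // normrX.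
    have h2 : 1 <= `|lam * x| ^+ 2 by rewrite expr_ge1 // ltW.
    have h3 : `|lam * x| ^+ 2 <= `|lam * x| ^+ 3 by rewrite [leRHS]exprS ler_peMl ?exprn_ge0 // ltW.
    lra.
  apply: (le_trans le1); rewrite normrM exprMn mulrA ler_wpM2r ?exprn_ge0 //; lra.
- move=> x x1; apply: cvgD.
    by apply: cvgB; [exact: continuous_coslin|exact: cvg_cst].
  apply: cvgMr; apply: (@continuous_if1 (fun x => x ^+ 2) (fun=> 0)) => //.
    exact: exprn_continuous.
  exact: cst_continuous.
Qed.

Let gsin_test lam : [/\ measurable_fun setT (gsin lam),
  (forall x, `|gsin lam x| <= `|lam| ^+ 3 + 1 + `|lam|),
  (forall x, `|x| <= 1 -> `|gsin lam x| <= (`|lam| ^+ 3 + 1 + `|lam|) * `|x| ^+ 3) &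
  forall x, `|x| != 1 -> {for x, continuous (gsin lam)}].
Proof.
have l3 : 0 <= `|lam| ^+ 3 by rewrite exprn_ge0.
have l1 : 0 <= `|lam| by [].
split.
- apply: measurable_funB; last by apply: measurable_funM => //; exact: measurable_if1.
  by apply: continuous_measurable_fun; exact: continuous_sinlin.
- move=> x; apply: le_trans (ler_normB _ _) _.
  have h1 := sin_max (lam * x).
  have h2 : `|lam * id1 x| <= `|lam|.
    rewrite normrM ler_piMr // /id1; case: ifP => // _; by rewrite normr0.
  lra.
- move=> x x1; rewrite /gsin /id1 x1.
  apply: (le_trans (sin_sub_id _)); rewrite normrM exprMn ler_wpM2r ?exprn_ge0 //; lra.
- move=> x x1; apply: cvgB; first exact: continuous_sinlin.
  by apply: cvgMr; apply: continuous_if1 => //; exact: cst_continuous.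
Qed.

Lemma Pi_integrableZ c f : Pi.-integrable setT (EFin \o f) ->
  Pi.-integrable setT (EFin \o (fun x => c * f x)).
Proof.
move=> i; rewrite (_ : EFin \o _ = (fun x => c%:E * (EFin \o f) x)%E) //.
exact: integrableZl.
Qed.

Lemma Pi_integrable_sq1 : Pi.-integrable setT (EFin \o sq1).
Proof. by apply: (@Pi_integrable _ 1); [exact: measurable_sq1|exact: sq1_m1]. Qed.

Lemma nu_cos lam : nu n (fun x => cos (lam * x) - 1) @[n --> \oo] --> RePhi Pi sigma2 lam.
Proof.
have [h1 h2 h3 h4] := gcos_test lam.
have ig : Pi.-integrable setT (EFin \o gcos lam).
  by apply: Pi_integrable h1 _; exact: test_m1 h2 h3.
have is' := Pi_integrableZ (lam ^+ 2 / 2) Pi_integrable_sq1.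
have -> : RePhi Pi sigma2 lam = Rintegral Pi setT (gcos lam) - lam ^+ 2 / 2 * S2.
  rewrite /RePhi /S2 Rintegral_sq1.
  have -> : Rintegral Pi setT (fun x => cos (lam * x) - 1) =
      Rintegral Pi setT (fun x => gcos lam x - lam ^+ 2 / 2 * sq1 x).
    by congr (Rintegral _ _ _); apply/funext => x; rewrite /gcos; ring.
  rewrite RintegralB // RintegralZl //; last exact: Pi_integrable_sq1.
  by ring.
apply: (@cvg_trans _ ((fun n => nu n (gcos lam) - lam ^+ 2 / 2 * nu n sq1) @ \oo)).
  apply: near_eq_cvg; near=> m.
  have m0 : (0 < m)%N by near: m; exists 1%N.
  rewrite -(nuZ _ m0 sq1_bounded) -nuB //.
  - by congr nu; apply/funext => x; rewrite /gcos; ring.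
  - by eexists; exact: h2.
  - by apply: bounded_fctZ; exact: sq1_bounded.
apply: cvgB; first exact: nu_test h1 h2 h3 h4.
by apply: cvgMr; exact: nu_sq1.
Unshelve. all: by end_near. Qed.

Lemma nu_sin lam : nu n (fun x => sin (lam * x)) @[n --> \oo] --> ImPhi Pi b lam.
Proof.
have [h1 h2 h3 h4] := gsin_test lam.
have -> : ImPhi Pi b lam = Rintegral Pi setT (gsin lam) + lam * b.
  rewrite /ImPhi addrC mulrC; congr (_ + _); congr (Rintegral _ _ _); apply/funext => x.
  by rewrite /gsin /id1; case: ifP; rewrite ?mulr1 ?mulr0.
apply: (@cvg_trans _ ((fun n => nu n (gsin lam) + lam * nu n id1) @ \oo)).
  apply: near_eq_cvg; near=> m.
  have m0 : (0 < m)%N by near: m; exists 1%N.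
  rewrite -(nuZ _ m0 id1_bounded) -nuD //.
  - by congr nu; apply/funext => x; rewrite /gsin subrK.
  - by eexists; exact: h2.
  - by apply: bounded_fctZ; exact: id1_bounded.
apply: cvgD; first exact: nu_test h1 h2 h3 h4.
by apply: cvgMr; exact: nu_id1.
Unshelve. all: by end_near. Qed.

(** Quadratic at 0 and bounded by 1: small increments are controlled by second moments and large
    ones by the tail, with a single function. *)
Definition lyap (z : R) : R := z ^+ 2 / (1 + z ^+ 2).

Lemma lyap_ge0 z : 0 <= lyap z.
Proof. by rewrite divr_ge0 ?sqr_ge0 // addr_ge0 ?sqr_ge0. Qed.

Let den_gt0 (z : R) : 0 < 1 + z ^+ 2.
Proof. by rewrite ltr_pwDl ?sqr_ge0. Qed.

Lemma lyap_le1 z : lyap z <= 1.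
Proof. by rewrite ler_pdivrMr ?den_gt0 // mul1r lerDr. Qed.

Lemma lyap0 : lyap 0 = 0.
Proof. by rewrite /lyap expr0n mul0r. Qed.

Lemma lyap_ge z : 1 <= `|z| -> 1 / 2 <= lyap z.
Proof.
move=> h; rewrite /lyap ler_pdivlMr ?den_gt0 //.
have : 1 <= z ^+ 2 by rewrite -[z ^+ 2]ger0_norm ?sqr_ge0 // normrX expr_ge1.
lra.
Qed.

Lemma lyap_lip x y : lyap (x + y) - lyap x <= `|y|.
Proof.
have d1 := den_gt0 x; have d2 := den_gt0 (x + y).
have -> : lyap (x + y) - lyap x = y * (x + (x + y)) / ((1 + x ^+ 2) * (1 + (x + y) ^+ 2)).
  by rewrite /lyap; field; rewrite !gt_eqF.
rewrite ler_pdivrMr ?mulr_gt0 //; apply: (le_trans (ler_norm _)).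
rewrite normrM ler_wpM2l // ler_norml; set w := x + y in d2 *.
have := sqr_ge0 (x - 1); have := sqr_ge0 (w - 1); have := sqr_ge0 (x + 1).
have := sqr_ge0 (w + 1); have := mulr_ge0 (sqr_ge0 x) (sqr_ge0 w).
move=> *; apply/andP; split; nra.
Qed.

(** A one-sided second order bound, valid for every [y]. With $w=x+y$, the difference of the two
    sides is $y^2$ times a quotient whose numerator is nonnegative because $(x+w)^2\ge0$. *)
Lemma lyap_quad x y : lyap (x + y) - lyap x <= 2 * x / (1 + x ^+ 2) ^+ 2 * y + y ^+ 2.
Proof.
have d1 := den_gt0 x; have d2 := den_gt0 (x + y); set w := x + y in d2 *.
rewrite -subr_ge0.
have -> : 2 * x / (1 + x ^+ 2) ^+ 2 * y + y ^+ 2 - (lyap w - lyap x) =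
  y ^+ 2 * (((1 + x ^+ 2) ^+ 2 * (1 + w ^+ 2) - ((1 + x ^+ 2) - 2 * x * (x + w)))
    / ((1 + x ^+ 2) ^+ 2 * (1 + w ^+ 2))).
  by rewrite /lyap /w; field; rewrite !gt_eqF // den_gt0.
rewrite mulr_ge0 ?sqr_ge0 // divr_ge0 //; last by rewrite mulr_ge0 ?sqr_ge0 // ltW.
rewrite subr_ge0; have h1 : 1 + x ^+ 2 - 2 * x * (x + w) <= 1 + w ^+ 2.
  by have := sqr_ge0 (x + w); nra.
apply: (le_trans h1); apply: ler_peMl; first exact: ltW.
by apply: exprn_ege1; rewrite lerDl sqr_ge0.
Qed.

Lemma lyap_slope (x : R) : `|2 * x / (1 + x ^+ 2) ^+ 2| <= 1.
Proof.
have d1 := den_gt0 x; rewrite normrM normfV ler_pdivrMr ?mul1r ?normr_gt0 ?gt_eqF ?exprn_gt0 //.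
rewrite [X in _ <= X]ger0_norm ?sqr_ge0 // ler_norml; apply/andP; split; nra.
Qed.

(** Three ranges of the jump: the quadratic bound for $|x|\le1$, the Lipschitz bound up to $A+1$,
    and [lyap <= 1 <= 2 * tail A x] beyond. *)
Lemma lyap_jump l A z x : 0 < l -> 0 < A ->
  lyap ((z + x) / l) - lyap (z / l) <=
  2 * (z / l) / (1 + (z / l) ^+ 2) ^+ 2 / l * id1 x + l^-1 ^+ 2 * sq1 x +
  (A + 1) / l * out1 x + 2 * tail A x.
Proof.
move=> l0 A0; rewrite mulrDl /id1 /sq1 /out1.
have li : 0 < l^-1 by rewrite invr_gt0.
have t0 := tail_ge0 A x.
have [x1|x1] := leP `|x| 1.
  have := lyap_quad (z / l) (x / l).
  rewrite exprMn; set s := 2 * (z / l) / _; move=> h.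
  rewrite mulr0 addr0 -mulrA (mulrC l^-1 x) (mulrC (l^-1 ^+ 2)); lra.
rewrite !mulr0 !add0r mulr1.
have [xA|xA] := leP `|x| (A + 1).
  have := lyap_lip (z / l) (x / l); rewrite normrM (gtr0_norm li) => h.
  have : `|x| / l <= (A + 1) / l by rewrite ler_pM2r.
  lra.
have h1 := tail_ge xA; have h2 := lyap_le1 (z / l + x / l); have h3 := lyap_ge0 (z / l).
have : 0 <= (A + 1) / l by rewrite divr_ge0 ?ltW //; lra.
lra.
Qed.

Definition lyap_jump_fct l z (x : R) : R := lyap ((z + x) / l) - lyap (z / l).

Lemma lyap_jump_fct_norm l z x : `|lyap_jump_fct l z x| <= 1.
Proof.
rewrite /lyap_jump_fct; have := lyap_ge0 ((z + x) / l); have := lyap_ge0 (z / l).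
have := lyap_le1 ((z + x) / l); have := lyap_le1 (z / l); rewrite ler_norml; lra.
Qed.

Lemma cvg_bounded_near (u : nat -> R) l : u @ \oo --> l ->
  \forall n \near \oo, `|u n| <= `|l| + 1.
Proof.
by move=> ul; apply: (cvgr_le `|l|); [exact: cvg_norm|rewrite ltrDl].
Qed.

Let B := `|b| + `|S2| + `|Rintegral Pi setT out1| + 3.

(** The slope of [lyap] is at most 1 in absolute value, so the bound does not depend on [z]. The
    constant [B] dominates the three moments once [m] is so large that each is within 1 of its limit
    in absolute value. *)
Lemma nu_lyap_jump_le l A : 0 < l -> 0 < A ->
  \forall m \near \oo, forall z,
    nu m (lyap_jump_fct l z) <= (A + 2 + l^-1) * B / l + 2 * nu m (tail A).
Proof.
move=> l0 A0; near=> m.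
have m0 : (0 < m)%N by near: m; exists 1%N.
have h1 : `|nu m id1| <= `|b| + 1 by near: m; exact: cvg_bounded_near nu_id1.
have h2 : `|nu m sq1| <= `|S2| + 1 by near: m; exact: cvg_bounded_near nu_sq1.
have h3 : `|nu m out1| <= `|Rintegral Pi setT out1| + 1.
  by near: m; exact: cvg_bounded_near nu_out1.
move=> z; set s := 2 * (z / l) / (1 + (z / l) ^+ 2) ^+ 2.
have s1 : `|s| <= 1 by exact: lyap_slope.
have b1 := bounded_fctZ (s / l) id1_bounded.
have b2 := bounded_fctZ (l^-1 ^+ 2) sq1_bounded.
have b3 := bounded_fctZ ((A + 1) / l) out1_bounded.
have b4 := bounded_fctZ 2 (tail_bounded A).
have b12 := bounded_fctD b1 b2; have b123 := bounded_fctD b12 b3.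
have bj : bounded_fct (lyap_jump_fct l z) by exists 1; exact: lyap_jump_fct_norm.
apply: le_trans (nu_le m0 bj (bounded_fctD b123 b4) (fun x => lyap_jump z x l0 A0)) _.
rewrite (nuD m0 b123 b4) (nuD m0 b12 b3) (nuD m0 b1 b2).
rewrite (nuZ _ m0 id1_bounded) (nuZ _ m0 sq1_bounded) (nuZ _ m0 out1_bounded).
rewrite (nuZ _ m0 (tail_bounded A)) lerD2r.
have li : 0 < l^-1 by rewrite invr_gt0.
have B1 : `|nu m id1| <= B by rewrite /B; have := normr_ge0 S2; have := normr_ge0 (Rintegral Pi setT out1); lra.
have B2 : `|nu m sq1| <= B by rewrite /B; have := normr_ge0 b; have := normr_ge0 (Rintegral Pi setT out1); lra.
have B3 : `|nu m out1| <= B by rewrite /B; have := normr_ge0 S2; have := normr_ge0 b; lra.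
have e1 : s / l * nu m id1 <= l^-1 * B.
  apply: le_trans (ler_norm _) _; rewrite 2!normrM (gtr0_norm li) -mulrA.
  apply: le_trans (ler_piMl _ s1) _; first by rewrite mulr_ge0 // ltW.
  by rewrite ler_pM2l.
have e2 : l^-1 ^+ 2 * nu m sq1 <= l^-1 ^+ 2 * B.
  by rewrite ler_pM2l ?exprn_gt0 // (le_trans (ler_norm _)).
have e3 : (A + 1) / l * nu m out1 <= (A + 1) / l * B.
  by rewrite ler_pM2l ?mulr_gt0 ?addr_gt0 // (le_trans (ler_norm _)).
move: e1 e2 e3; rewrite (_ : (A + 2 + l^-1) * B / l = l^-1 * B + l^-1 ^+ 2 * B + (A + 1) / l * B).
  lra.
by field; rewrite gt_eqF.
Unshelve. all: by end_near. Qed.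

Lemma nu_lyap_bounded l : 0 < l -> exists2 C, 0 < C &
  \forall m \near \oo, forall z, nu m (lyap_jump_fct l z) <= C.
Proof.
move=> l0; exists (`|(1 + 2 + l^-1) * B / l| + 2 * (`|Rintegral Pi setT (tail 1)| + 1)).
  by rewrite ltr_wpDl // mulr_gt0 // ltr_wpDl.
near=> m => z.
have h1 : forall z, nu m (lyap_jump_fct l z) <= (1 + 2 + l^-1) * B / l + 2 * nu m (tail 1).
  by near: m; apply: nu_lyap_jump_le.
have h2 : `|nu m (tail 1)| <= `|Rintegral Pi setT (tail 1)| + 1.
  by near: m; apply: cvg_bounded_near; apply: nu_tail.
apply: (le_trans (h1 z)); apply: lerD; first exact: ler_norm.
by rewrite ler_pM2l // (le_trans (ler_norm _)).
Unshelve. all: by end_near. Qed.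

(** A large [A] first makes the tail term small; then the scale [l] is taken large compared with [A]
    to beat the remaining term of order $A/l$. *)
Lemma nu_lyap_small e : 0 < e -> exists2 l0, 1 <= l0 & forall l, l0 <= l ->
  \forall m \near \oo, forall z, nu m (lyap_jump_fct l z) <= e.
Proof.
move=> e0; have e8 : 0 < e / 8 by rewrite divr_gt0.
have [N hN] : exists N, Rintegral Pi setT (tail N.+1%:R) <= e / 8.
  have /cvgrPdist_le/(_ _ e8) [N _ /(_ N (leqnn _))] := Rintegral_tail_cvg0.
  rewrite {1}/Rintegral integral0 /= sub0r normrN => h; exists N.
  by rewrite (le_trans (ler_norm _)).
have B0 : 0 < B.
  rewrite /B; have := normr_ge0 S2; have := normr_ge0 b.
  by have := normr_ge0 (Rintegral Pi setT out1); lra.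
set A : R := N.+1%:R; have A0 : 0 < A by rewrite ltr0n.
pose ell := 1 + (A + 3) * B / (e / 2).
have ell1 : 1 <= ell by rewrite lerDl divr_ge0 ?mulr_ge0 //; lra.
exists ell => // l ell_l; have l1 : 1 <= l by exact: le_trans ell_l.
have l0 : 0 < l by lra.
near=> m => z.
have h1 : forall z, nu m (lyap_jump_fct l z) <= (A + 2 + l^-1) * B / l + 2 * nu m (tail A).
  by near: m; apply: nu_lyap_jump_le.
have h2 : `|Rintegral Pi setT (tail A) - nu m (tail A)| <= e / 8.
  by near: m; have /cvgrPdist_le := nu_tail A0; exact.
apply: (le_trans (h1 z)).
have : (A + 2 + l^-1) * B / l <= e / 2.
  have le2 : e / 2 + (A + 3) * B <= e / 2 * l.
    rewrite (_ : _ + _ = e / 2 * ell); last by rewrite /ell; field; rewrite gt_eqF.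
    by rewrite ler_pM2l // divr_gt0.
  rewrite ler_pdivrMr //; apply: le_trans le2.
  have : l^-1 <= 1 by rewrite invf_le1.
  by move: (l^-1) => li h; nra.
by move: h2; rewrite ler_norml => /andP[h2 _]; lra.
Unshelve. all: by end_near. Qed.

End JumpMeasure.

(** * Skorokhod closeness *)

Section SkorokhodCloseness.
Variable R : realType.
Implicit Types (w v l : R -> R) (e t : R).

(** A strictly increasing map of $[0,\infty)$ onto itself cannot jump, so continuity is
    automatic. *)
Lemma time_changeI l : l 0 = 0 -> (forall s t, 0 <= s -> s < t -> l s < l t) ->
  (forall y, 0 <= y -> exists2 t, 0 <= t & l t = y) -> time_change l.
Proof.
move=> l0 lmono lsurj; split => //; split => //.
have lt_of s t : 0 <= s -> 0 <= t -> l s < l t -> s < t.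
  move=> s0 t0 st; rewrite ltNge; apply/negP; rewrite le_eqVlt => /orP[/eqP ts|ts].
    by move: st; rewrite ts ltxx.
  by have := lmono _ _ t0 ts; rewrite ltNge (ltW st).
have lge0 t : 0 <= t -> 0 <= l t.
  rewrite le_eqVlt => /orP[/eqP <-|t0]; first by rewrite l0.
  by rewrite -l0 ltW // lmono.
apply/continuous_within_itvcyP; split.
  move=> t; rewrite in_itv/= andbT => t0.
  apply/cvgrPdist_lt => e e0.
  have lt0 : 0 < l t by rewrite -l0 lmono.
  have [s1 s10 ls1] := lsurj (l t - Num.min e (l t)) ltac:(by rewrite subr_ge0 ge_min lexx orbT).
  have [s2 s20 ls2] := lsurj (l t + e) ltac:(by rewrite addr_ge0 ?ltW).
  have s1t : s1 < t.
    apply: lt_of => //; first exact: ltW.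
    by rewrite ls1 ltrBlDr ltrDl lt_min e0.
  have ts2 : t < s2.
    by apply: lt_of => //; [exact: ltW|rewrite ls2 ltrDl].
  near=> s.
  have ss1 : s1 < s by near: s; exact: lt_nbhsr.
  have ss2 : s < s2 by near: s; exact: lt_nbhsl.
  have h1 := lmono _ _ s10 ss1; have h2 := lmono _ _ (ltW (le_lt_trans s10 ss1)) ss2.
  have : Num.min e (l t) <= e by rewrite ge_min lexx.
  by rewrite ltr_distl; move: h1 h2; rewrite ls1 ls2; lra.
apply/cvgrPdist_lt => e e0.
have [s2 s20 ls2] := lsurj e (ltW e0).
have ts2 : 0 < s2 by apply: lt_of => //; rewrite l0 ls2.
near=> s.
have s0 : 0 < s by near: s; exact: nbhs_right_gt.
have ss2 : s < s2 by near: s; exact: nbhs_right_lt.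
have h2 := lmono _ _ (ltW s0) ss2.
have := lge0 s (ltW s0).
by rewrite l0 sub0r normrN => ?; rewrite ger0_norm // -ls2.
Unshelve. all: by end_near. Qed.

Lemma time_change_ge0 l t : time_change l -> 0 <= t -> 0 <= l t.
Proof.
move=> [l0 [_ [lmono _]]]; rewrite le_eqVlt => /orP[/eqP <-|t0]; first by rewrite l0.
by rewrite -l0 ltW // lmono.
Qed.

Lemma time_change_comp l1 l2 : time_change l1 -> time_change l2 ->
  time_change (l1 \o l2).
Proof.
move=> tc1 tc2; have := tc1; have := tc2.
move=> [l20 [_ [m2 s2]]] [l10 [_ [m1 s1]]]; apply: time_changeI => /=.
- by rewrite l20.
- move=> s t s0 st; apply: m1; first exact: time_change_ge0.
  exact: m2.
- move=> y y0; have [t t0 <-] := s1 _ y0.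
  by have [u u0 <-] := s2 _ t0; exists u.
Qed.

(** One parameter bounds the time distortion, the error in space and, through the horizon [e^-1],
    the part of the paths that is ignored. Closeness with parameters tending to 0 is $J_1$
    convergence. The relation is not symmetric: the time change acts on the first path and the
    horizon is measured along the second. *)
Definition close_paths e w v := exists l, [/\ time_change l,
  forall t, 0 <= t -> `|l t - t| <= e &
  forall t, 0 <= t -> t <= e^-1 -> `|w (l t) - v t| <= e].

Lemma time_change_id : time_change (id : R -> R).
Proof. by apply: time_changeI => // y y0; exists y. Qed.

Lemma close_refl e w : 0 <= e -> close_paths e w w.
Proof.
move=> e0; exists id; split; first exact: time_change_id.
  by move=> t _; rewrite subrr normr0.
by move=> t _ _; rewrite subrr normr0.
Qed.

Lemma close_trans e1 e2 w1 w2 w3 : 0 < e1 -> 0 < e2 -> e1 + e2 <= 1 ->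
  close_paths e1 w1 w2 -> close_paths e2 w2 w3 -> close_paths (e1 + e2) w1 w3.
Proof.
move=> e10 e20 e12 [l1 [tc1 l1e l1w]] [l2 [tc2 l2e l2w]].
exists (l1 \o l2); split; first exact: time_change_comp.
  move=> t t0 /=; have l2t := time_change_ge0 tc2 t0.
  have := l1e _ l2t; have := l2e _ t0; rewrite !ler_norml; lra.
move=> t t0 te /=; have l2t := time_change_ge0 tc2 t0.
have te2 : t <= e2^-1.
  by rewrite (le_trans te) // lef_pV2 ?posrE ?addr_gt0 // lerDr ltW.
(* The horizon of the composition, shifted by the distortion [e2], must stay within the first
   horizon: here [e1 + e2 <= 1] enters, through [e1 * (e1 + e2) <= 1]. *)
have l2te : l2 t <= e1^-1.
  have := l2e _ t0; rewrite ler_norml => /andP[_ h].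
  have : l2 t <= (e1 + e2)^-1 + e2 by lra.
  move=> /le_trans; apply.
  have e120 : 0 < e1 + e2 by rewrite addr_gt0.
  rewrite -subr_ge0.
  rewrite (_ : _ - _ = e2 * (1 - e1 * (e1 + e2)) / (e1 * (e1 + e2))); last first.
    by field; rewrite !gt_eqF.
  apply: divr_ge0; last by rewrite mulr_ge0 // ltW.
  by apply: mulr_ge0; [exact: ltW|nra].
have := l1w _ l2t l2te; have := l2w _ t0 te2; rewrite !ler_norml; lra.
Qed.

(** The elementary time change that resizes one interval, from length [a] to length [b], and
    translates what follows. Composing such maps aligns two subdivisions. *)
Definition bump (s0 a b s : R) :=
  if s <= s0 then s else
  if s <= s0 + a then s0 + (s - s0) * (b / a) else s + (b - a).

Lemma time_change_bump s0 a b : 0 <= s0 -> 0 < a -> 0 < b ->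
  time_change (bump s0 a b).
Proof.
move=> s00 a0 b0; have r0 : 0 < b / a by rewrite divr_gt0.
have rE : a * (b / a) = b by rewrite mulrC divfK // gt_eqF.
apply: time_changeI; rewrite /bump.
- by rewrite s00.
- move=> s t s0' st; set r := b / a in r0 rE *.
  case: (leP s s0) => h1; case: (leP t s0) => h2; try lra.
  + case: (leP t (s0 + a)) => h3; last lra.
    have : 0 < (t - s0) * r by apply: mulr_gt0 => //; lra.
    lra.
  + case: (leP s (s0 + a)) => h3; case: (leP t (s0 + a)) => h4; try lra.
      by rewrite ltrD2l ltr_pM2r //; lra.
    have : (s - s0) * r <= a * r by rewrite ler_pM2r //; lra.
    lra.
- move=> y y0.
  case: (leP y s0) => h1; first by exists y; rewrite // h1.
  case: (leP y (s0 + b)) => h2.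
    exists (s0 + (y - s0) * (a / b)).
      by rewrite addr_ge0 // mulr_ge0 // ?divr_ge0 ?ltW //; lra.
    have h3 : 0 < (y - s0) * (a / b) by rewrite mulr_gt0 ?divr_gt0 //; lra.
    have h4 : (y - s0) * (a / b) <= a.
      by rewrite mulrCA ger_pMr // ler_pdivrMr // mul1r; lra.
    rewrite ifF; last by apply/negbTE; rewrite -ltNge; lra.
    rewrite ifT; last lra.
    by field; rewrite !gt_eqF.
  exists (y - (b - a)); first lra.
  rewrite ifF; last by apply/negbTE; rewrite -ltNge; lra.
  rewrite ifF; last by apply/negbTE; rewrite -ltNge; lra.
  by ring.
Qed.

(** Each block is treated by composing with one more [bump], which leaves the earlier blocks alone.
    Inside a block the displacement [l t - t] is a convex combination of its values at the two ends,
    so it is controlled by the boundaries. *)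
Lemma time_change_blocks K (c c' : nat -> R) : c 0%N = 0 -> c' 0%N = 0 ->
  (forall j, (j < K)%N -> c j < c j.+1) ->
  (forall j, (j < K)%N -> c' j < c' j.+1) ->
  exists l, [/\ time_change l,
    forall j t, (j < K)%N -> c' j <= t -> t < c' j.+1 ->
      c j <= l t /\ l t < c j.+1,
    forall t, c' K <= t -> l t = t + (c K - c' K) &
    forall e, (forall j, (j <= K)%N -> `|c j - c' j| <= e) ->
      forall t, 0 <= t -> `|l t - t| <= e].
Proof.
move=> c0 c'0; elim: K => [|K IH] cmono c'mono.
  exists id; split => //.
  - exact: time_change_id.
  - by move=> t _; rewrite c0 c'0 subrr addr0.
  - move=> e /(_ 0%N (leqnn _)); rewrite c0 c'0 => h t _.
    by rewrite subrr -[X in `|X|](subrr 0).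
have [l [tcl lb lK le]] := IH (fun j jK => cmono j (ltnW jK)) (fun j jK => c'mono j (ltnW jK)).
have cK0 : 0 <= c K.
  elim: (K) (cmono) => [|k IHk] cm; first by rewrite c0.
  by apply: le_trans (ltW (cm k (leqnSn _))); apply: IHk => j jk; apply: cm; rewrite ltnS ltnW.
have c'K0 : 0 <= c' K.
  elim: (K) (c'mono) => [|k IHk] cm; first by rewrite c'0.
  by apply: le_trans (ltW (cm k (leqnSn _))); apply: IHk => j jk; apply: cm; rewrite ltnS ltnW.
have a0 : 0 < c' K.+1 - c' K by rewrite subr_gt0 c'mono.
have b0 : 0 < c K.+1 - c K by rewrite subr_gt0 cmono.
have lcK : l (c' K) = c K by rewrite lK //; ring.
have [_ [_ [lmono _]]] := tcl.
set a := c' K.+1 - c' K in a0 *; set b := c K.+1 - c K in b0 *.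
have rE : a * (b / a) = b by rewrite mulrC divfK // gt_eqF.
have gl1 t : 0 <= t -> t <= c' K -> bump (c K) a b (l t) = l t.
  move=> t0; rewrite le_eqVlt => /orP[/eqP ->|tK]; rewrite /bump.
    by rewrite lcK lexx.
  by rewrite ifT // -lcK ltW // lmono.
have gl2 t : c' K < t -> t <= c' K.+1 ->
    bump (c K) a b (l t) = c K + (t - c' K) * (b / a).
  move=> t1 t2; rewrite lK; last exact: ltW.
  rewrite /bump ifF; last by apply/negbTE; rewrite -ltNge; lra.
  rewrite ifT; last by rewrite /a; lra.
  by congr (_ + _ * _); ring.
have gl3 t : c' K.+1 <= t -> bump (c K) a b (l t) = t + (c K.+1 - c' K.+1).
  rewrite le_eqVlt => /orP[/eqP <-|t1].
    rewrite gl2 //; last by rewrite c'mono.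
    by rewrite -/a rE /b; ring.
  have cc := c'mono K (ltnSn _).
  rewrite lK; last by apply/ltW/(lt_trans cc).
  rewrite /bump ifF; last by apply/negbTE; rewrite -ltNge; lra.
  rewrite ifF; last by apply/negbTE; rewrite -ltNge /a; lra.
  by rewrite /a /b; ring.
exists (bump (c K) a b \o l); split.
- by apply: time_change_comp => //; exact: time_change_bump.
- move=> j t; rewrite ltnS leq_eqVlt => /orP[/eqP ->|jK] t1 t2 /=.
    have [tK|tK] := eqVneq t (c' K).
      by rewrite tK gl1 // lcK lexx cmono.
    have tK' : c' K < t by rewrite lt_neqAle eq_sym tK.
    rewrite gl2 //; last exact: ltW.
    have r0 : 0 < b / a by rewrite divr_gt0.
    split; first by rewrite lerDl mulr_ge0 // ?subr_ge0 // ltW.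
    have : (t - c' K) * (b / a) < a * (b / a) by rewrite ltr_pM2r // /a ltrD2r.
    by rewrite rE /b; lra.
  have c'j0 : 0 <= c' j.
    elim: (j) (jK) => [|i IHi] iK; first by rewrite c'0.
    by apply: le_trans (IHi (ltnW iK)) (ltW (c'mono _ _)); rewrite ltnS ltnW // ltnW.
  have jK2 : c' j.+1 <= c' K.
    have mono k : (j.+1 + k <= K)%N -> c' j.+1 <= c' (j.+1 + k)%N.
      elim: k => [|k IHk]; first by rewrite addn0.
      rewrite addnS => h; apply: le_trans (IHk (ltnW h)) (ltW (c'mono _ _)).
      by rewrite ltnS ltnW.
    by have := mono (K - j.+1)%N; rewrite subnKC // => ->.
  rewrite gl1; first exact: lb.
    exact: le_trans t1.
  by apply: ltW; apply: lt_le_trans t2 _.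
- by move=> t t1 /=; rewrite gl3.
- move=> e ce t t0 /=.
  have ceK : forall j, (j <= K)%N -> `|c j - c' j| <= e by move=> j jK; apply: ce; exact: leqW.
  have [tK|tK] := leP t (c' K); first by rewrite gl1 // (le e).
  have [tK2|tK2] := leP t (c' K.+1); last first.
    by rewrite gl3; [rewrite addrAC subrr add0r ce|exact: ltW].
  rewrite gl2 //.
  have h1 := ce K (leqnSn _); have h2 := ce K.+1 (leqnn _).
  set th := (t - c' K) / a.
  have th0 : 0 <= th by apply: divr_ge0; [rewrite subr_ge0; exact: ltW|exact: ltW].
  have th1 : th <= 1 by rewrite ler_pdivrMr // mul1r /a lerD2r.
  rewrite (_ : _ - t = (1 - th) * (c K - c' K) + th * (c K.+1 - c' K.+1)); last first.
    rewrite (_ : (t - c' K) * (b / a) = th * b); last by rewrite /th mulrAC mulrA.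
    rewrite (_ : c K + th * b - t = c K + th * b - c' K - (t - c' K)); last by ring.
    rewrite (_ : t - c' K = th * a); last by rewrite /th divfK // gt_eqF.
    by rewrite /a /b; ring.
  move: h1 h2; rewrite !ler_norml => /andP[h1 h1'] /andP[h2 h2'].
  by apply/andP; split; nra.
Qed.

Lemma close_blocks K (c c' : nat -> R) e w v : 0 < e ->
  c 0%N = 0 -> c' 0%N = 0 ->
  (forall j, (j < K)%N -> c j < c j.+1) ->
  (forall j, (j < K)%N -> c' j < c' j.+1) ->
  (forall j, (j <= K)%N -> `|c j - c' j| <= e) -> e^-1 < c' K ->
  (forall j t t', (j < K)%N -> c j <= t < c j.+1 -> c' j <= t' < c' j.+1 ->
    `|w t - v t'| <= e) ->
  close_paths e w v.
Proof.
move=> e0 c0 c'0 cm c'm cc' eK wv.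
have [l [tcl lb _ le]] := time_change_blocks c0 c'0 cm c'm.
exists l; split => //; first exact: le.
move=> t t0 te.
have [j jK /andP[h1 h2]] : exists2 j, (j < K)%N & c' j <= t < c' j.+1.
  have : t < c' K by exact: le_lt_trans te eK.
  elim: (K) => [|k IHk]; first by rewrite c'0 ltNge t0.
  have [tk _|tk h] := ltP t (c' k).
    by have [j jk h] := IHk tk; exists j => //; exact: leqW.
  by exists k => //; rewrite tk.
by apply: (wv j) => //; rewrite ?h1 // ; have [-> ->] := lb j t jK h1 h2.
Qed.

(* The inf-convolution of [F] with Skorokhod closeness, capped at [M]: a minorant
   of [F] that is Lipschitz for [close_paths]. *)
Definition lipreg (F : (R -> R) -> R) (M k : R) (w : R -> R) :=
  inf [set x | x = M \/ exists v e, [/\ 0 < e, cadlag v, close_paths e v w & x = F v + k * e]].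

(** * Lipschitz regularization from below *)

Section Regularization.
Variables (F : (R -> R) -> R) (M : R).
Hypothesis F0 : forall w, 0 <= F w.
Hypothesis FM : forall w, F w <= M.

Let S k w := [set x | x = M \/ exists v e, [/\ 0 < e, cadlag v, close_paths e v w & x = F v + k * e]].

Let lb0 k w : 0 <= k -> lbound (S k w) 0.
Proof.
move=> k0 x [->|[v [e [e0 _ _ ->]]]]; first exact: le_trans (F0 (fun=> 0)) (FM _).
by rewrite addr_ge0 // mulr_ge0 // ltW.
Qed.

Lemma lipreg_ge0 k w : 0 <= k -> 0 <= lipreg F M k w.
Proof. by move=> k0; apply: lb_le_inf; [exists M; left|exact: lb0]. Qed.

Lemma lipreg_leM k w : 0 <= k -> lipreg F M k w <= M.
Proof. by move=> k0; apply: ge_inf; [exists 0; exact: lb0|left]. Qed.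

Lemma lipreg_le k w : 0 <= k -> cadlag w -> lipreg F M k w <= F w.
Proof.
move=> k0 cw; apply/ler_addgt0Pr => e e0.
have h : lipreg F M k w <= F w + k * (e / (k + 1)).
  apply: ge_inf; first by exists 0; exact: lb0.
  have ek : 0 < e / (k + 1) by rewrite divr_gt0 //; lra.
  right; exists w, (e / (k + 1)); split => //.
  by apply: close_refl; exact: ltW.
apply: (le_trans h); rewrite lerD2l mulrCA ger_pMr // ler_pdivrMr ?mul1r; lra.
Qed.

Lemma lipreg_lip k e w1 w2 : 0 <= k -> M <= k -> 0 < e -> close_paths e w2 w1 ->
  lipreg F M k w1 <= lipreg F M k w2 + k * e.
Proof.
move=> k0 Mk e0 w21; rewrite -lerBlDr; apply: lb_le_inf; first by exists M; left.
move=> x [->|[v [e' [e'0 cv vw ->]]]].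
  rewrite lerBlDr; apply: le_trans (lipreg_leM _ k0) _.
  by rewrite lerDl mulr_ge0 // ltW.
rewrite lerBlDr; have [ee|ee] := leP (e' + e) 1.
  apply: ge_inf; first by exists 0; exact: lb0.
  right; exists v, (e' + e); split => //; first exact: addr_gt0.
    exact: close_trans vw w21.
  by ring.
(* For [e' + e > 1] closeness does not compose, but then [k * (e' + e)] already exceeds the cap [M],
   as [M <= k]. *)
apply: le_trans (lipreg_leM _ k0) _.
have := F0 v; nra.
Qed.

(** Near-minimizers have closeness parameters at most [(M + 2) / k.+1], since the values are capped
    by [M]. They therefore converge to [w] in $J_1$, and the sequential continuity of [F] fixes the
    limit of their values. *)
Lemma lipreg_cvg w : J1_bounded_continuous F -> cadlag w ->
  lipreg F M k.+1%:R w @[k --> \oo] --> F w.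
Proof.
move=> [_ [_ Fc]] cw.
have M0 : 0 <= M := le_trans (F0 (fun=> 0)) (FM _).
have ch k : exists vx : (R -> R) * R, [/\ 0 < vx.2, cadlag vx.1, close_paths vx.2 vx.1 w &
    F vx.1 + k.+1%:R * vx.2 <= lipreg F M k.+1%:R w + 2 * k.+1%:R^-1].
  have k0 : (0 : R) <= k.+1%:R by rewrite ler0n.
  have ki0 : (0 : R) < k.+1%:R^-1 by rewrite invr_gt0 ltr0n.
  have [x Sx xl] : exists2 x, S k.+1%:R w x & x < lipreg F M k.+1%:R w + k.+1%:R^-1.
    by apply: inf_adherent => //; split; [exists M; left|exists 0; exact: lb0].
  case: Sx => [xM|[v [e [e0 cv cle xE]]]]; last first.
    exists (v, e); split => //=; rewrite -xE (le_trans (ltW xl)) // lerD2l.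
    by rewrite ler_peMl ?ltW // ltr1n.
  have h := lipreg_le k0 cw.
  (* If the cap nearly realizes the infimum, [w] itself is a near-minimizer because [F w <= M]; its
     parameter is chosen so that the penalty is [k.+1%:R^-1]. *)
  exists (w, (k.+1%:R^-1 / k.+1%:R)); split => //=.
  - by apply: close_refl; rewrite divr_ge0 // ltW.
  - rewrite mulrC divfK; last by rewrite pnatr_eq0.
    rewrite mulr_natl mulr2n addrA lerD2r; apply: le_trans (FM w) _.
    by rewrite xM in xl; exact: ltW.
have /choice[ve veP] := ch.
pose v k := (ve k).1; pose ep k := (ve k).2.
have ep_small k : ep k <= (M + 2) / k.+1%:R.
  have [e0 _ _ h] := veP k.
  rewrite ler_pdivlMr ?ltr0n // mulrC.
  have := F0 (v k); have := @lipreg_leM k.+1%:R w ltac:(by rewrite ler0n).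
  have : k.+1%:R^-1 <= 1 :> R by rewrite invf_le1 ?ltr0n // ler1n.
  by move: h; rewrite /v /ep; move: (k.+1%:R : R) => r; lra.
have epl k e : 0 < e -> \forall k \near \oo, (M + 2) / k.+1%:R <= e :> R.
  move=> e0; near=> m.
  rewrite ler_pdivrMr ?ltr0n // mulrC -ler_pdivrMr //.
  have : (M + 2) / e <= m%:R.
    by near: m; apply: nbhs_infty_ger.
  by move=> /le_trans; apply; rewrite ler_nat.
have Jv : J1_cvg v w.
  have /choice[lk lkP] : forall k, exists l, [/\ time_change l,
    forall t, 0 <= t -> `|l t - t| <= ep k &
    forall t, 0 <= t -> t <= (ep k)^-1 -> `|v k (l t) - w t| <= ep k].
    by move=> k; have [_ _ ? _] := veP k.
  exists lk; split; first by move=> k; have [] := lkP k.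
  split.
    move=> e e0; near=> k => t t0; have [_ h _] := lkP k.
    apply: (le_trans (h _ t0)); apply: (le_trans (ep_small k)).
    by near: k; exact: epl.
  move=> T e e0; near=> k => t /andP[t0 tT]; have [_ _ h] := lkP k.
  have epe : ep k <= e.
    by apply: (le_trans (ep_small k)); near: k; exact: epl.
  apply: le_trans epe; apply: h => //; apply: (le_trans tT).
  have [ep0 _ _ _] := veP k.
  have epT : ep k <= (`|T| + 1)^-1.
    by apply: (le_trans (ep_small k)); near: k; apply: epl => //; rewrite invr_gt0 ltr_wpDl.
  have := ler_norm T.
  have : `|T| + 1 <= (ep k)^-1 by rewrite -[leLHS]invrK lef_pV2 ?posrE ?invr_gt0 // ltr_wpDl.
  lra.
have Fv : F (v k) @[k --> \oo] --> F w.
  by apply: Fc => // k; have [] := veP k.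
apply/cvgrPdist_le => e e0.
have e20 : 0 < e / 2 by rewrite divr_gt0.
have e40 : 0 < e / 4 by rewrite divr_gt0.
near=> k.
have h1 : `|F w - F (v k)| <= e / 2 by near: k; move/cvgrPdist_le : Fv; exact.
have h2 : k.+1%:R^-1 <= e / 4.
  near: k; near=> k; rewrite -[leRHS]invrK lef_pV2 ?posrE ?ltr0n ?invr_gt0 //.
  have : (e / 4)^-1 <= k%:R by near: k; exact: nbhs_infty_ger.
  by move=> /le_trans; apply; rewrite ler_nat.
have k0 : (0 : R) <= k.+1%:R by rewrite ler0n.
have h3 := lipreg_le k0 cw.
have [ep0 _ _ h4] := veP k.
have h5 : 0 <= k.+1%:R * (ve k).2 by rewrite mulr_ge0 // ltW.
move: h1; rewrite ler_norml => /andP[h1 h1'].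
rewrite ger0_norm ?subr_ge0 //; rewrite /v in h1 h1'.
by move: h2 h3 h4 h5; move: (k.+1%:R : R) => r h2 h3 h4 h5; lra.
Unshelve. all: by end_near. Qed.

End Regularization.
End SkorokhodCloseness.

(** * Regular variation *)

Section RegularVariation.
Variables (R : realType) (a : nat -> R) (gamma : R).
Hypothesis a_gt0 : forall n, 0 < a n.
Hypothesis gamma_gt0 : 0 < gamma.
Hypothesis a_rv : forall x, 0 < x ->
     (fun n => a (Num.truncn (x * n%:R)) / a n) @ \oo --> powR x gamma.

(** Halving the index multiplies [a] by nearly $2^{-\gamma}<1$. So [a] grows at least like a power
    of [s^-1] in the number of halvings that stay above [N], starting from a positive lower bound of
    [a]. *)
Lemma rv_cvgy : a n @[n --> \oo] --> +oo.
Proof.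
have r1 : powR (1 / 2 : R) gamma < 1.
  have e1 : powR (1 : R) gamma = 1 by rewrite powR1.
  rewrite -[ltRHS]e1 gt0_ltr_powR ?nnegrE //; lra.
pose s : R := (1 + powR (1 / 2 : R) gamma) / 2.
have r0 : 0 < powR (1 / 2 : R) gamma by rewrite powR_gt0.
have s0 : 0 < s by rewrite /s; lra.
have s1 : s < 1 by rewrite /s; lra.
have [N _ hN] : \forall n \near \oo, a (Num.truncn (1 / 2 * n%:R : R)) / a n < s.
  apply: (cvgr_lt (powR (1 / 2) gamma)); first by apply: a_rv; lra.
  by rewrite /s; lra.
have step n : (N <= n)%N -> a (Num.truncn (1 / 2 * n%:R : R)) / s <= a n.
  by move=> Nn; rewrite ler_pdivrMr // [leRHS]mulrC -ler_pdivrMr // ltW //; exact: hN.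
have [c c0 hc] : exists2 c, 0 < c & forall n, (n <= N)%N -> c <= a n.
  elim: (N) => [|k [c c0 hc]]; first by exists (a 0%N) => // n; rewrite leqn0 => /eqP ->.
  exists (Num.min c (a k.+1)); first by rewrite lt_min c0 /=.
  move=> n; rewrite leq_eqVlt ltnS => /orP[/eqP ->|nk]; first by rewrite ge_min lexx orbT.
  by rewrite ge_min hc.
have half_lt n : (0 < n)%N -> (Num.truncn (1 / 2 * n%:R : R) < n)%N.
  move=> n0; rewrite -(ltr_nat R); apply: le_lt_trans (_ : 1 / 2 * n%:R < n%:R).
    by have /andP[] := @truncn_itv R (1 / 2 * n%:R) ltac:(by rewrite mulr_ge0).
  by rewrite gtr_pMl ?ltr0n //; lra.
have base n : c <= a n.
  have [k] := ubnP n; elim: k n => // k IH n; rewrite ltnS => nk.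
  have [nN|Nn] := leqP n N; first exact: hc.
  apply: le_trans (step n (ltnW Nn)).
  have := IH (Num.truncn (1 / 2 * n%:R : R)) (leq_trans (half_lt n (leq_ltn_trans (leq0n N) Nn)) nk).
  by move=> h; apply: (le_trans h); rewrite ler_peMr ?ltW // -[1]invr1 ltf_pV2 ?posrE.
have grow j : forall n, (N * 2 ^ j <= n)%N -> c * s^-1 ^+ j <= a n.
  elim: j => [|j IH] n h; first by rewrite expr0 mulr1.
  have Nn : (N <= n)%N by apply: leq_trans h; rewrite leq_pmulr // expn_gt0.
  apply: le_trans (step n Nn).
  rewrite exprSr mulrA ler_pM2r ?invr_gt0 //; apply: IH.
  rewrite -(ler_nat R) in h.
  have h2 : ((N * 2 ^ j)%:R : R) <= 1 / 2 * n%:R.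
    by move: h; rewrite expnS mulnCA natrM; lra.
  have /andP[_ h3] := @truncn_itv R (1 / 2 * n%:R) ltac:(by rewrite mulr_ge0).
  by rewrite -ltnS -(ltr_nat R); apply: le_lt_trans h3.
apply/cvgryPge => A.
have [j hj] : exists j, A <= c * s^-1 ^+ j.
  have : geometric 1 s @ \oo --> (0 : R) by apply: cvg_geometric; rewrite ger0_norm // ltW.
  move=> /cvgr_lt/(_ (c / (`|A| + 1))).
  case; first by rewrite divr_gt0 // ltr_wpDl.
  move=> j _ /(_ j (leqnn j)) /=; rewrite mul1r => h; exists j.
  have A1 : 0 < `|A| + 1 by rewrite ltr_wpDl.
  have sj : 0 < s ^+ j by rewrite exprn_gt0.
  rewrite exprVn ler_pdivlMr //; have h' : s ^+ j * (`|A| + 1) < c by rewrite -ltr_pdivlMr.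
  have := ler_norm A; nra.
exists (N * 2 ^ j)%N => // n /= h.
by apply: le_trans hj _; exact: grow.
Qed.

Lemma measurable_truncn_fct (f : nat -> R) (c : R) :
  measurable_fun setT (fun x : R => f (Num.truncn (x * c))).
Proof.
have mt : measurable_fun setT (fun x : R => f (Num.truncn x)).
  move=> _ Y mY; rewrite setTI.
  rewrite (_ : _ @^-1` Y = \bigcup_(k in [set k | Y (f k)]) [set x : R | Num.truncn x = k]).
    apply: bigcup_measurable => -[|k] _.
      rewrite (_ : [set x | _] = `]-oo, (1 : R)[%classic); first exact: measurable_itv.
      apply/seteqP; split => x /=; rewrite in_itv/=; last by move=> x1; apply/eqP; rewrite -leqn0 leqNgt truncn_gt0 -ltNge.
      by move=> xk; rewrite ltNge -truncn_gt0 xk.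
    rewrite (_ : [set x | _] = `[k.+1%:R, k.+2%:R[%classic); first exact: measurable_itv.
    apply/seteqP; split => x /=; rewrite in_itv/=.
      move=> xk; have x0 : 0 <= x.
        rewrite leNgt; apply/negP => x0; have : (0 < Num.truncn x)%N by rewrite xk.
        by rewrite truncn_gt0 => h; move: x0; rewrite ltNge (le_trans ler01 h).
      by have := truncn_itv x0; rewrite xk.
    move=> /andP[h1 h2]; have x0 : 0 <= x by exact: le_trans h1.
    by apply/eqP; rewrite truncn_eq // h1 h2.
  apply/seteqP; split => x /=; first by move=> h; exists (Num.truncn x).
  by move=> [k /= Yk ->].
apply: (measurableT_comp mt); exact: measurable_funM.
Qed.

Lemma lebesgue_measure_scale (y : R) (A : set R) : 0 < y -> measurable A ->
  lebesgue_measure [set x | A (x * y)] = ((y^-1)%:E * lebesgue_measure A)%E.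
Proof.
move=> y0 mA.
have mg : measurable_fun setT ((fun x : R => x * y) : measurableTypeR R -> measurableTypeR R).
  exact: measurable_funM.
pose nu1 : {measure set (measurableTypeR R) -> \bar R} :=
  measure_function_pushforward__canonical__measure_function_Measure
    (@lebesgue_measure R : {measure set (measurableTypeR R) -> \bar R}) mg.
pose nu' : {measure set (measurableTypeR R) -> \bar R} := mscale (NngNum (ltW y0)) nu1.
have E : lebesgue_measure A = nu' A.
  apply: lebesgue_measure_unique => // X [[p q] /= _ <-].
  rewrite /nu' /nu1 /mscale /pushforward /=.
  rewrite {1}/pushforward (_ : _ @^-1` _ = `]p / y, q / y]%classic); last first.
    apply/seteqP; split => x /=; rewrite !in_itv/= ltr_pdivrMr // ler_pdivlMr //.
  rewrite !lebesgue_measure_itv /= !lte_fin ltr_pM2r ?invr_gt0 //.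
  case: ifP => _; last by rewrite mule0.
  rewrite -!EFinB -EFinM; congr (_%:E); rewrite -mulrBl mulrCA divff ?mulr1 // gt_eqF //.
rewrite E /nu' /nu1 /mscale /pushforward /= muleA -EFinM mulVf ?mul1e // gt_eqF //.
Qed.

Let g n x : R := a (Num.truncn (x * n%:R)) / a n * powR x (- gamma).

Let g_cvg x : 0 < x -> g n x @[n --> \oo] --> (1 : R).
Proof.
move=> x0; rewrite [X in _ --> X](_ : 1 = powR x gamma * powR x (- gamma)).
  by apply: cvgMl; exact: a_rv.
by rewrite powRN mulfV // gt_eqF // powR_gt0.
Qed.

Let measurable_g n : measurable_fun setT (g n).
Proof.
apply: measurable_funM; last exact: measurable_powR.
apply: measurable_funM => //; exact: measurable_truncn_fct.
Qed.

(** Stands in for the uniform convergence theorem of regular variation. As in Egorov's theorem, the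
    set [F N] of points of $[1,4l]$ that are bad for some index from [N] on has measure at most
    $1/4$. Pulling it back by multiplication with $m/n\ge1$ does not increase its measure, so the
    points bad for [m], or after scaling for [n], cannot fill $[1,2]$. *)
Lemma rv_common_good (e l : R) : 0 < e -> 1 <= l -> exists N, forall n m,
  (N <= n)%N -> (N <= m)%N -> (0 < n)%N -> (n <= m)%N -> m%:R <= l * n%:R ->
  exists2 x, 0 < x & `|g m x - 1| <= e /\ `|g n (x * (m%:R / n%:R)) - 1| <= e.
Proof.
move=> e0 l1.
pose E n := [set x : R | 1 <= x <= 4 * l /\ e < `|g n x - 1|].
pose F n := \bigcup_(k in [set k | (n <= k)%N]) E k.
have mE n : measurable (E n).
  rewrite (_ : E n = `[1, 4 * l]%classic `&` ((fun x => `|g n x - 1|) @^-1` `]e, +oo[%classic)).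
    apply: measurableI; first exact: measurable_itv.
    rewrite -[X in measurable X]setTI.
    have mf : measurable_fun setT (fun x => `|g n x - 1|).
      by apply: measurableT_comp => //; exact: measurable_funB.
    exact: mf.
  by apply/seteqP; split => x /=; rewrite !in_itv/= andbT => -[].
have mF n : measurable (F n) by apply: bigcup_measurable.
have F0 : \bigcap_n F n = set0.
  rewrite -subset0 => x FA.
  have x0 : 0 < x by have [k _ [/andP[h _] _]] := FA 0%N I; lra.
  have [N _ hN] : \forall n \near \oo, `|1 - g n x| <= e.
    by have /cvgrPdist_le := g_cvg x0; exact.
  have [k /= Nk [_ h]] := FA N I.
  by have := hN k Nk; rewrite distrC leNgt h.
have Fsub n : F n `<=` `[1, 4 * l]%classic by move=> x [k _ [h _]]; rewrite /= in_itv.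
have Ffin : (lebesgue_measure (F 0%N) < +oo)%E.
  apply: (@le_lt_trans _ _ (lebesgue_measure (`[1%R, 4 * l]%classic : set R))).
    by apply: le_measure; [rewrite inE; exact: mF|rewrite inE; exact: measurable_itv|exact: Fsub].
  by rewrite lebesgue_measure_itv /= lte_fin; case: ifP => _; rewrite ?ltry // -EFinB ltry.
have Fcvg : (lebesgue_measure \o F) n @[n --> \oo] --> (0 : \bar R)%E.
  rewrite -(measure0 (@lebesgue_measure R)) -F0; apply: nonincreasing_cvg_mu => //.
    by rewrite F0.
  by move=> n m nm; apply/subsetPset => x [k /= mk Ek]; exists k => //=; exact: leq_trans mk.
have [N FN] : exists N, (lebesgue_measure (F N) <= (1 / 4)%:E)%E.
  have : \forall n \near \oo, (lebesgue_measure (F n) < (1 / 4)%:E)%E.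
    move/fine_cvgP : Fcvg => [fn /cvgr_lt/(_ (1 / 4) _) hh].
    near=> n; have fin : (lebesgue_measure \o F) n \is a fin_num by near: n.
    rewrite -[ltLHS](fineK fin) lte_fin; near: n; apply: hh => /=; lra.
  by case=> N _ /(_ N (leqnn N)) h; exists N; rewrite ltW.
exists N => n m Nn Nm n0 nm ml.
have n0R : (0 : R) < n%:R by rewrite ltr0n.
pose y : R := m%:R / n%:R.
have y1 : 1 <= y by rewrite ler_pdivlMr // mul1r ler_nat.
have y0 : 0 < y by lra.
have yl : y <= l by rewrite ler_pdivrMr.
apply: contrapT => noex.
pose G := [set x : R | F N (x * y)].
have mG : measurable G.
  have mm : measurable_fun setT (fun x : R => x * y) by exact: measurable_funM.
  by rewrite -[G]setTI; exact: mm.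
have sub : `[1, 2]%classic `<=` F N `|` G.
  move=> x; rewrite /= in_itv/= => /andP[x1 x2].
  have [|h1] := lerP `|g m x - 1| e; last first.
    left; exists m => //; split => //; apply/andP; split; lra.
  have [|h2] := lerP `|g n (x * y) - 1| e; last first.
    by move=> _; right; exists n => //; split => //; apply/andP; split; nra.
  by move=> h2 h1; exfalso; apply: noex; exists x => //; lra.
have hG : (lebesgue_measure G <= (1 / 4)%:E)%E.
  rewrite (lebesgue_measure_scale y0 (mF N) : lebesgue_measure G = _).
  apply: le_trans FN; rewrite -[leRHS]mul1e; apply: lee_wpmul2r => //.
  by rewrite lee_fin invf_le1.
have : (lebesgue_measure (`[1%R, 2%R]%classic : set R) <= lebesgue_measure (F N `|` G))%E.
  by apply: le_measure; [rewrite inE; exact: measurable_itv|rewrite inE; apply: measurableU; [exact: mF|exact: mG]|exact: sub].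
move=> /le_trans/(_ (@measureU2 _ _ _ (@lebesgue_measure R) _ _ (mF N) mG)).
move=> /le_trans/(_ (leeD FN hG)).
rewrite lebesgue_measure_itv /= lte_fin ifT; last lra.
by rewrite -EFinB -EFinD lee_fin; lra.
Unshelve. all: by end_near. Qed.

Lemma rv_uniform (e l : R) : 0 < e -> 1 <= l -> exists N, forall n m,
  (N <= n)%N -> (N <= m)%N -> (0 < n)%N -> (0 < m)%N ->
  n%:R <= l * m%:R -> m%:R <= l * n%:R ->
  `|a m / a n - expR (gamma * logjump n m)| <= e * expR (gamma * logjump n m).
Proof.
move=> e0 l1; pose d := Num.min (e / 8) (1 / 8).
have d0 : 0 < d by rewrite lt_min; apply/andP; split; lra.
have de : d <= e / 8 by rewrite ge_min lexx.
have d8 : d <= 1 / 8 by rewrite ge_min lexx orbT.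
have [N hN] := rv_common_good d0 l1; exists N.
(* The two conclusions are exchanged by $q\mapsto1/q$; this serves the case $m<n$. *)
have key n m : (N <= n)%N -> (N <= m)%N -> (0 < n)%N -> (n <= m)%N ->
    m%:R <= l * n%:R -> let q := a m / a n / expR (gamma * logjump n m) in
    q <= 1 + 4 * d /\ 1 <= q * (1 + 4 * d).
  move=> Nn Nm n0 nm ml /=; have [x x0 [h1 h2]] := hN n m Nn Nm n0 nm ml.
  have m0 : (0 < m)%N by exact: leq_trans nm.
  have y0 : (0 : R) < m%:R / n%:R by exact: ratio_gt0.
  have xy : x * (m%:R / n%:R) * n%:R = x * m%:R :> R.
    by rewrite -mulrA divfK // pnatr_eq0 -lt0n.
  (* Both [g n (x * (m / n))] and [g m x] contain the value of [a] at the integer part of $xm$; it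
     cancels and leaves [a m / a n]. *)
  have gE : g n (x * (m%:R / n%:R)) = a m / a n / expR (gamma * logjump n m) * g m x.
    rewrite /g xy powRM ?ltW //.
    have -> : powR (m%:R / n%:R) (- gamma) = (expR (gamma * logjump n m))^-1.
      rewrite powRN /powR gt_eqF //; by rewrite ln_ratio.
    by field; rewrite !gt_eqF // expR_gt0.
  move: h2; rewrite gE; set q := a m / a n / _; move: h1; set G := g m x.
  rewrite !ler_norml => /andP[h1 h1'] /andP[h2 h2'].
  have q0 : 0 < q by rewrite !divr_gt0 // expR_gt0.
  split; nra.
move=> n m Nn Nm n0 m0 nl ml.
set X := expR (gamma * logjump n m); have X0 : 0 < X by exact: expR_gt0.
suff : `|a m / a n / X - 1| <= e.
  move=> h; rewrite -[X in `|_ - X|]mul1r -[a m / a n](divfK (lt0r_neq0 X0)) -mulrBl normrM (gtr0_norm X0).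
  by rewrite ler_pM2r.
have q0 : 0 < a m / a n / X by rewrite !divr_gt0.
have [nm|mn] := leqP n m.
  have [h1 h2] := key n m Nn Nm n0 nm ml; move: h1 h2 q0; rewrite -/X.
  set q := _ / X => h1 h2 q0; rewrite ler_norml; apply/andP; split; nra.
have [h1 h2] := key m n Nm Nn m0 (ltnW mn) nl; move: h1 h2.
have -> : a n / a m / expR (gamma * logjump m n) = (a m / a n / X)^-1.
  have -> : expR (gamma * logjump m n) = X^-1.
    by rewrite /X -expRN /logjump; congr expR; ring.
  by field; rewrite !gt_eqF.
set q := _ / X in q0 * => h1 h2.
have q1 : 1 <= q * (1 + 4 * d) by move: h1; rewrite -div1r ler_pdivrMr // mulrC.
have q2 : q <= 1 + 4 * d by move: h2; rewrite mulrC -[_ / q]/(_ * q^-1) ler_pdivlMr // mul1r.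
rewrite ler_norml; apply/andP; split; nra.
Qed.

End RegularVariation.

(** * Trajectories of the chain *)

Section DiscreteSplit.
Context d (T : measurableType d) (R : realType) (P : probability T R).

Lemma bmfun_nat_eq (D : T -> nat) i : (forall i, measurable [set x | D x = i]) ->
  bounded_mfun (fun x => (D x == i)%:R : R).
Proof.
move=> mD; rewrite (_ : (fun x => _) = \1_[set x | D x = i]).
  exact: bmfun_indic.
apply/funext => x; rewrite indicE; have [h|/eqP h] := eqVneq (D x) i.
  by rewrite mem_set.
by rewrite memNset.
Qed.

Lemma Ex_split (D : T -> nat) (f : T -> R) :
  (forall i, measurable [set x | D x = i]) -> bounded_mfun f ->
  (fun m => \sum_(0 <= i < m) Ex P (fun x => f x * (D x == i)%:R)) @ \oo --> Ex P f.
Proof.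
move=> mD bf; have bfD i : bounded_mfun (fun x => f x * (D x == i)%:R).
  by apply: bmfunM => //; exact: bmfun_nat_eq.
have -> : (fun m => \sum_(0 <= i < m) Ex P (fun x => f x * (D x == i)%:R)) =
    (fun m => Ex P (fun x => f x * (D x < m)%N%:R)).
  apply/funext => m; rewrite -Ex_sum //; apply: eq_Ex => x.
  rewrite -mulr_sumr; congr (_ * _).
  elim: m => [|m IH]; first by rewrite big_geq.
  rewrite big_nat_recr //= IH ltnS (leq_eqVlt (D x) m).
  by have [->|] := eqVneq (D x) m; rewrite ?ltnn ?add0r ?addr0.
have [mf [M fM]] := bf.
apply: (@Ex_cvg _ _ _ _ _ _ M).
- move=> m; have -> : (fun x => f x * (D x < m)%N%:R) = (fun x => \sum_(0 <= i < m) f x * (D x == i)%:R).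
    apply/funext => x; rewrite -mulr_sumr; congr (_ * _).
    elim: m => [|m IH]; first by rewrite big_geq.
    rewrite big_nat_recr //= -IH ltnS (leq_eqVlt (D x) m).
    by have [->|] := eqVneq (D x) m; rewrite ?ltnn ?add0r ?addr0.
  by have [] := @bmfun_sum _ _ _ nat (index_iota 0 m) xpredT (fun i x => f x * (D x == i)%:R) bfD.
- move=> m x; rewrite normrM; case: (D x < m)%N; rewrite ?normr1 ?normr0 ?mulr1 ?mulr0 //.
  exact: le_trans (normr_ge0 _) (fM x).
- move=> x; apply: cvg_near_cst; exists (D x).+1 => // m /= h.
  by rewrite h mulr1.
Qed.

Lemma eq_Ex_split (D : T -> nat) (f g : T -> R) :
  (forall i, measurable [set x | D x = i]) -> bounded_mfun f -> bounded_mfun g ->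
  (forall i, Ex P (fun x => f x * (D x == i)%:R) = Ex P (fun x => g x * (D x == i)%:R)) ->
  Ex P f = Ex P g.
Proof.
move=> mD bf bg fg; have cf := Ex_split mD bf; have cg := Ex_split mD bg.
apply: (cvg_unique _ cf); rewrite // (_ : (fun m => _) =
  (fun m => \sum_(0 <= i < m) Ex P (fun x => g x * (D x == i)%:R))) //.
by apply/funext => m; apply: eq_bigr => i _; exact: fg.
Qed.

End DiscreteSplit.

(** * Histories of the chain and the Markov property *)

Section ChainPaths.
Context d (Om : measurableType d) (R : realType) (P : probability Om R).
Variables (p : nat -> nat -> R) (X : nat -> nat -> Om -> nat).
Hypothesis p_ge0 : forall i j, 0 <= p i j.
Hypothesis p_sum1 : forall i, (0 < i)%N ->
  (fun m => \sum_(1 <= j < m) p i j) @ \oo --> (1 : R).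
Hypothesis mc : markov_chains P p X.
Variable n : nat.
Hypothesis n_gt0 : (0 < n)%N.

(** A history has countably many possible values, so every function of it is measurable. The
    starting point is left out: it equals [n] only almost surely, and [last n] supplies it for the
    empty history. *)
Definition trail k om : seq nat := [seq X n j om | j <- iota 1 k].

Lemma size_trail k om : size (trail k om) = k.
Proof. by rewrite size_map size_iota. Qed.

Lemma trailS k om : trail k.+1 om = rcons (trail k om) (X n k.+1 om).
Proof. by rewrite /trail -[k.+1]addn1 iotaD map_cat /= cats1 add1n addn1. Qed.

Lemma nth_trail k om j : (j < k)%N -> nth n (trail k om) j = X n j.+1 om.
Proof. by move=> jk; rewrite (nth_map 0%N) ?size_iota // nth_iota. Qed.

Lemma trail_gt0 k om : all (fun i => 0 < i)%N (trail k om).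
Proof. by apply/allP => i /mapP[j _ ->]; have [_ [h _]] := mc; exact: h. Qed.

Lemma last_gt0 (s : seq nat) : all (fun i => 0 < i)%N s -> (0 < last n s)%N.
Proof. by elim/last_ind: s => // s x _; rewrite all_rcons last_rcons => /andP[]. Qed.

Lemma measurable_X k i : measurable [set om | X n k om = i].
Proof. by have [h _] := mc; exact: h. Qed.

Lemma measurable_trail_eq k s : measurable [set om | trail k om = s].
Proof.
elim: k s => [|k IH] s.
  case: s => [|x s]; first by rewrite (_ : [set _ | _] = setT) //; apply/seteqP; split.
  by rewrite (_ : [set _ | _] = set0) //; apply/seteqP; split.
elim/last_ind: s => [|s x _].
  rewrite (_ : [set _ | _] = set0) //; apply/seteqP; split => // om /=.
rewrite (_ : [set _ | _] = [set om | trail k om = s] `&` [set om | X n k.+1 om = x]).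
  by apply: measurableI => //; exact: measurable_X.
apply/seteqP; split => om /=; rewrite trailS; last by move=> [-> ->].
by move=> /eqP; rewrite eqseq_rcons => /andP[/eqP -> /eqP ->].
Qed.

Lemma measurable_trail (T : Type) (f : seq nat -> T) k (Y : set T) :
  measurable [set om | Y (f (trail k om))].
Proof.
rewrite (_ : [set _ | _] = \bigcup_(i in [set i | exists2 s, pickle s = i & Y (f s)])
    [set om | pickle (trail k om) = i]).
  apply: bigcup_measurable => i [s <- _].
  rewrite (_ : [set _ | _] = [set om | trail k om = s]); first exact: measurable_trail_eq.
  apply/seteqP; split => om /=; last by move=> ->.
  exact: (pcan_inj pickleK).
apply/seteqP; split => om /= h.
  by exists (pickle (trail k om)) => //; exists (trail k om).
by move: h => [i [s <- Yfs] /= /(pcan_inj pickleK) ->].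
Qed.

Lemma bmfun_trail (U : seq nat -> R) M k : (forall s, `|U s| <= M) ->
  bounded_mfun (fun om => U (trail k om)).
Proof.
move=> UM; split; last by exists M.
by move=> _ Y mY; rewrite setTI; exact: (@measurable_trail _ U k Y).
Qed.

Lemma X0_ae : P [set om | X n 0 om = n] = 1%E.
Proof.
have [_ [_ /(_ n 0%N (fun=> n) n_gt0 (fun=> n_gt0))]] := mc.
rewrite eqxx big_ord0.
have -> : [set om | forall j, (j <= 0)%N -> X n j om = n] = [set om | X n 0 om = n].
  apply/seteqP; split => om /=; first exact.
  by move=> h' j; rewrite leqn0 => /eqP ->.
move=> h; rewrite -[LHS]fineK ?h //; apply: fin_num_measure; exact: measurable_X.
Qed.

Lemma trail_prob k (s : seq nat) : size s = k -> all (fun i => 0 < i)%N s ->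
  fine (P [set om | trail k om = s]) = \prod_(j < k) p (nth 1%N (n :: s) j) (nth 1%N (n :: s) j.+1).
Proof.
move=> sk s0.
have f0 j : (0 < nth 1%N (n :: s) j)%N.
  have [js|js] := ltnP j (size (n :: s)); last by rewrite nth_default.
  have /allP h : all (fun i => 0 < i)%N (n :: s) by rewrite /= n_gt0.
  by apply: h; exact: mem_nth.
have [_ [_ /(_ n k (fun j => nth 1%N (n :: s) j) n_gt0 f0)]] := mc.
rewrite /= eqxx => <-; congr fine.
have E : [set om | forall j, (j <= k)%N -> X n j om = nth 1%N (n :: s) j] =
    [set om | trail k om = s] `&` [set om | X n 0 om = n].
  apply/seteqP; split => om /=.
    move=> h; split; last by have := h 0%N isT.
    apply: (@eq_from_nth _ n); first by rewrite size_trail.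
    rewrite size_trail => j jk; rewrite nth_trail // h //= (set_nth_default n) // sk //.
  move=> [h h0] [|j] jk //=.
  by rewrite -(@nth_trail k om) // h (set_nth_default 1%N) // sk.
have m1 := measurable_trail_eq k s; have m2 := measurable_X 0 n.
rewrite E; apply/eqP; rewrite eq_le; apply/andP; split; last first.
  by apply: le_measure; rewrite ?inE //; exact: measurableI.
have : (P [set om | trail k om = s] <= P ([set om | trail k om = s] `&` [set om | X n 0 om = n])
     + P (~` [set om | X n 0 om = n]))%E.
  apply: le_trans (measureU2 _ _ _); last exact: measurableC.
    apply: le_measure; rewrite ?inE //.
      by apply: measurableU; [exact: measurableI|exact: measurableC].
    by move=> om /= h; have [h0|h0] := eqVneq (X n 0 om) n; [left|right; exact/eqP].
  exact: measurableI.
by rewrite probability_setC // X0_ae subee // adde0.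
Qed.

Lemma trail_prob_rcons k (s : seq nat) j : all (fun i => 0 < i)%N s -> size s = k -> (0 < j)%N ->
  fine (P [set om | trail k.+1 om = rcons s j]) = fine (P [set om | trail k om = s]) * p (last n s) j.
Proof.
move=> s0 sk j0; rewrite !trail_prob ?size_rcons ?sk // ?all_rcons ?j0 //.
rewrite big_ord_recr /=; congr (_ * _).
  apply: eq_bigr => i _ /=; congr (p _ _); last by rewrite nth_rcons sk ltn_ord.
  case: i => -[|i] /= ik //; rewrite nth_rcons sk ifT //; exact: ltnW.
congr (p _ _); last by rewrite nth_rcons sk ltnn eqxx.
rewrite -rcons_cons nth_rcons /= sk ltnSn (last_nth 1%N) sk //.
Qed.

(** The Markov property for functionals of the whole history: both sides are split over the
    countably many codes of the history, and on each piece the law of the next position is a row of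
    [p]. *)
Lemma one_step k (U : seq nat -> R) M : (forall s, `|U s| <= M) ->
  Ex P (fun om => U (trail k.+1 om)) =
  Ex P (fun om => psum p (last n (trail k om)) (fun j => U (rcons (trail k om) j))).
Proof.
move=> UM; have bU k' := bmfun_trail k' UM.
have bp : bounded_mfun (fun om => psum p (last n (trail k om)) (fun j => U (rcons (trail k om) j))).
  split.
    by move=> _ Y mY; rewrite setTI; exact: (@measurable_trail _ (fun s => psum p (last n s) (fun j => U (rcons s j))) k Y).
  exists M => om; apply: (psum_norm p_ge0 p_sum1) => //.
  exact/last_gt0/trail_gt0.
have mD (i : nat) : measurable [set om | pickle (trail k om) = i].
  exact: (@measurable_trail _ (fun s => pickle s) k [set i]).
apply: (@eq_Ex_split _ _ _ P (fun om => pickle (trail k om))) => // i.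
have [[om0 om0i]|noi] := pselect (exists om, pickle (trail k om) = i); last first.
  by apply: eq_Ex => om; case: eqP => h; [exfalso; apply: noi; exists om|rewrite !mulr0].
set s := trail k om0 in om0i.
have pE om : (pickle (trail k om) == i) = (trail k om == s).
  by rewrite -om0i; apply/eqP/eqP => [/(pcan_inj pickleK)|->].
have s0 : all (fun i => 0 < i)%N s by exact: trail_gt0.
have sk : size s = k by exact: size_trail.
have l0 := last_gt0 s0.
have m1 := measurable_trail_eq k s.
have indE (A : set Om) : measurable A -> Ex P (\1_A) = fine (P A) by exact: Ex_indic.
have RHSE : Ex P (fun om => psum p (last n (trail k om)) (fun j => U (rcons (trail k om) j)) * (pickle (trail k om) == i)%:R)
   = psum p (last n s) (fun j => U (rcons s j)) * fine (P [set om | trail k om = s]).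
  rewrite -indE // -ExZ; last exact: bmfun_indic.
  apply: eq_Ex => om; rewrite pE indicE; have [h|/eqP h] := eqVneq (trail k om) s.
    by rewrite mem_set // h.
  by rewrite memNset // !mulr0.
rewrite RHSE.
have bf : bounded_mfun (fun om => U (trail k.+1 om) * (pickle (trail k om) == i)%:R).
  by apply: bmfunM => //; exact: bmfun_nat_eq.
have := Ex_split (P := P) (measurable_X k.+1) bf => /cvg_unique; apply => //.
have h := psum_cvg p_ge0 p_sum1 l0 (fun j => UM (rcons s j)).
rewrite (_ : (fun m => _) = (fun m => (\sum_(1 <= j < m) p (last n s) j * U (rcons s j)) * fine (P [set om | trail k om = s]))).
  by apply: cvgMl.
apply/funext => m.
have T j : Ex P (fun om => U (trail k.+1 om) * (pickle (trail k om) == i)%:R * (X n k.+1 om == j)%:R)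
   = U (rcons s j) * fine (P [set om | trail k.+1 om = rcons s j]).
  rewrite -indE; last exact: measurable_trail_eq.
  rewrite -ExZ; last by apply: bmfun_indic; exact: measurable_trail_eq.
  apply: eq_Ex => om; rewrite pE indicE trailS.
  have [h1|/eqP h1] := eqVneq (trail k om) s; last first.
    by rewrite memNset ?mulr0 ?mul0r //= trailS => /eqP; rewrite eqseq_rcons => /andP[/eqP].
  have [h2|/eqP h2] := eqVneq (X n k.+1 om) j.
    by rewrite mem_set /= ?trailS h1 h2 ?mulr1.
  by rewrite memNset ?mulr0 //= trailS => /eqP; rewrite eqseq_rcons => /andP[_ /eqP].
case: m => [|m]; first by rewrite !big_geq // mul0r.
(* The sum over the next position starts at 0, which the chain never visits, whereas [psum] starts
   at 1. *)
rewrite big_ltn // T (_ : [set om | _ = rcons s 0] = set0) ?measure0 ?mulr0 ?add0r; last first.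
  rewrite -subset0 => om /= h'; have := trail_gt0 k.+1 om.
  by rewrite h' all_rcons.
rewrite mulr_suml big_nat_cond [RHS]big_nat_cond; apply: eq_bigr => j /andP[/andP[j0 _] _].
by rewrite T trail_prob_rcons //; ring.
Qed.

(* Stopping is encoded in [W] itself. *)
Lemma supermartingale k (W : seq nat -> R) M : (forall s, `|W s| <= M) ->
  (forall s, all (fun i => 0 < i)%N s ->
     psum p (last n s) (fun j => W (rcons s j)) <= W s) ->
  Ex P (fun om => W (trail k om)) <= W [::].
Proof.
move=> WM WS; elim: k => [|k IH].
  by rewrite -[leRHS](Ex_cst P).
rewrite (one_step k WM); apply: le_trans IH; apply: Ex_le.
- split.
    by move=> _ Y mY; rewrite setTI; exact: (@measurable_trail _ (fun s => psum p (last n s) (fun j => W (rcons s j))) k Y).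
  exists M => om; apply: (psum_norm p_ge0 p_sum1) => //.
  exact/last_gt0/trail_gt0.
- exact: bmfun_trail WM.
- by move=> om; apply: WS; exact: trail_gt0.
Qed.

End ChainPaths.

(** * Exploration of a trajectory *)

Section Machine.
Variables (R : realType) (p : nat -> nat -> R) (a : nat -> R) (n K : nat).
Variables (h eta ell o : R).
Hypothesis p_ge0 : forall i j, 0 <= p i j.
Hypothesis p_sum1 : forall i, (0 < i)%N ->
  (fun m => \sum_(1 <= j < m) p i j) @ \oo --> (1 : R).
Hypothesis a_gt0 : forall n, 0 < a n.
Hypothesis n_gt0 : (0 < n)%N.
Hypothesis h_gt0 : 0 < h.
Hypothesis eta_gt0 : 0 < eta.
Hypothesis ell_gt0 : 0 < ell.
Hypothesis o_ge0 : 0 <= o.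
Hypothesis o_lt_h : o < h.

Local Notation z := (@logjump R n).

(* The state of the exploration of the path, in the clock in which a step from
   [x] lasts [1 / a x].  The clock is cut into [K] cells of length [h]. *)
Record state := St {
  pos : nat;
  clk : R;
  stp : nat;               (* number of steps *)
  smp : seq nat;           (* positions sampled at the beginning of each cell *)
  bnd : seq (nat * R);     (* (step, clock) of the block boundaries *)
  phs : nat;               (* number of [eta]-exits in the current cell, 2 being absorbing *)
  ref : nat;               (* position from which the next [eta]-exit is measured *)
  ext : nat * R;           (* (step, clock) of the exit in the current cell *)
  nex : nat                (* number of cells with an exit *)
}.

Definition init_state := St n 0 0 [:: n] [::] 0 n (0%N, 0) 0.

Definition running st := (size (smp st) <= K)%N && (`|z (pos st)| <= ell).

Definition far st x := eta < `|z x - z (ref st)|.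

(** In a cell with one exit the block boundary is put at the exit instead of the end of the cell:
    the positions before it are close to the last sample and those after it to the next one. In
    phase 0 a large displacement made by the step that ends the cell is no exit, since the boundary
    falls there anyway. Leaving the range [ell] or filling all cells freezes the state. *)
Definition update st (x : nat) : state :=
  if ~~ running st then st else
  let t := clk st + (a (pos st))^-1 in let k := (stp st).+1 in
  let here := if phs st == 0%N then (k, t) else ext st in
  if ell < `|z x| then
    St x t k (smp st) (bnd st) (phs st) (ref st) (ext st) (nex st)
  else if (size (smp st))%:R * h <= t then
    St x t k (rcons (smp st) x) (rcons (bnd st) here)
      (if phs st == 0%N then 0%N else if (phs st == 1%N) && ~~ far st x then 0%N else 2%N)
      x (ext st) (nex st)
  else if far st x then
    St x t k (smp st) (bnd st) (if phs st == 0%N then 1%N else 2%N) x here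
      (nex st + (phs st == 0%N))
  else St x t k (smp st) (bnd st) (phs st) (ref st) (ext st) (nex st).

Definition run s := foldl update init_state s.

Lemma run_rcons s x : run (rcons s x) = update (run s) x.
Proof. by rewrite /run foldl_rcons. Qed.

Lemma run_ind (I : state -> Prop) : I init_state ->
  (forall st x, I st -> running st -> I (update st x)) -> forall s, I (run s).
Proof.
move=> I0 IS; elim/last_ind => // s x Is; rewrite run_rcons.
have [r|r] := boolP (running (run s)); first exact: IS.
by rewrite /update r.
Qed.

Lemma last_run s : running (run s) -> last n s = pos (run s).
Proof.
elim/last_ind: s => // s x _; rewrite last_rcons run_rcons /update.
have [r|/negbTE r] := boolP (running (run s)); last by rewrite /= r.
by case: ifP => //; case: ifP => //; case: ifP.
Qed.

(** This makes [o] a bound for the overshoot of the clock at the end of a cell. *)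
Definition small_steps := forall x, `|z x| <= ell -> (0 < x)%N /\ (a x)^-1 <= o.

Hypothesis ss : small_steps.

Lemma clk_upper st : running st -> 0 < (a (pos st))^-1 <= o.
Proof. by move=> /andP[_ /ss[_ ->]]; rewrite invr_gt0 a_gt0. Qed.

Lemma pos_gt0 st : running st -> (0 < pos st)%N.
Proof. by move=> /andP[_ /ss[]]. Qed.

Definition inv0 st := [/\ (size (smp st)).-1%:R * h <= clk st,
  running st -> clk st < (size (smp st))%:R * h,
  clk st <= K%:R * h + o, (1 <= size (smp st) <= K.+1)%N &
  (nex st < size (smp st) + (phs st != 0%N))%N].

Lemma inv0_run s : inv0 (run s).
Proof.
apply: run_ind.
  split => //=.
  - by rewrite mul0r.
  - by rewrite mul1r.
  - by rewrite addr_ge0 // mulr_ge0 // ltW.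
move=> st x [i1 i2 i3 /andP[i4 i5] i6] r.
have /andP[a0 ao] := clk_upper r.
have i2' := i2 r; have /andP[sK rng] := r.
have tK : clk st + (a (pos st))^-1 <= K%:R * h + o.
  apply: lerD => //; apply: ltW; apply: (lt_le_trans i2').
  by rewrite ler_pM2r // ler_nat.
have t1 : (size (smp st)).-1%:R * h <= clk st + (a (pos st))^-1.
  by rewrite (le_trans i1) // lerDl ltW.
rewrite /update r /=; case: ifPn => far1.
  split => //=; last by rewrite i4.
  by rewrite /running /= => /andP[_]; rewrite leNgt far1.
case: ifPn => cr.
  split => //=; rewrite ?size_rcons //.
  - move=> _; rewrite -natr1 mulrDl mul1r; apply: ltr_leD => //.
    exact: le_trans ao (ltW o_lt_h).
  - apply: leq_trans i6 _; rewrite addSnnS leq_add2l.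
    exact: leq_trans (leq_b1 _) _.
rewrite -ltNge in cr; case: ifPn => fr.
  split => //=; first by rewrite i4.
  by move: i6; case: (phs st) => [|k] /=; rewrite ?addn0 ?addn1 //= => /leqW.
by split => //=; rewrite i4.
Qed.

Lemma clk_ge0 s : 0 <= clk (run s).
Proof. by have [i1 _ _ _ _] := inv0_run s; apply: le_trans i1; rewrite mulr_ge0 // ltW. Qed.

Section WithChain.
Context d (Om : measurableType d) (P : probability Om R).
Variable X : nat -> nat -> Om -> nat.
Hypothesis mc : markov_chains P p X.

Lemma machine_supermartingale (W : state -> R) M k : (forall s, `|W (run s)| <= M) ->
  (forall s, running (run s) ->
    psum p (pos (run s)) (fun x => W (update (run s) x)) <= W (run s)) ->
  Ex P (fun om => W (run (trail X n k om))) <= W init_state.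
Proof.
move=> WM WS.
apply: (supermartingale p_ge0 p_sum1 mc n_gt0 k (W := fun s => W (run s)) WM) => s s0.
under eq_fun do rewrite run_rcons.
have [r|/negbTE r] := boolP (running (run s)).
  by rewrite last_run //; exact: WS.
under eq_fun do rewrite /update r /=.
by rewrite psum_cst // (last_gt0 n_gt0).
Qed.

Lemma bmfun_run (W : state -> R) M k : (forall s, `|W (run s)| <= M) ->
  bounded_mfun (fun om => W (run (trail X n k om))).
Proof. by move=> WM; exact: (@bmfun_trail _ _ _ _ _ _ mc _ (fun s => W (run s)) _ k WM). Qed.

Lemma psum_lyap l C x y : 0 < l -> (0 < x)%N -> nu p a x (lyap_jump_fct l (z x - y)) <= C ->
  psum p x (fun x' => lyap ((z x' - y) / l)) <= lyap ((z x - y) / l) + C / a x.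
Proof.
move=> l0 x0; rewrite /nu mulrC -ler_pdivlMr // => hC; rewrite -lerBlDl; apply: le_trans hC.
have lb (g : nat -> R) k : `|lyap (g k)| <= 1 by rewrite ger0_norm ?lyap_ge0 // lyap_le1.
rewrite (@eq_psum _ _ _ (fun k => lyap_jump_fct l (z x - y) (logjump x k))
  (fun k => lyap ((z k - y) / l) - lyap ((z x - y) / l))); last first.
  move=> k _; rewrite /lyap_jump_fct; congr (lyap (_ / l) - _).
  by rewrite /logjump; ring.
rewrite (psumB p_ge0 p_sum1 x0 (fun k => lb (fun k => (z k - y) / l) k) (fun k => lb (fun k => (z x - y) / l) k)).
by rewrite psum_cst.
Qed.

(** * Number of large displacements per cell *)

Section Exits.
Variable C : R.
Hypothesis C_ge0 : 0 <= C.
Hypothesis lyap_eta : forall x y, `|z x| <= ell -> nu p a x (lyap_jump_fct eta y) <= C.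

Let kap := 2 * C * (h + o).

(** The factor 2 makes this at least 1 at an exit, where [lyap >= 1 / 2]; just after the reference
    position has been reset it is at most [kap], the part in [C] alone. *)
Definition pot st := 2 * (lyap ((z (pos st) - z (ref st)) / eta)
  + C * ((size (smp st))%:R * h - clk st + o)).

Lemma pot_ge0 s : running (run s) -> 0 <= pot (run s).
Proof.
move=> r; have [_ /(_ r) i2 _ _ _] := inv0_run s.
have L0 := lyap_ge0 ((z (pos (run s)) - z (ref (run s))) / eta).
apply: mulr_ge0 => //; apply: addr_ge0 => //; apply: mulr_ge0 => //.
by apply: addr_ge0 => //; rewrite subr_ge0 ltW.
Qed.

Variables al be : R.
Hypothesis al_ge0 : 0 <= al.
Hypothesis be_ge0 : 0 <= be.

Let A := al + be * kap.

Let coef st := if phs st == 0%N then A else if phs st == 1%N then be else 0.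

(* The potential [pot] pays for the next exit and its drift is paid by the clock;
   in phase 0 a first exit also has to provide the potential for a second one. *)
Definition exit_fct st : R := al * (nex st)%:R + be * (1 < phs st)%N%:R
  + (if running st then coef st * pot st else 0)
  - A * kap * (size (smp st)).-1%:R.

Let kap_ge0 : 0 <= kap.
Proof. by rewrite !mulr_ge0 // addr_ge0 // ltW. Qed.

Let A_ge0 : 0 <= A.
Proof. by rewrite addr_ge0 // mulr_ge0. Qed.

Let coef_ge0 st : 0 <= coef st.
Proof. by rewrite /coef; case: ifP => // _; case: ifP. Qed.

Lemma exit_fct_step s x : let st := run s in running st ->
  exit_fct (update st x) <= al * (nex st)%:R + be * (1 < phs st)%N%:R
    - A * kap * (size (smp st)).-1%:R
    + coef st * (2 * (lyap ((z x - z (ref st)) / eta)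
        + C * ((size (smp st))%:R * h - (clk st + (a (pos st))^-1) + o))).
Proof.
move=> st r; have [i1 i2 i3 /andP[i4 i5] i6] := inv0_run s; rewrite -/st in i1 i2 i3 i4 i5 i6.
have /andP[a0 ao] := clk_upper r.
have i2' := i2 r; have /andP[sK rng] := r.
set t := clk st + (a (pos st))^-1; set S := (size (smp st))%:R in i2' *.
have t1 : (size (smp st)).-1%:R * h <= t by rewrite (le_trans i1) // lerDl ltW.
have SE : (size (smp st)).-1%:R = S - 1 :> R by rewrite /S -{2}(prednK i4) -natr1 addrK.
have t2 : S * h - h <= t by move: t1; rewrite SE mulrBl mul1r.
have L0 := lyap_ge0 ((z x - z (ref st)) / eta).
have L1 : far st x -> 1 / 2 <= lyap ((z x - z (ref st)) / eta).
  rewrite /far => fr; apply: lyap_ge; rewrite normrM normfV (gtr0_norm eta_gt0).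
  by rewrite ler_pdivlMr // mul1r ltW.
have r0 : 0 <= S * h - t + o by rewrite /t; lra.
have Cr0 := mulr_ge0 C_ge0 r0.
have c0 := coef_ge0 st.
have g0 : 0 <= coef st * (2 * (lyap ((z x - z (ref st)) / eta) + C * (S * h - t + o))).
  by rewrite !mulr_ge0 // addr_ge0.
have Ak0 := mulr_ge0 A_ge0 kap_ge0.
have bk0 := mulr_ge0 be_ge0 kap_ge0.
have kapE : kap = 2 * (C * (h + o)) by rewrite /kap; ring.
have Cho : 0 <= C * (h + o) by rewrite mulr_ge0 // addr_ge0 // ltW.
have runbound st' q : pot st' <= kap -> 0 <= q ->
    (if running st' then q * pot st' else 0) <= q * kap.
  by move=> pk q0; case: ifP => _; [exact: ler_wpM2l|exact: mulr_ge0].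
have nEr : 0 <= al * (nex st)%:R + be * (1 < phs st)%N%:R by rewrite addr_ge0 // mulr_ge0.
rewrite /update r /= -/t -/S; case: ifPn => far1.
  rewrite /exit_fct /running /= [(`|_| <= ell)%R]leNgt far1 andbF addr0; lra.
(* At the end of a cell a fresh potential is needed, worth at most [A * kap]; the term of [exit_fct]
   in the number of samples pays for it. *)
case: ifPn => cr.
  set st' := St _ _ _ _ _ _ _ _ _.
  have pk : pot st' <= kap.
    rewrite /pot /st' /= subrr mul0r lyap0 add0r size_rcons -natr1 -/S kapE.
    by rewrite ler_pM2l // ler_wpM2l //; lra.
  have := runbound st' (coef st') pk (coef_ge0 _).
  rewrite /exit_fct; set Q := (if running st' then _ else _).
  rewrite /st' /= size_rcons /= -/S SE {1}/coef /=.
  move: g0 L1; rewrite /coef; case: (phs st) => [|[|q]] /=.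
  - by move=> g0 _; lra.
  - case: (far st x) => /= g0 L1 Qb; last by rewrite !mulr0 in Qb *; lra.
    have := L1 isT; have : be * 1 <= be * (2 * (lyap ((z x - z (ref st)) / eta) + C * (S * h - t + o))).
      by rewrite ler_wpM2l //; have := L1 isT; lra.
    rewrite /= in Qb; lra.
  - by move=> g0 _ Qb; rewrite /= in Qb; lra.
rewrite -ltNge in cr; case: ifPn => fr.
  set st' := St _ _ _ _ _ _ _ _ _.
  have pk : pot st' <= kap.
    rewrite /pot /st' /= subrr mul0r lyap0 add0r -/S kapE.
    by rewrite ler_pM2l // ler_wpM2l //; lra.
  have := runbound st' (coef st') pk (coef_ge0 _).
  rewrite /exit_fct; set Q := (if running st' then _ else _).
  rewrite /st' /= {1}/coef /=; have L1' := L1 fr.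
  have gb q : 0 <= q -> q * 1 <= q * (2 * (lyap ((z x - z (ref st)) / eta) + C * (S * h - t + o))).
    by move=> q0; rewrite ler_wpM2l //; lra.
  have gA := gb _ A_ge0; have gbe := gb _ be_ge0.
  move: g0; rewrite /coef; case: (phs st) => [|[|q]] /=.
  - by move=> _ Qb; rewrite addn1 -natr1 mulrDr; rewrite /A in gA *; lra.
  - by move=> _ Qb; rewrite addn0; lra.
  - by move=> _ Qb; rewrite addn0; lra.
rewrite /exit_fct.
have -> : (if running (St x t (stp st).+1 (smp st) (bnd st) (phs st) (ref st) (ext st) (nex st))
  then coef (St x t (stp st).+1 (smp st) (bnd st) (phs st) (ref st) (ext st) (nex st))
    * pot (St x t (stp st).+1 (smp st) (bnd st) (phs st) (ref st) (ext st) (nex st)) else 0)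
  = coef st * (2 * (lyap ((z x - z (ref st)) / eta) + C * (S * h - t + o))).
  by rewrite /running /= sK leNgt far1.
rewrite /=; lra.
Qed.

Lemma exit_fct_bound : exists M, forall s, `|exit_fct (run s)| <= M.
Proof.
have Ak0 := mulr_ge0 A_ge0 kap_ge0.
exists (al * K.+2%:R + be + (A + be) * (2 * (1 + C * (K.+1%:R * h + o))) + A * kap * K.+1%:R) => s.
have [i1 i2 i3 /andP[i4 i5] i6] := inv0_run s; have t0 := clk_ge0 s.
set st := run s in i1 i2 i3 i4 i5 i6 t0 *.
have n1 : (nex st)%:R <= K.+2%:R :> R.
  rewrite ler_nat; have : (nex st < K.+1 + 1)%N by apply: leq_trans i6 _; rewrite leq_add // leq_b1.
  by rewrite addn1 => /ltnW.
have n2 : (1 < phs st)%N%:R <= 1 :> R by case: (_ < _)%N.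
have n3 : (size (smp st)).-1%:R <= K.+1%:R :> R by rewrite ler_nat (leq_trans (leq_pred _)).
have e1 : 0 <= al * (nex st)%:R <= al * K.+2%:R by rewrite mulr_ge0 // ler_wpM2l.
have e2 : 0 <= be * (1 < phs st)%N%:R <= be.
  by rewrite mulr_ge0 //= -[leRHS]mulr1 ler_wpM2l.
have e3 : 0 <= A * kap * (size (smp st)).-1%:R <= A * kap * K.+1%:R by rewrite mulr_ge0 // ler_wpM2l.
have e4 : 0 <= (if running st then coef st * pot st else 0) <= (A + be) * (2 * (1 + C * (K.+1%:R * h + o))).
  case: ifPn => r; last first.
    by rewrite lexx mulr_ge0 ?addr_ge0 // mulr_ge0 // addr_ge0 // mulr_ge0 // addr_ge0 // mulr_ge0 // ltW.
  have i2' := i2 r.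
  have l0 := lyap_ge0 ((z (pos st) - z (ref st)) / eta).
  have l1 := lyap_le1 ((z (pos st) - z (ref st)) / eta).
  have Sh : (size (smp st))%:R * h <= K.+1%:R * h by rewrite ler_pM2r // ler_nat.
  have p0 : 0 <= pot st by exact: pot_ge0.
  rewrite mulr_ge0 //=; apply: ler_pM => //.
    rewrite /coef; case: ifP => _; first by lra.
    by case: ifP => _; [rewrite lerDr|exact: addr_ge0].
  rewrite ler_pM2l // lerD // ler_wpM2l //; lra.
move: e1 e2 e3 e4; rewrite /exit_fct ler_norml.
set q1 := al * _; set q2 := be * _; set q3 := A * kap * _; set q4 := (if _ then _ else _).
move=> /andP[? ?] /andP[? ?] /andP[? ?] /andP[? ?]; apply/andP; split; lra.
Qed.

(** Here [kap] is of the order of $h$. With [be = 0] the expected number of cells with an exit is at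
    most of order $Kh$; with [al = 0] the probability of a second exit in some cell is at most of
    order $Kh^2$, which vanishes with $h$ when $Kh$ is fixed. *)
Lemma exit_estimate k :
  Ex P (fun om => let st := run (trail X n k om) in
    al * (nex st)%:R + be * (1 < phs st)%N%:R) <= A * kap * K.+1%:R.
Proof.
have Ak0 := mulr_ge0 A_ge0 kap_ge0.
have [M hM] := exit_fct_bound.
have init : exit_fct init_state <= A * kap.
  rewrite /exit_fct /= !mulr0 addr0 add0r subr0 /running /= /coef /= /pot /= mul1r !subrr subr0.
  rewrite mul0r lyap0 add0r; case: ifP => _; last exact: Ak0.
  by rewrite ler_wpM2l // /kap mulrA.
have bW := bmfun_run k hM.
have E := machine_supermartingale k hM _.
have : Ex P (fun om => exit_fct (run (trail X n k om))) <= A * kap.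
  apply: le_trans init; apply: E => s r.
  set st := run s in r *.
  have [i1 i2 i3 /andP[i4 i5] i6] := inv0_run s; rewrite -/st in i1 i2 i3 i4 i5 i6.
  have x0 := pos_gt0 r; have /andP[_ rng] := r.
  have i2' := i2 r.
  have lb y k' : `|lyap ((z k' - y) / eta)| <= 1 by rewrite ger0_norm ?lyap_ge0 // lyap_le1.
  set c0 := al * (nex st)%:R + be * (1 < phs st)%N%:R - A * kap * (size (smp st)).-1%:R.
  set c1 := C * ((size (smp st))%:R * h - (clk st + (a (pos st))^-1) + o).
  have gE x : al * (nex st)%:R + be * (1 < phs st)%N%:R - A * kap * (size (smp st)).-1%:R
    + coef st * (2 * (lyap ((z x - z (ref st)) / eta) + c1)) =
    (c0 + coef st * 2 * c1) + coef st * 2 * lyap ((z x - z (ref st)) / eta).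
    by rewrite /c0; ring.
  have bg : forall x, `|(c0 + coef st * 2 * c1) + coef st * 2 * lyap ((z x - z (ref st)) / eta)|
      <= `|c0 + coef st * 2 * c1| + `|coef st * 2|.
    move=> x; apply: le_trans (ler_normD _ _) _; rewrite lerD2l normrM.
    by rewrite ler_piMr.
  apply: (@le_trans _ _ (psum p (pos st) (fun x => (c0 + coef st * 2 * c1) + coef st * 2 * lyap ((z x - z (ref st)) / eta)))).
    apply: (psum_le p_ge0 p_sum1 x0 (M := M) _ bg).
      by move=> x; rewrite -run_rcons.
    move=> x _; rewrite -gE; exact: exit_fct_step r.
  have bl : forall x, `|coef st * 2 * lyap ((z x - z (ref st)) / eta)| <= `|coef st * 2|.
    by move=> x; rewrite normrM ler_piMr.
  rewrite (psumD p_ge0 p_sum1 x0 (fun=> lexx `|c0 + coef st * 2 * c1|) bl) psum_cst //.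
  rewrite (psumZ p_ge0 p_sum1 _ x0 (lb (z (ref st)))).
  have := @psum_lyap eta C (pos st) (z (ref st)) eta_gt0 x0 (lyap_eta _ rng).
  move=> /(ler_wpM2l (mulr_ge0 (coef_ge0 st) (ler0n R 2))).
  rewrite /exit_fct r /c0 /c1 /pot; set L := lyap _; set c := coef st; set Ls := psum _ _ _.
  by move=> hh; rewrite mulrDr in hh; lra.
have step : Ex P (fun om => let st := run (trail X n k om) in
    al * (nex st)%:R + be * (1 < phs st)%N%:R) <=
    Ex P (fun om => exit_fct (run (trail X n k om)) + A * kap * K%:R).
  have bn : forall s, `|al * (nex (run s))%:R + be * (1 < phs (run s))%N%:R| <= al * K.+2%:R + be.
    move=> s; have [_ _ _ /andP[i4 i5] i6] := inv0_run s.
    rewrite ger0_norm ?addr_ge0 ?mulr_ge0 // lerD //.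
      rewrite ler_wpM2l // ler_nat.
      have : (nex (run s) < K.+1 + 1)%N by apply: leq_trans i6 _; rewrite leq_add // leq_b1.
      by rewrite addn1 => /ltnW.
    by rewrite -[leRHS]mulr1 ler_wpM2l //; case: (_ < _)%N.
  apply: Ex_le.
  - exact: (bmfun_run (W := fun st => al * (nex st)%:R + be * (1 < phs st)%N%:R) k bn).
  - by apply: bmfunD => //; exact: bmfun_cst.
  move=> om /=; have [i1 i2 i3 /andP[i4 i5] i6] := inv0_run (trail X n k om).
  set st := run _ in i1 i2 i3 i4 i5 i6 *; rewrite /exit_fct.
  have : 0 <= (if running st then coef st * pot st else 0).
    by case: ifPn => r //; apply: mulr_ge0 => //; exact: pot_ge0.
  have : A * kap * (size (smp st)).-1%:R <= A * kap * K%:R by rewrite ler_wpM2l // ler_nat -ltnS prednK.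
  lra.
rewrite ExD ?Ex_cst // in step; last exact: bmfun_cst.
by move=> E2; apply: (le_trans step); rewrite -natr1 mulrDr mulr1; lra.
Qed.

End Exits.

(** [lyap (z / ell) - C * clk] is a supermartingale started at 0. Outside the range [lyap] is at
    least $1/2$, and [C] is small for a large scale [ell], so this controls the probability of
    leaving the range. *)
Lemma range_estimate C k : 0 <= C ->
  (forall x y, `|z x| <= ell -> nu p a x (lyap_jump_fct ell y) <= C) ->
  Ex P (fun om => lyap (z (pos (run (trail X n k om))) / ell)) <= C * (K%:R * h + o).
Proof.
move=> C0 hC.
have lb (x : nat) : `|lyap (z x / ell)| <= 1 by rewrite ger0_norm ?lyap_ge0 // lyap_le1.
have Kh0 : 0 <= K%:R * h + o by rewrite addr_ge0 // mulr_ge0 // ltW.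
have hM : forall s, `|lyap (z (pos (run s)) / ell) - C * clk (run s)| <= 1 + C * (K%:R * h + o).
  move=> s; apply: le_trans (ler_normB _ _) _; apply: lerD => //.
  have [_ _ i3 _ _] := inv0_run s.
  by rewrite ger0_norm ?mulr_ge0 ?clk_ge0 // ler_wpM2l.
have E := @machine_supermartingale (fun st => lyap (z (pos st) / ell) - C * clk st) _ k hM.
have {}E : Ex P (fun om => lyap (z (pos (run (trail X n k om))) / ell) - C * clk (run (trail X n k om))) <= 0.
  have -> : 0 = lyap (z (pos init_state) / ell) - C * clk init_state :> R.
    by rewrite /= /logjump subrr mul0r lyap0 mulr0 subrr.
  apply: E => s r; set st := run s in r *.
  have x0 := pos_gt0 r; have /andP[_ rng] := r.
  have upE x : lyap (z (pos (update st x)) / ell) - C * clk (update st x) =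
      lyap (z x / ell) - C * (clk st + (a (pos st))^-1).
    by rewrite /update r /=; case: ifP => //; case: ifP => //; case: ifP.
  under eq_fun do rewrite upE.
  rewrite (psumB p_ge0 p_sum1 x0 lb (fun=> lexx `|C * (clk st + (a (pos st))^-1)|)) psum_cst //.
  have := @psum_lyap ell C (pos st) 0 ell_gt0 x0 (hC _ _ rng).
  rewrite subr0; under eq_fun do rewrite subr0.
  by rewrite mulrDr; lra.
have bl := bmfun_run (W := fun st => lyap (z (pos st) / ell)) k (fun s => lb (pos (run s))).
apply: (@le_trans _ _ (Ex P (fun om => (lyap (z (pos (run (trail X n k om))) / ell) - C * clk (run (trail X n k om))) + C * (K%:R * h + o)))).
  have bE := bmfun_run (W := fun st => lyap (z (pos st) / ell) - C * clk st) k hM.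
  apply: Ex_le => //; first by apply: bmfunD => //; exact: bmfun_cst.
  move=> om; have [_ _ i3 _ _] := inv0_run (trail X n k om).
  by have := ler_wpM2l C0 i3; lra.
rewrite ExD ?Ex_cst; [lra| |exact: bmfun_cst].
exact: (bmfun_run (W := fun st => lyap (z (pos st) / ell) - C * clk st) k hM).
Qed.

(** * Joint law of the increments over the cells *)

Section FiniteDimensional.
Variables (fs : nat -> R -> R) (qs : nat -> R -> R -> R) (B L e : R).
Hypothesis B_ge1 : 1 <= B.
Hypothesis L_ge0 : 0 <= L.
Hypothesis e_ge0 : 0 <= e.
Hypothesis qs0 : forall i x, qs i 0 x = fs i x.
Hypothesis qsB : forall i s x, - o <= s <= h -> `|qs i s x| <= B.
Hypothesis qsL : forall i s s' x, - o <= s <= h -> - o <= s' <= h ->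
  `|qs i s x - qs i s' x| <= L * `|s - s'|.
Hypothesis qs_drift : forall x i s y, `|z x| <= ell -> 0 <= s <= h ->
  `|psum p x (fun k => qs i (s - (a x)^-1) (y + logjump x k)) - qs i s y| <= e / a x.

Definition zsmp st i := z (nth n (smp st) i).

(* Approximate conditional expectation of [\prod_i fs i (D i)] given the current
   state, [D i] being the increments between the samples and [qs i s] the
   evolution of [fs i] over the clock time [s] left in the cell. *)
Definition fdd_fct st : R := let j := (size (smp st)).-1 in
  (\prod_(0 <= i < j) fs i (zsmp st i.+1 - zsmp st i)) *
  (if (j < K)%N then qs j (j.+1%:R * h - clk st) (z (pos st) - zsmp st j)
    * \prod_(j.+1 <= i < K) qs i h 0 else 1).

Let BK := B ^+ K.
(** [E0] is the error per unit of clock, due to the approximate backward equation; [E1] is the error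
    per completed cell, due to the overshoot of the clock. *)
Let E0 := BK * BK * e.
Let E1 := 2 * L * o * B * (BK * BK).

Let BK_ge1 : 1 <= BK.
Proof. exact: exprn_ege1. Qed.

Let B_ge0 : 0 <= B. Proof. exact: le_trans B_ge1. Qed.

Let BK_ge0 : 0 <= BK. Proof. exact: le_trans BK_ge1. Qed.

Let prod_bound (g : nat -> R) m k : (forall i, `|g i| <= B) -> (k <= K)%N ->
  `|\prod_(m <= i < k) g i| <= BK.
Proof.
move=> gB kK; apply: (@le_trans _ _ (B ^+ (k - m))); last first.
  by apply: ler_weXn2l => //; apply: leq_trans (leq_subr _ _) kK.
rewrite normr_prod -prodr_const_nat; apply: ler_prod => i _.
by rewrite normr_ge0 gB.
Qed.

Let h_range : - o <= h <= h.
Proof. by rewrite lexx andbT; move: o_ge0 h_gt0; lra. Qed.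

Let zero_range : - o <= 0 <= h.
Proof. by rewrite oppr_le0 o_ge0 ltW. Qed.

Let fsB i x : `|fs i x| <= B.
Proof. by rewrite -qs0; apply: qsB. Qed.

Lemma fdd_fct_bound st : - o <= (size (smp st)).-1.+1%:R * h - clk st <= h ->
  (size (smp st) <= K.+1)%N -> `|fdd_fct st| <= BK * (B * BK).
Proof.
move=> r1 r2; rewrite /fdd_fct normrM; apply: ler_pM => //.
  by apply: prod_bound; [move=> i; exact: fsB|rewrite -subn1 leq_subLR add1n].
case: ifP => jK; last first.
  by rewrite normr1 -[1]mulr1; apply: ler_pM.
rewrite normrM; apply: ler_pM => //; first exact: qsB.
by apply: prod_bound => // i; exact: qsB.
Qed.

Lemma fdd_clk_range s : (size (smp (run s)) <= K)%N ->
  - o <= (size (smp (run s))).-1.+1%:R * h - clk (run s) <= h.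
Proof.
elim/last_ind: s => [|s x IH].
  by rewrite /= mul1r subr0.
rewrite run_rcons; have [r|/negbTE r] := boolP (running (run s)); last first.
  by rewrite /update r.
have [i1 i2 i3 /andP[i4 i5] i6] := inv0_run s; have i2' := i2 r.
have /andP[a0 ao] := clk_upper r.
have E : (size (smp (run s)))%:R = (size (smp (run s))).-1%:R + 1 :> R.
  by rewrite natr1 prednK.
rewrite /update r /=; case: ifPn => f1 /=.
  by move=> _; rewrite prednK //; move: i1 i2'; rewrite E !mulrDl mul1r; lra.
case: ifPn => cr /=.
  by rewrite size_rcons /= => _; rewrite -natr1 mulrDl mul1r; move: o_ge0 o_lt_h i2' cr; set u := _%:R * h; lra.
by case: ifPn => f2 /= _; rewrite prednK //; move: i1 i2'; rewrite E !mulrDl mul1r; lra.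
Qed.

(** The value of [fdd_fct] after a step to [x] if the step is treated as remaining in the current
    cell. *)
Let cont st x := (\prod_(0 <= i < (size (smp st)).-1) fs i (zsmp st i.+1 - zsmp st i)) *
  (qs (size (smp st)).-1 ((size (smp st)).-1.+1%:R * h - clk st - (a (pos st))^-1)
     (z x - zsmp st (size (smp st)).-1)
    * \prod_((size (smp st)).-1.+1 <= i < K) qs i h 0).

Let psum_cont s : let st := run s in running st ->
  `|psum p (pos st) (cont st) - fdd_fct st| <= E0 / a (pos st).
Proof.
move=> st r; have [i1 i2 i3 /andP[i4 i5] i6] := inv0_run s; rewrite -/st in i1 i2 i3 i4 i5 i6.
have /andP[sK rng] := r; have x0 := pos_gt0 r; have i2' := i2 r.
have /andP[a0 ao] := clk_upper r.
set j := (size (smp st)).-1; set sv := j.+1%:R * h - clk st.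
have jS : j.+1 = size (smp st) by rewrite prednK.
have jK : (j < K)%N by rewrite jS.
have sv1 : 0 <= sv <= h.
  by rewrite /sv jS; move: i1 i2'; rewrite -jS /= -natr1 mulrDl mul1r; lra.
rewrite /fdd_fct -/j jK -/sv.
set D := \prod_(0 <= i < j) _; set Q := \prod_(j.+1 <= i < K) _.
have DB : `|D| <= BK by apply: prod_bound => //; exact: ltnW.
have QB : `|Q| <= BK by apply: prod_bound => // i; exact: qsB.
have qb (k : nat) : `|qs j (sv - (a (pos st))^-1) (z (pos st) - zsmp st j + logjump (pos st) k)| <= B.
  by apply: qsB; lra.
have -> : psum p (pos st) (cont st) = D * Q *
    psum p (pos st) (fun k => qs j (sv - (a (pos st))^-1) (z (pos st) - zsmp st j + logjump (pos st) k)).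
  rewrite -(psumZ p_ge0 p_sum1 (D * Q) x0 qb); apply: eq_psum => k _.
  rewrite /cont -/j -/sv -/D -/Q (_ : z k - zsmp st j = z (pos st) - zsmp st j + logjump (pos st) k); last first.
    by rewrite /logjump; ring.
  by ring.
rewrite (_ : D * (_ * Q) = D * Q * qs j sv (z (pos st) - zsmp st j)); last by ring.
rewrite -mulrBr normrM normrM (_ : E0 / a (pos st) = BK * BK * (e / a (pos st))); last by rewrite /E0 mulrA.
apply: ler_pM => //.
- exact: ler_pM.
- exact: qs_drift.
Qed.

Let cross_bound (D Q f1 q1 q2 q3 : R) : `|D| <= BK -> `|Q| <= BK -> `|f1| <= B -> `|q3| <= B ->
  `|q1| <= B -> `|f1 - q1| <= L * o -> `|q2 - q3| <= L * o ->
  `|D * f1 * (q2 * Q) - D * (q1 * (q3 * Q))| <= E1.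
Proof.
move=> DB QB fB q3B q1B fq qq.
rewrite (_ : _ - _ = D * Q * ((f1 - q1) * q3 + f1 * (q2 - q3))); last by ring.
rewrite 2!normrM /E1 mulrC; apply: ler_pM => //; last exact: ler_pM.
apply: le_trans (ler_normD _ _) _; rewrite !normrM.
have h1 : `|f1 - q1| * `|q3| <= L * o * B by apply: ler_pM.
have h2 : `|f1| * `|q2 - q3| <= B * (L * o) by apply: ler_pM.
by move: h1 h2; set u := `|f1 - q1| * _; set v := `|f1| * _; lra.
Qed.

(** Only the end of a cell costs something: the finished factor is evaluated at a remaining time in
    [[- o, 0]] instead of 0, and the next one starts from [h] shortened by the overshoot. [qsL]
    bounds both changes. *)
Let update_cont s x : let st := run s in running st ->
  `|fdd_fct (update st x) - cont st x| <=
    E1 * ((size (smp (update st x))).-1%:R - (size (smp st)).-1%:R).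
Proof.
move=> st r; have [i1 i2 i3 /andP[i4 i5] i6] := inv0_run s; rewrite -/st in i1 i2 i3 i4 i5 i6.
have /andP[sK rng] := r; have x0 := pos_gt0 r; have i2' := i2 r.
have /andP[a0 ao] := clk_upper r.
have jK : ((size (smp st)).-1 < K)%N by rewrite prednK.
have same k' t' b' p' r' e' n' : t' = clk st + (a (pos st))^-1 ->
   `|fdd_fct (St x t' k' (smp st) b' p' r' e' n') - cont st x| <= 
   E1 * ((size (smp st)).-1%:R - (size (smp st)).-1%:R).
  move=> ->; rewrite subrr mulr0 /fdd_fct /cont /= jK /zsmp /= opprD addrA subrr.
  by rewrite normr0.
rewrite /update r /=; case: ifPn => f1; first exact: same.
case: ifPn => cr; last by case: ifPn => f2; exact: same.
rewrite /fdd_fct /cont /= size_rcons /=.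
set t := clk st + _ in cr *.
set j := (size (smp st)).-1 in jK *.
have jS : size (smp st) = j.+1 by rewrite prednK.
rewrite (_ : (size (smp st))%:R - j%:R = 1 :> R) ?mulr1; last by rewrite jS -natr1 addrC addKr.
rewrite jS.
have nthr i : (i <= j)%N -> nth n (rcons (smp st) x) i = nth n (smp st) i.
  by move=> ij; rewrite nth_rcons jS ltnS ij.
have nthx : nth n (rcons (smp st) x) j.+1 = x by rewrite nth_rcons jS ltnn eqxx.
rewrite /zsmp /= big_nat_recr //=.
rewrite (eq_big_nat _ _ (F2 := fun i => fs i (z (nth n (smp st) i.+1) - z (nth n (smp st) i)))); last first.
  by move=> i /andP[_ ij]; rewrite !nthr // ltnW.
rewrite nthx nthr //.
set D := \prod_(0 <= i < j) _; set y := z x - z (nth n (smp st) j).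
have DB : `|D| <= BK by apply: prod_bound => //; exact: ltnW.
set s' := j.+1%:R * h - t.
rewrite (_ : j.+1%:R * h - clk st - (a (pos st))^-1 = s'); last by rewrite /s' /t opprD addrA.
have s'0 : - o <= s' <= 0.
  by move: cr i2'; rewrite /s' /t jS; lra.
have s'r : - o <= s' <= h by have := h_gt0; lra.
have fq : `|fs j y - qs j s' y| <= L * o.
  rewrite -qs0; apply: le_trans (qsL j y zero_range s'r) _.
  by rewrite ler_wpM2l // sub0r normrN ler0_norm; lra.
case: ifPn => jK2; last first.
  have jE : K = j.+1 by apply/eqP; rewrite eqn_leq jK /= leqNgt jK2.
  rewrite big_geq -?jE // !mulr1.
  have := @cross_bound D 1 (fs j y) (qs j s' y) 1 1 DB _ (fsB _ _) _ _ fq _.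
  rewrite !mulr1; apply => //; rewrite ?normr1 //; first exact: qsB.
  by rewrite subrr normr0 mulr_ge0.
rewrite (big_ltn jK2) subrr.
apply: cross_bound => //; try exact: qsB.
- by apply: prod_bound => // i; exact: qsB.
- have hs : - o <= j.+2%:R * h - t <= h.
    by move: s'0; rewrite /s' -[j.+2]addn1 natrD mulrDl mul1r; move: o_lt_h o_ge0; lra.
  apply: le_trans (qsL _ _ hs h_range) _; rewrite ler_wpM2l //.
  rewrite (_ : _ - h = s'); last by rewrite /s' -[j.+2]addn1 natrD mulrDl mul1r; ring.
  by rewrite ler0_norm; lra.
Qed.

Lemma fdd_estimate k :
  `|Ex P (fun om => fdd_fct (run (trail X n k om))) - \prod_(0 <= i < K) qs i h 0|
  <= E0 * (K%:R * h + o) + E1 * K%:R.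
Proof.
have E0_ge0 : 0 <= E0 by rewrite !mulr_ge0.
have E1_ge0 : 0 <= E1 by rewrite !mulr_ge0.
have vB s : `|fdd_fct (run s)| <= BK * (B * BK).
  have [i1 i2 i3 /andP[i4 i5] i6] := inv0_run s.
  have [sK|sK] := leqP (size (smp (run s))) K.
    by apply: fdd_fct_bound => //; exact: fdd_clk_range.
  have -> : fdd_fct (run s) = \prod_(0 <= i < K) fs i (zsmp (run s) i.+1 - zsmp (run s) i) * 1.
    have jE : (size (smp (run s))).-1 = K by move: i5; rewrite leq_eqVlt ltnS leqNgt sK orbF => /eqP ->.
    by rewrite /fdd_fct jE ltnn.
  rewrite normrM normr1; apply: ler_pM => //; first exact: prod_bound.
  by rewrite -[1]mulr1; apply: ler_pM.
have initE : fdd_fct init_state = \prod_(0 <= i < K) qs i h 0.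
  rewrite /fdd_fct /= big_geq // mul1r; case: ifPn => K0.
    by rewrite mul1r subr0 subrr (big_ltn K0).
  by rewrite big_geq // leqNgt.
(* The compensator [E0 * clk + E1 * (number of completed cells)] turns both [fdd_fct] and its
   opposite into supermartingales; the two signs [sg] give the two-sided bound. *)
set v := Ex P _; pose W sg st : R := sg * fdd_fct st - E0 * clk st - E1 * (size (smp st)).-1%:R.
have bv := bmfun_run k vB.
have Wend sg : `|sg| = 1 -> sg * v <= sg * \prod_(0 <= i < K) qs i h 0 + (E0 * (K%:R * h + o) + E1 * K%:R).
  move=> sg1.
  have WM s : `|W sg (run s)| <= BK * (B * BK) + E0 * (K%:R * h + o) + E1 * K%:R.
    have [_ _ i3 /andP[i4 i5] _] := inv0_run s; have c0 := clk_ge0 s.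
    have e0 : 0 <= E0 * clk (run s) <= E0 * (K%:R * h + o) by rewrite mulr_ge0 // ler_wpM2l.
    have e1 : 0 <= E1 * (size (smp (run s))).-1%:R <= E1 * K%:R.
      by rewrite mulr_ge0 //= ler_wpM2l // ler_nat -ltnS prednK.
    have : `|sg * fdd_fct (run s)| <= BK * (B * BK) by rewrite normrM sg1 mul1r.
    move: e0 e1; rewrite /W !ler_norml; set u := E0 * clk _; set w := E1 * _%:R.
    by move=> /andP[? ?] /andP[? ?] /andP[? ?]; apply/andP; split; lra.
  have E := machine_supermartingale k WM _.
  have {}E : Ex P (fun om => W sg (run (trail X n k om))) <= W sg init_state.
    apply: E => s r; set st := run s in r *.
    have x0 := pos_gt0 r.
    have upt x : clk (update st x) = clk st + (a (pos st))^-1.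
      by rewrite /update r /=; case: ifP => //; case: ifP => //; case: ifP.
    set c := E0 * (clk st + (a (pos st))^-1) + E1 * (size (smp st)).-1%:R.
    have [i1 i2 i3 /andP[i4 i5] i6] := inv0_run s; rewrite -/st in i1 i2 i3 i4 i5 i6.
    have /andP[sK rng] := r; have i2' := i2 r.
    have /andP[a0 ao] := clk_upper r.
    have contB x : `|sg * cont st x| <= BK * (B * BK).
      rewrite normrM sg1 mul1r /cont normrM; apply: ler_pM => //.
        by apply: prod_bound => //; rewrite (leq_trans (leq_pred _)).
      rewrite normrM; apply: ler_pM => //.
        apply: qsB; rewrite prednK //.
        have E' : (size (smp st))%:R = (size (smp st)).-1%:R + 1 :> R by rewrite natr1 prednK.
        by move: i1 i2'; rewrite E' !mulrDl mul1r; lra.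
      by apply: prod_bound => // i; exact: qsB.
    apply: (@le_trans _ _ (psum p (pos st) (fun x => sg * cont st x - c))).
      apply: (psum_le p_ge0 p_sum1 x0 (M := BK * (B * BK) + E0 * (K%:R * h + o) + E1 * K%:R)
         (N := BK * (B * BK) + `|c|)).
      - by move=> x; rewrite -run_rcons.
      - by move=> x; apply: le_trans (ler_normB _ _) _; rewrite lerD2r.
      move=> x _; rewrite /W upt /c.
      have := @update_cont s x r; rewrite -/st mulrBr.
      have : sg * fdd_fct (update st x) - sg * cont st x <= `|fdd_fct (update st x) - cont st x|.
        by rewrite -mulrBr (le_trans (ler_norm _)) // normrM sg1 mul1r.
      set u1 := sg * fdd_fct _; set u2 := sg * cont _ _; set u3 := `|_ - _|.
      by set u4 := E1 * _; set u5 := E1 * _; lra.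
    rewrite (psumB p_ge0 p_sum1 x0 contB (fun=> lexx `|c|)) psum_cst //.
    have cB : forall x, `|cont st x| <= BK * (B * BK).
      by move=> x; have := contB x; rewrite normrM sg1 mul1r.
    rewrite (psumZ p_ge0 p_sum1 _ x0 cB) /W /c.
    have := @psum_cont s r; rewrite -/st.
    have : sg * psum p (pos st) (cont st) - sg * fdd_fct st <= `|psum p (pos st) (cont st) - fdd_fct st|.
      by rewrite -mulrBr (le_trans (ler_norm _)) // normrM sg1 mul1r.
    rewrite mulrDr; set u1 := sg * psum _ _ _; set u2 := sg * fdd_fct _; set u3 := `|_ - _|.
    by set u4 := E0 * _; set u5 := E1 * _; set u6 := E0 * _; lra.
  have Winit : W sg init_state = sg * \prod_(0 <= i < K) qs i h 0.
    by rewrite /W initE /= !mulr0 !subr0.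
  rewrite Winit in E.
  have : Ex P (fun om => sg * fdd_fct (run (trail X n k om))) <=
     Ex P (fun om => W sg (run (trail X n k om)) + (E0 * (K%:R * h + o) + E1 * K%:R)).
    have bW := bmfun_run k WM.
    apply: Ex_le; [exact: bmfunZ|by apply: bmfunD => //; exact: bmfun_cst|].
    move=> om; have [_ _ i3 /andP[i4 i5] _] := inv0_run (trail X n k om).
    have e0 : E0 * clk (run (trail X n k om)) <= E0 * (K%:R * h + o) by rewrite ler_wpM2l.
    have e1 : E1 * (size (smp (run (trail X n k om)))).-1%:R <= E1 * K%:R.
      by rewrite ler_wpM2l // ler_nat -ltnS prednK.
    by rewrite /W; move: e0 e1; set u1 := E0 * clk _; set u2 := E1 * _.-1%:R; lra.
  rewrite ExZ // ExD ?Ex_cst; [|exact: bmfun_run k WM|exact: bmfun_cst].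
  by rewrite -/v; lra.
have w1 := Wend 1 (normr1 _); have w2 := Wend (-1) ltac:(by rewrite normrN normr1).
by rewrite ler_norml; move: w1 w2; rewrite !mulN1r !mul1r; lra.
Qed.

End FiniteDimensional.

(** Positions in the range are at most $ne^{\ell}$, hence finitely many, and each running step
    advances the clock by at least some [c > 0], while the clock never exceeds [K%:R * h + o]. *)
Lemma run_stops : exists k0, forall s, (k0 <= size s)%N -> ~~ running (run s).
Proof.
have [c c0 hc] : exists2 c, 0 < c & forall x, `|z x| <= ell -> c <= (a x)^-1.
  have [c c0 hc] : exists2 c, 0 < c & forall x, (x <= Num.truncn (n%:R * expR ell))%N -> c <= (a x)^-1.
    elim: (Num.truncn _) => [|k [c c0 hc]].
      by exists (a 0%N)^-1; rewrite ?invr_gt0 // => x; rewrite leqn0 => /eqP ->.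
    exists (Num.min c (a k.+1)^-1); first by rewrite lt_min c0 invr_gt0 a_gt0.
    move=> x; rewrite leq_eqVlt ltnS => /orP[/eqP ->|xk]; first by rewrite ge_min lexx orbT.
    by rewrite ge_min hc.
  exists c => // x zx; apply: hc; have [x0 _] := ss zx.
  have : ln (x%:R : R) - ln n%:R <= ell by move: zx; rewrite /logjump ler_norml => /andP[].
  rewrite lerBlDl -ler_expR expRD !lnK ?posrE ?ltr0n // => xl.
  rewrite -ltnS -(ltr_nat R); apply: le_lt_trans xl _.
  by have /andP[] := @truncn_itv R (n%:R * expR ell) ltac:(by rewrite mulr_ge0 // expR_ge0).
have clk_lower s : running (run s) -> c * (size s)%:R <= clk (run s).
  elim/last_ind: s => [|s x IH]; first by rewrite mulr0.
  rewrite run_rcons size_rcons; have [r|/negbTE r] := boolP (running (run s)); last first.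
    by rewrite /update r /= r.
  move=> _; have -> : clk (update (run s) x) = clk (run s) + (a (pos (run s)))^-1.
    by rewrite /update r /=; case: ifP => //; case: ifP => //; case: ifP.
  rewrite -natr1 mulrDr mulr1 lerD //; first exact: IH.
  by apply: hc; case/andP: r.
exists (Num.truncn ((K%:R * h + o) / c)).+1 => s sk; apply/negP => r.
have h1 := clk_lower s r; have [_ _ i3 _ _] := inv0_run s.
have : (size s)%:R <= (K%:R * h + o) / c by rewrite ler_pdivlMr // mulrC (le_trans h1).
have := truncnS_gt ((K%:R * h + o) / c) => h2 h3.
have := le_lt_trans h3 h2; by rewrite ltr_nat ltnS leqNgt sk.
Qed.

End WithChain.
End Machine.

(** * Step paths *)

Section StepPaths.
Context {R : realType}.
Implicit Types (c v z : nat -> R).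

Definition step_path c v K (t : R) : R :=
  \sum_(0 <= j < K) (if c j <= t < c j.+1 then v j else 0).

Lemma incr_le c K : (forall j, (j < K)%N -> c j < c j.+1) ->
  forall i j, (i <= j)%N -> (j <= K)%N -> c i <= c j.
Proof.
move=> cm i; elim=> [|j IH]; first by rewrite leqn0 => /eqP ->.
rewrite leq_eqVlt ltnS => /orP[/eqP -> //|ij] jK.
by apply: le_trans (ltW (cm _ jK)); apply: IH => //; exact: ltnW.
Qed.

Lemma step_pathE c v K j t : (forall j, (j < K)%N -> c j < c j.+1) -> (j < K)%N ->
  c j <= t < c j.+1 -> step_path c v K t = v j.
Proof.
move=> cm jK /andP[t1 t2]; rewrite /step_path big_mkord (bigD1 (Ordinal jK)) //= t1 t2 /=.
rewrite big1 ?addr0 // => i; rewrite -val_eqE /= => ij.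
have [h|h|h] := ltngtP i j; last by rewrite h eqxx in ij.
- have /negbTE -> : ~~ (t < c i.+1); last by rewrite andbF.
  by rewrite -leNgt (le_trans _ t1) //; exact: incr_le cm _ _ h (ltnW jK).
- have /negbTE -> // : ~~ (c i <= t).
  by rewrite -ltNge (lt_le_trans t2) //; exact: incr_le cm _ _ h (ltnW (ltn_ord i)).
Qed.

Lemma step_path_out c v K t : (forall j, (j < K)%N -> c j < c j.+1) ->
  c K <= t -> step_path c v K t = 0.
Proof.
move=> cm ct; rewrite /step_path big_mkord big1 // => i _.
have /negbTE -> : ~~ (t < c i.+1); last by rewrite andbF.
by rewrite -leNgt (le_trans _ ct) //; exact: incr_le cm _ _ (ltn_ord i) (leqnn _).
Qed.

Variable gamma : R.

(** The Riemann sum of $\int e^{\gamma z}$ for a path sampled at the multiples of [h]. *)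
Definition step_clock h z i : R := \sum_(0 <= j < i) h * expR (gamma * z j).

Definition lamperti_step h K z := step_path (step_clock h z) (fun j => expR (z j)) K.

Lemma step_clock_lt h z j : 0 < h -> step_clock h z j < step_clock h z j.+1.
Proof.
by move=> h0; rewrite /step_clock big_nat_recr //= ltrDl mulr_gt0 // expR_gt0.
Qed.

Lemma step_clock0 h z : step_clock h z 0%N = 0.
Proof. by rewrite /step_clock big_geq. Qed.

Lemma lamperti_step_close (e h : R) K z z' : 0 < e -> 0 < h ->
  (forall j, (j <= K)%N -> `|step_clock h z j - step_clock h z' j| <= e) ->
  (forall j, (j < K)%N -> `|expR (z j) - expR (z' j)| <= e) ->
  close_paths e (lamperti_step h K z) (lamperti_step h K z').
Proof.
move=> e0 h0 hc hv.
(* One more block, longer than [e^-1], on which both paths are 0, carries the subdivision past the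
   horizon even when the clocks are short. *)
pose ext z j := if (j <= K)%N then step_clock h z j else step_clock h z K + e^-1 + 1.
have ei : 0 < e^-1 by rewrite invr_gt0.
have extm z1 j : (j < K.+1)%N -> ext z1 j < ext z1 j.+1.
  rewrite /ext ltnS => jK; rewrite jK; case: ifP => h1; first exact: step_clock_lt.
  have -> : j = K by apply/eqP; rewrite eqn_leq jK leqNgt h1.
  by rewrite -addrA ltrDl addr_gt0.
apply: (@close_blocks _ K.+1 (ext z) (ext z')) => //.
- by rewrite /ext leq0n step_clock0.
- by rewrite /ext leq0n step_clock0.
- exact: extm.
- exact: extm.
- move=> j _; rewrite /ext; case: ifP => h1; first exact: hc.
  have := hc K (leqnn _).
  by set u := step_clock h z K; set u' := step_clock h z' K; rewrite (_ : u + e^-1 + 1 - (u' + e^-1 + 1) = u - u') //; ring.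
- rewrite /ext ltnn -addrA; have : 0 <= step_clock h z' K.
    by apply: sumr_ge0 => i _; rewrite mulr_ge0 ?expR_ge0 ?ltW.
  by set u := e^-1; lra.
move=> j t t'; rewrite ltnS leq_eqVlt => /orP[/eqP ->|jK].
  rewrite /ext leqnn ltnn => /andP[t1 _] /andP[t'1 _].
  rewrite /lamperti_step !step_path_out //; try by move=> i _; exact: step_clock_lt.
  by rewrite subrr normr0 ltW.
rewrite /ext (ltnW jK) jK => t1 t2.
rewrite /lamperti_step (step_pathE _ _ jK t1); last by move=> i _; exact: step_clock_lt.
rewrite (step_pathE _ _ jK t2); last by move=> i _; exact: step_clock_lt.
exact: hv.
Qed.

Lemma sum_widen (f : nat -> R) j K : (forall i, 0 <= f i) -> (j <= K)%N ->
  \sum_(0 <= i < j) f i <= \sum_(0 <= i < K) f i.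
Proof.
move=> f0; elim: K => [|K IH]; first by rewrite leqn0 => /eqP ->.
rewrite leq_eqVlt ltnS => /orP[/eqP -> //|jK].
by rewrite big_nat_recr //= (le_trans (IH jK)) // lerDl.
Qed.

(** The block boundaries are [u] in one clock, near the grid [i * h], and [c] in the other; [r] is
    the rate between the clocks, accurate up to the relative error [kap]. Moving a boundary changes
    two neighbouring blocks, whence the factor 2, and only the total displacement [D] matters. It
    serves the chain as well as the cadlag paths. *)
Lemma clock_compare (u c r : nat -> R) (K : nat) (h kap rmax D : R) : 0 <= kap -> 0 <= rmax ->
  u 0%N = 0 -> c 0%N = 0 -> (forall i, (i < K)%N -> u i <= u i.+1) ->
  (forall i, (i < K)%N -> 0 <= r i <= rmax) ->
  (forall i, (i < K)%N -> `|c i.+1 - c i - r i * (u i.+1 - u i)| <= kap * (r i * (u i.+1 - u i))) ->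
  \sum_(0 <= i < K.+1) `|u i - i%:R * h| <= D ->
  forall j, (j <= K)%N -> `|c j - \sum_(0 <= i < j) h * r i| <= rmax * (kap * u K + 2 * D).
Proof.
move=> kap0 rm0 u0 c0 um rm ch hD j jK.
pose dv i : R := `|u i - i%:R * h|.
have dv0 i : 0 <= dv i by exact: normr_ge0.
have step i : (i <= j)%N -> `|c i - \sum_(0 <= l < i) h * r l| <=
    rmax * (kap * u i + \sum_(0 <= l < i) (dv l + dv l.+1)).
  elim: i => [_|i IH ij]; first by rewrite !big_geq // c0 subrr normr0 u0 mulr0 add0r mulr0.
  have iK : (i < K)%N by exact: leq_trans ij jK.
  have := IH (ltnW ij); rewrite !big_nat_recr //=.
  set S1 := \sum_(0 <= l < i) _; set S2 := \sum_(0 <= l < i) _ => IHi.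
  have /andP[ri0 rirm] := rm i iK.
  have E : c i.+1 - (S1 + h * r i) = (c i - S1) + (c i.+1 - c i - r i * (u i.+1 - u i))
    + r i * ((u i.+1 - i.+1%:R * h) - (u i - i%:R * h)) by rewrite -natr1; ring.
  rewrite E; apply: le_trans (ler_normD _ _) _.
  have h1 : `|r i * ((u i.+1 - i.+1%:R * h) - (u i - i%:R * h))| <= rmax * (dv i + dv i.+1).
    rewrite normrM ger0_norm //; apply: ler_pM => //.
    by rewrite [leRHS]addrC; exact: ler_normB.
  have h2 := ch i iK.
  have h3 : kap * (r i * (u i.+1 - u i)) <= rmax * (kap * u i.+1) - rmax * (kap * u i).
    by rewrite mulrCA -!mulrBr; apply: ler_wpM2r => //; rewrite mulr_ge0 // subr_ge0 um.
  have h4 := ler_normD (c i - S1) (c i.+1 - c i - r i * (u i.+1 - u i)).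
  move: IHi h1 h2 h3 h4.
  set n2 := `|r i * _|; set n3 := `|c i.+1 - _ - _|; set n4 := `|_ + _|.
  set n1 := `|c i - S1|; rewrite !mulrDr.
  by set m1 := rmax * (kap * u i); set m2 := rmax * (kap * u i.+1); lra.
apply: le_trans (step j (leqnn _)) _; apply: ler_wpM2l => //.
have uj : u j <= u K.
  elim: (K) jK um => [|k IH]; first by rewrite leqn0 => /eqP ->.
  rewrite leq_eqVlt ltnS => /orP[/eqP -> //|jk] um.
  by apply: le_trans (um k _) => //; apply: IH => // i ik; apply: um; exact: ltnW.
apply: lerD; first exact: ler_wpM2l.
rewrite big_split /= mulrDl mul1r; apply: lerD; apply: le_trans hD.
  by apply: sum_widen => //; exact: leqW.
by rewrite big_nat_recl //= -/(dv 0%N) ler_wpDl // sum_widen.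
Qed.

End StepPaths.

(** * From the exploration to Skorokhod closeness *)

Section ChainPath.
Variables (R : realType) (a : nat -> R) (n K : nat).
Variables (h eta ell o : R).
Hypothesis a_gt0 : forall n, 0 < a n.
Hypothesis n_gt0 : (0 < n)%N.
Hypothesis h_gt0 : 0 < h.
Hypothesis eta_gt0 : 0 < eta.
Hypothesis ell_gt0 : 0 < ell.
Hypothesis o_ge0 : 0 <= o.
Hypothesis o_lt_h : o < h.
Hypothesis ss : small_steps a n ell o.

Variable x : nat -> nat.
Hypothesis x0 : x 0%N = n.

Local Notation z := (@logjump R n).
Local Notation runK := (run a n K h eta ell).
Local Notation updateK := (update a n K h eta ell).
Local Notation runningK := (@running R n K ell).
Local Notation init := (init_state R n).

Definition trace k := [seq x j | j <- iota 1 k].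

Lemma traceS k : trace k.+1 = rcons (trace k) (x k.+1).
Proof. by rewrite /trace -[k.+1]addn1 iotaD map_cat /= cats1 add1n addn1. Qed.

Lemma runS k : runK (trace k.+1) = updateK (runK (trace k)) (x k.+1).
Proof. by rewrite traceS run_rcons. Qed.

Lemma stp_run k : runningK (runK (trace k)) -> stp (runK (trace k)) = k.
Proof.
elim: k => // k IH; rewrite runS; have [r _|r] := boolP (runningK (runK (trace k))).
  have -> : stp (updateK (runK (trace k)) (x k.+1)) = (stp (runK (trace k))).+1.
    by rewrite /update r /=; case: ifP => //; case: ifP => //; case: ifP.
  by rewrite IH.
by rewrite /update r /= (negbTE r).
Qed.

Lemma run_trace_ind (I : state R -> Prop) : I init ->
  (forall k, I (runK (trace k)) -> runningK (runK (trace k)) ->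
     stp (runK (trace k)) = k -> I (updateK (runK (trace k)) (x k.+1))) ->
  forall k, I (runK (trace k)).
Proof.
move=> I0 IS; elim=> // k Ik; rewrite runS.
have [r|r] := boolP (runningK (runK (trace k))).
  by apply: IS => //; exact: stp_run.
by rewrite /update r.
Qed.

Definition path_clock k : R := \sum_(0 <= m < k) (a (x m))^-1.

Lemma path_clockS k : path_clock k.+1 = path_clock k + (a (x k))^-1.
Proof. by rewrite /path_clock big_nat_recr. Qed.

Definition bdy (st : state R) i := nth (0%N, 0) ((0%N, 0) :: bnd st) i.

Definition inv1 (st : state R) := [/\ pos st = x (stp st), clk st = path_clock (stp st),
  size (bnd st) = (size (smp st)).-1, (0 < size (smp st))%N &
  forall m, (m < stp st)%N -> `|z (x m)| <= ell].

Lemma inv1_run k : inv1 (runK (trace k)).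
Proof.
apply: run_trace_ind => [|{}k].
  by split => //=; rewrite /path_clock big_geq.
set st := runK _ => -[i1 i2 i3 i4 i5] r sk.
have clkE : clk st + (a (pos st))^-1 = path_clock (stp st).+1 by rewrite path_clockS i2 i1.
have rng m : (m < (stp st).+1)%N -> `|z (x m)| <= ell.
  rewrite ltnS leq_eqVlt => /orP[/eqP ->|]; last exact: i5.
  by rewrite -i1; case/andP: r.
have xk : x k.+1 = x (stp st).+1 by rewrite sk.
rewrite /update r /=; case: ifP => _; first by split.
by case: ifP => _; [split => //=; rewrite !size_rcons ?i3 ?prednK|case: ifP => _; split].
Qed.

Definition inv2 (st : state R) := (phs st < 2)%N -> [/\
  forall i, (i < size (smp st))%N -> `|z (nth n (smp st) i)| <= ell,
  forall i, (i < size (smp st))%N -> (bdy st i).2 = path_clock (bdy st i).1,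
  forall i, (i.+1 < size (smp st))%N -> ((bdy st i).1 < (bdy st i.+1).1)%N,
  ((bdy st (size (smp st)).-1).1 <= stp st)%N &
  phs st == 1%N ->
    [/\ ((bdy st (size (smp st)).-1).1 < (ext st).1 <= stp st)%N,
        (ext st).2 = path_clock (ext st).1 &
        (size (smp st)).-1%:R * h <= (ext st).2 <= (size (smp st))%:R * h]].

Lemma nth_bdy_rcons st s t k u b q rf e m i : (i <= size (bnd st))%N ->
  bdy (St s t k u (rcons (bnd st) b) q rf e m) i = bdy st i.
Proof. by move=> ik; rewrite /bdy /= -rcons_cons nth_rcons /= ltnS ik. Qed.

Lemma nth_bdy_last st s t k u b q rf e m :
  bdy (St s t k u (rcons (bnd st) b) q rf e m) (size (bnd st)).+1 = b.
Proof. by rewrite /bdy /= nth_rcons ltnn eqxx. Qed.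

Lemma inv2_run k : inv2 (runK (trace k)).
Proof.
apply: run_trace_ind => [|{}k].
  move=> _; split => //=.
  - by case => //= _; rewrite /logjump subrr normr0 ltW.
  - by case => //= _; rewrite /path_clock big_geq.
set st := runK _ => IH r sk.
have [i1 i2 i3 i4 i5] := inv1_run k; rewrite -/st in i1 i2 i3 i4 i5.
have [j1 /(_ r) j2 j3 j4 j5] := inv0_run K eta a_gt0 h_gt0 o_ge0 o_lt_h ss (trace k); rewrite -/st in j1 j2 j3 j4 j5.
have clkE : clk st + (a (pos st))^-1 = path_clock (stp st).+1 by rewrite path_clockS i2 i1.
have a0 : 0 < (a (pos st))^-1 by rewrite invr_gt0.
have ph2 : (phs (updateK st (x k.+1)) < 2)%N -> (phs st < 2)%N.
  rewrite /update r /=; case: ifP => // _; case: ifP => _ /=; last first.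
    by case: ifP => //= _; case: (phs st) => [|[|q]].
  by case: (phs st) => [|[|q]].
move=> ph; have {IH} [b1 b2 b3 b4 b5] := IH (ph2 ph).
move: ph; rewrite /update r /=; case: ifPn => f1 /=; first by move=> ph; split => //= [|ph1]; [exact: leqW|have [/andP[c1 c2] c3 c4] := b5 ph1; split => //; rewrite c1 leqW].
case: ifPn => cr /=.
  pose here := if phs st == 0%N then ((stp st).+1, clk st + (a (pos st))^-1) else ext st.
  rewrite -/here => ph.
  have phl : (phs st < 2)%N by apply: ph2; rewrite /update r /= (negbTE f1) cr.
  have hereP : [/\ ((bdy st (size (smp st)).-1).1 < here.1 <= (stp st).+1)%N & here.2 = path_clock here.1].
    rewrite /here; case: ifPn => ph0 /=; first by rewrite ltnS b4 clkE leqnn.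
    have ph1 : phs st == 1%N by move: ph0 phl; case: (phs st) => [|[|q]].
    by have [/andP[c1 c2] c3 c4] := b5 ph1; rewrite c1 leqW.
  have [/andP[h1 h2] h3] := hereP.
  have szb : size (smp st) = (size (bnd st)).+1 by rewrite i3 prednK.
  split => /=; rewrite ?size_rcons.
  - move=> i; rewrite ltnS nth_rcons => ik; case: ltnP => ik2; first exact: b1.
    have -> : i = size (smp st) by apply/eqP; rewrite eqn_leq ik.
    by rewrite eqxx leNgt.
  - move=> i; rewrite ltnS => ik; have [ik2|ik2] := leqP i (size (bnd st)).
      by rewrite nth_bdy_rcons //; apply: b2; rewrite szb ltnS.
    have -> : i = (size (bnd st)).+1 by apply/eqP; rewrite eqn_leq ik2 -szb ik.
    by rewrite nth_bdy_last.
  - move=> i; rewrite ltnS => ik.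
    have ik' : (i <= size (bnd st))%N by rewrite -ltnS -szb.
    rewrite nth_bdy_rcons //; have [ik2|ik2] := leqP i.+1 (size (bnd st)).
      by rewrite nth_bdy_rcons //; apply: b3; rewrite szb ltnS.
    have -> : i = size (bnd st) by apply/eqP; rewrite eqn_leq ik'.
    by rewrite nth_bdy_last; move: h1; rewrite szb.
  - by rewrite szb nth_bdy_last.
  - by move: ph; case: (phs st) => [|[|q]] //=; case: (far _ _ _ _).
rewrite -ltNge in cr; case: ifPn => fr /= ph; last first.
  by split => //= [|ph1]; [exact: leqW|have [/andP[c1 c2] c3 c4] := b5 ph1; split => //; rewrite c1 leqW].
split => //=; first exact: leqW.
move=> _; have ph0 : phs st == 0%N by move: ph; case: (phs st).
rewrite ph0 /=; split => //; first by rewrite ltnS b4 leqnn.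
by apply/andP; split; [apply: le_trans j1 _; rewrite lerDl ltW|exact: ltW].
Qed.

Definition dev (st : state R) := \sum_(0 <= i < size (smp st)) `|(bdy st i).2 - i%:R * h|.

(** A boundary at the end of its cell is late by at most [o]; one moved back to an exit deviates by
    at most [h]. The term in [phs st == 1] is the amount reserved by an exit until its boundary is
    recorded. *)
Lemma dev_run k : let st := runK (trace k) in (phs st < 2)%N ->
  dev st + (phs st == 1%N)%:R * (h + o) <= (nex st)%:R * (h + o) + (size (smp st)).-1%:R * o.
Proof.
apply: (run_trace_ind (I := fun st => (phs st < 2)%N ->
  dev st + (phs st == 1%N)%:R * (h + o) <= (nex st)%:R * (h + o) + (size (smp st)).-1%:R * o)) => [|{}k].
  by move=> _; rewrite /dev /= big_nat1 /= !mul0r subrr normr0 addr0.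
set st := runK _ => IH r sk.
have [i1 i2 i3 i4 i5] := inv1_run k; rewrite -/st in i1 i2 i3 i4 i5.
have [j1 /(_ r) j2 j3 j4 j5] := inv0_run K eta a_gt0 h_gt0 o_ge0 o_lt_h ss (trace k); rewrite -/st in j1 j2 j3 j4 j5.
have a0 : 0 < (a (pos st))^-1 by rewrite invr_gt0.
have ao : (a (pos st))^-1 <= o by have [] := ss (x := pos st) _ => //; case/andP: r.
have ph2 : (phs (updateK st (x k.+1)) < 2)%N -> (phs st < 2)%N.
  rewrite /update r /=; case: ifP => // _; case: ifP => _ /=; last first.
    by case: ifP => //= _; case: (phs st) => [|[|q]].
  by case: (phs st) => [|[|q]].
move=> ph; have {}IH := IH (ph2 ph); have phl := ph2 ph.
have [_ _ _ _ b5] := inv2_run phl; rewrite -/st in b5.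
have szb : size (smp st) = (size (bnd st)).+1 by rewrite i3 prednK.
move: ph; rewrite /update r /=; case: ifPn => f1 //=.
case: ifPn => cr /=.
  pose here := if phs st == 0%N then ((stp st).+1, clk st + (a (pos st))^-1) else ext st.
  rewrite -/here => ph.
  rewrite /dev /= size_rcons big_nat_recr //= {2}szb nth_bdy_last.
  rewrite (eq_big_nat _ _ (F2 := fun i => `|(bdy st i).2 - i%:R * h|)); last first.
    by move=> i /andP[_ ik]; rewrite nth_bdy_rcons // -ltnS -szb.
  rewrite -/(dev st).
  have sE : (size (smp st))%:R * o = (size (smp st)).-1%:R * o + o.
    by rewrite -{1}(prednK i4) -natr1 mulrDl mul1r.
  move: phl IH b5 ph; rewrite {}/here sE; case: (phs st) => [|[|q]] //= _ IH b5.
    move=> _; rewrite mul0r addr0 in IH *; rewrite ger0_norm ?subr_ge0 //.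
    by move: IH j2 ao; set u := dev st; lra.
  case: (far _ _ _ _) => //= _.
  have [_ _ /andP[c1 c2]] := b5 isT.
  have : `|(ext st).2 - (size (smp st))%:R * h| <= h.
    rewrite distrC ger0_norm ?subr_ge0 //.
    by move: c1; rewrite -{1}(prednK i4) /= -{2}(prednK i4) -natr1 mulrDl mul1r; lra.
  by rewrite mul1r in IH; rewrite mul0r addr0; move: IH o_ge0; set u := dev st; lra.
case: ifPn => fr //= ph.
rewrite /dev /= -/(dev st).
have ph0 : phs st == 0%N by move: ph; case: (phs st).
move: IH; rewrite (eqP ph0) (_ : (0%N == 1%N)%:R = 0 :> R) //.
rewrite (_ : ((if 0%N == 0%N then 1%N else 2%N) == 1%N)%:R = 1 :> R) //.
rewrite (_ : (nex st + (0%N == 0%N))%:R = (nex st)%:R + 1 :> R); last by rewrite addn1 natr1.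
rewrite mul0r [(_ + 1) * _]mulrDl !mul1r /dev /=.
by set u := \sum_(_ <= _ < _) _; rewrite /bdy /=; lra.
Qed.

(** The distance [2 * eta] comes from the positions between an exit and the end of its cell: they
    and the next sample are all within [eta] of the exit position. *)
Definition inv3 (st : state R) := (phs st < 2)%N -> [/\
  forall i m, (i.+1 < size (smp st))%N -> ((bdy st i).1 <= m < (bdy st i.+1).1)%N ->
    `|z (x m) - z (nth n (smp st) i)| <= 2 * eta,
  phs st == 0%N -> ref st = nth n (smp st) (size (smp st)).-1 /\
    forall m, ((bdy st (size (smp st)).-1).1 <= m <= stp st)%N -> `|z (x m)| <= ell ->
    `|z (x m) - z (nth n (smp st) (size (smp st)).-1)| <= 2 * eta &
  phs st == 1%N -> 
    (forall m, ((bdy st (size (smp st)).-1).1 <= m < (ext st).1)%N ->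
      `|z (x m) - z (nth n (smp st) (size (smp st)).-1)| <= 2 * eta) /\
    (forall m, ((ext st).1 <= m <= stp st)%N -> `|z (x m)| <= ell ->
      `|z (x m) - z (ref st)| <= eta)].

Lemma inv3_run k : inv3 (runK (trace k)).
Proof.
have e20 : 0 <= 2 * eta by rewrite mulr_ge0 // ltW.
apply: run_trace_ind => [|{}k].
  by move=> _; split => //= _; split => // m; rewrite leqn0 => /eqP ->; rewrite x0 subrr normr0.
set st := runK _ => IH r sk.
have [i1 i2 i3 i4 i5] := inv1_run k; rewrite -/st in i1 i2 i3 i4 i5.
have ph2 : (phs (updateK st (x k.+1)) < 2)%N -> (phs st < 2)%N.
  rewrite /update r /=; case: ifP => // _; case: ifP => _ /=; last first.
    by case: ifP => //= _; case: (phs st) => [|[|q]].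
  by case: (phs st) => [|[|q]].
move=> ph; have {IH} [b1 b2 b3] := IH (ph2 ph); have phl := ph2 ph.
have [_ _ _ b4 b5] := inv2_run phl; rewrite -/st in b4 b5.
have szb : size (smp st) = (size (bnd st)).+1 by rewrite i3 prednK.
have rng m : (m <= stp st)%N -> `|z (x m)| <= ell.
  by rewrite leq_eqVlt => /orP[/eqP ->|]; [rewrite -i1; case/andP: r|exact: i5].
have xk : x k.+1 = x (stp st).+1 by rewrite sk.
move: ph; rewrite /update r /=; case: ifPn => f1 /=.
  have out m : (m <= (stp st).+1)%N -> `|z (x m)| <= ell -> (m <= stp st)%N.
    rewrite leq_eqVlt => /orP[/eqP ->|//]; by rewrite -xk leNgt f1.
  move=> _; split => //=.
    move=> ph0; have [c1 c2] := b2 ph0; split => // m /andP[m1 m2] zm.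
    by apply: c2 => //; rewrite m1 /=; exact: out.
  move=> ph1; have [c1 c2] := b3 ph1; split => // m /andP[m1 m2] zm.
  by apply: c2 => //; rewrite m1 /=; exact: out.
case: ifPn => cr /=.
  pose here := if phs st == 0%N then ((stp st).+1, clk st + (a (pos st))^-1) else ext st.
  rewrite -/here => ph.
  have blk m : ((bdy st (size (smp st)).-1).1 <= m < here.1)%N ->
      `|z (x m) - z (nth n (smp st) (size (smp st)).-1)| <= 2 * eta.
    rewrite /here; case: ifPn => ph0 /=.
      by rewrite ltnS => /andP[m1 m2]; have [_] := b2 ph0; apply; rewrite ?m1 ?m2 //; exact: rng.
    have ph1 : phs st == 1%N by move: ph0 phl; case: (phs st) => [|[|q]].
    by have [c1 c2] := b3 ph1; exact: c1.
  split => /=; rewrite ?size_rcons.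
  - move=> i m; rewrite ltnS => ik.
    have ik' : (i <= size (bnd st))%N by rewrite -ltnS -szb.
    rewrite nth_bdy_rcons // nth_rcons ik; have [ik2|ik2] := leqP i.+1 (size (bnd st)).
      by rewrite nth_bdy_rcons //; apply: b1; rewrite szb ltnS.
    have -> : i = size (bnd st) by apply/eqP; rewrite eqn_leq ik'.
    by rewrite nth_bdy_last; move: blk; rewrite szb; apply.
  - move=> ph0; rewrite /= nth_rcons ltnn eqxx; split => //.
    rewrite {1}szb nth_bdy_last => m /andP[m1 m2] zm.
    move: m2; rewrite leq_eqVlt ltnS => /orP[/eqP ->|m2]; first by rewrite -xk subrr normr0.
    move: m1 ph0; rewrite /here; case: (phs st) (b3) => [_ /= m1|[|q] // b3']; first by rewrite ltnNge m2 in m1.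
    move=> /= m1; case: ifPn => // nf _.
    have [_ c2] := b3' isT.
    have d1 : `|z (x m) - z (ref st)| <= eta by apply: c2; rewrite ?m1.
    move: nf; rewrite /far -leNgt distrC => nf.
    rewrite (_ : z (x m) - z (x k.+1) = (z (x m) - z (ref st)) + (z (ref st) - z (x k.+1))); last by ring.
    by apply: le_trans (ler_normD _ _) _; move: d1 nf; lra.
  - by move=> ph1; move: ph1 ph; case: (phs st) => [|[|q]] //=; case: ifP.
case: ifPn => fr /= ph.
  have ph0 : phs st == 0%N by move: ph; case: (phs st).
  rewrite ph0 /=; split => //= _; split => m; last first.
    by rewrite -eqn_leq => /eqP <- _; rewrite -xk subrr normr0 ltW.
  rewrite ltnS => /andP[m1 m2]; have [_] := b2 ph0; apply; rewrite ?m1 ?m2 //; exact: rng.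
move: fr; rewrite /far -leNgt => fr.
split => //=.
  move=> ph0; have [c1 c2] := b2 ph0; split => // m /andP[m1]; rewrite leq_eqVlt ltnS => /orP[/eqP -> _|m2].
    by rewrite -xk -c1; apply: le_trans fr _; move: eta_gt0; lra.
  by apply: c2; rewrite m1.
move=> ph1; have [c1 c2] := b3 ph1; split => // m /andP[m1].
rewrite leq_eqVlt ltnS => /orP[/eqP -> _|m2]; first by rewrite -xk.
by apply: c2; rewrite m1.
Qed.

Variables (gamma kap e : R).
Hypothesis gamma_gt0 : 0 < gamma.
Hypothesis kap_ge0 : 0 <= kap.
Hypothesis e_gt0 : 0 < e.
Hypothesis rate : forall i j, `|z i| <= ell -> `|z j| <= ell -> `|z i - z j| <= 2 * eta ->
  `|a i / a n - expR (gamma * z j)| <= kap * expR (gamma * z j).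
Hypothesis value : forall i j, `|z i| <= ell -> `|z j| <= ell -> `|z i - z j| <= 2 * eta ->
  `|i%:R / n%:R - expR (z j)| <= e.

(** In real time every step lasts $1/a_n$, in the exploration $1/a_x$. Throughout a block the ratio
    $a_x/a_n$ is within a relative error [kap] of the rate at the sample, so [clock_compare] places
    the real times of the boundaries near [step_clock], and [close_blocks] concludes. *)
Lemma chain_close k : let st := runK (trace k) in
  size (smp st) = K.+1 -> (phs st < 2)%N ->
  expR (gamma * ell) * (kap * (K%:R * h + o) + 2 * ((nex st)%:R * (h + o) + K%:R * o)) <= e ->
  e^-1 < step_clock gamma h (zsmp n st) K ->
  close_paths e (fun t => (x (Num.truncn (a n * t)))%:R / n%:R) (lamperti_step gamma h K (zsmp n st)).
Proof.
move=> st sK ph hD eK.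
have [i1 i2 i3 i4 i5] := inv1_run k; rewrite -/st in i1 i2 i3 i4 i5.
have [_ _ j3 _ _] := inv0_run K eta a_gt0 h_gt0 o_ge0 o_lt_h ss (trace k); rewrite -/st in j3.
have [b1 b2 b3 b4 _] := inv2_run ph; rewrite -/st in b1 b2 b3 b4.
have [c1 _ _] := inv3_run ph; rewrite -/st in c1.
rewrite sK /= in b1 b2 b3 b4 c1.
pose B i := (bdy st i).1.
have Bm i : (i < K)%N -> (B i < B i.+1)%N by move=> iK; apply: b3; rewrite ltnS.
have BK i : (i <= K)%N -> (B i <= stp st)%N.
  move=> iK; apply: leq_trans b4; have := @incr_le R (fun i => (B i)%:R) K.
  move=> /(_ _ i K iK (leqnn _)); rewrite ler_nat; apply => j jK.
  by rewrite ltr_nat; exact: Bm.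
have blk i m : (i < K)%N -> (B i <= m < B i.+1)%N ->
    [/\ `|z (x m)| <= ell, `|zsmp n st i| <= ell & `|z (x m) - zsmp n st i| <= 2 * eta].
  move=> iK mB; split.
  - by apply: i5; case/andP: mB => _ mB; apply: leq_trans mB _; exact: BK.
  - by apply: b1; exact: leqW.
  - by apply: c1 => //; rewrite ltnS.
pose u i := path_clock (B i).
have uE i : (i <= K)%N -> u i = (bdy st i).2 by move=> iK; rewrite b2.
have u0 : u 0%N = 0 by rewrite /u /B /bdy /= /path_clock big_geq.
pose c i : R := (B i)%:R / a n.
have split_sum (f : nat -> R) i : (i < K)%N ->
    \sum_(0 <= m < B i.+1) f m - \sum_(0 <= m < B i) f m = \sum_(B i <= m < B i.+1) f m.
  by move=> iK; rewrite (big_cat_nat (leq0n (B i)) (ltnW (Bm _ iK))) /= addrAC subrr add0r.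
have du i : (i < K)%N -> u i.+1 - u i = \sum_(B i <= m < B i.+1) (a (x m))^-1 by exact: split_sum.
have um i : (i < K)%N -> u i <= u i.+1.
  by move=> iK; rewrite -subr_ge0 du // sumr_ge0 // => m _; rewrite invr_ge0 ltW.
have dc i : (i < K)%N -> c i.+1 - c i = \sum_(B i <= m < B i.+1) (a n)^-1.
  move=> iK; rewrite /c -mulrBl -natrB ?(ltnW (Bm _ iK)) //.
  by rewrite sumr_const_nat mulr_natl.
have cm i : (i < K)%N -> c i < c i.+1 by move=> iK; rewrite /c ltr_pM2r ?invr_gt0 // ltr_nat Bm.
have c0 : c 0%N = 0 by rewrite /c /B /bdy /= mul0r.
have rel i : (i < K)%N -> `|c i.+1 - c i - expR (gamma * zsmp n st i) * (u i.+1 - u i)| <=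
    kap * (expR (gamma * zsmp n st i) * (u i.+1 - u i)).
  move=> iK; rewrite dc // du // !mulr_sumr -sumrB.
  apply: le_trans (ler_norm_sum _ _ _) _.
  rewrite big_nat [leRHS]big_nat; apply: ler_sum => m mB.
  have [h1 h2 h3] := blk i m iK mB.
  have := rate h1 h2 h3; rewrite -/(zsmp n st i).
  rewrite (_ : (a n)^-1 - _ = (a (x m) / a n - expR (gamma * zsmp n st i)) * (a (x m))^-1); last first.
    by rewrite mulrBl mulrAC divff ?mul1r // gt_eqF.
  have am0 : 0 <= (a (x m))^-1 by rewrite invr_ge0 ltW.
  by move=> hh; rewrite normrM (ger0_norm am0) mulrA; exact: ler_wpM2r.
have rmx i : (i < K)%N -> 0 <= expR (gamma * zsmp n st i) <= expR (gamma * ell).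
  move=> iK; rewrite expR_ge0 ler_expR ler_pM2l //.
  by apply: le_trans (ler_norm _) _; apply: b1; exact: leqW.
have devE : \sum_(0 <= i < K.+1) `|u i - i%:R * h| <= (nex st)%:R * (h + o) + K%:R * o.
  have := dev_run ph; rewrite -/st /dev sK /=.
  rewrite (eq_big_nat _ _ (F2 := fun i => `|u i - i%:R * h|)); last first.
    by move=> i /andP[_ iK]; rewrite uE // -ltnS.
  have : 0 <= (phs st == 1%N)%:R * (h + o) by rewrite mulr_ge0 ?addr_ge0 // ltW.
  by set p1 := _ * (h + o); lra.
have uK : u K <= K%:R * h + o.
  apply: le_trans j3; rewrite i2 /u /path_clock; apply: sum_widen; last exact: BK.
  by move=> i; rewrite invr_ge0 ltW.
have cc i : (i <= K)%N -> `|c i - step_clock gamma h (zsmp n st) i| <= e.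
  move=> iK; have := clock_compare kap_ge0 (expR_ge0 _) u0 c0 um rmx rel devE iK.
  move=> hh; apply: le_trans hh _; apply: le_trans hD; rewrite ler_wpM2l ?expR_ge0 //.
  by rewrite lerD2r ler_wpM2l.
apply: (@close_blocks _ K c (step_clock gamma h (zsmp n st))) => //.
- exact: step_clock0.
- by move=> j _; exact: step_clock_lt.
move=> j t t' jK /andP[t1 t2] t'c.
rewrite /lamperti_step (step_pathE _ _ jK t'c); last by move=> i _; exact: step_clock_lt.
have an0 := a_gt0 n.
have Bj : (B j <= Num.truncn (a n * t) < B j.+1)%N.
  move: t1 t2; rewrite /c ler_pdivrMr // ltr_pdivlMr // mulrC => t1 t2.
  have at0 : 0 <= a n * t by apply: le_trans t1; rewrite ler0n.
  by rewrite truncn_ge_nat // t1 /= truncn_lt_nat // mulrC.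
have [h1 h2 h3] := blk j _ jK Bj.
exact: value.
Qed.

End ChainPath.

(** * Increments of the Levy process *)

Lemma Ex_finite d (T : measurableType d) (R : realType) (P : probability T R)
    (I : finType) (g : T -> I) (f : I -> R) :
  (forall i, measurable [set x | g x = i]) ->
  bounded_mfun (fun x => f (g x)) /\
  Ex P (fun x => f (g x)) = \sum_i f i * fine (P [set x | g x = i]).
Proof.
move=> mg.
have E x : f (g x) = \sum_i f i * \1_[set x | g x = i] x.
  rewrite (bigD1 (g x)) //= indicE mem_set // mulr1 big1 ?addr0 // => i ig.
  by rewrite indicE memNset ?mulr0 //= => gi; rewrite gi eqxx in ig.
have bi i : bounded_mfun (fun x => f i * \1_[set x | g x = i] x).
  by apply: bmfunZ; exact: bmfun_indic.
have -> : (fun x => f (g x)) = (fun x => \sum_i f i * \1_[set x | g x = i] x) by apply/funext.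
split; first exact: bmfun_sum.
rewrite Ex_sum //; apply: eq_bigr => i _.
by rewrite ExZ ?Ex_indic //; exact: bmfun_indic.
Qed.

Section Functionals.
Context {R : realType}.

(* bounded functionals of the first [K] terms of a sequence, continuous for
   termwise convergence *)
Definition cfun K (g : (nat -> R) -> R) := [/\
  forall x y, (forall i, (i < K)%N -> x i = y i) -> g x = g y,
  exists M, forall x, `|g x| <= M &
  forall (xs : nat -> nat -> R) x, (forall i, (i < K)%N -> xs ^~ i @ \oo --> x i) ->
    (fun m => g (xs m)) @ \oo --> g x].

(** Rounding to the points $k/m-m$ of $[-m,m]$, with only finitely many values. *)
Definition grid m (x : R) : nat := minn (Num.truncn ((x + m%:R) * m%:R)) (2 * m * m).
Definition gval m k : R := k%:R / m%:R - m%:R.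

Lemma grid_cvg (x : R) : (fun m => gval m (grid m x)) @ \oo --> x.
Proof.
apply/cvgrPdist_le => e e0; near=> m.
have em : e^-1 <= m%:R by near: m; exact: nbhs_infty_ger.
have xm : `|x| <= m%:R by near: m; exact: nbhs_infty_ger.
have m0 : 0 < (m%:R : R) by rewrite ltr0n; near: m; exact: nbhs_infty_gt.
have me : m%:R^-1 <= e by rewrite invf_ple // posrE.
have x2 : x <= m%:R by exact: le_trans (ler_norm _) xm.
have x1 : 0 <= x + m%:R.
  by rewrite -lerBlDr sub0r lerNl; apply: le_trans xm; rewrite -normrN ler_norm.
have y0 : 0 <= (x + m%:R) * m%:R by rewrite mulr_ge0 // ltW.
have y1 : (Num.truncn ((x + m%:R) * m%:R) <= 2 * m * m)%N.
  rewrite -(ler_nat R) (@le_trans _ _ ((x + m%:R) * m%:R)) ?truncn_le // natrM; apply: ler_wpM2r; [exact: ltW|rewrite natrM; lra].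
rewrite /grid /gval (minn_idPl y1).
have /andP[t1 t2] := truncn_itv y0.
move: me t1 t2; set k := (Num.truncn _)%:R; rewrite -natr1 -/k => me t1 t2.
rewrite (_ : x - _ = ((x + m%:R) * m%:R - k) / m%:R); last first.
  by rewrite mulrBl mulfK ?gt_eqF //; ring.
have im0 : 0 <= (m%:R : R)^-1 by rewrite invr_ge0 ltW.
rewrite normrM (ger0_norm im0); apply: le_trans me.
by rewrite ger0_norm ?subr_ge0 // ler_piMl //; lra.
Unshelve. all: by end_near. Qed.

Lemma measurable_grid m k : measurable [set x : R | grid m x = k].
Proof.
pose f j : R := (minn j (2 * m * m) == k)%:R.
have mf : measurable_fun setT (fun x : R => f (Num.truncn ((x + m%:R) * m%:R))).
  apply: (measurableT_comp (measurable_truncn_fct f m%:R)).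
  exact: measurable_funD.
rewrite (_ : [set x | _] = [set x | f (Num.truncn ((x + m%:R) * m%:R)) = 1]).
  have := mf measurableT [set 1] (measurable_set1 _); rewrite setTI.
  by congr (measurable _); apply/seteqP.
apply/seteqP; split => x /=; rewrite /f /grid; first by move=> ->; rewrite eqxx.
by case: eqP => // _ /eqP; rewrite eq_sym oner_eq0.
Qed.

Lemma cfun_cst K c : cfun K (fun=> c : R).
Proof. by split => //; [by exists `|c| |by move=> *; exact: cvg_cst]. Qed.

Lemma cfunM K g1 g2 : cfun K g1 -> cfun K g2 -> cfun K (fun x => g1 x * g2 x).
Proof.
move=> [a1 [M1 b1] c1] [a2 [M2 b2] c2]; split.
- by move=> x y xy; rewrite (a1 _ _ xy) (a2 _ _ xy).
- by exists (M1 * M2) => x; rewrite normrM ler_pM.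
- by move=> xs x xx; apply: cvgM; [exact: c1|exact: c2].
Qed.

Lemma cfun_coord K i (f : R -> R) M : (i < K)%N -> continuous f -> (forall x, `|f x| <= M) ->
  cfun K (fun x => f (x i)).
Proof.
move=> iK cf fM; split.
- by move=> x y ->.
- by exists M.
- by move=> xs x xx; apply: (cvg_comp _ _ (xx _ iK)); exact: cf.
Qed.

Lemma cfun_leq K K' g : (K <= K')%N -> cfun K g -> cfun K' g.
Proof.
move=> KK [a1 b1 c1]; split => //.
- by move=> x y xy; apply: a1 => i iK; apply: xy; exact: leq_trans KK.
- by move=> xs x xx; apply: c1 => i iK; apply: xx; exact: leq_trans KK.
Qed.

End Functionals.

(** * Independence of the increments for continuous functionals *)

Section Increments.
Context (R : realType) d (Om : measurableType d) (Q : probability Om R).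
Variables (xi : R -> Om -> R).
Hypothesis xi_meas : forall t, measurable_fun setT (xi t).
Hypothesis xi_ind : forall (k : nat) (t : nat -> R) (B : nat -> set R),
     0 <= t 0%N -> (forall j, (j < k)%N -> t j < t j.+1) ->
     (forall j, measurable (B j)) ->
     fine (Q [set om | forall j, (j < k)%N -> xi (t j.+1) om - xi (t j) om \in B j])
     = \prod_(j < k) fine (Q [set om | xi (t j.+1) om - xi (t j) om \in B j]).
Hypothesis xi_stat : forall s t (B : set R), 0 <= s -> 0 <= t -> measurable B ->
     Q [set om | xi (t + s) om - xi t om \in B] = Q [set om | xi s om \in B].

Variable h : R.
Hypothesis h_gt0 : 0 < h.

Definition incr j om i := xi ((j + i.+1)%:R * h) om - xi ((j + i)%:R * h) om.

Let evt j K (B : nat -> set R) := [set om | forall i, (i < K)%N -> incr j om i \in B i].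

Let measurable_evt j K B : (forall i, measurable (B i)) -> measurable (evt j K B).
Proof.
move=> mB; rewrite (_ : evt j K B = \bigcap_(i in [set i | (i < K)%N])
    ((fun om => incr j om i) @^-1` B i)).
  apply: bigcap_measurableType => i _; rewrite -[X in measurable X]setTI.
  by apply: measurable_funB => //; exact: measurable_funB.
apply/seteqP; split => om /= H i iK; last by apply/mem_set; exact: H.
by have := H i iK; rewrite inE.
Qed.

Let evt_prob j K B : (forall i, measurable (B i)) ->
  fine (Q (evt j K B)) = \prod_(i < K) fine (Q [set om | xi h om \in B i]).
Proof.
move=> mB; rewrite (xi_ind (t := fun i => (j + i)%:R * h)) //.
- apply: eq_bigr => i _; rewrite -(xi_stat (ltW h_gt0) (t := (j + i)%:R * h)) //.
    by rewrite addnS -natr1 mulrDl mul1r.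
  by rewrite mulr_ge0 // ltW.
- by rewrite mulr_ge0 // ltW.
- by move=> i _; rewrite ltr_pM2r // ltr_nat addnS.
Qed.

Let evt_joint j K B C : (forall i, measurable (B i)) -> (forall i, measurable (C i)) ->
  fine (Q (evt 0 j B `&` evt j K C)) = fine (Q (evt 0 j B)) * fine (Q (evt 0 K C)).
Proof.
move=> mB mC; pose D i := if (i < j)%N then B i else C (i - j)%N.
have mD i : measurable (D i) by rewrite /D; case: ifP.
rewrite (_ : _ `&` _ = evt 0 (j + K) D).
  rewrite !evt_prob // big_split_ord /=; congr (_ * _); apply: eq_bigr => i _.
    by rewrite /D ltn_ord.
  by rewrite /D ltnNge leq_addr /= addKn.
apply/seteqP; split => om /=.
  move=> [b c] i ij; rewrite /D; case: ltnP => ji; first exact: b.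
  have := c (i - j)%N; rewrite ltn_subLR // => /(_ ij).
  by rewrite /incr addnS subnKC // add0n.
move=> H; split => i iK.
  by have := H i (ltn_addr _ iK); rewrite /D iK.
have := H (j + i)%N; rewrite ltn_add2l => /(_ iK).
by rewrite /D ltnNge leq_addr /= addKn /incr !add0n addnS.
Qed.

Let cells m K := {ffun 'I_K -> 'I_(2 * m * m).+1}.
Let cell m j K om : cells m K := [ffun i : 'I_K => inord (grid m (incr j om i))].
Let box m K (c : cells m K) (i : nat) : set R :=
  if insub i is Some i' then [set x | grid m x = c i'] else setT.
Let corner m K (c : cells m K) (i : nat) : R :=
  if insub i is Some i' then gval m (c i') else 0.

Let cellE m j K (c : cells m K) : [set om | cell m j K om = c] = evt j K (box c).
Proof.
apply/seteqP; split => om /=.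
  move=> <- i iK; rewrite /box insubT inE /= ffunE inordK //.
  by rewrite ltnS /grid geq_minr.
move=> H; apply/ffunP => i; rewrite ffunE; apply: val_inj => /=.
have := H i (ltn_ord i); rewrite /box insubT ?ltn_ord // => iK; rewrite inE /= => gE.
rewrite inordK; last by rewrite ltnS /grid geq_minr.
by rewrite gE; congr (nat_of_ord (c _)); exact: val_inj.
Qed.

Let measurable_box m K (c : cells m K) i : measurable (box c i).
Proof. by rewrite /box; case: insub => // i'; exact: measurable_grid. Qed.

Let measurable_cell m j K (c : cells m K) : measurable [set om | cell m j K om = c].
Proof. by rewrite cellE; apply: measurable_evt; exact: measurable_box. Qed.

Let corner_cvg j K om i : (i < K)%N -> (fun m => corner (cell m j K om) i) @ \oo --> incr j om i.
Proof.
move=> iK; rewrite (_ : (fun m => _) = (fun m => gval m (grid m (incr j om i)))); first exact: grid_cvg.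
apply/funext => m; rewrite /corner insubT /= ffunE inordK //.
by rewrite ltnS /grid geq_minr.
Qed.

Lemma bmfun_incr j K g : cfun K g -> bounded_mfun (fun om => g (incr j om)).
Proof.
move=> [_ [M gM] gc].
apply: (bmfun_cvg (f_ := fun m om => g (corner (cell m j K om))) (M := M)) => //.
- by move=> m; have [[]] := Ex_finite Q (fun c => g (corner c)) (@measurable_cell m j K).
- by move=> om; apply: gc => i iK; exact: corner_cvg.
Qed.

(** Independence is known for product sets only. Rounding the increments to a finite grid turns the
    expectations into finite sums over boxes, where it applies, and dominated convergence removes
    the rounding. *)
Lemma Ex_past_future j K f g : cfun j f -> cfun K g ->
  Ex Q (fun om => f (incr 0 om) * g (incr j om)) =
  Ex Q (fun om => f (incr 0 om)) * Ex Q (fun om => g (incr 0 om)).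
Proof.
move=> [_ [M fM] fc] [_ [N gN] gc].
have ap m : Ex Q (fun om => f (corner (cell m 0 j om)) * g (corner (cell m j K om))) =
    Ex Q (fun om => f (corner (cell m 0 j om))) * Ex Q (fun om => g (corner (cell m 0 K om))).
  have mj (c : cells m j * cells m K) : [set om | (cell m 0 j om, cell m j K om) = c] =
      evt 0 j (box c.1) `&` evt j K (box c.2).
    by rewrite -!cellE; apply/seteqP; split => om /=; case: c => c1 c2 /=; [case|case => -> ->].
  have mm c : measurable [set om | (cell m 0 j om, cell m j K om) = c].
    by rewrite mj; apply: measurableI; apply: measurable_evt; exact: measurable_box.
  have [_ ->] := Ex_finite Q (fun c => f (corner c.1) * g (corner c.2)) mm.
  have [_ ->] := Ex_finite Q (fun c => f (corner c)) (@measurable_cell m 0 j).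
  have [_ ->] := Ex_finite Q (fun c => g (corner c)) (@measurable_cell m 0 K).
  rewrite mulr_suml; under [RHS]eq_bigr do rewrite mulr_sumr.
  rewrite pair_big /=; apply: eq_bigr => -[c1 c2] _ /=.
  rewrite mj evt_joint /=; try exact: measurable_box.
  by rewrite !cellE; ring.
have l1 : (fun m => Ex Q (fun om => f (corner (cell m 0 j om)) * g (corner (cell m j K om)))) @ \oo -->
    Ex Q (fun om => f (incr 0 om) * g (incr j om)).
  apply: (Ex_cvg (M := M * N)).
  - move=> m; apply: measurable_funM.
      by have [[]] := Ex_finite Q (fun c => f (corner c)) (@measurable_cell m 0 j).
    by have [[]] := Ex_finite Q (fun c => g (corner c)) (@measurable_cell m j K).
  - by move=> m x; rewrite normrM ler_pM.
  - by move=> om; apply: cvgM; [apply: fc|apply: gc] => i iK; exact: corner_cvg.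
have l2 : (fun m => Ex Q (fun om => f (corner (cell m 0 j om)))) @ \oo --> Ex Q (fun om => f (incr 0 om)).
  apply: (Ex_cvg (M := M)) => // [m|om].
    by have [[]] := Ex_finite Q (fun c => f (corner c)) (@measurable_cell m 0 j).
  by apply: fc => i iK; exact: corner_cvg.
have l3 : (fun m => Ex Q (fun om => g (corner (cell m 0 K om)))) @ \oo --> Ex Q (fun om => g (incr 0 om)).
  apply: (Ex_cvg (M := N)) => // [m|om].
    by have [[]] := Ex_finite Q (fun c => g (corner c)) (@measurable_cell m 0 K).
  by apply: gc => i iK; exact: corner_cvg.
rewrite -(cvg_lim _ l1) //; apply/cvg_lim => //.
by under eq_fun do rewrite ap; exact: cvgM l2 l3.
Qed.

Hypothesis xi0 : forall om, xi 0 om = 0.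

Lemma cfun_prod K (f : nat -> R -> R) M : (forall i, continuous (f i)) ->
  (forall i x, `|f i x| <= M) -> cfun K (fun x => \prod_(0 <= i < K) f i (x i)).
Proof.
move=> fc fM; elim: K => [|K IH].
  rewrite (_ : (fun x => _) = fun=> 1); first exact: cfun_cst.
  by apply/funext => x; rewrite big_geq.
rewrite (_ : (fun x => _) = fun x => (\prod_(0 <= i < K) f i (x i)) * f K (x K)).
  apply: cfunM; first exact: cfun_leq IH.
  exact: cfun_coord.
by apply/funext => x; rewrite big_nat_recr.
Qed.

Lemma Ex_prod_incr K (f : nat -> R -> R) M : (forall i, continuous (f i)) ->
  (forall i x, `|f i x| <= M) ->
  Ex Q (fun om => \prod_(0 <= i < K) f i (incr 0 om i)) =
  \prod_(0 <= i < K) Ex Q (fun om => f i (xi h om)).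
Proof.
move=> fc fM; elim: K => [|K IH].
  by rewrite big_geq // -[RHS](Ex_cst Q); apply: eq_Ex => om; rewrite big_geq.
rewrite big_nat_recr //= -IH.
have c1 := cfun_prod K fc fM.
have c2 : cfun 1 (fun x => f K (x 0%N)) by exact: cfun_coord.
transitivity (Ex Q (fun om => (\prod_(0 <= i < K) f i (incr 0 om i)) * f K (incr K om 0%N))).
  by apply: eq_Ex => om; rewrite big_nat_recr //= /incr !add0n addn0 addn1.
rewrite (Ex_past_future c1 c2); congr (_ * _); apply: eq_Ex => om.
by rewrite /incr !addn0 mul1r mul0r xi0 subr0.
Qed.

End Increments.

(** * Approximate backward equation *)

Lemma continuous_scale (R : realType) (g : R -> R) (lam : R) : continuous g ->
  continuous (fun x => g (lam * x)).
Proof.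
move=> cg x; apply: (@continuous_comp _ _ _ (fun x => lam * x) g); last exact: cg.
by apply: cvgM; [exact: cvg_cst|exact: cvg_id].
Qed.

Section Evolutions.
Context (R : realType) d (Om : measurableType d) (Q : probability Om R).
Variables (p : nat -> nat -> R) (a : nat -> R) (re im : R -> R) (xi : R -> Om -> R) (T : R).
Hypothesis p_ge0 : forall i j, 0 <= p i j.
Hypothesis p_sum1 : forall i, (0 < i)%N ->
  (fun m => \sum_(1 <= j < m) p i j) @ \oo --> (1 : R).
Hypothesis a_gt0 : forall n, 0 < a n.
Hypothesis a_cvgy : a n @[n --> \oo] --> +oo.
Hypothesis nu_re : forall lam, nu p a n (fun x => cos (lam * x) - 1) @[n --> \oo] --> re lam.
Hypothesis nu_im : forall lam, nu p a n (fun x => sin (lam * x)) @[n --> \oo] --> im lam.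
Hypothesis xi_meas : forall t, measurable_fun setT (xi t).
Hypothesis xi0 : forall om, xi 0 om = 0.
Hypothesis xi_cos : forall t lam, 0 <= t ->
  Ex Q (fun om => cos (lam * xi t om)) = expR (t * re lam) * cos (t * im lam).
Hypothesis xi_sin : forall t lam, 0 <= t ->
  Ex Q (fun om => sin (lam * xi t om)) = expR (t * re lam) * sin (t * im lam).
Hypothesis T_ge0 : 0 <= T.

(** [q] is the semigroup of $\xi$ applied to [f], continued to times down to $-1$ because the clock
    may overshoot the end of a cell. The last clause is the backward equation over one step of the
    chain, with an error $o(1/a_m)$ uniform in time and position. *)
Definition evolution (f : R -> R) (q : R -> R -> R) := [/\
  continuous f,
  forall s y, 0 <= s -> q s y = Ex Q (fun om => f (y + xi s om)),
  exists M, forall s y, -1 <= s <= T -> `|q s y| <= M,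
  exists2 L, 0 <= L & forall s s' y, -1 <= s <= T -> -1 <= s' <= T ->
    `|q s y - q s' y| <= L * `|s - s'| &
  forall e, 0 < e -> exists N, forall m, (N <= m)%N -> forall s y, 0 <= s <= T ->
    `|psum p m (fun k => q (s - (a m)^-1) (y + logjump m k)) - q s y| <= e / a m].

Lemma evolution0 f q : evolution f q -> forall x, q 0 x = f x.
Proof.
move=> [_ qE _ _ _] x; rewrite qE // -[RHS](Ex_cst Q); apply: eq_Ex => om.
by rewrite xi0 addr0.
Qed.

Lemma evolution_bmfun f q s y : evolution f q -> bounded_mfun (fun om => f (y + xi s om)).
Proof.
move=> ev; have := ev => -[cf _ [M qM] _ _]; apply: (bmfun_comp (M := M)).
- exact: continuous_measurable_fun.
- by move=> x; rewrite -(evolution0 ev) qM // T_ge0 andbT; lra.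
- exact: measurable_funD.
Qed.

Lemma near_inv_a (e : R) : 0 < e -> \forall m \near \oo, (0 < m)%N /\ (a m)^-1 <= e.
Proof.
move=> e0; near=> m; split; first by near: m; exists 1%N.
have : e^-1 <= a m by near: m; move/cvgryPge : a_cvgy; exact.
by move=> h; rewrite invf_ple ?posrE.
Unshelve. all: by end_near. Qed.

Lemma inv_a_le (e : R) : 0 < e -> exists N, forall m, (N <= m)%N -> (0 < m)%N /\ (a m)^-1 <= e.
Proof. by move=> /near_inv_a [N _ hN]; exists N => m Nm; exact: hN. Qed.

Lemma evolutionD f1 f2 q1 q2 : evolution f1 q1 -> evolution f2 q2 ->
  evolution (fun x => f1 x + f2 x) (fun s y => q1 s y + q2 s y).
Proof.
move=> e1 e2; have [c1 h1 [M1 b1] [L1 L10 l1] d1] := e1.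
have [c2 h2 [M2 b2] [L2 L20 l2] d2] := e2; split.
- by move=> x; apply: cvgD; [exact: c1|exact: c2].
- move=> s y s0; rewrite h1 // h2 // ExD //; [exact: (evolution_bmfun s y e1)|exact: (evolution_bmfun s y e2)].
- by exists (M1 + M2) => s y sr; rewrite (le_trans (ler_normD _ _)) // lerD ?b1 ?b2.
- exists (L1 + L2) => [|s s' y sr s'r]; first exact: addr_ge0.
  rewrite opprD addrACA mulrDl (le_trans (ler_normD _ _)) // lerD ?l1 ?l2 //.
- move=> e e0; have e20 : 0 < e / 2 by rewrite divr_gt0.
  have [N1 n1] := d1 _ e20; have [N2 n2] := d2 _ e20; have [N3 n3] := inv_a_le ltr01.
  exists (maxn N1 (maxn N2 N3)) => m; rewrite !geq_max => /and3P[m1 m2 m3] s y sr.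
  have [m0 am] := n3 m m3.
  have ai0 : 0 <= (a m)^-1 by rewrite invr_ge0 ltW.
  have sr' : -1 <= s - (a m)^-1 <= T.
    by have /andP[s0 sT] := sr; apply/andP; split; lra.
  rewrite (psumD p_ge0 p_sum1 m0 (fun k => b1 _ _ sr') (fun k => b2 _ _ sr')).
  rewrite opprD addrACA (le_trans (ler_normD _ _)) // (splitr e) mulrDl.
  by apply: lerD; [exact: n1|exact: n2].
Qed.

Lemma evolutionZ c f q : evolution f q -> evolution (fun x => c * f x) (fun s y => c * q s y).
Proof.
move=> ev; have [cf h1 [M b1] [L L0 l1] d1] := ev; split.
- by move=> x; apply: cvgM; [exact: cvg_cst|exact: cf].
- move=> s y s0; rewrite h1 // ExZ //; exact: (evolution_bmfun s y ev).
- by exists (`|c| * M) => s y sr; rewrite normrM ler_wpM2l ?b1.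
- exists (`|c| * L) => [|s s' y sr s'r]; first exact: mulr_ge0.
  by rewrite -mulrBr normrM -mulrA ler_wpM2l // l1.
- move=> e e0; have c1 : 0 < `|c| + 1 by rewrite ltr_wpDl.
  have e20 : 0 < e / (`|c| + 1) by rewrite divr_gt0.
  have [N1 n1] := d1 _ e20; have [N3 n3] := inv_a_le ltr01.
  exists (maxn N1 N3) => m; rewrite !geq_max => /andP[m1 m3] s y sr.
  have [m0 am] := n3 m m3.
  have ai0 : 0 <= (a m)^-1 by rewrite invr_ge0 ltW.
  have sr' : -1 <= s - (a m)^-1 <= T.
    by have /andP[s0 sT] := sr; apply/andP; split; lra.
  rewrite (psumZ p_ge0 p_sum1 _ m0 (fun k => b1 _ _ sr')) -mulrBr normrM.
  apply: (@le_trans _ _ ((`|c| + 1) * (e / (`|c| + 1) / a m))).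
    by apply: ler_pM => //; [rewrite lerDl|exact: n1].
  by rewrite mulrA mulrCA divff ?mulr1 // gt_eqF.
Qed.

(** A derivative at 0 read along the sequence $1/a_m\to0$. *)
Lemma lim_scale (f : R -> R) l C dl : 0 < dl ->
  (forall x, 0 <= x <= dl -> `|f x - l * x| <= C * x ^+ 2) ->
  a m * f (a m)^-1 @[m --> \oo] --> l.
Proof.
move=> dl0 h; apply/cvgrPdist_le => e e0.
have C0 : 0 < `|C| + 1 by rewrite ltr_wpDl.
have d0 : 0 < Num.min dl (e / (`|C| + 1)) by rewrite lt_min dl0 divr_gt0.
near=> m.
have [_] : (0 < m)%N /\ (a m)^-1 <= Num.min dl (e / (`|C| + 1)) by near: m; exact: near_inv_a.
rewrite le_min => /andP[a1 a2].
have am := a_gt0 m; have ai0 : 0 <= (a m)^-1 by rewrite invr_ge0 ltW.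
have := h (a m)^-1; rewrite ai0 a1 => /(_ isT) hh.
rewrite (_ : l - _ = a m * - (f (a m)^-1 - l * (a m)^-1)); last first.
  by rewrite opprB mulrBr mulrCA divff ?mulr1 // gt_eqF.
rewrite normrM normrN gtr0_norm // mulrC -ler_pdivlMr //; apply: (le_trans hh).
rewrite expr2 mulrA ler_wpM2r //; apply: (@le_trans _ _ ((`|C| + 1) * (a m)^-1)).
  by rewrite ler_wpM2r // (le_trans (ler_norm _)) // lerDl.
by rewrite mulrC -ler_pdivlMr.
Unshelve. all: by end_near. Qed.

Lemma expR_taylor (x : R) : `|x| <= 1 / 2 -> `|expR x - 1 - x| <= 2 * x ^+ 2.
Proof.
move=> xx; have /andP[x1 x2] : - (1 / 2) <= x <= 1 / 2 by rewrite -ler_norml.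
have h1 := expR_ge1Dx x; have h2 := expR_ge1Dx (- x).
have h3 : expR x * expR (- x) = 1 by rewrite -expRD subrr expR0.
have e0 := expR_gt0 x.
have h4 : expR x * (1 - x) <= 1 by apply: le_trans (ler_wpM2l (ltW e0) h2) _; rewrite h3.
by rewrite ger0_norm; [nra|lra].
Qed.

Lemma cos_taylor (x : R) : `|cos x - 1| <= x ^+ 2.
Proof.
have -> : cos x - 1 = - (2 * sin (x / 2) ^+ 2).
  by rewrite {1}(splitr x) cosD; have := cos2Dsin2 (x / 2); rewrite -!expr2; lra.
have := sin_le_norm (x / 2) => h.
rewrite normrN normrM normrX (ger0_norm (ler0n _ 2)).
have : `|sin (x / 2)| ^+ 2 <= `|x / 2| ^+ 2 by rewrite lerXn2r ?nnegrE.
rewrite !real_normK ?num_real // expr_div_n; have := sqr_ge0 x; lra.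
Qed.

(** On characters the semigroup multiplies by $e^{s\Phi(\lambda)}$, here in real form, which makes
    sense for $s<0$ too. A step of the chain multiplies by $1+(c_m+id_m)/a_m$ with
    $c_m+id_m\to\Phi(\lambda)$, and the elapsed time $1/a_m$ by $e^{-\Phi(\lambda)/a_m}$; the
    product is $1+o(1/a_m)$. *)
Lemma evolution_cos lam phi : evolution (fun x => cos (lam * x + phi))
  (fun s y => expR (s * re lam) * cos (lam * y + phi + s * im lam)).
Proof.
set u := re lam; set v := im lam.
have bc s : bounded_mfun (fun om => cos (lam * xi s om)).
  apply: (bmfun_comp (g := fun x => cos (lam * x)) (M := 1)) => //.
  - by apply: continuous_measurable_fun; apply: continuous_scale; exact: continuous_cos.
  - by move=> y; rewrite ler_norml cos_geN1 cos_le1.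
have bs s : bounded_mfun (fun om => sin (lam * xi s om)).
  apply: (bmfun_comp (g := fun x => sin (lam * x)) (M := 1)) => //.
  - by apply: continuous_measurable_fun; apply: continuous_scale; exact: continuous_sin.
  - by move=> y; rewrite ler_norml sin_geN1 sin_le1.
have c1 x : `|cos x| <= 1 :> R by rewrite ler_norml cos_geN1 cos_le1.
have s1 x : `|sin x| <= 1 :> R by rewrite ler_norml sin_geN1 sin_le1.
have sT s : -1 <= s <= T -> `|s| <= T + 1 by move=> ?; rewrite ler_norml; have := T_ge0; lra.
pose E := expR ((T + 1) * `|u|).
have eE s : -1 <= s <= T -> 0 <= expR (s * u) <= E.
  move=> /sT h; rewrite expR_ge0 ler_expR (le_trans (ler_norm _)) // normrM.
  by apply: ler_pM.
have E0 : 0 <= E by exact: expR_ge0.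
split.
- move=> x; apply: (@continuous_comp _ _ _ (fun x => lam * x + phi) cos); last exact: continuous_cos.
  by apply: cvgD; [apply: cvgM; [exact: cvg_cst|exact: cvg_id]|exact: cvg_cst].
- move=> s y s0.
  rewrite (eq_Ex Q (g := fun om => cos (lam * y + phi) * cos (lam * xi s om)
     + (- sin (lam * y + phi)) * sin (lam * xi s om))); last first.
    move=> om; rewrite (_ : _ + phi = (lam * y + phi) + lam * xi s om); last by ring.
    by rewrite cosD mulNr.
  rewrite ExD ?ExZ ?xi_cos ?xi_sin //; try exact: bmfunZ.
  by rewrite cosD -/u -/v; ring.
- exists E => s y /eE /andP[e0 e1]; rewrite normrM (ger0_norm e0) -[leRHS]mulr1.
  by apply: ler_pM.
- have eL s s' : -1 <= s <= T -> -1 <= s' <= T -> s' <= s ->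
      `|expR (s * u) - expR (s' * u)| <= E * `|u| * `|s - s'|.
    move=> sr sr' ss.
    have k x y : x <= y -> expR y <= E -> 0 <= expR y - expR x <= E * (y - x).
      move=> xy yE; rewrite subr_ge0 ler_expR xy /=.
      have -> : expR y - expR x = expR y * (1 - expR (x - y)).
        by rewrite mulrBr mulr1 -expRD; congr (_ - expR _); ring.
      apply: ler_pM => //.
        by rewrite subr_ge0 -[leRHS]expR0 ler_expR subr_le0.
      by have := expR_ge1Dx (x - y); lra.
    have /andP[_ e1] := eE s sr; have /andP[_ e2] := eE s' sr'.
    rewrite -mulrA -normrM mulrBr (mulrC u) (mulrC u).
    have [xy|xy] := leP (s' * u) (s * u).
      have /andP[k1 k2] := k _ _ xy e1.
      by rewrite !ger0_norm // subr_ge0.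
    have /andP[k1 k2] := k _ _ (ltW xy) e2.
    by rewrite distrC [`|s * u - _|]distrC !ger0_norm // subr_ge0 ltW.
  have cL x y : `|cos x - cos y| <= `|x - y| :> R.
    have -> : cos x - cos y = - (2 * (sin ((x + y) / 2) * sin ((x - y) / 2))).
      have -> : cos x = cos ((x + y) / 2 + (x - y) / 2) by congr cos; field.
      have -> : cos y = cos ((x + y) / 2 - (x - y) / 2) by congr cos; field.
      by rewrite cosB cosD; ring.
    rewrite normrN !normrM (ger0_norm (ler0n _ 2)).
    have h1 := sin_le_norm ((x - y) / 2); rewrite normrM (@ger0_norm _ 2^-1) // in h1.
    have : `|sin ((x + y) / 2)| * `|sin ((x - y) / 2)| <= 1 * `|sin ((x - y) / 2)|.
      exact: ler_wpM2r.
    by move: h1; set q1 := `|sin _|; set q2 := `|sin _|; lra.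
  exists (E * `|u| + E * `|v|) => [|]; first by rewrite addr_ge0 // mulr_ge0.
  have main s s' y : -1 <= s <= T -> -1 <= s' <= T -> s' <= s ->
    `|expR (s * u) * cos (lam * y + phi + s * v) - expR (s' * u) * cos (lam * y + phi + s' * v)|
      <= (E * `|u| + E * `|v|) * `|s - s'|.
    move=> sr sr' ss; have h1 := eL _ _ sr sr' ss; have /andP[h2 h3] := eE s' sr'.
    rewrite (_ : _ - _ = (expR (s * u) - expR (s' * u)) * cos (lam * y + phi + s * v) +
      expR (s' * u) * (cos (lam * y + phi + s * v) - cos (lam * y + phi + s' * v))); last by ring.
    apply: le_trans (ler_normD _ _) _; rewrite [leRHS]mulrDl !normrM; apply: lerD.
      by rewrite -[leRHS]mulr1; apply: ler_pM.
    rewrite (ger0_norm h2) -mulrA; apply: ler_pM => //; apply: le_trans (cL _ _) _.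
    by rewrite -normrM (_ : _ - _ = v * (s - s')) //; ring.
  move=> s s' y sr sr'; have [ss|ss] := leP s' s; first exact: main.
  by rewrite distrC [`|s - s'|]distrC; apply: main => //; exact: ltW.
move=> e e0.
pose c m := nu p a m (fun x => cos (lam * x) - 1); pose ds m := nu p a m (fun x => sin (lam * x)).
have cc : c m @[m --> \oo] --> u by exact: nu_re.
have dc : ds m @[m --> \oo] --> v by exact: nu_im.
have ri : (a m)^-1 @[m --> \oo] --> (0 : R).
  apply/cvgrPdist_le => e' e'0; near=> m.
  have [_ h] : (0 < m)%N /\ (a m)^-1 <= e' by near: m; exact: near_inv_a.
  by rewrite sub0r normrN ger0_norm // invr_ge0 ltW.
have Ec : expR (- u * (a m)^-1) @[m --> \oo] --> (1 : R).
  rewrite -expR0; apply: continuous_cvg; first exact: continuous_expR.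
  by rewrite -(mulr0 (- u)); apply: cvgM => //; exact: cvg_cst.
have Uc : cos (v * (a m)^-1) @[m --> \oo] --> (1 : R).
  rewrite -cos0; apply: continuous_cvg; first exact: continuous_cos.
  by rewrite -(mulr0 v); apply: cvgM => //; exact: cvg_cst.
have Vc : sin (v * (a m)^-1) @[m --> \oo] --> (0 : R).
  rewrite -sin0; apply: continuous_cvg; first exact: continuous_sin.
  by rewrite -(mulr0 v); apply: cvgM => //; exact: cvg_cst.
have dE : a m * (expR (- u * (a m)^-1) - 1) @[m --> \oo] --> - u.
  have u0 : 0 < `|u| + 1 by rewrite ltr_wpDl.
  apply: (@lim_scale (fun x => expR (- u * x) - 1) _ (2 * u ^+ 2) (1 / 2 / (`|u| + 1))).
    by rewrite !divr_gt0.
  move=> x /andP[x0 x1]; rewrite (_ : 2 * _ * _ = 2 * (- u * x) ^+ 2); last by ring.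
  apply: expR_taylor; rewrite normrM normrN (ger0_norm x0).
  apply: (@le_trans _ _ ((`|u| + 1) * x)); first by rewrite ler_wpM2r // lerDl.
  by rewrite mulrC -ler_pdivlMr.
have dU : a m * (cos (v * (a m)^-1) - 1) @[m --> \oo] --> (0 : R).
  apply: (@lim_scale (fun x => cos (v * x) - 1) 0 (v ^+ 2) 1) => // x _.
  by rewrite mul0r subr0 -exprMn; exact: cos_taylor.
have dV : a m * sin (v * (a m)^-1) @[m --> \oo] --> v.
  apply: (@lim_scale (fun x => sin (v * x)) v (`|v| ^+ 3) 1) => // x /andP[x0 x1].
  apply: le_trans (sin_sub_id _) _; rewrite normrM exprMn (ger0_norm x0) ler_wpM2l ?exprn_ge0 //.
  by rewrite exprS ler_piMl // exprn_ge0.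
(* With $\zeta=e^{-(u+iv)/a_m}(1+(c_m+id_m)/a_m)$, [al m] is $a_m(\mathrm{Re}\,\zeta-1)$ and [be m]
   is $-a_m\mathrm{Im}\,\zeta$. *)
pose al m := a m * (expR (- u * (a m)^-1) - 1) * (cos (v * (a m)^-1) * (1 + c m * (a m)^-1) + sin (v * (a m)^-1) * (ds m * (a m)^-1))
   + (a m * (cos (v * (a m)^-1) - 1) + cos (v * (a m)^-1) * c m + sin (v * (a m)^-1) * ds m).
pose be m := expR (- u * (a m)^-1) * (a m * sin (v * (a m)^-1) * (1 + c m * (a m)^-1) - cos (v * (a m)^-1) * ds m).
have alc : al m @[m --> \oo] --> (0 : R).
  rewrite (_ : 0 = - u * (1 * (1 + u * 0) + 0 * (v * 0)) + (0 + 1 * u + 0 * v)); last by ring.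
  apply: cvgD; last by apply: cvgD; [apply: cvgD => //; exact: cvgM|exact: cvgM].
  apply: cvgM => //; apply: cvgD; apply: cvgM => //; last exact: cvgM.
  by apply: cvgD; [exact: cvg_cst|exact: cvgM].
have bec : be m @[m --> \oo] --> (0 : R).
  rewrite (_ : 0 = 1 * (v * (1 + u * 0) - 1 * v)); last by ring.
  apply: cvgM => //; apply: cvgB; last exact: cvgM.
  by apply: cvgM => //; apply: cvgD; [exact: cvg_cst|exact: cvgM].
have e20 : 0 < e / (2 * (E + 1)) by rewrite divr_gt0 // mulr_gt0 // ltr_wpDl.
have [N1 _ n1] : \forall m \near \oo, `|al m| <= e / (2 * (E + 1)).
  have /cvgrPdist_le/(_ _ e20) := alc; apply: filterS => m.
  by rewrite sub0r normrN.
have [N2 _ n2] : \forall m \near \oo, `|be m| <= e / (2 * (E + 1)).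
  have /cvgrPdist_le/(_ _ e20) := bec; apply: filterS => m.
  by rewrite sub0r normrN.
have [N3 n3] := inv_a_le ltr01.
exists (maxn N1 (maxn N2 N3)) => m; rewrite !geq_max => /and3P[m1 m2 m3] s y sr.
have [m0 am] := n3 m m3; have am0 := a_gt0 m.
have ai0 : 0 <= (a m)^-1 by rewrite invr_ge0 ltW.
have sr' : -1 <= s <= T by have /andP[s0 sT'] := sr; apply/andP; split; lra.
have /andP[es0 es1] := eE s sr'.
set r := (a m)^-1; pose th := lam * y + phi + s * v.
have pc : psum p m (fun k => cos (lam * logjump m k) - 1) = c m * r.
  by rewrite /c /nu mulrAC mulfV ?mul1r // gt_eqF.
have ps : psum p m (fun k => sin (lam * logjump m k)) = ds m * r.
  by rewrite /ds /nu mulrAC mulfV ?mul1r // gt_eqF.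
have bcm k : `|cos (lam * logjump m k) - 1| <= 2 :> R.
  by apply: le_trans (ler_normB _ _) _; rewrite normr1; have := c1 (lam * logjump m k); lra.
have -> : psum p m (fun k => expR ((s - r) * u) * cos (lam * (y + logjump m k) + phi + (s - r) * v)) =
    expR ((s - r) * u) * (cos (th - r * v) * (1 + c m * r) - sin (th - r * v) * (ds m * r)).
  rewrite (@eq_psum _ _ _ _ (fun k => (expR ((s - r) * u) * cos (th - r * v)) +
     (expR ((s - r) * u) * cos (th - r * v) * (cos (lam * logjump m k) - 1) +
      (- (expR ((s - r) * u) * sin (th - r * v))) * sin (lam * logjump m k)))); last first.
    move=> k _; rewrite (_ : lam * _ + _ + _ = (th - r * v) + lam * logjump m k); last by rewrite /th; ring.
    by rewrite cosD; ring.
  have bz (x : R) (g : nat -> R) B : (forall k, `|g k| <= B) -> forall k, `|x * g k| <= `|x| * B.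
    by move=> gB k; rewrite normrM ler_wpM2l.
  have b1 := bz (expR ((s - r) * u) * cos (th - r * v)) _ _ bcm.
  have b2 := bz (- (expR ((s - r) * u) * sin (th - r * v))) _ _ (fun k => s1 (lam * logjump m k)).
  have b3 k : _ := le_trans (ler_normD _ _) (lerD (b1 k) (b2 k)).
  rewrite (psumD p_ge0 p_sum1 m0 (fun=> lexx `|expR ((s - r) * u) * cos (th - r * v)|) b3).
  rewrite (psumD p_ge0 p_sum1 m0 b1 b2) psum_cst // (psumZ p_ge0 p_sum1 _ m0 bcm).
  rewrite (psumZ p_ge0 p_sum1 _ m0 (fun k => s1 (lam * logjump m k))) pc ps.
  by ring.
have -> : expR ((s - r) * u) * (cos (th - r * v) * (1 + c m * r) - sin (th - r * v) * (ds m * r))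
    - expR (s * u) * cos th = expR (s * u) * (r * (cos th * al m + sin th * be m)).
  have -> : expR ((s - r) * u) = expR (s * u) * expR (- u * r) by rewrite -expRD; congr expR; ring.
  have ar : a m * r = 1 by rewrite mulfV // gt_eqF.
  rewrite sinB cosB /al /be -/r [r * v]mulrC.
  move: ar; set q1 := expR (- u * r); set q2 := cos (v * r); set q3 := sin (v * r).
  set c' := c m; set d' := ds m; set am' := a m; move=> ar.
  rewrite -mulrA -mulrBr; congr (_ * _).
  have -> : r * (cos th * (am' * (q1 - 1) * (q2 * (1 + c' * r) + q3 * (d' * r)) + (am' * (q2 - 1) + q2 * c' + q3 * d'))
     + sin th * (q1 * (am' * q3 * (1 + c' * r) - q2 * d'))) =
    cos th * ((am' * r) * (q1 - 1) * (q2 * (1 + c' * r) + q3 * (d' * r)) + ((am' * r) * (q2 - 1) + r * (q2 * c' + q3 * d')))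
     + sin th * (q1 * ((am' * r) * q3 * (1 + c' * r) - r * (q2 * d'))) by ring.
  by rewrite ar; ring.
rewrite 2!normrM (ger0_norm es0) (ger0_norm ai0) mulrCA mulrC ler_wpM2r //.
have h1 : `|al m| <= _ := n1 m m1; have h2 : `|be m| <= _ := n2 m m2.
have h3 : `|cos th * al m + sin th * be m| <= e / (E + 1).
  apply: le_trans (ler_normD _ _) _; rewrite (normrM (cos th)) (normrM (sin th)).
  have -> : e / (E + 1) = 1 * (e / (2 * (E + 1))) + 1 * (e / (2 * (E + 1))).
    rewrite mul1r invfM -mulrDl -[RHS]mulr1 !mulrA; field.
    by rewrite gt_eqF // ltr_wpDl.
  apply: lerD; [apply: ler_pM (c1 _) h1|apply: ler_pM (s1 _) h2]; exact: normr_ge0.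
apply: (@le_trans _ _ ((E + 1) * (e / (E + 1)))).
  by apply: ler_pM => //; rewrite (le_trans es1) // lerDl.
by rewrite mulrCA divff ?mulr1 // gt_eqF // ltr_wpDl.
Unshelve. all: by end_near. Qed.

Inductive trig_poly : (R -> R) -> Prop :=
| tp_cos lam phi : trig_poly (fun x => cos (lam * x + phi))
| tp_add f g : trig_poly f -> trig_poly g -> trig_poly (fun x => f x + g x)
| tp_scale c f : trig_poly f -> trig_poly (fun x => c * f x).

Lemma trig_poly_evolution f : trig_poly f -> exists q, evolution f q.
Proof.
elim=> [lam phi|{}f g _ [q1 h1] _ [q2 h2]|c {}f _ [q hq]].
- by eexists; exact: evolution_cos.
- by eexists; exact: evolutionD h1 h2.
- by eexists; exact: evolutionZ hq.
Qed.

Lemma tp_mul f g : trig_poly f -> trig_poly g -> trig_poly (fun x => f x * g x).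
Proof.
move=> tf tg; elim: tf => [lam phi|f1 f2 _ h1 _ h2|c f1 _ h1]; last first.
- rewrite (_ : (fun x => _) = fun x => c * (f1 x * g x)); first exact: tp_scale.
  by apply/funext => x; rewrite mulrA.
- rewrite (_ : (fun x => _) = fun x => f1 x * g x + f2 x * g x); first exact: tp_add.
  by apply/funext => x; rewrite mulrDl.
elim: tg => [lam' phi'|f1 f2 _ h1 _ h2|c f1 _ h1]; last first.
- rewrite (_ : (fun x => _) = fun x => c * (cos (lam * x + phi) * f1 x)); first exact: tp_scale.
  by apply/funext => x; rewrite mulrCA.
- rewrite (_ : (fun x => _) = fun x => cos (lam * x + phi) * f1 x + cos (lam * x + phi) * f2 x); first exact: tp_add.
  by apply/funext => x; rewrite mulrDr.
rewrite (_ : (fun x => _) = fun x => 2^-1 * (cos ((lam + lam') * x + (phi + phi')) + cos ((lam - lam') * x + (phi - phi')))).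
  by apply: tp_scale; apply: tp_add; exact: tp_cos.
apply/funext => x.
have -> : (lam + lam') * x + (phi + phi') = (lam * x + phi) + (lam' * x + phi') by ring.
have -> : (lam - lam') * x + (phi - phi') = (lam * x + phi) - (lam' * x + phi') by ring.
by move: (lam * x + phi) (lam' * x + phi') => A B; rewrite cosB cosD; field.
Qed.

Lemma tp_cst (c : R) : trig_poly (fun=> c).
Proof.
rewrite (_ : (fun=> c) = fun x => c * cos (0 * x + 0)); first by apply: tp_scale; exact: tp_cos.
by apply/funext => x; rewrite mul0r addr0 cos0 mulr1.
Qed.

End Evolutions.

(** * Convergence of the sampled increments *)

Section Bernstein.
Context {R : realType}.
Implicit Types (t x : R).

(** The binomial probability of [k] successes in [N] trials, by conditioning on one trial; the mean
    and the variance then follow by induction. *)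
Fixpoint bern t N k : R :=
  if N is N'.+1 then t * (if k is k'.+1 then bern t N' k' else 0) + (1 - t) * bern t N' k
  else (k == 0%N)%:R.

Lemma bern_ge0 t N k : 0 <= t <= 1 -> 0 <= bern t N k.
Proof.
move=> /andP[t0 t1]; elim: N k => [|N IH] k /=; first exact: ler0n.
apply: addr_ge0; apply: mulr_ge0 => //; last by rewrite subr_ge0.
by case: k => [|k] //; exact: IH.
Qed.

Lemma bern_gt t N k : (N < k)%N -> bern t N k = 0.
Proof.
elim: N k => [|N IH] [|k] //=; rewrite ltnS => Nk.
by rewrite !IH ?mulr0 ?addr0 // ltnW.
Qed.

Lemma bern_sumS t N (g : nat -> R) : \sum_(k < N.+2) bern t N.+1 k * g k =
  t * (\sum_(k < N.+1) bern t N k * g k.+1) + (1 - t) * \sum_(k < N.+1) bern t N k * g k.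
Proof.
rewrite (eq_bigr (fun k : 'I_N.+2 => t * ((if k : nat is k'.+1 then bern t N k' else 0) * g k)
   + (1 - t) * (bern t N k * g k))); last by move=> k _ /=; ring.
rewrite big_split /= -!mulr_sumr; congr (_ * _ + _ * _).
  by rewrite big_ord_recl /= mul0r add0r; apply: eq_bigr.
by rewrite big_ord_recr /= bern_gt // mul0r addr0.
Qed.

Lemma bern_sum1 t N : \sum_(k < N.+1) bern t N k = 1.
Proof.
have -> : \sum_(k < N.+1) bern t N k = \sum_(k < N.+1) bern t N k * (fun=> 1) (k : nat).
  by apply: eq_bigr => k _; rewrite mulr1.
elim: N => [|N IH]; first by rewrite big_ord_recl big_ord0 /= mulr1 addr0.
by rewrite (bern_sumS t N (fun=> 1)) IH; ring.
Qed.

Lemma bern_mean t N : \sum_(k < N.+1) bern t N k * (k%:R - N%:R * t) = 0.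
Proof.
elim: N => [|N IH]; first by rewrite big_ord_recl big_ord0 /= mul0r subrr mulr0 addr0.
have s1 := bern_sum1 t N.
rewrite (bern_sumS t N (fun k => k%:R - N.+1%:R * t)).
have -> : \sum_(k < N.+1) bern t N k * (k.+1%:R - N.+1%:R * t) =
    \sum_(k < N.+1) bern t N k * (k%:R - N%:R * t) + (1 - t) * \sum_(k < N.+1) bern t N k.
  rewrite mulr_sumr -big_split /=; apply: eq_bigr => k _.
  by rewrite -[k.+1%:R]natr1 -[N.+1%:R]natr1; ring.
have -> : \sum_(k < N.+1) bern t N k * (k%:R - N.+1%:R * t) =
    \sum_(k < N.+1) bern t N k * (k%:R - N%:R * t) - t * \sum_(k < N.+1) bern t N k.
  rewrite mulr_sumr -sumrB /=; apply: eq_bigr => k _.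
  by rewrite -[N.+1%:R]natr1; ring.
by rewrite IH s1; ring.
Qed.

Lemma bern_var t N : \sum_(k < N.+1) bern t N k * (k%:R - N%:R * t) ^+ 2 = N%:R * (t * (1 - t)).
Proof.
elim: N => [|N IH]; first by rewrite big_ord_recl big_ord0 /= mul0r subrr expr2 !mulr0 addr0 mul0r.
have s1 := bern_sum1 t N; have sm := bern_mean t N.
rewrite (bern_sumS t N (fun k => (k%:R - N.+1%:R * t) ^+ 2)).
have -> : \sum_(k < N.+1) bern t N k * (k.+1%:R - N.+1%:R * t) ^+ 2 =
    \sum_(k < N.+1) bern t N k * (k%:R - N%:R * t) ^+ 2
    + 2 * (1 - t) * (\sum_(k < N.+1) bern t N k * (k%:R - N%:R * t))
    + (1 - t) ^+ 2 * \sum_(k < N.+1) bern t N k.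
  rewrite !mulr_sumr -!big_split /=; apply: eq_bigr => k _.
  by rewrite -[k.+1%:R]natr1 -[N.+1%:R]natr1; ring.
have -> : \sum_(k < N.+1) bern t N k * (k%:R - N.+1%:R * t) ^+ 2 =
    \sum_(k < N.+1) bern t N k * (k%:R - N%:R * t) ^+ 2
    - 2 * t * (\sum_(k < N.+1) bern t N k * (k%:R - N%:R * t))
    + t ^+ 2 * \sum_(k < N.+1) bern t N k.
  rewrite !mulr_sumr -sumrB -!big_split /=; apply: eq_bigr => k _.
  by rewrite -[N.+1%:R]natr1; ring.
by rewrite IH s1 sm -[N.+1%:R]natr1; ring.
Qed.

(* [sin] is a homeomorphism of [-1, 1], so [half_sin B] identifies [-B, B] with a
   subinterval of [0, 1]; Bernstein polynomials in it are trigonometric. *)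
Definition half_sin B x : R := (1 + sin (x / B)) / 2.

Lemma half_sin01 B x : 0 <= half_sin B x <= 1.
Proof.
have := @sin_geN1 R (x / B); have := @sin_le1 R (x / B); rewrite /half_sin.
by move: (sin _) => u ? ?; apply/andP; split; lra.
Qed.

Definition bker B N k x := bern (half_sin B x) N k.

Lemma bker_ge0 B N k x : 0 <= bker B N k x.
Proof. exact: bern_ge0 (half_sin01 B x). Qed.

Lemma bker_sum1 B N x : \sum_(k < N.+1) bker B N k x = 1.
Proof. exact: bern_sum1. Qed.

Lemma bker_trig B N k : trig_poly (bker B N k).
Proof.
have th : trig_poly (half_sin B).
  rewrite (_ : half_sin B = fun x => 2^-1 * (1 + cos (B^-1 * x + - (pi / 2)))).
    by apply: tp_scale; apply: tp_add; [exact: tp_cst|exact: tp_cos].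
  apply/funext => x; rewrite cosB cos_pihalf sin_pihalf /half_sin [x / B]mulrC.
  by ring.
have th1 : trig_poly (fun x => 1 + (-1) * half_sin B x).
  by apply: tp_add; [exact: tp_cst|exact: tp_scale].
elim: N k => [|N IH] k; first exact: tp_cst.
rewrite (_ : bker B N.+1 k = fun x => half_sin B x * (if k is k'.+1 then bker B N k' x else 0)
   + (1 + (-1) * half_sin B x) * bker B N k x); last first.
  by apply/funext => x; rewrite /bker /= mulN1r.
apply: tp_add; apply: tp_mul => //.
by case: k => [|k] //; exact: tp_cst.
Qed.

Lemma cos_ge_half x : `|x| <= 1 -> 1 / 2 <= cos x.
Proof.
move=> x1; have -> : cos x = 1 - 2 * sin (x / 2) ^+ 2.
  by rewrite {1}(splitr x) cosD; have := cos2Dsin2 (x / 2); rewrite -!expr2; lra.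
have : `|sin (x / 2)| ^+ 2 <= `|x / 2| ^+ 2 by rewrite lerXn2r ?nnegrE // sin_le_norm.
have : `|x| ^+ 2 <= 1 by rewrite expr_le1.
by rewrite !real_normK ?num_real // expr_div_n; lra.
Qed.

Lemma sin_sep (x y : R) : -1 <= x -> x <= y -> y <= 1 -> (y - x) / 2 <= sin y - sin x.
Proof.
move=> x1; rewrite le_eqVlt => /orP[/eqP ->|xy] y1; first by rewrite !subrr mul0r.
have [c c01 ->] : exists2 c, c \in `]x, y[%R & sin y - sin x = cos c * (y - x).
  apply: MVT => //.
  apply: continuous_subspaceT; exact: continuous_sin.
move: c01; rewrite in_itv /= => /andP[xc cy].
have := @cos_ge_half c; rewrite ler_norml => /(_ ltac:(apply/andP; split; lra)) h.
by rewrite mulrC ler_wpM2r // ?subr_ge0; lra.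
Qed.

Lemma bern_node B N k : 0 < B -> exists2 y, `|y| <= B &
  forall x, `|x| <= B -> `|x - y| <= 4 * B * `|half_sin B x - k%:R / N%:R|.
Proof.
move=> B0; set c : R := 2 * (k%:R / N%:R) - 1.
have s1 : 0 <= sin 1 :> R by have := sin_sep (x := 0) (y := 1); rewrite sin0; lra.
(* The value $c=2k/N-1$ may lie outside the image of $[-1,1]$ under [sin]. Clamping it does not
   increase its distance to any [sin w] with $|w|\le1$; the slope of [sin] there is at least $1/2$,
   whence the constant 4. *)
pose v := Num.max (- sin 1) (Num.min (sin 1) c).
have v1 : - sin 1 <= v <= sin 1.
  by rewrite le_max lexx ge_max ge_min lexx /= andbT; lra.
have [u] : exists2 u, u \in `[-1, 1]%R & sin u = v.
  apply: IVT => //.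
    by apply: continuous_subspaceT; exact: continuous_sin.
  by rewrite sinN minEle maxEle; case: ifP => h; rewrite ?v1 //; move: h; lra.
rewrite in_itv /= => /andP[u1 u2] uv.
exists (B * u) => [|x xB].
  by rewrite normrM gtr0_norm // ler_piMr //; [exact: ltW|rewrite ler_norml u1].
set w := x / B; have w1 : -1 <= w <= 1.
  by rewrite -ler_norml normrM normfV (gtr0_norm B0) ler_pdivrMr // mul1r.
have -> : x - B * u = B * (w - u) by rewrite mulrBr [B * w]mulrC /w divfK // gt_eqF.
have -> : half_sin B x - k%:R / N%:R = (sin w - c) / 2 by rewrite /half_sin -/w /c; move: (k%:R / N%:R) => q; field.
rewrite normrM gtr0_norm // [in X in _ <= X]normrM (@ger0_norm _ 2^-1) //.
have /andP[w1' w2'] := w1.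
have sw1 : sin w <= sin 1 by have := @sin_sep w 1 w1' w2' (lexx _); lra.
have sw2 : - sin 1 <= sin w by have := @sin_sep (-1) w (lexx _) w1' w2'; rewrite sinN; lra.
have h1 : `|sin w - v| <= `|sin w - c|.
  rewrite /v; have [c1|c1] := leP (sin 1) c.
    by rewrite max_r; [|lra]; rewrite !ler0_norm; lra.
  have [c2|c2] := leP (- sin 1) c; first by [].
  by rewrite !ger0_norm; lra.
have h2 : `|w - u| <= 2 * `|sin w - v|.
  rewrite -uv; have [wu|wu] := leP w u.
    have q := @sin_sep w u w1' wu u2; rewrite !ler0_norm; lra.
  have q := @sin_sep u w u1 (ltW wu) w2'; rewrite !ger0_norm; lra.
rewrite (_ : 4 * B * _ = B * (2 * `|sin w - c|)); last by field.
by rewrite ler_pM2l //; lra.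
Qed.

Definition pick_pt (y : nat -> R) K N (al : {ffun 'I_K -> 'I_N.+1}) (i : nat) : R :=
  if insub i is Some i' then y (al i') else 0.

Lemma pick_ptE y K N (al : {ffun 'I_K -> 'I_N.+1}) (i : 'I_K) : pick_pt y al i = y (al i).
Proof. by rewrite /pick_pt valK. Qed.

(** The multivariate Bernstein operator: [G] averaged over nodes with independent binomial
    weights. *)
Definition tensor B N y K (G : (nat -> R) -> R) (x : nat -> R) : R :=
  \sum_(al : {ffun 'I_K -> 'I_N.+1}) G (pick_pt y al) * \prod_(i < K) bker B N (al i) (x i).

Lemma sum_bker_prod B N K (x : nat -> R) (i : 'I_K) (w : nat -> R) :
  \sum_(al : {ffun 'I_K -> 'I_N.+1}) (\prod_(j < K) bker B N (al j) (x j)) * w (al i) =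
  \sum_(k < N.+1) bker B N k (x i) * w k.
Proof.
pose F (j : 'I_K) (k : 'I_N.+1) := bker B N k (x j) * (if j == i then w k else 1).
transitivity (\sum_(al : {ffun 'I_K -> 'I_N.+1}) \prod_(j < K) F j (al j)).
  apply: eq_bigr => al _; rewrite big_split /=; congr (_ * _).
  by rewrite (bigD1 i) //= eqxx big1 ?mulr1 // => j /negbTE ->.
rewrite -bigA_distr_bigA (bigD1 i) //= [X in _ * X]big1 ?mulr1.
  by apply: eq_bigr => k _; rewrite /F eqxx.
move=> j /negbTE ji; rewrite -[RHS](bker_sum1 B N (x j)); apply: eq_bigr => k _.
by rewrite /F ji mulr1.
Qed.

Lemma sum_bker_prod1 B N K (x : nat -> R) :
  \sum_(al : {ffun 'I_K -> 'I_N.+1}) \prod_(j < K) bker B N (al j) (x j) = 1.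
Proof.
rewrite -(bigA_distr_bigA (fun (j : 'I_K) (k : 'I_N.+1) => bker B N k (x j))) big1 // => j _.
exact: bker_sum1.
Qed.

(** Bernstein's argument in [K] variables. If all nodes are within [dl] of the point, [Gd] applies;
    otherwise some variance term times [c] is at least 1, because [bern_node] converts a distance
    [dl] into a deviation of the binomial mean. The variances add up to at most $K/N$, which fixes
    [N]. *)
Lemma tensor_approx K (B M e dl : R) (G : (nat -> R) -> R) : 0 < B -> 0 < e -> 0 < dl ->
  (forall x : nat -> R, `|G x| <= M) ->
  (forall x y : nat -> R, (forall i, (i < K)%N -> [/\ `|x i| <= B, `|y i| <= B & `|x i - y i| <= dl]) ->
    `|G x - G y| <= e / 2) ->
  exists N y, forall x : nat -> R, (forall i, (i < K)%N -> `|x i| <= B) -> `|tensor B N y K G x - G x| <= e.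
Proof.
move=> B0 e0 d0 GM Gd.
have M0 : 0 <= M := le_trans (normr_ge0 _) (GM (fun=> 0)).
pose c := (4 * B / dl) ^+ 2; have c0 : 0 <= c by exact: sqr_ge0.
pose N := (Num.truncn (2 * M * c * K%:R / (e / 2))).+1.
have hN : 2 * M * c * K%:R / N%:R <= e / 2.
  rewrite ler_pdivrMr ?ltr0n // [leRHS]mulrC -ler_pdivrMr ?divr_gt0 // ltW //.
  exact: truncnS_gt.
have N0 : 0 < (N%:R : R) by rewrite ltr0n.
have /choice[y yP] : forall k, exists y, `|y| <= B /\
    forall x, `|x| <= B -> `|x - y| <= 4 * B * `|half_sin B x - k%:R / N%:R|.
  by move=> k; have [y y1 y2] := bern_node N k B0; exists y.
exists N, y => x xB.
have th01 i := half_sin01 B (x i).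
pose V i (k : nat) := (k%:R - N%:R * half_sin B (x i)) ^+ 2 / N%:R ^+ 2.
have V0 i k : 0 <= V i k by rewrite divr_ge0 // sqr_ge0.
have diff (al : {ffun 'I_K -> 'I_N.+1}) : `|G (pick_pt y al) - G x| <=
    e / 2 + 2 * M * c * \sum_(i < K) V i (al i).
  have S0 : 0 <= \sum_(i < K) V i (al i) by exact: sumr_ge0.
  have Mc0 : 0 <= 2 * M * c by apply: mulr_ge0 => //; exact: mulr_ge0.
  have [all_close|] := pselect (forall i, (i < K)%N -> `|pick_pt y al i - x i| <= dl).
    apply: (@le_trans _ _ (e / 2)); last by rewrite lerDl; exact: mulr_ge0.
    apply: Gd => i iK; split; [|exact: xB|exact: all_close].
    by rewrite (pick_ptE y al (Ordinal iK)); have [] := yP (al (Ordinal iK)).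
  move=> /existsNP[i /not_implyP[iK /negP]]; rewrite -ltNge => far_i.
  have V1 : 1 <= c * V i (al (Ordinal iK)).
    have [_ /(_ _ (xB i iK))] := yP (al (Ordinal iK)).
    rewrite distrC -(pick_ptE y al (Ordinal iK)) /= => h.
    have h2 : 1 <= (4 * B / dl) * `|half_sin B (x i) - (al (Ordinal iK))%:R / N%:R|.
      by rewrite mulrAC ler_pdivlMr // mul1r (le_trans (ltW far_i)).
    have -> : c * V i (al (Ordinal iK)) = ((4 * B / dl) * `|half_sin B (x i) - (al (Ordinal iK))%:R / N%:R|) ^+ 2.
      rewrite [RHS]exprMn -/c real_normK ?num_real //; congr (_ * _); rewrite /V.
      by field; rewrite gt_eqF.
    exact: exprn_ege1.
  have VS : V i (al (Ordinal iK)) <= \sum_(i < K) V i (al i).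
    by rewrite (bigD1 (Ordinal iK)) //= lerDl sumr_ge0.
  apply: (@le_trans _ _ (2 * M)).
    by rewrite mulr_natl mulr2n (le_trans (ler_normB _ _)) // lerD.
  apply: (@le_trans _ _ (2 * M * c * \sum_(i < K) V i (al i))); last by rewrite lerDr divr_ge0 // ltW.
  rewrite -mulrA; apply: ler_peMr; first exact: mulr_ge0.
  by apply: (le_trans V1); exact: ler_wpM2l.
have GxE : G x = \sum_(al : {ffun 'I_K -> 'I_N.+1}) G x * \prod_(j < K) bker B N (al j) (x j).
  by rewrite -mulr_sumr sum_bker_prod1 mulr1.
rewrite /tensor GxE -sumrB.
apply: le_trans (ler_norm_sum _ _ _) _.
apply: (@le_trans _ _ (\sum_(al : {ffun 'I_K -> 'I_N.+1}) (\prod_(j < K) bker B N (al j) (x j)) *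
    (e / 2 + 2 * M * c * \sum_(i < K) V i (al i)))).
  apply: ler_sum => al _; rewrite -mulrBl normrM mulrC ger0_norm.
    by rewrite ler_wpM2l // prodr_ge0 // => j _; exact: bker_ge0.
  by rewrite prodr_ge0 // => j _; exact: bker_ge0.
under eq_bigr do rewrite mulrDr.
rewrite big_split /= -mulr_suml sum_bker_prod1 mul1r.
have -> : \sum_(al : {ffun 'I_K -> 'I_N.+1}) (\prod_(j < K) bker B N (al j) (x j)) *
    (2 * M * c * \sum_(i < K) V i (al i)) =
    2 * M * c * \sum_(i < K) (\sum_(k < N.+1) bker B N k (x i) * V i k).
  rewrite (eq_bigr (fun al : {ffun 'I_K -> 'I_N.+1} => 2 * M * c * \sum_(i < K)
      (\prod_(j < K) bker B N (al j) (x j)) * V i (al i))); last first.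
    by move=> al _; rewrite mulrCA mulr_sumr.
  rewrite -mulr_sumr; congr (_ * _); rewrite exchange_big /=; apply: eq_bigr => i _.
  by rewrite (@sum_bker_prod B N K x i (V i)).
have VN (i : 'I_K) : \sum_(k < N.+1) bker B N k (x i) * V i k <= N%:R^-1.
  rewrite (eq_bigr (fun k : 'I_N.+1 => bker B N k (x i) * (k%:R - N%:R * half_sin B (x i)) ^+ 2 / N%:R ^+ 2)).
    rewrite -mulr_suml bern_var expr2 invfM mulrACA divff ?gt_eqF // mul1r.
    rewrite ler_piMl ?invr_ge0 ?ltW //.
    have /andP[t0 t1] := th01 i; nra.
  by move=> k _; rewrite mulrA.
have S1 : \sum_(i < K) (\sum_(k < N.+1) bker B N k (x i) * V i k) <= K%:R / N%:R.
  apply: le_trans (ler_sum _ (fun i _ => VN i)) _.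
  by rewrite sumr_const card_ord mulr_natl.
rewrite [leRHS]splitr lerD2l; apply: le_trans hN; rewrite -[leRHS]mulrA.
by apply: ler_wpM2l => //; apply: mulr_ge0 => //; exact: mulr_ge0.
Qed.

End Bernstein.

Lemma uniform_bound (R : realType) (Pr : nat -> R -> Prop) N :
  (forall k x y, x <= y -> Pr k x -> Pr k y) -> (forall k, exists x, Pr k x) ->
  exists2 x, 1 <= x & forall k, (k <= N)%N -> Pr k x.
Proof.
move=> Pm Pe; elim: N => [|N [x x1 hx]].
  have [x hx] := Pe 0%N; exists (Num.max 1 x); first by rewrite le_max lexx.
  by move=> k; rewrite leqn0 => /eqP ->; apply: Pm hx; rewrite le_max lexx orbT.
have [y hy] := Pe N.+1; exists (Num.max x y); first by rewrite le_max x1.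
move=> k; rewrite leq_eqVlt => /orP[/eqP ->|kN].
  by apply: Pm hy; rewrite le_max lexx orbT.
by apply: Pm (hx k kN); rewrite le_max lexx.
Qed.

(** * Lower bound for functionals of the sampled increments *)

Section ChainToLevy.
Context (R : realType) d (Om : measurableType d) (P : probability Om R).
Context d' (Om' : measurableType d') (Q : probability Om' R).
Variables (p : nat -> nat -> R) (a : nat -> R) (re im : R -> R) (xi : R -> Om' -> R).
Variable X : nat -> nat -> Om -> nat.
Hypothesis p_ge0 : forall i j, 0 <= p i j.
Hypothesis p_sum1 : forall i, (0 < i)%N ->
  (fun m => \sum_(1 <= j < m) p i j) @ \oo --> (1 : R).
Hypothesis a_gt0 : forall n, 0 < a n.
Hypothesis a_cvgy : a n @[n --> \oo] --> +oo.
Hypothesis nu_re : forall lam, nu p a n (fun x => cos (lam * x) - 1) @[n --> \oo] --> re lam.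
Hypothesis nu_im : forall lam, nu p a n (fun x => sin (lam * x)) @[n --> \oo] --> im lam.
Hypothesis xi_meas : forall t, measurable_fun setT (xi t).
Hypothesis xi0 : forall om, xi 0 om = 0.
Hypothesis xi_cos : forall t lam, 0 <= t ->
  Ex Q (fun om => cos (lam * xi t om)) = expR (t * re lam) * cos (t * im lam).
Hypothesis xi_sin : forall t lam, 0 <= t ->
  Ex Q (fun om => sin (lam * xi t om)) = expR (t * re lam) * sin (t * im lam).
Hypothesis xi_ind : forall (k : nat) (t : nat -> R) (B : nat -> set R),
     0 <= t 0%N -> (forall j, (j < k)%N -> t j < t j.+1) ->
     (forall j, measurable (B j)) ->
     fine (Q [set om | forall j, (j < k)%N -> xi (t j.+1) om - xi (t j) om \in B j])
     = \prod_(j < k) fine (Q [set om | xi (t j.+1) om - xi (t j) om \in B j]).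
Hypothesis xi_stat : forall s t (B : set R), 0 <= s -> 0 <= t -> measurable B ->
     Q [set om | xi (t + s) om - xi t om \in B] = Q [set om | xi s om \in B].
Hypothesis mc : markov_chains P p X.

Lemma near_small_steps (ell o : R) (N0 : nat) : 0 < o -> \forall n \near \oo,
  small_steps a n ell o /\ forall x, `|logjump n x| <= ell -> (N0 <= x)%N.
Proof.
move=> o0.
have [N1 hN1] := inv_a_le a_gt0 a_cvgy o0.
near=> n.
have n1 : expR ell < n%:R by near: n; exact: nbhs_infty_gtr.
have n2 : (maxn N1 N0)%:R * expR ell <= n%:R by near: n; exact: nbhs_infty_ger.
have n0 : 0 < (n%:R : R) by apply: lt_trans n1; exact: expR_gt0.
have big x : `|@logjump R n x| <= ell -> (0 < x)%N /\ (maxn N1 N0 <= x)%N.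
  (* As [ln] is 0 at 0, position 0 has logarithmic coordinate $-\ln n$, out of range once
     $n>e^{\ell}$. *)
  case: x => [|x].
    rewrite /logjump ln0 // sub0r normrN => h.
    have := le_trans (ler_norm _) h; rewrite -ler_expR lnK ?posrE // => h2.
    by have := lt_le_trans n1 h2; rewrite ltxx.
  move=> h; split => //; have : - ell <= @logjump R n x.+1 by move: h; rewrite ler_norml => /andP[].
  rewrite /logjump lerBrDl -ler_expR expRD !lnK ?posrE // ?ltr0n // expRN => h2.
  rewrite -(ler_nat R) -(ler_pM2r (expR_gt0 ell)); apply: le_trans n2 _.
  by rewrite -ler_pdivrMr ?expR_gt0.
split => x /big [x0]; rewrite geq_max => /andP[x1 x2] //; split => //.
by have [] := hN1 x x1.
Unshelve. all: by end_near. Qed.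

Variables (h ell M : R) (K : nat) (G : (nat -> R) -> R).
Hypothesis h_gt0 : 0 < h.
Hypothesis ell_gt0 : 0 < ell.
Hypothesis G_ge0 : forall x, 0 <= G x.
Hypothesis G_le : forall x, G x <= M.
Hypothesis G_cfun : cfun K G.
Hypothesis G_unif : forall e, 0 < e -> exists2 dl, 0 < dl &
  forall x y : nat -> R, (forall i, (i < K)%N -> [/\ `|x i| <= 2 * ell, `|y i| <= 2 * ell & `|x i - y i| <= dl]) ->
    `|G x - G y| <= e.

Definition dsmp n (st : state R) i := zsmp n st i.+1 - zsmp n st i.

Definition completed (st : state R) := (K < size (smp st))%N.

Lemma smp_range n eta s i : (0 < n)%N -> (i < size (smp (run a n K h eta ell s)))%N ->
  `|zsmp n (run a n K h eta ell s) i| <= ell.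
Proof.
move=> n0.
apply: (run_ind (I := fun st => forall i, (i < size (smp st))%N -> `|zsmp n st i| <= ell)) i.
  by move=> i _; case: i => [|[|i]] //=; rewrite /zsmp /= /logjump subrr normr0 ltW.
move=> st x IH r; rewrite /update r /=; case: ifPn => //= f1.
case: ifPn => _ /=; last by case: ifPn.
move=> i; rewrite size_rcons ltnS /zsmp /= nth_rcons => ik; case: ltnP => ik2; first exact: IH.
have -> : i = size (smp st) by apply/eqP; rewrite eqn_leq ik.
by rewrite eqxx leNgt.
Qed.

Let outQ := [set om | exists2 i, (i <= K)%N & ell < `|xi (i%:R * h) om|].

Lemma measurable_outQ : measurable outQ.
Proof.
rewrite (_ : outQ = \bigcup_(i in [set i | (i <= K)%N]) [set om | ell < `|xi (i%:R * h) om|]).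
  apply: bigcup_measurable => i _.
  have mf : measurable_fun setT (fun om => `|xi (i%:R * h) om|) by exact: measurableT_comp.
  rewrite (_ : [set om | _] = (fun om => `|xi (i%:R * h) om|) @^-1` `]ell, +oo[%classic).
    by rewrite -[X in measurable X]setTI; apply: mf.
  by apply/seteqP; split => om /=; rewrite in_itv /= andbT.
by apply/seteqP; split => om /= [i iK hi]; exists i.
Qed.

Lemma Ex_tensor N y :
  bounded_mfun (fun om => tensor (2 * ell) N y K G (incr xi h 0 om)) /\
  Ex Q (fun om => tensor (2 * ell) N y K G (incr xi h 0 om)) =
  \sum_(al : {ffun 'I_K -> 'I_N.+1}) G (pick_pt y al) *
    \prod_(i < K) Ex Q (fun om => bker (2 * ell) N (al i) (xi h om)).
Proof.
have ckap k : continuous (bker (2 * ell) N k).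
  elim: (bker_trig (2 * ell) N k) => [lam phi|f g _ cf _ cg|c f _ cf] x.
  - apply: (@continuous_comp _ _ _ (fun x => lam * x + phi) cos); last exact: continuous_cos.
    by apply: cvgD; [apply: cvgM; [exact: cvg_cst|exact: cvg_id]|exact: cvg_cst].
  - by apply: cvgD; [exact: cf|exact: cg].
  - by apply: cvgM; [exact: cvg_cst|exact: cf].
have bkap k x : `|bker (2 * ell) N k x| <= 1.
  rewrite ger0_norm ?bker_ge0 //; have [kN|kN] := leqP k N; last by rewrite /bker bern_gt.
  have s1 := bker_sum1 (2 * ell) N x; rewrite (bigD1 (Ordinal (kN : (k < N.+1)%N))) //= in s1.
  rewrite -[leRHS]s1 lerDl; apply: sumr_ge0 => i _; exact: bker_ge0.
pose ix (al : {ffun 'I_K -> 'I_N.+1}) i : nat := if insub i is Some i' then al i' else 0%N.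
have ixE al (i : 'I_K) : ix al i = al i by rewrite /ix valK.
have cp (al : {ffun 'I_K -> 'I_N.+1}) : cfun K (fun x => \prod_(i < K) bker (2 * ell) N (al i) (x i)).
  rewrite (_ : (fun x => _) = fun x => \prod_(0 <= i < K) bker (2 * ell) N (ix al i) (x i)).
    exact: (cfun_prod K (fun i => ckap (ix al i)) (fun i => bkap (ix al i))).
  by apply/funext => x; rewrite big_mkord; apply: eq_bigr => i _; rewrite ixE.
split.
  apply: bmfun_sum => al; apply: bmfunZ.
  exact: (bmfun_incr Q xi_meas h 0 (cp al)).
rewrite Ex_sum; last first.
  by move=> al; apply: bmfunZ; exact: (bmfun_incr Q xi_meas h 0 (cp al)).
apply: eq_bigr => al _; rewrite ExZ; last exact: (bmfun_incr Q xi_meas h 0 (cp al)).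
congr (_ * _).
have := Ex_prod_incr xi_meas xi_ind xi_stat h_gt0 xi0 K (fun i => ckap (ix al i)) (fun i => bkap (ix al i)).
rewrite big_mkord => H.
rewrite (eq_bigr (fun i : 'I_K => Ex Q (fun om => bker (2 * ell) N (ix al i) (xi h om)))); last first.
  by move=> i _; rewrite ixE.
rewrite -H; apply: eq_Ex => om; rewrite big_mkord; apply: eq_bigr => i _.
by rewrite ixE.
Qed.

Lemma powr_le_exp3 (r : R) m : 0 <= r <= 1 -> (1 + r) ^+ m <= 1 + r * 3 ^+ m.
Proof.
move=> /andP[r0 r1]; elim: m => [|m IH]; first by rewrite !expr0 mulr1 lerDl.
have h3 : 1 <= 3 ^+ m :> R by apply: exprn_ege1; lra.
rewrite !exprS; have := ler_wpM2l (_ : 0 <= 1 + r) IH; rewrite addr_ge0 // => /(_ isT) h1.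
apply: (le_trans h1); move: h3; set q := 3 ^+ m => h3.
have k1 : r <= r * q by exact: ler_peMr.
have k2 : r * (r * q) <= r * q by apply: ler_piMl => //; exact: le_trans k1.
by rewrite (mulrCA r 3) mulrDl mul1r mulrDr mulr1; lra.
Qed.

(** [G] is replaced by its Bernstein approximation, to which [fdd_estimate] applies term by term. A
    run that stops without completing its cells has left the range; there the whole sum is at most
    [M * (1 + e)], because its weights are nonnegative and add up to 1 except for the effect of an
    overshoot. Bounding the terms one by one would instead give a constant growing with [N]. *)
Lemma fdd_lower (e : R) : 0 < e -> \forall n \near \oo, forall (eta : R) k, 0 < eta ->
  (forall om, ~~ running n K ell (run a n K h eta ell (trail X n k om))) ->
  Ex Q (fun om => G (incr xi h 0 om)) - e - M * fine (Q outQ)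
    - M * (1 + e) * Ex P (fun om => (ell < `|@logjump R n (pos (run a n K h eta ell (trail X n k om)))|)%R%:R)
  <= Ex P (fun om => let st := run a n K h eta ell (trail X n k om) in
       (completed st)%:R * G (dsmp n st)).
Proof.
move=> e0; have M0 : 0 <= M := le_trans (G_ge0 (fun=> 0)) (G_le _).
have GM x : `|G x| <= M by rewrite ger0_norm.
have e4 : 0 < e / 4 by rewrite divr_gt0.
have e42 : 0 < e / 4 / 2 by rewrite divr_gt0.
have l20 : 0 < 2 * ell by rewrite mulr_gt0.
have [dl dl0 Gdl] := G_unif e42.
have [N [y HG]] := tensor_approx l20 e4 dl0 GM Gdl.
have h0 := ltW h_gt0.
have /choice[qk evk] : forall k, exists q, evolution Q p a xi h (bker (2 * ell) N k) q.
  move=> k; exact: (trig_poly_evolution p_ge0 p_sum1 a_gt0 a_cvgy nu_re nu_im xi_meas xi0 xi_cos xi_sin h0 (bker_trig (2 * ell) N k)).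
have zr : -1 <= (0 : R) <= h by apply/andP; split => //; exact: lerN10.
have hr : -1 <= h <= h by rewrite lexx andbT (le_trans (lerN10 R)).
have q0 k x : qk k 0 x = bker (2 * ell) N k x by exact: (evolution0 xi0 (evk k)).
have [BB BB1 hBB] : exists2 BB, 1 <= BB & forall k, (k <= N)%N -> forall s x, -1 <= s <= h -> `|qk k s x| <= BB.
  apply: uniform_bound => [k u v uv H s x sr|k]; first exact: le_trans (H _ _ sr) uv.
  by have [_ _ [B hB] _ _] := evk k; exists B.
have [LL LL1 hLL] : exists2 LL, 1 <= LL & forall k, (k <= N)%N -> forall s s' x, -1 <= s <= h -> -1 <= s' <= h ->
    `|qk k s x - qk k s' x| <= LL * `|s - s'|.
  apply: uniform_bound => [k u v uv H s s' x sr sr'|k].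
    by apply: le_trans (H _ _ _ sr sr') _; rewrite ler_wpM2r.
  by have [_ _ _ [L _ hL] _] := evk k; exists L.
have BB0 : 0 <= BB by exact: le_trans BB1.
have LL0 : 0 <= LL by exact: le_trans LL1.
pose NA : R := #|{ffun 'I_K -> 'I_N.+1}|%:R.
have NA0 : 0 <= NA by exact: ler0n.
have BK1 : 1 <= BB ^+ K by exact: exprn_ege1.
have BK0 : 0 <= BB ^+ K by exact: le_trans BK1.
have BK20 : 0 <= BB ^+ K * BB ^+ K by exact: mulr_ge0.
have Kh0 : 0 <= K%:R * h by exact: mulr_ge0.
pose c1 := M * NA * (BB ^+ K * BB ^+ K) * (K%:R * h + 1) + 1.
have c10 : 0 < c1 by rewrite ltr_wpDl // !mulr_ge0 // addr_ge0.
pose c2 := M * NA * (2 * LL * BB * (BB ^+ K * BB ^+ K)) * K%:R + 1.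
have c20 : 0 < c2 by rewrite ltr_wpDl // !mulr_ge0 // mulr_ge0.
pose e' := e / 8 / c1.
have e'0 : 0 < e' by rewrite !divr_gt0.
(* Each of the [K] factors of the weights will have total absolute mass at most [1 + r]; this choice
   keeps their product below [1 + e]. *)
pose r := Num.min 1 (e / 3 ^+ K).
have r0 : 0 < r by rewrite lt_min ltr01 divr_gt0 // exprn_gt0.
have r1 : r <= 1 by rewrite ge_min lexx.
have rK : (1 + r) ^+ K <= 1 + e.
  apply: le_trans (powr_le_exp3 _ _) _; first by rewrite ltW.
  by rewrite lerD2l -ler_pdivlMr ?exprn_gt0 // ge_min lexx orbT.
(* In turn: an overshoot stays below a cell, the times stay above $-1$, the errors per cell add up
   to at most [e / 8], and the [N + 1] weights of the current cell change by at most [r] in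
   total. *)
pose o := Num.min (Num.min (h / 2) 1) (Num.min (e / 8 / c2) (r / (N.+1%:R * LL))).
have NLL : 0 < N.+1%:R * LL by rewrite mulr_gt0 ?ltr0n //; exact: lt_le_trans LL1.
have o0 : 0 < o.
  have d1 : 0 < h / 2 by exact: divr_gt0.
  have d2 : 0 < e / 8 / c2 by apply: divr_gt0 => //; exact: divr_gt0.
  have d3 : 0 < r / (N.+1%:R * LL) by exact: divr_gt0.
  by rewrite /o !lt_min d1 ltr01 d2 d3.
have oh2 : o <= h / 2 by rewrite !ge_min lexx.
have oh : o < h by apply: (le_lt_trans oh2); rewrite ltr_pdivrMr // ltr_pMr // ltr1n.
have o1 : o <= 1 by rewrite !ge_min lexx orbT.
have oc : o <= e / 8 / c2 by rewrite !ge_min lexx !orbT.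
have or' : N.+1%:R * LL * o <= r by rewrite mulrC -ler_pdivlMr // !ge_min lexx !orbT.
have [N1r _ hN1] : exists2 x : R, 1 <= x & forall k, (k <= N)%N -> forall m, x <= m%:R -> forall s y', 0 <= s <= h ->
   `|psum p m (fun j => qk k (s - (a m)^-1) (y' + logjump m j)) - qk k s y'| <= e' / a m.
  apply: uniform_bound => [k u v uv H m vm|k]; first by apply: H; exact: le_trans vm.
  have [_ _ _ _ /(_ _ e'0) [N1 hN1]] := evk k; exists N1%:R => m; rewrite ler_nat.
  exact: hN1.
pose N1 := (Num.truncn N1r).+1.
have N1E m : (N1 <= m)%N -> N1r <= m%:R.
  by move=> Nm; apply: (le_trans (ltW (truncnS_gt _))); rewrite ler_nat.
near=> n; move=> eta k eta0 stopped.
have n0 : (0 < n)%N by near: n; exists 1%N.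
have [ss bigx] : small_steps a n ell o /\ forall x, `|@logjump R n x| <= ell -> (N1 <= x)%N.
  by near: n; exact: near_small_steps.
have o0' := ltW o0.
pose ix (al : {ffun 'I_K -> 'I_N.+1}) i : nat := if insub i is Some i' then al i' else 0%N.
have ixE al (i : 'I_K) : ix al i = al i by rewrite /ix valK.
have ixN al i : (ix al i <= N)%N by rewrite /ix; case: insub => // i'; rewrite -ltnS.
have sr1 s : - o <= s <= h -> -1 <= s <= h.
  by move=> /andP[s1 s2]; rewrite s2 andbT (le_trans _ s1) // lerN2.
pose fdd al st := fdd_fct n K h (fun i => bker (2 * ell) N (ix al i)) (fun i => qk (ix al i)) st.
have EPfdd al := fdd_estimate K eta p_ge0 p_sum1 a_gt0 n0 h_gt0 o0' oh ss mc
  (fs := fun i => bker (2 * ell) N (ix al i)) (qs := fun i => qk (ix al i))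
  BB1 LL0 (ltW e'0) (fun i => q0 (ix al i))
  (fun i s x sr => hBB _ (ixN al i) s x (sr1 _ sr))
  (fun i s s' x sr sr' => hLL _ (ixN al i) s s' x (sr1 _ sr) (sr1 _ sr'))
  (fun x i s y' xl => hN1 _ (ixN al i) x (N1E _ (bigx _ xl)) s y') k.
pose rn om := run a n K h eta ell (trail X n k om).
pose V st := \sum_(al : {ffun 'I_K -> 'I_N.+1}) G (pick_pt y al) * fdd al st.
have Vdone s : let st := run a n K h eta ell s in completed st -> V st = tensor (2 * ell) N y K G (dsmp n st).
  move=> st cst; have [_ _ _ /andP[_ i5] _] := inv0_run K eta a_gt0 h_gt0 o0' oh ss s.
  rewrite -/st in i5.
  apply: eq_bigr => al _; congr (_ * _); rewrite /fdd /fdd_fct.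
  have -> : (size (smp st)).-1 = K.
    by apply/eqP; rewrite eqn_leq -subn1 leq_subLR add1n i5 subn1 -ltnS prednK // (leq_ltn_trans _ cst).
  by rewrite ltnn mulr1 big_mkord; apply: eq_bigr => i _; rewrite ixE.
have Vout s : let st := run a n K h eta ell s in ~~ completed st -> `|V st| <= M * (1 + e).
  move=> st cst.
  have [_ _ _ /andP[i4 _] _] := inv0_run K eta a_gt0 h_gt0 o0' oh ss s; rewrite -/st in i4.
  have sK : (size (smp st) <= K)%N by rewrite leqNgt.
  have sr := fdd_clk_range a_gt0 h_gt0 o0' oh ss sK; rewrite -/st in sr.
  set j := (size (smp st)).-1 in sr; have jK : (j < K)%N by rewrite prednK.
  set sv := j.+1%:R * h - clk st in sr; set yv := logjump n (pos st) - zsmp n st j.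
  (* The weight of a multi-index factors over the cells: a past cell gives its Bernstein weight, the
     current one the conditional expectation, a future one the expectation. *)
  pose w (i : 'I_K) (l : nat) := if (i < j)%N then bker (2 * ell) N l (dsmp n st i)
    else if (i == j :> nat) then qk l sv yv else qk l h 0.
  have fddE al : fdd al st = \prod_(i < K) w i (al i).
    rewrite /fdd /fdd_fct -/j jK.
    rewrite (eq_bigr (fun i : 'I_K => (fun i : nat => if (i < j)%N then bker (2 * ell) N (ix al i) (dsmp n st i)
      else if (i == j :> nat) then qk (ix al i) sv yv else qk (ix al i) h 0) i)); last first.
      by move=> i _; rewrite /w ixE.
    rewrite -(big_mkord xpredT (fun i : nat => if (i < j)%N then bker (2 * ell) N (ix al i) (dsmp n st i)
      else if (i == j :> nat) then qk (ix al i) sv yv else qk (ix al i) h 0)).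
    rewrite (big_cat_nat (leq0n j) (ltnW jK)) /=; congr (_ * _).
      by apply: eq_big_nat => i /andP[_ ij]; rewrite ij.
    rewrite [RHS](big_ltn jK) ltnn eqxx; congr (_ * _).
    by apply: eq_big_nat => i /andP[ij _]; rewrite ltnNge (ltnW ij) /= gtn_eqF.
  have qpos l s' y' : 0 <= s' -> 0 <= qk l s' y'.
    move=> s'0; have [_ -> // _ _ _] := evk l; apply: Ex_ge0 => om; exact: bker_ge0.
  have qsum s' y' : 0 <= s' -> \sum_(l < N.+1) qk l s' y' = 1.
    move=> s'0; rewrite (eq_bigr (fun l : 'I_N.+1 => Ex Q (fun om => bker (2 * ell) N l (y' + xi s' om)))).
      rewrite -Ex_sum.
        by rewrite -[RHS](Ex_cst Q); apply: eq_Ex => om; exact: bker_sum1.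
      move=> l; exact: (evolution_bmfun xi_meas xi0 h0 s' y' (evk l)).
    by move=> l _; have [_ -> //] := evk l.
  have wsum (i : 'I_K) : \sum_(l < N.+1) `|w i l| <= 1 + r.
    have [ij|ij] := ltnP i j.
      rewrite (eq_bigr (fun l : 'I_N.+1 => bker (2 * ell) N l (dsmp n st i))); last first.
        by move=> l _; rewrite /w ij ger0_norm // bker_ge0.
      by rewrite bker_sum1 lerDl ltW.
    have [ij2|ij2] := eqVneq (i : nat) j; last first.
      rewrite (eq_bigr (fun l : 'I_N.+1 => qk l h 0)); last first.
        by move=> l _; rewrite /w ltnNge ij /= (negbTE ij2) ger0_norm // qpos.
      by rewrite qsum // lerDl ltW.
    rewrite (eq_bigr (fun l : 'I_N.+1 => `|qk l sv yv|)); last first.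
      by move=> l _; rewrite /w ltnNge ij /= ij2 eqxx.
    have [sv0|sv0] := leP 0 sv.
      rewrite (eq_bigr (fun l : 'I_N.+1 => qk l sv yv)); last by move=> l _; rewrite ger0_norm // qpos.
      by rewrite qsum // lerDl ltW.
    apply: (@le_trans _ _ (\sum_(l < N.+1) (bker (2 * ell) N l yv + LL * o))).
      apply: ler_sum => l _.
      have lN : (l <= N)%N by rewrite -ltnS.
      have := hLL l lN sv 0 yv (sr1 _ sr) zr; rewrite q0 subr0 => hh.
      rewrite -[qk l sv yv](subrK (bker (2 * ell) N l yv)) addrC (le_trans (ler_normD _ _)) //.
      rewrite ger0_norm ?bker_ge0 // lerD2l (le_trans hh) // ler_wpM2l // ltr0_norm //.
      by move: sr => /andP[s1 _]; rewrite lerNl.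
    rewrite big_split /= bker_sum1 sumr_const card_ord -mulr_natl mulrA lerD2l.
    exact: or'.
  apply: le_trans (ler_norm_sum _ _ _) _.
  apply: (@le_trans _ _ (\sum_(al : {ffun 'I_K -> 'I_N.+1}) M * \prod_(i < K) `|w i (al i)|)).
    apply: ler_sum => al _; rewrite normrM fddE normr_prod ler_wpM2r //.
    exact: prodr_ge0.
  rewrite -mulr_sumr ler_wpM2l // -(bigA_distr_bigA (fun (i : 'I_K) (l : 'I_N.+1) => `|w i l|)).
  apply: le_trans rK; rewrite -[X in _ ^+ X]card_ord -prodr_const.
  by apply: ler_prod => i _; rewrite wsum andbT sumr_ge0.
have fddB al : exists B, forall s, `|fdd al (run a n K h eta ell s)| <= B.
  exists (BB ^+ K * (BB * BB ^+ K)) => s.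
  have [i1 i2 i3 /andP[i4 i5] i6] := inv0_run K eta a_gt0 h_gt0 o0' oh ss s.
  set st := run _ _ _ _ _ _ _ in i1 i2 i3 i4 i5 i6 *.
  have kB l x : (l <= N)%N -> `|bker (2 * ell) N l x| <= BB.
    by move=> lN; rewrite -q0; exact: hBB.
  have pB (g : nat -> R) u v : (forall i, `|g i| <= BB) -> (v <= K)%N -> `|\prod_(u <= i < v) g i| <= BB ^+ K.
    move=> gB vK; apply: (@le_trans _ _ (BB ^+ (v - u))); last first.
      by apply: ler_weXn2l => //; apply: leq_trans (leq_subr _ _) vK.
    rewrite normr_prod -prodr_const_nat; apply: ler_prod => i _.
    by rewrite normr_ge0 gB.
  rewrite /fdd /fdd_fct normrM; apply: ler_pM => //.
    by apply: pB => [i|]; [exact: kB|rewrite -subn1 leq_subLR add1n].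
  case: ifP => jK; last by rewrite normr1 -[1]mulr1; apply: ler_pM.
  rewrite normrM; apply: ler_pM => //; last by apply: pB => // i; exact: hBB.
  apply: hBB => //; apply: sr1; apply: (fdd_clk_range a_gt0 h_gt0 o0' oh ss).
  by rewrite -(prednK i4).
have bfdd al : bounded_mfun (fun om => fdd al (rn om)).
  by have [B hB] := fddB al; exact: (bmfun_run mc (W := fdd al) k hB).
have bV : bounded_mfun (fun om => V (rn om)).
  by apply: bmfun_sum => al; exact: bmfunZ.
have bO : bounded_mfun (fun om => (ell < `|@logjump R n (pos (rn om))|)%R%:R : R).
  apply: (bmfun_run mc (W := fun st => (ell < `|@logjump R n (pos st)|)%R%:R) (M := 1) k) => s.
  by rewrite ger0_norm // ; case: (_ < _).
have bG : bounded_mfun (fun om => (completed (rn om))%:R * G (dsmp n (rn om))).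
  apply: (bmfun_run mc (W := fun st => (completed st)%:R * G (dsmp n st)) (M := M) k) => s.
  by rewrite normrM ger0_norm //; case: (completed _); rewrite ?mul1r ?mul0r.
have EV : Ex P (fun om => V (rn om)) - M * (1 + e) * Ex P (fun om => (ell < `|@logjump R n (pos (rn om))|)%R%:R) - e / 4
    <= Ex P (fun om => (completed (rn om))%:R * G (dsmp n (rn om))).
  rewrite -ExZ // -ExB //; last exact: bmfunZ.
  rewrite -[X in _ - X <= _](Ex_cst P) -ExB; [|by apply: bmfunB => //; exact: bmfunZ|exact: bmfun_cst].
  apply: Ex_le => //; first by apply: bmfunB; [apply: bmfunB => //; exact: bmfunZ|exact: bmfun_cst].
  move=> om; have [cst|cst] := boolP (completed (rn om)).
    rewrite mul1r Vdone //.
    have := HG (dsmp n (rn om)); have H i : (i < K)%N -> `|dsmp n (rn om) i| <= 2 * ell.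
      move=> iK; rewrite /dsmp (le_trans (ler_normB _ _)) // mulr_natl mulr2n lerD //.
        by apply: smp_range => //; apply: leq_trans cst; rewrite ltnS.
      by apply: smp_range => //; apply: leq_trans cst; rewrite ltnS ltnW.
    move=> /(_ H); rewrite ler_norml => /andP[_ h2].
    have : 0 <= M * (1 + e) * (ell < `|@logjump R n (pos (rn om))|)%R%:R.
      by apply: mulr_ge0 => //; apply: mulr_ge0 => //; rewrite addr_ge0 // ltW.
    move=> u0; rewrite lerBlDr; apply: (@le_trans _ _ (tensor (2 * ell) N y K G (dsmp n (rn om)))).
      by rewrite gerBl.
    by rewrite -lerBlDl.
  have oo : ell < `|@logjump R n (pos (rn om))|.
    by have := stopped om; rewrite /running -leqNgt in cst *; rewrite negb_and -ltnNge ltnNge cst /= -ltNge.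
  rewrite mul0r oo mulr1; have := Vout _ cst.
  rewrite -/(rn om) ler_norml => /andP[_ VM]; rewrite subr_le0.
  by apply: (@le_trans _ _ 0); [rewrite subr_le0|exact: divr_ge0 (ltW e0) _].
have EV2 : Ex Q (fun om => tensor (2 * ell) N y K G (incr xi h 0 om)) - e / 4 <= Ex P (fun om => V (rn om)).
  have [_ ->] := Ex_tensor N y; rewrite Ex_sum; last by move=> al; exact: bmfunZ.
  rewrite lerBlDl -lerBlDr -sumrB.
  apply: (@le_trans _ _ (\sum_(al : {ffun 'I_K -> 'I_N.+1}) M * (BB ^+ K * BB ^+ K * e' * (K%:R * h + o)
     + 2 * LL * o * BB * (BB ^+ K * BB ^+ K) * K%:R))).
    apply: ler_sum => al _; rewrite ExZ // -mulrBr; apply: le_trans (ler_norm _) _.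
    rewrite normrM; apply: ler_pM => //; rewrite distrC; apply: le_trans (EPfdd al).
    rewrite big_mkord (eq_bigr (fun i : 'I_K => qk (ix al i) h 0)) // => i _.
    have [_ -> // _ _ _] := evk (ix al i); rewrite ixE; apply: eq_Ex => om.
    by rewrite add0r.
  rewrite sumr_const -[X in X <= _]mulr_natl -/NA mulrDr mulrDr.
  have t1 : NA * (M * (BB ^+ K * BB ^+ K * e' * (K%:R * h + o))) <= e / 8.
    apply: (@le_trans _ _ (c1 * e')); last by rewrite /e' mulrC divfK // gt_eqF.
    rewrite /c1 mulrDl mul1r; apply: ler_wpDr; first exact: ltW.
    rewrite (_ : NA * _ = M * NA * (BB ^+ K * BB ^+ K) * (K%:R * h + o) * e'); last by ring.
    apply: ler_wpM2r; first exact: ltW.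
    by apply: ler_wpM2l; [exact: mulr_ge0 (mulr_ge0 M0 NA0) BK20|rewrite lerD2l].
  have t2 : NA * (M * (2 * LL * o * BB * (BB ^+ K * BB ^+ K) * K%:R)) <= e / 8.
    apply: (@le_trans _ _ (c2 * o)); last by rewrite mulrC -ler_pdivlMr.
    rewrite (_ : c2 * o = NA * (M * (2 * LL * o * BB * (BB ^+ K * BB ^+ K) * K%:R)) + o).
      by rewrite lerDl.
    by rewrite /c2; ring.
  by move: t1 t2; set u1 := NA * _; set u2 := NA * _; lra.
have EV3 : Ex Q (fun om => G (incr xi h 0 om)) - e / 4 - M * fine (Q outQ) <=
    Ex Q (fun om => tensor (2 * ell) N y K G (incr xi h 0 om)).
  have [bT _] := Ex_tensor N y.
  have bGQ := bmfun_incr Q xi_meas h 0 G_cfun.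
  have bI := @bmfun_indic _ _ R _ measurable_outQ.
  rewrite -(Ex_indic Q measurable_outQ) -ExZ // -[X in _ - X - _](Ex_cst Q) -ExB //; last exact: bmfun_cst.
  rewrite -ExB; [|by apply: bmfunB => //; exact: bmfun_cst|exact: bmfunZ].
  apply: Ex_le => //; first by apply: bmfunB; [apply: bmfunB => //; exact: bmfun_cst|exact: bmfunZ].
  move=> om; rewrite indicE; have [oo|oo] := boolP (om \in outQ).
    have : 0 <= tensor (2 * ell) N y K G (incr xi h 0 om).
      apply: sumr_ge0 => al _; apply: mulr_ge0 => //; apply: prodr_ge0 => i _; exact: bker_ge0.
    apply: le_trans; rewrite mulr1 subr_le0; apply: le_trans (G_le (incr xi h 0 om)).
    by rewrite gerBl divr_ge0 // ltW.
  rewrite mulr0 subr0; have H i : (i < K)%N -> `|incr xi h 0 om i| <= 2 * ell.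
    have xl i' : (i' <= K)%N -> `|xi (i'%:R * h) om| <= ell.
      move=> i'K; rewrite leNgt; apply/negP => hl; move/negP: oo; apply; rewrite inE.
      by exists i'.
    move=> iK; rewrite /incr !add0n; apply: (le_trans (ler_normB _ _)).
    by rewrite (mulr_natl ell 2) mulr2n lerD ?xl // ltnW.
  by have := HG _ H; rewrite ler_norml => /andP[+ _]; rewrite lerBrDl.
move: EV EV2 EV3; rewrite /rn.
by set v1 := M * fine _; set v2 := M * (1 + e) * _; set v3 := Ex P _; set v4 := Ex Q _; set v5 := Ex Q _; set v6 := Ex P _; lra.
Unshelve. all: by end_near. Qed.

End ChainToLevy.

(** * Lamperti transform of a cadlag path *)

Section CadlagPaths.
Context {R : realType}.
Variable w : R -> R.
Hypothesis cw : cadlag w.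

Lemma cadlag_right t e : 0 <= t -> 0 < e -> exists2 dl, 0 < dl &
  forall x, t <= x < t + dl -> `|w x - w t| <= e.
Proof.
move=> t0 e0; have [/cvgrPdist_le/(_ e e0) [dl /= dl0 h] _] := cw t0.
exists dl => // x /andP[tx xd]; rewrite distrC.
move: tx; rewrite le_eqVlt => /orP[/eqP <-|tx]; first by rewrite subrr normr0 ltW.
by apply: h => //=; rewrite distrC gtr0_norm ?subr_gt0 // ltrBlDl.
Qed.

Lemma cadlag_left t : 0 < t -> exists l, forall e, 0 < e -> exists2 dl, 0 < dl &
  forall x, t - dl < x < t -> `|w x - l| <= e.
Proof.
move=> t0; have [_ /(_ t0) /cvg_ex[l hl]] := cw (ltW t0); exists l => e e0.
have /cvgrPdist_le/(_ e e0) [dl /= dl0 h] := hl.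
exists dl => // x /andP[xd xt]; rewrite distrC.
by apply: h => //=; rewrite gtr0_norm ?subr_gt0 //; lra.
Qed.

Definition small_osc e u v := forall x y, u <= x < v -> u <= y < v -> `|w x - w y| <= e.

Definition cut e t J (s : nat -> R) := [/\ s 0%N = 0, s J = t,
  forall j, (j < J)%N -> s j < s j.+1 & forall j, (j < J)%N -> small_osc e (s j) (s j.+1)].

Lemma cut_ext e t t' J s : cut e t J s -> t < t' -> small_osc e t t' ->
  cut e t' J.+1 (fun j => if (j <= J)%N then s j else t').
Proof.
move=> [s0 sJ sm so] tt' ot; split => //=.
- by rewrite ltnn.
- move=> j; rewrite ltnS => jJ; rewrite jJ; case: (ltnP j J) => jJ2; first exact: sm.
  by have -> : j = J; [apply/eqP; rewrite eqn_leq jJ|rewrite sJ].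
- move=> j; rewrite ltnS => jJ; rewrite jJ; case: (ltnP j J) => jJ2; first exact: so.
  by have -> : j = J; [apply/eqP; rewrite eqn_leq jJ|rewrite sJ].
Qed.

(** The supremum of the times that admit a subdivision is itself one of them, by the left limit, and
    right continuity passes beyond it unless it is [T]. *)
Lemma cadlag_cut e T : 0 < e -> 0 <= T -> exists J s, cut e T J s.
Proof.
move=> e0 T0; have e20 : 0 < e / 2 by rewrite divr_gt0.
pose S := [set t | 0 <= t <= T /\ exists J s, cut e t J s].
have S0 : S 0.
  by split; [rewrite lexx|exists 0%N, (fun=> 0); split].
have supS : has_sup S.
  by split; [exists 0|exists T => t [/andP[]]].
set t := sup S; have t0 : 0 <= t by apply: ub_le_sup => //; case: supS.
have tT : t <= T by apply: ge_sup => [|u [/andP[]]]; first by exists 0.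
have right u v : small_osc e u v -> forall v', v' <= v -> small_osc e u v'.
  by move=> o v' v'v x y /andP[x1 x2] /andP[y1 y2]; apply: o; apply/andP; split => //; exact: lt_le_trans v'v.
have [J [s cs]] : exists J s, cut e t J s.
  move: t0; rewrite le_eqVlt => /orP[/eqP t0|t0].
    by rewrite -t0; exists 0%N, (fun=> 0); split.
  have [l /(_ _ e20) [dl dl0 hl]] := cadlag_left t0.
  have [u [ur [J [s cs]]] tu] := sup_adherent dl0 supS.
  have ut : u <= t.
    by apply: ub_le_sup; [case: supS|split => //; exists J, s].
  move: ut; rewrite le_eqVlt => /orP[/eqP <-|ut]; first by exists J, s.
  exists J.+1; eexists; apply: (cut_ext cs ut) => x y /andP[x1 x2] /andP[y1 y2].
  rewrite (splitr e) (_ : w x - w y = (w x - l) + (l - w y)); last by ring.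
  rewrite (le_trans (ler_normD _ _)) // lerD //.
    by apply: hl; rewrite x2 andbT (lt_le_trans tu).
  by rewrite distrC; apply: hl; rewrite y2 andbT (lt_le_trans tu).
move: tT; rewrite le_eqVlt => /orP[/eqP <-|tT]; first by exists J, s.
have [dl dl0 hd] := cadlag_right t0 e20.
have tt' : t < Num.min T (t + dl) by rewrite lt_min tT ltrDl.
have : S (Num.min T (t + dl)).
  split; first by rewrite ge_min lexx /= andbT (le_trans t0 (ltW tt')).
  exists J.+1; eexists; apply: (cut_ext cs tt') => x y /andP[x1 x2] /andP[y1 y2].
  rewrite (splitr e) (_ : w x - w y = (w x - w t) + (w t - w y)); last by ring.
  move: x2 y2; rewrite !lt_min => /andP[_ x2] /andP[_ y2].
  rewrite (le_trans (ler_normD _ _)) // lerD //; first by apply: hd; rewrite x1.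
  by rewrite distrC; apply: hd; rewrite y1.
move=> /(ub_le_sup _) h; have := h ltac:(by case: supS); rewrite -/t leNgt tt'.
by [].
Qed.

Lemma cut_locate e T J s x : cut e T J s -> 0 <= x < T ->
  exists2 j, (j < J)%N & s j <= x < s j.+1.
Proof.
move=> [s0 sJ sm so] /andP[x0]; rewrite -sJ.
elim: (J) => [|k IHk]; first by rewrite s0 ltNge x0.
have [tk _|tk h] := ltP x (s k).
  by have [j jk h] := IHk tk; exists j => //; exact: leqW.
by exists k => //; rewrite tk.
Qed.

Lemma cadlag_bounded T : exists2 B, 0 <= B & forall x, 0 <= x <= T -> `|w x| <= B.
Proof.
have [T0|T0] := ltP T 0.
  by exists 0 => // x /andP[x0 xT]; have := lt_le_trans T0 (le_trans x0 xT); rewrite ltxx.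
have [J [s cs]] := cadlag_cut ltr01 (addr_ge0 T0 ler01).
exists (\sum_(0 <= j < J) `|w (s j)| + 1); first by rewrite addr_ge0 // sumr_ge0.
move=> x /andP[x0 xT].
have xr : 0 <= x < T + 1 by rewrite x0 (le_lt_trans xT) // ltrDl.
have [j jJ xj] := cut_locate cs xr.
have [_ _ sm so] := cs.
have h : `|w x - w (s j)| <= 1 by apply: (so j jJ) => //; rewrite lexx sm.
have h2 : `|w (s j)| <= \sum_(0 <= j < J) `|w (s j)|.
  by rewrite big_mkord (bigD1 (Ordinal jJ)) //= lerDl sumr_ge0.
rewrite -[w x](subrK (w (s j))) (le_trans (ler_normD _ _)) // addrC lerD //.
Qed.

(** Right continuity: the values at grid points strictly to the right of [x] converge to the value
    at [x]. *)
Lemma cadlag_measurable : measurable_fun `[(0 : R), +oo[ w.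
Proof.
refine (@measurable_fun_cvg _ _ _ _ (fun m (x : R) => w ((Num.truncn (x * m.+1%:R)).+1%:R / m.+1%:R)) _ _ _).
  move=> m; apply: measurable_funTS.
  exact: (measurable_truncn_fct (fun k => w (k.+1%:R / m.+1%:R)) m.+1%:R).
move=> x /=; rewrite in_itv /= andbT => x0.
apply/cvgrPdist_le => e e0; have [dl dl0 hd] := cadlag_right x0 e0.
near=> m; rewrite distrC; apply: hd.
have md : dl^-1 < m%:R by near: m; exact: nbhs_infty_gtr.
have m0 : 0 < (m.+1%:R : R) by rewrite ltr0n.
have md' : dl^-1 < m.+1%:R by rewrite (lt_trans md) // ltr_nat.
have xm0 : 0 <= x * m.+1%:R by rewrite mulr_ge0 // ltW.
have /andP[t1 t2] := truncn_itv xm0.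
move: m0 md' t1 t2; set q : R := m.+1%:R; rewrite -natr1; set k : R := (Num.truncn _)%:R => q0 md' t1 t2.
rewrite ler_pdivlMr // ltW //= ltr_pdivrMr // mulrDl.
have : 1 < dl * q by rewrite -ltr_pdivrMl // mulr1.
lra.
Unshelve. all: by end_near. Qed.

Variable gamma : R.
Hypothesis gamma_gt0 : 0 < gamma.

Definition clock_int u : R := fine (lamperti_I gamma w u).
Local Notation J := clock_int.

Let f x : \bar R := (expR (gamma * w x))%:E.

Let mf : measurable_fun `[(0 : R), +oo[ f.
Proof.
apply/measurable_EFinP; apply: measurableT_comp => //.
by apply: measurable_funM => //; exact: cadlag_measurable.
Qed.

Let mfs (A : set R) : measurable A -> A `<=` `[(0 : R), +oo[ -> measurable_fun A f.
Proof. by move=> mA A0; exact: measurable_funS mf. Qed.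

Let f0 x : (0 <= f x)%E.
Proof. by rewrite lee_fin expR_ge0. Qed.

Let lamperti_I_co u : lamperti_I gamma w u = (\int[lebesgue_measure]_(x in `[0%R, u[) f x)%E.
Proof.
rewrite /lamperti_I -integral_itv_bndo_bndc //; apply: mfs => //.
by move=> x /=; rewrite !in_itv /= andbT => /andP[].
Qed.

Lemma lamperti_I_split u v : 0 <= u -> u <= v ->
  lamperti_I gamma w v = (lamperti_I gamma w u + \int[lebesgue_measure]_(x in `[u, v[) f x)%E.
Proof.
move=> u0 uv; rewrite !lamperti_I_co.
have E : `[0, v[%classic = `[0, u[%classic `|` `[u, v[%classic :> set R.
  apply/seteqP; split => x /=; rewrite !in_itv /=.
    move=> /andP[x0 xv]; have [xu|xu] := ltP x u; [left|right]; rewrite ?x0 ?xu //.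
  by case=> /andP[h1 h2]; apply/andP; split => //; [exact: lt_le_trans uv|exact: le_trans h1].
rewrite {1}E ge0_integral_setU //.
- by rewrite -E; apply: mfs => // x /=; rewrite !in_itv /= andbT => /andP[].
- apply/disj_setPS => x [] /=; rewrite !in_itv /= => /andP[_ h1] /andP[h2 _].
  by have := lt_le_trans h1 h2; rewrite ltxx.
Qed.

Lemma clock_piece u v m M : 0 <= u -> u <= v -> 0 <= m ->
  (forall x, u <= x < v -> m <= expR (gamma * w x) <= M) ->
  ((m * (v - u))%:E <= \int[lebesgue_measure]_(x in `[u, v[) f x <= (M * (v - u))%:E)%E.
Proof.
move=> u0 uv m0 h.
have mm : measurable_fun `[u, v[ f.
  by apply: mfs => // x /=; rewrite !in_itv /= andbT => /andP[h1 _]; exact: le_trans h1.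
have lE : lebesgue_measure `[u, v[%classic = (v - u)%:E :> \bar R.
  rewrite lebesgue_measure_itv /=; case: ifPn => //; rewrite lte_fin -leNgt => vu.
  have vE : v = u by apply/eqP; rewrite eq_le uv vu.
  by rewrite vE subrr.
have intc c : (\int[lebesgue_measure]_(x in `[u, v[) (cst c%:E) x = (c * (v - u))%:E)%E.
  by rewrite integral_cst // [X in (_ * X)%E]lE EFinM.
apply/andP; split.
  rewrite -intc; apply: ge0_le_integral => //.
  by move=> x /=; rewrite in_itv /= => /h /andP[]; rewrite lee_fin.
have [uv'|uv'] := ltP u v; last first.
  have -> : v = u by apply/eqP; rewrite eq_le uv uv'.
  by rewrite set_itvco0 integral_set0 subrr mulr0.
have M0 : 0 <= M by have /andP[h1 h2] := h u ltac:(by rewrite lexx); rewrite (le_trans m0) // (le_trans h1).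
rewrite -intc; apply: ge0_le_integral => //.
by move=> x /=; rewrite in_itv /= => /h /andP[]; rewrite lee_fin.
Qed.

Lemma clock_intE u : 0 <= u -> lamperti_I gamma w u = (J u)%:E.
Proof.
move=> u0; rewrite /clock_int fineK // ge0_fin_numE; last exact: integral_ge0.
have [B B0 hB] := cadlag_bounded u.
have h x : 0 <= x < u -> 0 <= expR (gamma * w x) <= expR (gamma * B).
  move=> /andP[x1 x2]; rewrite expR_ge0 ler_expR ler_pM2l //.
  by rewrite (le_trans (ler_norm _)) // hB // x1 ltW.
have /andP[_] := clock_piece (lexx 0) u0 (lexx 0) h.
by rewrite -lamperti_I_co => hle; apply: (le_lt_trans hle); rewrite ltry.
Qed.

Lemma clock_int0 : J 0 = 0.
Proof.
have h x : 0 <= x < 0 -> 0 <= expR (gamma * w x) <= 0.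
  by move=> /andP[x1 x2]; have := le_lt_trans x1 x2; rewrite ltxx.
have := clock_piece (lexx 0) (lexx 0) (lexx 0) h.
rewrite -lamperti_I_co clock_intE // !lee_fin !mul0r => /andP[h1 h2].
by apply/eqP; rewrite eq_le h1 h2.
Qed.

Lemma clock_int_diff u v m M : 0 <= u -> u <= v -> 0 <= m ->
  (forall x, u <= x < v -> m <= expR (gamma * w x) <= M) ->
  m * (v - u) <= J v - J u <= M * (v - u).
Proof.
move=> u0 uv m0 /(clock_piece u0 uv m0); have := lamperti_I_split u0 uv.
rewrite !clock_intE //; last exact: le_trans uv.
case: (integral _ _ _) => [r||] //; rewrite !lee_fin.
by move=> [->] /andP[h1 h2]; apply/andP; split; lra.
Qed.

Lemma clock_int_lt u v : 0 <= u -> u < v -> J u < J v.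
Proof.
move=> u0 uv; have [B B0 hB] := cadlag_bounded v.
have h x : u <= x < v -> expR (- (gamma * B)) <= expR (gamma * w x) <= expR (gamma * B).
  move=> /andP[x1 x2]; have : `|w x| <= B by rewrite hB // (le_trans u0) //= ltW.
  by rewrite ler_norml => /andP[h1 h2]; rewrite !ler_expR -mulrN !ler_pM2l // h1.
have /andP[h1 _] := clock_int_diff u0 (ltW uv) (expR_ge0 _) h.
by rewrite -subr_gt0; apply: lt_le_trans h1; rewrite mulr_gt0 ?expR_gt0 // subr_gt0.
Qed.

Lemma clock_int_le u v : 0 <= u -> u <= v -> J u <= J v.
Proof.
by move=> u0; rewrite le_eqVlt => /orP[/eqP ->|] //; move/(clock_int_lt u0)/ltW.
Qed.

Lemma clock_int_lip T B u v : 0 <= u -> u <= v -> v <= T ->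
  (forall x, 0 <= x <= T -> `|w x| <= B) -> J v - J u <= expR (gamma * B) * (v - u).
Proof.
move=> u0 uv vT hB.
have h x : u <= x < v -> 0 <= expR (gamma * w x) <= expR (gamma * B).
  move=> /andP[x1 x2]; rewrite expR_ge0 ler_expR ler_pM2l //.
  by rewrite (le_trans (ler_norm _)) // hB // (le_trans u0 x1) /= ltW // (lt_le_trans x2).
by have /andP[] := clock_int_diff u0 uv (lexx 0) h.
Qed.

Lemma clock_int_surj u t : 0 <= u -> 0 <= t <= J u -> exists2 x, 0 <= x <= u & J x = t.
Proof.
move=> u0 tJ; have [B B0 hB] := cadlag_bounded u.
(* Clamping the argument to $[0,u]$ makes the clock Lipschitz on the whole line, ready for the
   intermediate value theorem. *)
pose cl x := Num.max 0 (Num.min u x).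
have clr x : 0 <= cl x <= u by rewrite /cl le_max lexx /= ge_max u0 ge_min lexx.
have clE x : 0 <= x <= u -> cl x = x by move=> /andP[x0 xu]; rewrite /cl min_r // max_r.
have cll x y : x <= y -> 0 <= cl y - cl x <= y - x.
  move=> xy; rewrite /cl !maxEle !minEle.
  by move: u0 xy; clear; do ! case: ifPn; rewrite -?ltNge => *; apply/andP; split; lra.
have L0 := expR_gt0 (gamma * B); set L := expR (gamma * B) in L0.
have Jl x y : x <= y -> `|J (cl y) - J (cl x)| <= L * (y - x).
  move=> xy; have /andP[c1 c2] := cll x y xy; have /andP[c3 c4] := clr x; have /andP[c5 c6] := clr y.
  rewrite subr_ge0 in c1; rewrite ger0_norm ?subr_ge0 ?clock_int_le //.
  by apply: le_trans (clock_int_lip c3 c1 c6 hB) _; rewrite ler_pM2l.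
have [x xr Jx] : exists2 x, x \in `[0, u]%R & (J \o cl) x = t.
  apply: IVT => //; last first.
    rewrite /comp !clE ?lexx ?u0 // clock_int0; have /andP[t0 tu] := tJ.
    by rewrite min_l ?max_r ?t0 // (le_trans t0).
  apply: continuous_subspaceT => x; apply/cvgrPdist_le => e e0.
  near=> y; have h : `|x - y| <= e / L.
    by near: y; apply: cvgr_dist_le => //; rewrite divr_gt0.
  apply: (@le_trans _ _ (L * `|x - y|)); last by rewrite mulrC -ler_pdivlMr.
  have [xy|xy] := leP x y; first by rewrite distrC [`|x - y|]distrC [`|y - x|]ger0_norm ?subr_ge0 //; exact: Jl.
  by rewrite [`|x - y|]gtr0_norm ?subr_gt0 //; apply: Jl; exact: ltW.
rewrite in_itv /= in xr; exists x => //; by rewrite /= clE in Jx.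
Unshelve. all: by end_near. Qed.

Lemma lamperti_Iinf_gt t : (t%:E < lamperti_Iinf gamma w)%E <-> exists2 u, 0 <= u & t < J u.
Proof.
split=> [tI|[u u0 tu]]; last first.
  apply: (@lt_le_trans _ _ (J u)%:E); first by rewrite lte_fin.
  rewrite -clock_intE //; apply: ge0_subset_integral => //.
  by move=> x /=; rewrite !in_itv /= andbT => /andP[].
have cvI : (fun n => lamperti_I gamma w n%:R) @ \oo --> lamperti_Iinf gamma w.
  have -> : lamperti_Iinf gamma w = (\int[lebesgue_measure]_(x in \bigcup_n `[0%R, (n%:R)%R]%classic) f x)%E.
    rewrite /lamperti_Iinf; congr integral; apply/seteqP; split => x /=; rewrite in_itv /= andbT.
      move=> x0; exists (Num.truncn x).+1 => //=; rewrite in_itv /= x0 /=.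
      by apply: ltW; exact: truncnS_gt.
    by move=> [n _] /=; rewrite in_itv /= => /andP[].
  apply: ge0_nondecreasing_set_cvg_integral => //.
  - move=> n m nm; apply/subsetPset => x /=; rewrite !in_itv /= => /andP[-> xn] /=.
    by rewrite (le_trans xn) // ler_nat.
  - by move=> i; apply: mfs => // x /=; rewrite !in_itv /= andbT => /andP[].
have [n hn] : exists n, (t%:E < lamperti_I gamma w n%:R)%E.
  apply: contrapT => /forallNP H.
  have : (lamperti_Iinf gamma w <= t%:E)%E.
    rewrite -(cvg_lim _ cvI) //; apply: lime_le; first exact: (cvgP _ cvI).
    by apply: nearW => n; rewrite leNgt; apply/negP; exact: H.
  by rewrite leNgt tI.
by exists n%:R => //; move: hn; rewrite clock_intE // lte_fin.
Qed.

Lemma lamperti_tauE u : 0 <= u -> lamperti_tau gamma w (J u) = u.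
Proof.
move=> u0; rewrite /lamperti_tau.
have -> : [set v | 0 <= v /\ ((J u)%:E < lamperti_I gamma w v)%E] = `]u, +oo[%classic.
  apply/seteqP; split => v /=; rewrite in_itv /= andbT.
    move=> [v0]; rewrite clock_intE // lte_fin => uv; rewrite ltNge; apply/negP => vu.
    by have := lt_le_trans uv (clock_int_le v0 vu); rewrite ltxx.
  move=> uv; have v0 := le_trans u0 (ltW uv).
  by split => //; rewrite clock_intE // lte_fin clock_int_lt.
by rewrite inf_itv // bnd_simp.
Qed.

Lemma lampertiE u : 0 <= u -> lamperti gamma w (J u) = expR (w u).
Proof.
move=> u0; rewrite /lamperti.
have -> : ((J u)%:E < lamperti_Iinf gamma w)%E.
  apply/lamperti_Iinf_gt; exists (u + 1); first exact: addr_ge0.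
  by apply: clock_int_lt => //; rewrite ltrDl.
by rewrite lamperti_tauE.
Qed.

Lemma expR_osc B e : 0 < e -> exists2 eta : R, 0 < eta &
  forall x y, `|x| <= B -> `|x - y| <= eta -> `|expR y - expR x| <= e.
Proof.
move=> e0; have B0 := expR_gt0 B.
have := @continuous_expR R 0 => /cvgrPdist_le /(_ (e / expR B)).
rewrite divr_gt0 // => /(_ isT) [eta /= eta0 h].
exists (eta / 2); first by rewrite divr_gt0.
move=> x y xB xy; rewrite expR0 in h.
have -> : expR y - expR x = expR x * (expR (y - x) - 1).
  by rewrite mulrBr mulr1 -expRD; congr (expR _ - _); ring.
rewrite normrM (ger0_norm (expR_ge0 _)).
have xB' : expR x <= expR B by rewrite ler_expR (le_trans (ler_norm _)).
have h2 : `|expR (y - x) - 1| <= e / expR B.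
  by rewrite distrC; apply: h => /=; rewrite sub0r normrN distrC; lra.
apply: (@le_trans _ _ (expR B * (e / expR B))); first by apply: ler_pM => //; exact: expR_ge0.
by rewrite mulrCA divff ?mulr1 // gt_eqF.
Qed.

Hypothesis Iinf : lamperti_Iinf gamma w = +oo%E.

Lemma clock_int_onto t : 0 <= t -> exists2 u, 0 <= u & J u = t.
Proof.
move=> t0; have /lamperti_Iinf_gt[u u0 tu] : (t%:E < lamperti_Iinf gamma w)%E by rewrite Iinf ltry.
have [x /andP[x0 _] Jx] := clock_int_surj u0 (introT andP (conj t0 (ltW tu))).
by exists x.
Qed.

Lemma clock_int_ltI u v : 0 <= u -> 0 <= v -> J u < J v -> u < v.
Proof.
move=> u0 v0 uv; rewrite ltNge; apply/negP => vu.
by have := lt_le_trans uv (clock_int_le v0 vu); rewrite ltxx.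
Qed.

Lemma clock_int_leI u v : 0 <= u -> 0 <= v -> J u <= J v -> u <= v.
Proof.
move=> u0 v0 uv; rewrite leNgt; apply/negP => vu.
by have := le_lt_trans uv (clock_int_lt v0 vu); rewrite ltxx.
Qed.

Lemma lamperti_cadlag : cadlag (lamperti gamma w).
Proof.
move=> t t0; have [u u0 Ju] := clock_int_onto t0; split.
  apply/cvgrPdist_le => e e0; have [eta eta0 he] := expR_osc `|w u| e0.
  have [dl dl0 hd] := cadlag_right u0 eta0.
  have Jd : 0 < J (u + dl) - t by rewrite subr_gt0 -Ju clock_int_lt // ltrDl.
  exists (J (u + dl) - t) => // t' /= tt' tt.
  have t'0 := le_trans t0 (ltW tt); have [x x0 Jx] := clock_int_onto t'0.
  rewrite -Jx -Ju !lampertiE // distrC; apply: he => //.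
  rewrite distrC; apply: hd; rewrite clock_int_leI ?Jx ?Ju ?(ltW tt) //=.
  apply: clock_int_ltI => //; first by rewrite addr_ge0 // ltW.
  by move: tt'; rewrite distrC gtr0_norm ?subr_gt0 // Jx; lra.
move=> tgt0; have u1 : 0 < u by apply: clock_int_ltI => //; rewrite clock_int0 Ju.
have [l hl] := cadlag_left u1; apply/cvg_ex; exists (expR l).
apply/cvgrPdist_le => e e0; have [eta eta0 he] := expR_osc `|l| e0.
have [dl dl0 hd] := hl _ eta0.
pose u' := Num.max 0 (u - dl).
have u'0 : 0 <= u' by rewrite le_max lexx.
have u'u : u' < u by rewrite gt_max u1 ltrBlDr ltrDl.
have Jd : 0 < t - J u' by rewrite subr_gt0 -Ju clock_int_lt.
exists (t - J u') => // t' /= tt' tt.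
have Jt' : J u' < t' by move: tt'; rewrite gtr0_norm ?subr_gt0 //; lra.
have t'0 : 0 <= t' by apply: le_trans (ltW Jt'); rewrite -clock_int0 clock_int_le.
have [x x0 Jx] := clock_int_onto t'0.
rewrite -Jx lampertiE // distrC; apply: he => //.
rewrite distrC; apply: hd; apply/andP; split; last by apply: clock_int_ltI => //; rewrite Jx Ju.
apply: le_lt_trans (_ : u' < x); first by rewrite le_max lexx orbT.
by apply: clock_int_ltI => //; rewrite Jx.
Qed.

End CadlagPaths.

(** * Sampling a cadlag path on a grid *)

Section SampledPath.
Context {R : realType}.
Variables (w : R -> R) (gamma : R).
Hypothesis cw : cadlag w.
Hypothesis gamma_gt0 : 0 < gamma.

Local Notation J := (clock_int w gamma).
Local Notation smpl h := (fun i : nat => w (i%:R * h)).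

Lemma sum_eq_le1 (S : nat -> R) n a : injective S -> \sum_(i < n) (S i == a)%:R <= 1 :> R.
Proof.
move=> Si; have [[i Sa]|no] := pselect (exists i : 'I_n, S i = a).
  rewrite (bigD1 i) //= Sa eqxx big1 ?addr0 // => j ji.
  have -> // : (S j == a) = false.
  by apply/eqP; rewrite -Sa => /Si h; move/negP: ji; apply; apply/eqP; exact: val_inj.
rewrite big1 // => i _; have -> // : (S i == a) = false.
by apply/eqP => h; apply: no; exists i.
Qed.

Lemma cut_gap n (s : nat -> R) : (forall j, (j < n)%N -> s j < s j.+1) ->
  exists2 g, 0 < g & forall i j, (i < j)%N -> (j <= n)%N -> g <= s j - s i.
Proof.
elim: n => [|n IH] sm.
  by exists 1 => // i j ij; rewrite leqn0 => /eqP j0; rewrite j0 in ij.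
have [g g0 hg] := IH (fun j jn => sm j (ltnW jn)).
exists (Num.min g (s n.+1 - s n)); first by rewrite lt_min g0 subr_gt0 sm.
move=> i j ij; rewrite leq_eqVlt ltnS => /orP[/eqP jE|jn]; last by rewrite ge_min hg.
rewrite jE ge_min; apply/orP; right; rewrite lerD2l lerN2.
by apply: (incr_le sm); [rewrite -ltnS -jE|exact: leqnSn].
Qed.

(** The boundary [S i] is moved back from [i * h] to the cut point in the preceding cell, if there
    is one. On [[S i, S i.+1[] the path then stays within one oscillation of its value at [i * h].
    Only [n.+1] boundaries can move, each by at most [h], so [clock_compare] applies with a total
    displacement [n.+1 * h]. *)
Lemma cadlag_blocks T e : 0 < T -> 0 < e -> exists2 dl, 0 < dl & forall h, 0 < h < dl ->
  exists S : nat -> R, [/\ S 0%N = 0, forall i, i%:R * h - h < S i <= i%:R * h,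
    forall i x, i.+1%:R * h <= T -> S i <= x < S i.+1 ->
      `|expR (w x) - expR (w (i%:R * h))| <= e &
    forall j, j%:R * h <= T -> `|J (S j) - step_clock gamma h (smpl h) j| <= e].
Proof.
move=> T0 e0; have [B B0 hB] := cadlag_bounded cw T.
have C0 := expR_gt0 (gamma * B); set C := expR _ in C0.
pose kap := e / 2 / (C * T).
have kap0 : 0 < kap by rewrite !divr_gt0 // mulr_gt0.
have [eta1 eta10 he1] := expR_osc B e0.
have [eta2 eta20 he2] := expR_osc 0 kap0.
pose eta := Num.min eta1 (eta2 / gamma).
have eta0 : 0 < eta by rewrite lt_min eta10 divr_gt0.
have [n [s cs]] := cadlag_cut cw eta0 (ltW T0).
have [s0 sn sm so] := cs.
have [g g0 hg] := cut_gap sm.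
have n0 : 0 < (n.+1%:R : R) by rewrite ltr0n.
(* Below the gap [g] a cell contains at most one cut point; the second bound makes the displaced
   boundaries cost at most [e / 2]. *)
exists (Num.min g (e / 2 / (C * (2 * n.+1%:R)))).
  by rewrite lt_min g0 !divr_gt0 // !mulr_gt0.
move=> h /andP[h0]; rewrite lt_min => /andP[hg0 hc].
have uniq_s a i j : (i <= n)%N -> (j <= n)%N -> a - h < s i <= a -> a - h < s j <= a -> s i = s j.
  move=> iK jK /andP[i1 i2] /andP[j1 j2]; have [ij|ij|-> //] := ltngtP i j.
    by have := hg i j ij jK; lra.
  by have := hg j i ij iK; lra.
have /choice[S SP] : forall i : nat, exists x, [/\ i%:R * h - h < x <= i%:R * h,
    forall j, (j <= n)%N -> i%:R * h - h < s j <= i%:R * h -> s j = x &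
    x = i%:R * h \/ exists2 j, (j <= n)%N & x = s j].
  move=> i; have [[j jn sj]|no] := pselect (exists2 j, (j <= n)%N & i%:R * h - h < s j <= i%:R * h).
    exists (s j); split => //; last by right; exists j.
    by move=> j' j'n sj'; exact: uniq_s sj.
  exists (i%:R * h); split; [by rewrite lexx andbT ltrBlDr ltrDl| |by left].
  by move=> j jn sj; exfalso; apply: no; exists j.
have S0 : S 0%N = 0.
  by have [_ H _] := SP 0%N; rewrite -(H 0%N) // s0 mul0r lexx sub0r oppr_lt0 h0.
have SS i : S i < S i.+1.
  have [/andP[_ h1] _ _] := SP i; have [/andP[h2 _] _ _] := SP i.+1.
  by apply: le_lt_trans h1 _; move: h2; rewrite -natr1 mulrDl mul1r addrK.
have Si : injective S.
  have inc i k : S i < S (i + k.+1)%N.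
    elim: k => [|k IH]; first by rewrite addn1.
    by rewrite addnS; exact: lt_trans (SS _).
  move=> i j; have [ij|ij|//] := ltngtP i j.
    by have := inc i (j - i.+1)%N; rewrite addnS -addSn subnKC // => h1 h2; rewrite h2 ltxx in h1.
  by have := inc j (i - j.+1)%N; rewrite addnS -addSn subnKC // => h1 h2; rewrite h2 ltxx in h1.
have Sge0 i : 0 <= S i.
  by elim: i => [|i IH]; [rewrite S0|exact: le_trans (ltW (SS i))].
have osc i x : i.+1%:R * h <= T -> S i <= x < S i.+1 -> `|w (i%:R * h) - w x| <= eta.
  move=> iT xr; have [/andP[a1 a2] a3 _] := SP i; have [/andP[b1 b2] b3 _] := SP i.+1.
  have iS : i.+1%:R * h - h = i%:R * h by rewrite -natr1 mulrDl mul1r addrK.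
  rewrite iS in b1 b3.
  have SiT : 0 <= S i < T by rewrite Sge0 (lt_le_trans (SS i)) // (le_trans b2).
  have [j jn /andP[j1 j2]] := cut_locate cs SiT.
  have j3 : S i.+1 <= s j.+1.
    rewrite leNgt; apply/negP => h1.
    have [h2|h2] := leP (s j.+1) (i%:R * h).
      by have := a3 j.+1 jn; rewrite h2 andbT (lt_trans a1) // => /(_ isT) h3; rewrite h3 ltxx in j2.
    by have := b3 j.+1 jn; rewrite h2 (le_trans (ltW h1)) // => /(_ isT) h3; rewrite h3 ltxx in h1.
  have /andP[x1 x2] := xr.
  apply: (so j jn); first by rewrite (le_trans j1) // (lt_le_trans b1).
  by rewrite (le_trans j1) //= (lt_le_trans x2).
have iT' i : i.+1%:R * h <= T -> 0 <= i%:R * h <= T.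
  move=> iT; rewrite mulr_ge0 //=; last exact: ltW.
  by apply: le_trans iT; rewrite ler_pM2r // ler_nat.
exists S; split => //.
- by move=> i; have [] := SP i.
- move=> i x iT xr; have := osc i x iT xr => o; apply: he1; first by apply: hB; exact: iT'.
  by apply: le_trans o _; rewrite ge_min lexx.
move=> j jT.
have Kb i : (i < j)%N -> i.+1%:R * h <= T.
  by move=> ij; apply: le_trans jT; rewrite ler_pM2r // ler_nat.
have rb i : (i < j)%N -> 0 <= expR (gamma * w (i%:R * h)) <= C.
  move=> ij; rewrite expR_ge0 ler_expR ler_pM2l // (le_trans (ler_norm _)) // hB //.
  exact: iT' (Kb i ij).
have rel i : (i < j)%N -> `|J (S i.+1) - J (S i) - expR (gamma * w (i%:R * h)) * (S i.+1 - S i)| <=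
    kap * (expR (gamma * w (i%:R * h)) * (S i.+1 - S i)).
  move=> ij; set r := expR (gamma * w (i%:R * h)).
  have r0 : 0 < r by exact: expR_gt0.
  have Hx x : S i <= x < S i.+1 -> Num.max 0 (r * (1 - kap)) <= expR (gamma * w x) <= r * (1 + kap).
    move=> xr; have o := osc i x (Kb i ij) xr.
    have -> : expR (gamma * w x) = r * expR (gamma * (w x - w (i%:R * h))).
      by rewrite /r -expRD; congr expR; ring.
    have : `|expR (gamma * (w x - w (i%:R * h))) - expR 0| <= kap.
      apply: he2; first by rewrite normr0.
      rewrite sub0r normrN normrM gtr0_norm // distrC mulrC -ler_pdivlMr //.
      by apply: (le_trans o); rewrite ge_min lexx orbT.
    rewrite expR0 ler_norml => /andP[h1 h2].
    rewrite ge_max mulr_ge0 ?expR_ge0 ?(ltW r0) //= !ler_pM2l //.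
    by apply/andP; split; lra.
  have m0 : 0 <= Num.max 0 (r * (1 - kap)) by rewrite le_max lexx.
  have /andP[d1 d2] := clock_int_diff cw gamma_gt0 (Sge0 i) (ltW (SS i)) m0 Hx.
  have dS : 0 <= S i.+1 - S i by rewrite subr_ge0 ltW.
  have d3 : r * (1 - kap) * (S i.+1 - S i) <= J (S i.+1) - J (S i).
    by apply: le_trans d1; rewrite ler_wpM2r // le_max lexx orbT.
  have E1 : r * (1 - kap) * (S i.+1 - S i) = r * (S i.+1 - S i) - kap * (r * (S i.+1 - S i)) by ring.
  have E2 : r * (1 + kap) * (S i.+1 - S i) = r * (S i.+1 - S i) + kap * (r * (S i.+1 - S i)) by ring.
  rewrite E1 in d3; rewrite E2 in d2; rewrite ler_norml; apply/andP; split; lra.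
have devs : \sum_(0 <= i < j.+1) `|S i - i%:R * h| <= n.+1%:R * h.
  rewrite big_mkord.
  apply: (@le_trans _ _ (\sum_(i < j.+1) h * \sum_(l < n.+1) (S i == s l)%:R)).
    apply: ler_sum => i _; have [/andP[h1 h2] _ [Sih|[l ln Sl]]] := SP i.
      by rewrite Sih subrr normr0; apply: mulr_ge0; [exact: ltW|exact: sumr_ge0].
    rewrite distrC ger0_norm ?subr_ge0 // -[leLHS]mulr1.
    apply: ler_pM => //; first by rewrite subr_ge0.
      by move: h1; lra.
    rewrite (bigD1 (Ordinal (ln : (l < n.+1)%N))) //= -Sl eqxx lerDl.
    exact: sumr_ge0.
  rewrite -mulr_sumr mulrC exchange_big /=; apply: ler_wpM2r; first exact: ltW.
  apply: (@le_trans _ _ (\sum_(l < n.+1) 1)); last by rewrite sumr_const card_ord.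
  by apply: ler_sum => l _; exact: sum_eq_le1.
have Cge0 : 0 <= C by exact: ltW.
have := clock_compare (ltW kap0) Cge0 S0 _ (fun i _ => ltW (SS i)) rb rel devs (leqnn j).
rewrite S0 (clock_int0 cw gamma_gt0) => /(_ erefl) hh; apply: (le_trans hh).
have Sj : S j <= T by have [/andP[_ h1] _ _] := SP j; exact: le_trans jT.
have t1 : C * (kap * S j) <= e / 2.
  apply: (@le_trans _ _ (kap * (C * T))); last by rewrite /kap divfK // gt_eqF // mulr_gt0.
  by rewrite mulrCA; apply: ler_wpM2l; [exact: ltW|rewrite ler_pM2l].
have t2 : C * (2 * (n.+1%:R * h)) <= e / 2.
  have CN : 0 < C * (2 * n.+1%:R) by rewrite !mulr_gt0.
  by apply: ltW; rewrite ltr_pdivlMr // in hc; rewrite (_ : C * _ = h * (C * (2 * n.+1%:R))) //; ring.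
by rewrite mulrDr (splitr e) lerD.
Qed.

Lemma step_close e : 0 < e -> lamperti_Iinf gamma w = +oo%E ->
  exists T dl, [/\ 0 < dl, 0 < T & forall h K, 0 < h < dl -> T <= K%:R * h ->
    [/\ close_paths e (lamperti_step gamma h K (smpl h)) (lamperti gamma w),
       close_paths e (lamperti gamma w) (lamperti_step gamma h K (smpl h)) &
       e^-1 < step_clock gamma h (smpl h) K]].
Proof.
move=> e0 Iinf.
have [u u0 uJ] : exists2 u, 0 <= u & e^-1 + e < J u.
  by apply/(lamperti_Iinf_gt cw gamma_gt0); rewrite Iinf ltry.
have T0 : 0 < u + 2 by rewrite ltr_wpDl.
have [dl dl0 hdl] := cadlag_blocks T0 e0.
exists (u + 2), (Num.min dl 1); split => //; first by rewrite lt_min dl0 ltr01.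
move=> h K /andP[h0]; rewrite lt_min => /andP[hd h1] TK.
have [S [S0 Sr Sv Sc]] := hdl h (introT andP (conj h0 hd)).
(* Two more cells than [u / h]: [S K0] still exceeds [u] after being moved back by less than [h],
   while [K0 * h <= u + 2] because [h < 1]. *)
pose K0 := (Num.truncn (u / h)).+2.
have uh0 : 0 <= u / h by rewrite divr_ge0 // ltW.
have /andP[k1 k2] := truncn_itv uh0.
have K0T : K0%:R * h <= u + 2.
  rewrite /K0 -natr1 -natr1 !mulrDl mul1r; move: k1; rewrite ler_pdivlMr //.
  by set q := _%:R * h; lra.
have K0u : u <= K0%:R * h - h.
  rewrite /K0 -natr1 mulrDl mul1r addrK; apply: ltW.
  by rewrite ltr_pdivrMr // in k2; exact: k2.
have K0K : (K0 <= K)%N.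
  by rewrite -(ler_nat R) -(ler_pM2r h0); exact: le_trans TK.
have Sm i : S i < S i.+1.
  have /andP[_ a1] := Sr i; have /andP[a2 _] := Sr i.+1.
  by apply: le_lt_trans a1 _; move: a2; rewrite -natr1 mulrDl mul1r addrK.
have Sge0 i : 0 <= S i.
  by elim: i => [|i IH]; [rewrite S0|exact: le_trans (ltW (Sm i))].
have Jm i : J (S i) < J (S i.+1) by exact: clock_int_lt.
have iT i : (i <= K0)%N -> i%:R * h <= u + 2.
  by move=> iK; apply: le_trans K0T; rewrite ler_pM2r // ler_nat.
have cc i : (i <= K0)%N -> `|J (S i) - step_clock gamma h (smpl h) i| <= e.
  by move=> iK; apply: Sc; exact: iT.
have JK : e^-1 + e < J (S K0).
  apply: lt_le_trans uJ _; apply: clock_int_le => //; apply: (le_trans K0u).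
  by have /andP[a1 _] := Sr K0; exact: ltW.
have CK : e^-1 < step_clock gamma h (smpl h) K0.
  by have := cc K0 (leqnn _); rewrite ler_norml => /andP[_]; move: JK; set q := e^-1; lra.
have J0 : J (S 0%N) = 0 by rewrite S0 clock_int0.
have eKJ : e^-1 < J (S K0) by move: JK; set q := e^-1; lra.
have val j t t' : (j < K0)%N -> step_clock gamma h (smpl h) j <= t < step_clock gamma h (smpl h) j.+1 ->
    J (S j) <= t' < J (S j.+1) -> `|lamperti_step gamma h K (smpl h) t - lamperti gamma w t'| <= e.
  move=> jK tr /andP[t'1 t'2].
  rewrite /lamperti_step (step_pathE _ _ (leq_trans jK K0K) tr); last by move=> i _; exact: step_clock_lt.
  have t'0 : 0 <= t' by apply: le_trans t'1; rewrite -J0; apply: clock_int_le => //; rewrite S0.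
  have [x x0 Jx] := clock_int_onto cw gamma_gt0 Iinf t'0.
  rewrite -Jx lampertiE // distrC; apply: Sv; first exact: iT.
  apply/andP; split; first by apply: (clock_int_leI cw gamma_gt0) => //; rewrite Jx.
  by apply: (clock_int_ltI cw gamma_gt0) => //; rewrite Jx.
split.
- apply: (@close_blocks _ K0 (step_clock gamma h (smpl h)) (fun i => J (S i))) => //.
  + exact: step_clock0.
  + by move=> j _; exact: step_clock_lt.
  + by move=> j jK; rewrite distrC; exact: cc.
- apply: (@close_blocks _ K0 (fun i => J (S i)) (step_clock gamma h (smpl h))) => //.
  + exact: step_clock0.
  + by move=> j _; exact: step_clock_lt.
  + by move=> j t t' jK tr t'r; rewrite distrC; exact: (val j t' t jK t'r tr).
- apply: lt_le_trans CK _.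
  by apply: (incr_le (K := K)) => // j _; exact: step_clock_lt.
Qed.

Definition mesh m : R := ((2 ^ m)%:R)^-1.

Lemma mesh_gt0 m : 0 < mesh m.
Proof. by rewrite invr_gt0 ltr0n expn_gt0. Qed.

Lemma step_clock_cvg T (K : nat -> nat) : 0 <= T -> (\forall m \near \oo, (K m)%:R * mesh m = T) ->
  (fun m => step_clock gamma (mesh m) (smpl (mesh m)) (K m)) @ \oo --> J T.
Proof.
rewrite le_eqVlt => /orP[/eqP <- Km|T0 Km].
  rewrite clock_int0 //; apply: cvg_near_cst; apply: filterS Km => m /eqP.
  by rewrite mulf_eq0 (gt_eqF (mesh_gt0 m)) orbF pnatr_eq0 => /eqP ->; rewrite step_clock0.
have [B B0 hB] := cadlag_bounded cw T.
apply/cvgrPdist_le => e e0; have e20 : 0 < e / 2 by rewrite divr_gt0.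
have [dl dl0 hdl] := cadlag_blocks T0 e20.
have C0 := expR_gt0 (gamma * B); set C := expR _ in C0.
have d0 : 0 < Num.min dl (Num.min (e / 2 / C) T) by rewrite !lt_min dl0 T0 !divr_gt0.
near=> m.
have m1 : (Num.min dl (Num.min (e / 2 / C) T))^-1 < (2 ^ m)%:R.
  apply: (@lt_le_trans _ _ (m%:R)); last by rewrite ler_nat ltnW // ltn_expl.
  near: m; exact: nbhs_infty_gtr.
have KT : (K m)%:R * mesh m = T by near: m.
have hb : mesh m < Num.min dl (Num.min (e / 2 / C) T).
  by rewrite /mesh invf_plt // posrE ltr0n expn_gt0.
have h0 := mesh_gt0 m; set h := mesh m in KT hb h0 *.
move: hb; rewrite !lt_min => /and3P[hd hC hT].
have [S [S0 Sr Sv Sc]] := hdl h (introT andP (conj h0 hd)).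
have h1 := Sc (K m); rewrite KT lexx in h1; have {}h1 := h1 isT.
have /andP[s1 s2] := Sr (K m); rewrite KT in s1 s2.
have S00 : 0 <= S (K m) by apply: le_trans (ltW s1); rewrite subr_ge0 ltW.
have h2 := clock_int_lip cw gamma_gt0 S00 s2 (lexx T) hB.
have h3 := clock_int_le cw gamma_gt0 S00 s2.
have h4 : C * (T - S (K m)) <= e / 2.
  rewrite ltr_pdivlMr // in hC; apply: le_trans (ltW hC).
  by rewrite mulrC ler_pM2r //; move: s1; lra.
move: h1; rewrite !ler_norml => /andP[q1 q2].
by move: h2; rewrite -/C => h2; apply/andP; split; lra.
Unshelve. all: by end_near. Qed.

End SampledPath.

(** * The clock is infinite *)

Section Walks.
Context {R : realType}.
Implicit Types (x y : nat -> R).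

Definition walk x k : R := \sum_(0 <= i < k) x i.

Lemma walk_local K x y k : (forall i, (i < K)%N -> x i = y i) -> (k <= K)%N -> walk x k = walk y k.
Proof.
move=> xy kK; apply: eq_big_nat => i /andP[_ ik]; apply: xy; exact: leq_trans kK.
Qed.

Lemma walk_cvg K (xs : nat -> nat -> R) x k : (forall i, (i < K)%N -> xs ^~ i @ \oo --> x i) ->
  (k <= K)%N -> (fun m => walk (xs m) k) @ \oo --> walk x k.
Proof.
move=> xx; elim: k => [|k IH] kK.
  rewrite {2}/walk big_geq //; rewrite (_ : (fun m => _) = fun=> 0); first exact: cvg_cst.
  by apply/funext => m; rewrite /walk big_geq.
rewrite {2}/walk big_nat_recr //=; rewrite (_ : (fun m => _) = fun m => walk (xs m) k + xs m k).
  by apply: cvgD; [exact: IH (ltnW kK)|exact: xx].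
by apply/funext => m; rewrite /walk big_nat_recr.
Qed.

Lemma cfun_walk K K' (g : (nat -> R) -> R) idx : cfun K' g -> (forall i, (i < K')%N -> (idx i <= K)%N) ->
  cfun K (fun x => g (fun i => walk x (idx i))).
Proof.
move=> [gl [M gM] gc] iK; split.
- by move=> x y xy; apply: gl => i /iK ik; exact: walk_local ik.
- by exists M.
- by move=> xs x xx; apply: gc => i /iK ik; exact: (walk_cvg xx ik).
Qed.

Variable gamma : R.

Lemma step_clock_sampled_cfun (h : R) K (g : R -> R) M : 0 <= h -> continuous g -> (forall r : R, 0 <= r -> `|g r| <= M) ->
  cfun K (fun x => g (step_clock gamma h (walk x) K)).
Proof.
move=> h0 cg gM; have sc0 x k : 0 <= step_clock gamma h x k.
  by apply: sumr_ge0 => i _; rewrite mulr_ge0 // expR_ge0.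
split.
- move=> x y xy; congr g; apply: eq_big_nat => i /andP[_ iK].
  by rewrite (walk_local xy (ltnW iK)).
- by exists M => x; exact: gM.
- move=> xs x xx; apply: continuous_cvg; first exact: cg.
  suff H k : (k <= K)%N -> (fun m => step_clock gamma h (walk (xs m)) k) @ \oo --> step_clock gamma h (walk x) k by exact: H.
  elim: k => [|k IH] kK.
    rewrite step_clock0 (_ : (fun m => _) = fun=> 0); first exact: cvg_cst.
    by apply/funext => m; rewrite step_clock0.
  rewrite {2}/step_clock big_nat_recr //=.
  rewrite (_ : (fun m => _) = fun m => step_clock gamma h (walk (xs m)) k + h * expR (gamma * walk (xs m) k)).
    apply: cvgD; first exact: IH (ltnW kK).
    apply: cvgM; first exact: cvg_cst.
    apply: continuous_cvg; first exact: continuous_expR.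
    by apply: cvgM; [exact: cvg_cst|exact: (walk_cvg xx (ltnW kK))].
  by apply/funext => m; rewrite /step_clock big_nat_recr.
Qed.

(** Restarting the path from level 0 at index [j] divides the clock by $e^{\gamma x_j}$; this is the
    scaling behind [shifted_clock]. *)
Lemma step_clock_shift h x j i :
  step_clock gamma h (fun k => x (j + k)%N - x j) i =
  expR (- gamma * x j) * (step_clock gamma h x (j + i) - step_clock gamma h x j).
Proof.
elim: i => [|i IH]; first by rewrite step_clock0 addn0 subrr mulr0.
rewrite /step_clock big_nat_recr //= addnS [in RHS]big_nat_recr //= -/(step_clock _ _ _ _) IH.
rewrite -!/(step_clock _ _ _ _) mulrDr (_ : gamma * (x (j + i)%N - x j) = - gamma * x j + gamma * x (j + i)%N); last by ring.
by rewrite expRD /step_clock; ring.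
Qed.

End Walks.

(** * A clock that may be finite forces the drift to $-\infty$ *)

Section DriftDichotomy.
Context (R : realType) d (Om : measurableType d) (Q : probability Om R).
Variables (xi : R -> Om -> R) (gamma : R).
Hypothesis gamma_gt0 : 0 < gamma.
Hypothesis xi_meas : forall t, measurable_fun setT (xi t).
Hypothesis xi0 : forall om, xi 0 om = 0.
Hypothesis xi_cadlag : forall om, cadlag (xi ^~ om).
Hypothesis xi_ind : forall (k : nat) (t : nat -> R) (B : nat -> set R),
     0 <= t 0%N -> (forall j, (j < k)%N -> t j < t j.+1) ->
     (forall j, measurable (B j)) ->
     fine (Q [set om | forall j, (j < k)%N -> xi (t j.+1) om - xi (t j) om \in B j])
     = \prod_(j < k) fine (Q [set om | xi (t j.+1) om - xi (t j) om \in B j]).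
Hypothesis xi_stat : forall s t (B : set R), 0 <= s -> 0 <= t -> measurable B ->
     Q [set om | xi (t + s) om - xi t om \in B] = Q [set om | xi s om \in B].

Local Notation J om := (clock_int (xi ^~ om) gamma).
#[local] Opaque lamperti_Iinf clock_int.

Lemma walk_incr h j om k : walk (incr xi h j om) k = xi ((j + k)%:R * h) om - xi (j%:R * h) om.
Proof.
elim: k => [|k IH]; first by rewrite /walk big_geq // addn0 subrr.
by rewrite /walk big_nat_recr //= -/(walk _ _) IH /incr; ring.
Qed.

(** The clock of the process restarted at [t], $\int_0^s e^{\gamma(\xi(t+r)-\xi(t))}dr$. *)
Definition shifted_clock t om s : R := expR (- gamma * xi t om) * (J om (t + s) - J om t).

Let T l j : R := j%:R * mesh l.

Lemma mesh_mul l m j : (l <= m)%N -> (j * 2 ^ (m - l))%:R * mesh m = j%:R * (mesh l : R).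
Proof.
move=> lm; rewrite /mesh natrM -mulrA; congr (_ * _).
by rewrite -{2}(subnK lm) expnD natrM invfM mulrA divff ?mul1r // pnatr_eq0 expn_eq0.
Qed.

Lemma shifted_clock_cvg l j N om :
  (fun m => step_clock gamma (mesh m) (walk (incr xi (mesh m) (j * 2 ^ (m - l)) om)) (N * 2 ^ m)) @ \oo -->
  shifted_clock (T l j) om N%:R.
Proof.
have m0 i : 0 <= i%:R * (mesh l : R) by rewrite mulr_ge0 // ltW // mesh_gt0.
have c1 : (fun m => step_clock gamma (mesh m) (fun i => xi (i%:R * mesh m) om) (j * 2 ^ (m - l) + N * 2 ^ m)) @ \oo -->
    J om (T l j + N%:R).
  apply: step_clock_cvg => //; first by rewrite addr_ge0 // m0.
  exists l => // m /= lm; rewrite natrD mulrDl mesh_mul //; congr (_ + _).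
  by rewrite /mesh natrM mulfK // pnatr_eq0 expn_eq0.
have c2 : (fun m => step_clock gamma (mesh m) (fun i => xi (i%:R * mesh m) om) (j * 2 ^ (m - l))) @ \oo -->
    J om (T l j).
  apply: step_clock_cvg => //; first by rewrite m0.
  by exists l => // m /= lm; rewrite mesh_mul.
have c3 : (fun m => expR (- gamma * xi (T l j) om) *
   (step_clock gamma (mesh m) (fun i => xi (i%:R * mesh m) om) (j * 2 ^ (m - l) + N * 2 ^ m) -
    step_clock gamma (mesh m) (fun i => xi (i%:R * mesh m) om) (j * 2 ^ (m - l)))) @ \oo -->
   shifted_clock (T l j) om N%:R.
  by apply: cvgM; [exact: cvg_cst|exact: cvgB].
apply: cvg_trans c3; apply: near_eq_cvg; exists l => // m /= lm.
rewrite /T -(mesh_mul j lm) -(step_clock_shift gamma (mesh m) (fun i => xi (i%:R * mesh m) om)).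
by apply: eq_big_nat => i _; rewrite walk_incr.
Qed.

(** As $N\to\infty$ and then $\varepsilon\to0$, the second factor tends to the indicator of a finite
    clock. Before these limits everything depends on a bounded stretch of increments after [t], to
    which independence from the past applies. *)
Definition killed eps t (N : nat) om : R :=
  (1 - expR (- shifted_clock t om 1)) * expR (- (eps * shifted_clock t om N%:R)).

Let skel l (i : nat) om := xi (T l i) om.

(* The integrals are limits of Riemann sums on dyadic grids, which only involve
   finitely many increments. *)
Lemma killed_past_future l j (th : (nat -> R) -> R) eps N : 0 <= eps -> cfun j.+1 th ->
  bounded_mfun (fun om => th (fun i => skel l i om)) /\
  bounded_mfun (killed eps (T l j) N) /\
  Ex Q (fun om => th (fun i => skel l i om) * killed eps (T l j) N om) =
  Ex Q (fun om => th (fun i => skel l i om)) * Ex Q (killed eps 0 N).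
Proof.
move=> eps0 cth; have [_ [M thM] _] := cth.
pose thm m (x : nat -> R) := th (fun i => walk x (i * 2 ^ (m - l))).
have cthm m : cfun (j * 2 ^ (m - l)) (thm m).
  by apply: cfun_walk cth _ => i; rewrite ltnS leq_pmul2r // expn_gt0.
have thmE m om : (l <= m)%N -> thm m (incr xi (mesh m) 0 om) = th (fun i => skel l i om).
  move=> lm; have [tl _ _] := cth; apply: tl => i _.
  by rewrite walk_incr add0n mesh_mul // mul0r xi0 subr0.
have bth : bounded_mfun (fun om => th (fun i => skel l i om)).
  have -> : (fun om => th (fun i => skel l i om)) = (fun om => thm l (incr xi (mesh l) 0 om)).
    by apply/funext => om; rewrite thmE.
  exact: (bmfun_incr Q xi_meas (mesh l) 0 (cthm l)).
pose Ph m (x : nat -> R) := (1 - expR (- step_clock gamma (mesh m) (walk x) (1 * 2 ^ m)))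
   * expR (- (eps * step_clock gamma (mesh m) (walk x) (N * 2 ^ m))).
have sc0 m x k : 0 <= step_clock gamma (mesh m) x k :> R.
  by apply: sumr_ge0 => i _; rewrite mulr_ge0 ?expR_ge0 // ltW // mesh_gt0.
have g1 (x : R) : 0 <= x -> `|1 - expR (- x)| <= 1.
  move=> x0; rewrite ger0_norm; first by rewrite gerBl expR_ge0.
  by rewrite subr_ge0 -[leRHS]expR0 ler_expR oppr_le0.
have g2 (x : R) : 0 <= x -> `|expR (- (eps * x))| <= 1.
  move=> x0; rewrite ger0_norm ?expR_ge0 // -[leRHS]expR0 ler_expR oppr_le0.
  exact: mulr_ge0.
have cPh m : cfun (maxn 1 N * 2 ^ m) (Ph m).
  apply: cfunM.
    apply: cfun_leq (_ : cfun (1 * 2 ^ m) _); first by rewrite leq_mul2r leq_maxl orbT.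
    apply: (@step_clock_sampled_cfun R gamma (mesh m) _ (fun x => 1 - expR (- x)) 1) => //; first exact: ltW (mesh_gt0 m).
    move=> x; apply: cvgB; first exact: cvg_cst.
    by apply: continuous_cvg; [exact: continuous_expR|exact: opp_continuous].
  apply: cfun_leq (_ : cfun (N * 2 ^ m) _); first by rewrite leq_mul2r leq_maxr orbT.
  apply: (@step_clock_sampled_cfun R gamma (mesh m) _ (fun x => expR (- (eps * x))) 1) => //; first exact: ltW (mesh_gt0 m).
  move=> x; apply: continuous_cvg; first exact: continuous_expR.
  by apply: cvgN; apply: cvgM; [exact: cvg_cst|exact: cvg_id].
have PhM m x : `|Ph m x| <= 1.
  by rewrite /Ph normrM -[leRHS]mulr1; apply: ler_pM => //; [exact: g1|exact: g2].
have Phc j' om : (fun m => Ph m (incr xi (mesh m) (j' * 2 ^ (m - l)) om)) @ \oo --> killed eps (T l j') N om.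
  have c1 := @shifted_clock_cvg l j' 1 om; have c2 := @shifted_clock_cvg l j' N om.
  apply: cvgM.
    apply: cvgB; first exact: cvg_cst.
    apply: continuous_cvg; first exact: continuous_expR.
    by apply: cvgN; exact: c1.
  apply: continuous_cvg; first exact: continuous_expR.
  by apply: cvgN; apply: cvgM; [exact: cvg_cst|exact: c2].
have mPh j' m : measurable_fun setT (fun om => Ph m (incr xi (mesh m) (j' * 2 ^ (m - l)) om)).
  by have [] := bmfun_incr Q xi_meas (mesh m) (j' * 2 ^ (m - l)) (cPh m).
have bk j' : bounded_mfun (killed eps (T l j') N).
  by apply: (bmfun_cvg (mPh j') (fun m om => PhM m _)) => om; exact: Phc.
split => //; split => //.
have lim1 : (fun m => Ex Q (fun om => th (fun i => skel l i om) * Ph m (incr xi (mesh m) (j * 2 ^ (m - l)) om))) @ \oo -->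
   Ex Q (fun om => th (fun i => skel l i om) * killed eps (T l j) N om).
  apply: (Ex_cvg (M := M * 1)).
  - by move=> m; apply: measurable_funM => //; exact: bth.1.
  - by move=> m om; rewrite normrM ler_pM.
  - by move=> om; apply: cvgM; [exact: cvg_cst|exact: Phc].
have lim2 : (fun m => Ex Q (fun om => Ph m (incr xi (mesh m) (0 * 2 ^ (m - l)) om))) @ \oo -->
   Ex Q (killed eps (T l 0) N).
  by apply: (Ex_cvg (M := 1)).
have T0 : T l 0 = 0 by rewrite /T mul0r.
rewrite T0 in lim2.
have lim3 : (fun m => Ex Q (fun om => th (fun i => skel l i om)) *
    Ex Q (fun om => Ph m (incr xi (mesh m) (0 * 2 ^ (m - l)) om))) @ \oo -->
    Ex Q (fun om => th (fun i => skel l i om)) * Ex Q (killed eps 0 N).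
  by apply: cvgM; [exact: cvg_cst|exact: lim2].
have lim4 : (fun m => Ex Q (fun om => th (fun i => skel l i om) * Ph m (incr xi (mesh m) (j * 2 ^ (m - l)) om))) @ \oo -->
    Ex Q (fun om => th (fun i => skel l i om)) * Ex Q (killed eps 0 N).
  apply: cvg_trans lim3; apply: near_eq_cvg; exists l => // m /= lm.
  have thE : (fun om => th (fun i => skel l i om)) = (fun om => thm m (incr xi (mesh m) 0 om)).
    by apply/funext => om; rewrite thmE.
  rewrite mul0n thE -(Ex_past_future xi_meas xi_ind xi_stat (mesh_gt0 m) (cthm m) (cPh m)).
  by apply: eq_Ex => om; rewrite thmE.
by rewrite -(cvg_lim _ lim1) // -(cvg_lim _ lim4).
Qed.

Let Iinf om := lamperti_Iinf gamma (xi ^~ om).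

Definition finite_clock om : R := if (Iinf om < +oo)%E then 1 else 0.

(** The clock is finite exactly when the clock restarted at [t] is, so this is a functional of the
    increments after [t], with the same law for every [t]. *)
Definition survived t om : R := (1 - expR (- shifted_clock t om 1)) * finite_clock om.

Lemma mulr_if (b : bool) (x : R) : x * (if b then 1 else 0) = if b then x else 0.
Proof. by case: b; rewrite ?mulr1 ?mulr0. Qed.

Lemma survivedE t om :
  survived t om = if (Iinf om < +oo)%E then 1 - expR (- shifted_clock t om 1) else 0.
Proof. exact: mulr_if. Qed.

Lemma clock_nat_cvg t om : 0 <= t -> (Iinf om < +oo)%E -> (fun N => J om (t + N%:R)) @ \oo --> fine (Iinf om).
Proof.
move=> t0 fI; have I0 : (0 <= Iinf om)%E by apply: integral_ge0 => x _; rewrite lee_fin expR_ge0.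
have IE : Iinf om = (fine (Iinf om))%:E by rewrite fineK // ge0_fin_numE.
have up u : 0 <= u -> J om u <= fine (Iinf om).
  move=> u0; rewrite leNgt; apply/negP => h.
  have : ((fine (Iinf om))%:E < lamperti_Iinf gamma (xi ^~ om))%E.
    by apply/(lamperti_Iinf_gt (xi_cadlag om) gamma_gt0); exists u.
  by rewrite -IE ltxx.
apply/cvgrPdist_le => e e0.
have : ((fine (Iinf om) - e)%:E < lamperti_Iinf gamma (xi ^~ om))%E.
  by rewrite -/(Iinf om) IE lte_fin ltrBlDr ltrDl.
move=> /(lamperti_Iinf_gt (xi_cadlag om) gamma_gt0)[u u0 uJ].
near=> N; have uN : u <= N%:R by near: N; exact: nbhs_infty_ger.
have t1 : 0 <= t + N%:R by rewrite addr_ge0.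
have h1 : J om u <= J om (t + N%:R).
  by apply: clock_int_le => //; rewrite (le_trans uN) // lerDr.
have h2 := up _ t1.
by rewrite ger0_norm ?subr_ge0 //; move: uJ; lra.
Unshelve. all: by end_near. Qed.

Lemma clock_nat_cvgy t om c : 0 <= t -> ~ (Iinf om < +oo)%E -> \forall N \near \oo, c <= J om (t + N%:R).
Proof.
move=> t0 /negP; rewrite -leNgt leye_eq => /eqP fI.
have : (c%:E < lamperti_Iinf gamma (xi ^~ om))%E by rewrite -/(Iinf om) fI ltry.
move=> /(lamperti_Iinf_gt (xi_cadlag om) gamma_gt0)[u u0 uJ].
near=> N; have uN : u <= N%:R by near: N; exact: nbhs_infty_ger.
apply: le_trans (ltW uJ) _; apply: clock_int_le => //.
by rewrite (le_trans uN) // lerDr.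
Unshelve. all: by end_near. Qed.

Lemma shifted_clock_ge0 t om s : 0 <= t -> 0 <= s -> 0 <= shifted_clock t om s.
Proof.
move=> t0 s0; rewrite mulr_ge0 ?expR_ge0 // subr_ge0.
by apply: clock_int_le => //; rewrite lerDl.
Qed.

Lemma killed_cvg t eps om : 0 <= t -> 0 < eps ->
  (fun N => killed eps t N om) @ \oo --> (1 - expR (- shifted_clock t om 1)) *
    (if (Iinf om < +oo)%E then expR (- (eps * (expR (- gamma * xi t om) * (fine (Iinf om) - J om t)))) else 0).
Proof.
move=> t0 e0; apply: cvgM; first exact: cvg_cst.
have [fI|fI] := boolP (Iinf om < +oo)%E.
  apply: continuous_cvg; first exact: continuous_expR.
  apply: cvgN; apply: cvgM; first exact: cvg_cst.
  apply: cvgM; first exact: cvg_cst.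
  by apply: cvgB; [exact: clock_nat_cvg|exact: cvg_cst].
apply/cvgrPdist_le => e ee0; set a := expR (- gamma * xi t om).
have a0 : 0 < a by exact: expR_gt0.
have := @clock_nat_cvgy t om (J om t + (eps * a)^-1 * e^-1) t0 (negP fI).
apply: filterS => N h.
rewrite sub0r normrN ger0_norm ?expR_ge0 // /shifted_clock -/a.
have h1 : e^-1 <= eps * (a * (J om (t + N%:R) - J om t)).
  have ea : 0 < eps * a by exact: mulr_gt0.
  by rewrite mulrA -ler_pdivrMl // lerBrDl.
have h2 : e^-1 <= expR (eps * (a * (J om (t + N%:R) - J om t))).
  by apply: (le_trans h1); apply: le_trans (expR_ge1Dx _); rewrite lerDr.
by rewrite expRN invf_ple // posrE expR_gt0.
Qed.

Lemma killed_bound eps t N om : 0 <= t -> 0 <= eps -> `|killed eps t N om| <= 1.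
Proof.
move=> t0 e0; rewrite normrM -[leRHS]mulr1; apply: ler_pM => //.
  rewrite ger0_norm; first by rewrite gerBl expR_ge0.
  by rewrite subr_ge0 -[leRHS]expR0 ler_expR oppr_le0 shifted_clock_ge0.
rewrite ger0_norm ?expR_ge0 // -[leRHS]expR0 ler_expR oppr_le0.
by rewrite mulr_ge0 // shifted_clock_ge0.
Qed.

Lemma survived_past_future l j (th : (nat -> R) -> R) : cfun j.+1 th ->
  bounded_mfun (fun om => th (fun i => skel l i om)) /\
  bounded_mfun (survived (T l j)) /\
  Ex Q (fun om => th (fun i => skel l i om) * survived (T l j) om) =
  Ex Q (fun om => th (fun i => skel l i om)) * Ex Q (survived 0).
Proof.
move=> cth; have [_ [M thM] _] := cth.
have bth : bounded_mfun (fun om => th (fun i => skel l i om)).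
  by have [] := killed_past_future l 0 (lexx 0) cth.
have T0 i : 0 <= T l i by rewrite mulr_ge0 // ltW // mesh_gt0.
(* The limit of [killed] as $N\to\infty$; letting [eps] decrease to 0 along [k.+1%:R^-1] then gives
   [survived]. *)
pose lk eps t om := (1 - expR (- shifted_clock t om 1)) *
    (if (Iinf om < +oo)%E then expR (- (eps * (expR (- gamma * xi t om) * (fine (Iinf om) - J om t)))) else 0).
have step1 eps : 0 < eps -> bounded_mfun (lk eps (T l j)) /\ bounded_mfun (lk eps 0) /\
    Ex Q (fun om => th (fun i => skel l i om) * lk eps (T l j) om) =
    Ex Q (fun om => th (fun i => skel l i om)) * Ex Q (lk eps 0).
  move=> e0; have key N := killed_past_future l N (ltW e0) cth.
  have b0 N : bounded_mfun (killed eps 0 N).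
    have [_ [h _]] := killed_past_future l (j := 0) N (ltW e0) (cfun_cst 1 1).
    by rewrite /T mul0r in h.
  have bj N : bounded_mfun (killed eps (T l j) N) by have [_ []] := key N.
  have l0 : bounded_mfun (lk eps 0).
    apply: (bmfun_cvg (f_ := fun N => killed eps 0 N) (M := 1)).
    - by move=> N; exact: (b0 N).1.
    - by move=> N om; apply: killed_bound => //; exact: ltW.
    - by move=> om; exact: killed_cvg.
  have lj : bounded_mfun (lk eps (T l j)).
    apply: (bmfun_cvg (f_ := fun N => killed eps (T l j) N) (M := 1)).
    - by move=> N; exact: (bj N).1.
    - by move=> N om; apply: killed_bound => //; exact: ltW.
    - by move=> om; exact: killed_cvg.
  split => //; split => //.
  have c1 : (fun N => Ex Q (fun om => th (fun i => skel l i om) * killed eps (T l j) N om)) @ \oo -->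
      Ex Q (fun om => th (fun i => skel l i om) * lk eps (T l j) om).
    apply: (Ex_cvg (M := M * 1)).
    - by move=> N; apply: measurable_funM; [exact: bth.1|exact: (bj N).1].
    - by move=> N om; rewrite normrM ler_pM // killed_bound // ltW.
    - by move=> om; apply: cvgM; [exact: cvg_cst|exact: killed_cvg].
  have c2 : (fun N => Ex Q (killed eps 0 N)) @ \oo --> Ex Q (lk eps 0).
    apply: (Ex_cvg (M := 1)).
    - by move=> N; exact: (b0 N).1.
    - by move=> N om; apply: killed_bound => //; exact: ltW.
    - by move=> om; exact: killed_cvg.
  have c3 : (fun N => Ex Q (fun om => th (fun i => skel l i om)) * Ex Q (killed eps 0 N)) @ \oo -->
      Ex Q (fun om => th (fun i => skel l i om)) * Ex Q (lk eps 0).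
    by apply: cvgM; [exact: cvg_cst|exact: c2].
  rewrite -(cvg_lim _ c1) //; apply/cvg_lim => //; apply: cvg_trans c3.
  by apply: near_eq_cvg; apply: nearW => N /=; have [_ [_ ->]] := key N.
have lkB k t om : 0 <= t -> `|lk k.+1%:R^-1 t om| <= 1.
  move=> t0; rewrite /lk normrM -[leRHS]mulr1; apply: ler_pM => //.
    rewrite ger0_norm; first by rewrite gerBl expR_ge0.
    by rewrite subr_ge0 -[leRHS]expR0 ler_expR oppr_le0 shifted_clock_ge0.
  case: ifPn => [fI|_]; last by rewrite normr0.
  rewrite ger0_norm ?expR_ge0 // -[leRHS]expR0 ler_expR oppr_le0 mulr_ge0 //.
  rewrite mulr_ge0 ?expR_ge0 // subr_ge0 -(cvg_lim _ (clock_nat_cvg t0 fI)) //.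
  apply: limr_ge; first exact: (cvgP _ (clock_nat_cvg t0 fI)).
  by apply: nearW => N; apply: clock_int_le => //; rewrite lerDl.
have invc : (fun k : nat => k.+1%:R^-1 : R) @ \oo --> (0 : R).
  apply/cvgrPdist_le => e e0; near=> k; rewrite sub0r normrN ger0_norm ?invr_ge0 //.
  have : e^-1 <= k%:R by near: k; exact: nbhs_infty_ger.
  by move=> h; rewrite invf_ple ?posrE // (le_trans h) // ler_nat.
have lkc t om : 0 <= t -> (fun k => lk k.+1%:R^-1 t om) @ \oo --> survived t om.
  move=> t0; apply: cvgM; first exact: cvg_cst.
  rewrite /finite_clock; case: ifPn => [fI|_]; last exact: cvg_cst.
  set a := expR _ * _; rewrite [X in _ --> X](_ : _ = expR (- (0 * a))); last by rewrite mul0r oppr0 expR0.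
  apply: continuous_cvg; first exact: continuous_expR.
  apply: cvgN.
  by apply: cvgM; [exact: invc|exact: cvg_cst].
have key k : 0 < k.+1%:R^-1 :> R by rewrite invr_gt0.
have bsj : bounded_mfun (survived (T l j)).
  apply: (bmfun_cvg (f_ := fun k => lk k.+1%:R^-1 (T l j)) (M := 1)).
  - by move=> k; have [[]] := step1 _ (key k).
  - by move=> k om; exact: lkB.
  - by move=> om; exact: lkc.
split => //; split => //.
have c1 : (fun k => Ex Q (fun om => th (fun i => skel l i om) * lk k.+1%:R^-1 (T l j) om)) @ \oo -->
      Ex Q (fun om => th (fun i => skel l i om) * survived (T l j) om).
  apply: (Ex_cvg (M := M * 1)).
  - by move=> k; apply: measurable_funM; [exact: bth.1|have [[]] := step1 _ (key k)].
  - by move=> k om; rewrite normrM ler_pM // lkB.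
  - by move=> om; apply: cvgM; [exact: cvg_cst|exact: lkc].
have c2 : (fun k => Ex Q (lk k.+1%:R^-1 0)) @ \oo --> Ex Q (survived 0).
  apply: (Ex_cvg (M := 1)).
  - by move=> k; have [_ [[]]] := step1 _ (key k).
  - by move=> k om; exact: lkB.
  - by move=> om; exact: lkc.
have c3 : (fun k => Ex Q (fun om => th (fun i => skel l i om)) * Ex Q (lk k.+1%:R^-1 0)) @ \oo -->
    Ex Q (fun om => th (fun i => skel l i om)) * Ex Q (survived 0).
  by apply: cvgM; [exact: cvg_cst|exact: c2].
rewrite -(cvg_lim _ c1) //; apply/cvg_lim => //; apply: cvg_trans c3.
by apply: near_eq_cvg; apply: nearW => k /=; have [_ [_ ->]] := step1 _ (key k).
Unshelve. all: by end_near. Qed.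

Lemma measurable_clock N : measurable_fun setT (fun om => J om N%:R).
Proof.
apply: (@measurable_fun_cvg _ _ _ _ (fun m om =>
  step_clock gamma (mesh m) (walk (incr xi (mesh m) (0 * 2 ^ (m - 0)) om)) (N * 2 ^ m))) => [m|om _].
  apply: measurable_sum => i; apply: measurable_funM => //.
  apply: measurableT_comp => //; apply: measurable_funM => //.
  under eq_fun do rewrite walk_incr.
  exact: measurable_funB.
have := @shifted_clock_cvg 0 0 N om.
by rewrite /shifted_clock /T mul0r add0r xi0 mulr0 expR0 mul1r clock_int0 // subr0.
Qed.

Lemma bmfun_finite_clock : bounded_mfun finite_clock.
Proof.
pose f k (N : nat) om := expR (- (k.+1%:R^-1 * J om N%:R)).
pose g k om : R := if (Iinf om < +oo)%E then expR (- (k.+1%:R^-1 * fine (Iinf om))) else 0.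
have J0 om N : 0 <= J om N%:R.
  by rewrite -(clock_int0 (xi_cadlag om) gamma_gt0) clock_int_le.
have k0 k : 0 < k.+1%:R^-1 :> R by rewrite invr_gt0.
have fM k N om : `|f k N om| <= 1.
  by rewrite ger0_norm ?expR_ge0 // -[leRHS]expR0 ler_expR oppr_le0 mulr_ge0 // ltW.
have fg k om : (fun N => f k N om) @ \oo --> g k om.
  rewrite /f /g; case: ifPn => fI.
    apply: continuous_cvg; first exact: continuous_expR.
    apply: cvgN; apply: cvgM; first exact: cvg_cst.
    have := clock_nat_cvg (lexx 0) fI.
    by under eq_fun do rewrite add0r.
  apply/cvgrPdist_le => e ee0.
  have := @clock_nat_cvgy 0 om (k.+1%:R / e) (lexx 0) (negP fI).
  apply: filterS => N; rewrite add0r => h.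
  rewrite sub0r normrN ger0_norm ?expR_ge0 // expRN invf_ple ?posrE ?expR_gt0 //.
  have h1 : e^-1 <= k.+1%:R^-1 * J om N%:R by rewrite ler_pdivlMl.
  by apply: (le_trans h1); apply: le_trans (expR_ge1Dx _); rewrite lerDr.
have bg k : bounded_mfun (g k).
  apply: (bmfun_cvg (f_ := f k) (M := 1)) => // N.
  apply: measurableT_comp => //; apply: measurableT_comp => //; apply: measurable_funM => //.
  exact: measurable_clock.
have invc : (fun k : nat => k.+1%:R^-1 : R) @ \oo --> (0 : R).
  apply/cvgrPdist_le => e e0; near=> k; rewrite sub0r normrN ger0_norm ?invr_ge0 //.
  have : e^-1 <= k%:R by near: k; exact: nbhs_infty_ger.
  by move=> h; rewrite invf_ple ?posrE // (le_trans h) // ler_nat.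
apply: (bmfun_cvg (f_ := g) (M := 1)) => [k|k om|om].
- exact: (bg k).1.
- rewrite /g; case: ifPn => fI; last by rewrite normr0.
  rewrite ger0_norm ?expR_ge0 // -[leRHS]expR0 ler_expR oppr_le0 mulr_ge0 ?(ltW (k0 k)) //.
  by apply: fine_ge0; apply: integral_ge0 => x _; rewrite lee_fin expR_ge0.
- rewrite /g /finite_clock; case: ifPn => fI; last exact: cvg_cst.
  rewrite -[X in _ --> X]expR0 -[X in expR X]oppr0; apply: continuous_cvg; first exact: continuous_expR.
  apply: cvgN; rewrite -(mul0r (fine (Iinf om))).
  by apply: cvgM; [exact: invc|exact: cvg_cst].
Unshelve. all: by end_near. Qed.

Lemma finite_clock_range om : 0 <= finite_clock om <= 1.
Proof. by rewrite /finite_clock; case: ifP => _; rewrite ?lexx ?ler01. Qed.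

Definition late c (m : nat) om : R := (1 - expR (- (c * (fine (Iinf om) - J om m%:R)))) * finite_clock om.

Lemma lateE c m om : late c m om =
  if (Iinf om < +oo)%E then 1 - expR (- (c * (fine (Iinf om) - J om m%:R))) else 0.
Proof. exact: mulr_if. Qed.

Lemma clock_le_fine t om : 0 <= t -> (Iinf om < +oo)%E -> J om t <= fine (Iinf om).
Proof.
move=> t0 fI; rewrite -(cvg_lim _ (clock_nat_cvg t0 fI)) //.
apply: limr_ge; first exact: (cvgP _ (clock_nat_cvg t0 fI)).
by apply: nearW => N; apply: clock_int_le => //; rewrite lerDl.
Qed.

Lemma late_range c m om : 0 <= c -> 0 <= late c m om <= 1.
Proof.
move=> c0; rewrite lateE; case: ifPn => fI; last by rewrite lexx ler01.
rewrite gerBl expR_ge0 andbT subr_ge0 -[leRHS]expR0 ler_expR oppr_le0 mulr_ge0 // subr_ge0.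
exact: clock_le_fine.
Qed.

Lemma bmfun_late c m : 0 <= c -> bounded_mfun (late c m).
Proof.
move=> c0; apply: (bmfun_cvg (f_ := fun N om => (1 - expR (- (c * (J om (m + N)%:R - J om m%:R)))) * finite_clock om) (M := 1)).
- move=> N; apply: measurable_funM; last exact: bmfun_finite_clock.1.
  apply: measurable_funB => //; apply: measurableT_comp => //; apply: measurableT_comp => //.
  by apply: measurable_funM => //; apply: measurable_funB; exact: measurable_clock.
- move=> N om; rewrite normrM -[leRHS]mulr1; apply: ler_pM => //; last first.
    by have /andP[f0 f1] := finite_clock_range om; rewrite ger0_norm.
  have q0 : 0 <= c * (J om (m + N)%:R - J om m%:R).
    by rewrite mulr_ge0 // subr_ge0 clock_int_le // ler_nat leq_addr.
  rewrite ger0_norm; first by rewrite gerBl expR_ge0.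
  by rewrite subr_ge0 -[leRHS]expR0 ler_expR oppr_le0.
- move=> om; rewrite lateE; case: (boolP (Iinf om < +oo)%E) => fI; last first.
    rewrite (_ : (fun N => _) = fun=> 0); first exact: cvg_cst.
    by apply/funext => N; rewrite mulr_if ifN.
  rewrite (_ : (fun N => _) = fun N => 1 - expR (- (c * (J om (m + N)%:R - J om m%:R)))); last first.
    by apply/funext => N; rewrite mulr_if fI.
  apply: cvgB; first exact: cvg_cst.
  apply: continuous_cvg; first exact: continuous_expR.
  apply: cvgN; apply: cvgM; first exact: cvg_cst.
  apply: cvgB; last exact: cvg_cst.
  by under eq_fun do rewrite natrD; exact: clock_nat_cvg.
Qed.

Lemma Ex_late_cvg c : 0 <= c -> (fun m => Ex Q (late c m)) @ \oo --> (0 : R).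
Proof.
move=> c0; rewrite -(Ex_cst Q 0); apply: (Ex_cvg (M := 1)).
- by move=> m; exact: (bmfun_late m c0).1.
- by move=> m om; have /andP[l0 l1] := late_range m om c0; rewrite ger0_norm.
- move=> om; case: (boolP (Iinf om < +oo)%E) => fI; last first.
    rewrite (_ : (fun m => _) = fun=> 0); first exact: cvg_cst.
    by apply/funext => m; rewrite lateE ifN.
  rewrite (_ : (fun m => _) = fun m => 1 - expR (- (c * (fine (Iinf om) - J om m%:R)))); last first.
    by apply/funext => m; rewrite lateE fI.
  rewrite -(subrr 1); apply: cvgB; first exact: cvg_cst.
  rewrite -[X in _ --> X]expR0 -[X in expR X]oppr0; apply: continuous_cvg; first exact: continuous_expR.
  apply: cvgN; rewrite -(mulr0 c); apply: cvgM; first exact: cvg_cst.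
  rewrite -(subrr (fine (Iinf om))); apply: cvgB; first exact: cvg_cst.
  have := clock_nat_cvg (lexx 0) fI.
  by under eq_fun do rewrite add0r.
Qed.

Lemma ler_wpM2l_pos (x y z : R) : 0 <= x -> (0 < x -> y <= z) -> x * y <= x * z.
Proof.
rewrite le_eqVlt => /orP[/eqP <- _|x0 /(_ x0) yz]; first by rewrite !mul0r.
by rewrite ler_pM2l.
Qed.

Lemma ler_mulE_pdiv (x y z : R) : 0 < y -> (x * y <= z) = (x <= z / y).
Proof. by move=> y0; rewrite ler_pdivlMr. Qed.

(* [th i] is a smoothed indicator that the skeleton first exceeds [- K] at time
   [i]; the clock that remains after such a time is large with a probability
   that does not depend on the past. *)
Section Excursions.
Variables (K m0 l : nat).
Let i0 := (m0 * 2 ^ l)%N.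
(** The grid times run from [m0] to [m0 + l]: horizon and refinement grow together, so that a single
    limit in [l] covers all times after [m0]. *)
Let n := ((m0 + l) * 2 ^ l)%N.

Let u (x : R) : R := Num.max 0 (Num.min 1 (x + K%:R + 1)).
Let ui i (x : R) : R := if (i < i0)%N then 0 else u x.

Let u01 x : 0 <= u x <= 1.
Proof. by rewrite /u le_max lexx /= ge_max ler01 ge_min lexx. Qed.

Let ui01 i x : 0 <= ui i x <= 1.
Proof. by rewrite /ui; case: ifP => _ //; rewrite lexx ler01. Qed.

Let cu : continuous u.
Proof.
move=> x; apply: continuous_maxr => z; first exact: cvg_cst.
apply: continuous_minr => y; first exact: cvg_cst.
by apply: cvgD; [apply: cvgD; [exact: cvg_id|exact: cvg_cst]|exact: cvg_cst].
Qed.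

Let cui i : continuous (ui i).
Proof.
have [ii|ii] := ltnP i i0.
  rewrite (_ : ui i = fun=> 0); first by move=> x; exact: cvg_cst.
  by apply/funext => x; rewrite /ui ii.
rewrite (_ : ui i = u); first exact: cu.
by apply/funext => x; rewrite /ui ltnNge ii.
Qed.

Let th i (x : nat -> R) := (\prod_(0 <= k < i) (1 - ui k (x k))) * ui i (x i).

Let cth i : cfun i.+1 (th i).
Proof.
apply: cfunM.
  apply: cfun_leq (leqnSn i) _; apply: (@cfun_prod _ _ (fun k x => 1 - ui k x) 1).
  - by move=> k x; apply: cvgB; [exact: cvg_cst|exact: cui].
  - by move=> k x; have /andP[h1 h2] := ui01 k x; rewrite ger0_norm ?subr_ge0 // gerBl.
apply: (@cfun_coord _ _ _ (ui i) 1) => // x.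
by have /andP[h1 h2] := ui01 i x; rewrite ger0_norm.
Qed.

Let th_ge0 i x : 0 <= th i x.
Proof.
apply: mulr_ge0; last by have /andP[] := ui01 i (x i).
by apply: prodr_ge0 => k _; rewrite subr_ge0; have /andP[] := ui01 k (x k).
Qed.

Let th_sum x k : \sum_(0 <= i < k) th i x = 1 - \prod_(0 <= i < k) (1 - ui i (x i)).
Proof.
elim: k => [|k IH]; first by rewrite !big_geq // subrr.
by rewrite !big_nat_recr //= IH /th; ring.
Qed.

Definition high := [set om | exists2 i, (i0 <= i < n)%N & - K%:R <= xi (T l i) om].

Lemma measurable_high : measurable high.
Proof.
rewrite (_ : high = \bigcup_(i in [set i | (i0 <= i < n)%N]) [set om | - K%:R <= xi (T l i) om]).
  apply: bigcup_measurable => i _.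
  rewrite (_ : [set om | _] = xi (T l i) @^-1` `[- K%:R, +oo[%classic).
    by rewrite -[X in measurable X]setTI; apply: xi_meas.
  by apply/seteqP; split => om /=; rewrite in_itv /= andbT.
by apply/seteqP; split => om /= [i ir hi]; exists i.
Qed.

(** The weights [th] add up to 1 on [high] and are independent of what follows. Where [th i] is
    positive, $\xi\ge-(K+1)$ at that time, so the scaling factor of [shifted_clock] is at most
    $e^{\gamma(K+1)}$ and the clock after that time is part of the clock after [m0]: [survived] is
    at most [late]. *)
Lemma high_bound : fine (Q high) * Ex Q (survived 0) <= Ex Q (late (expR (gamma * (K%:R + 1))) m0).
Proof.
set c := expR (gamma * (K%:R + 1)); have c0 : 0 <= c by exact: expR_ge0.
have T0 i : 0 <= T l i by rewrite mulr_ge0 // ltW // mesh_gt0.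
have key i := survived_past_future l (cth i).
have p0 : 0 <= Ex Q (survived 0).
  apply: Ex_ge0 => om; apply: mulr_ge0; last by have /andP[] := finite_clock_range om.
  by rewrite subr_ge0 -[leRHS]expR0 ler_expR oppr_le0 shifted_clock_ge0.
have bth i : bounded_mfun (fun om => th i (fun k => skel l k om)) by have [] := key i.
have bsv i : bounded_mfun (survived (T l i)) by have [_ []] := key i.
have h1 : fine (Q high) <= Ex Q (fun om => \sum_(0 <= i < n) th i (fun k => skel l k om)).
  rewrite -(Ex_indic Q measurable_high); apply: Ex_le.
  - exact: bmfun_indic measurable_high.
  - exact: bmfun_sum.
  move=> om; rewrite indicE th_sum; have [oh|oh] := boolP (om \in high); last first.
    rewrite subr_ge0; apply: prodr_ile1 => k _; have /andP[h1 h2] := ui01 k (skel l k om).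
    by rewrite subr_ge0 h2 gerBl.
  move: oh; rewrite inE => -[i /andP[i1 i2] hi].
  have -> : \prod_(0 <= k < n) (1 - ui k (skel l k om)) = 0; last by rewrite subr0.
  rewrite big_mkord; apply/eqP; rewrite prodf_seq_eq0; apply/hasP; exists (Ordinal i2).
    by rewrite mem_index_enum.
  rewrite /= /ui ltnNge i1 /= /u min_l ?max_r ?subrr //; rewrite /skel; move: hi.
  by set q := xi _ _; lra.
have h2 : Ex Q (fun om => \sum_(0 <= i < n) th i (fun k => skel l k om)) * Ex Q (survived 0) =
    Ex Q (fun om => \sum_(0 <= i < n) th i (fun k => skel l k om) * survived (T l i) om).
  rewrite !Ex_sum //; last by move=> i; exact: bmfunM.
  rewrite mulr_suml; apply: eq_bigr => i _.
  by have [_ [_ ->]] := key i.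
apply: (le_trans (ler_wpM2r p0 h1)); rewrite h2; apply: Ex_le.
- by apply: bmfun_sum => i; exact: bmfunM.
- exact: bmfun_late.
move=> om; have /andP[l0 l1] := late_range m0 om c0.
apply: (@le_trans _ _ (\sum_(0 <= i < n) th i (fun k => skel l k om) * late c m0 om)); last first.
  rewrite -mulr_suml th_sum -[leRHS]mul1r; apply: ler_wpM2r => //.
  rewrite gerBl; apply: prodr_ge0 => k _; rewrite subr_ge0.
  by have /andP[] := ui01 k (skel l k om).
apply: ler_sum => i _; apply: ler_wpM2l_pos; first exact: th_ge0.
move=> th0; rewrite (survivedE (T l i) om) (lateE c m0 om).
have [fI|fI] := boolP (Iinf om < +oo)%E; last exact: lexx.
rewrite lerD2l lerN2 ler_expR lerN2.
have ui0 : ui i (skel l i om) != 0.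
  by apply/eqP => h; move: th0; rewrite /th h mulr0 ltxx.
have [ii0|ii0] := ltnP i i0; first by rewrite /ui ii0 eqxx in ui0.
have xK : - (K%:R + 1) <= xi (T l i) om.
  rewrite leNgt; apply/negP => hx; move/eqP: ui0; apply.
  rewrite /ui ltnNge ii0 /= /u max_l // ge_min /skel; apply/orP; right.
  by move: hx; set q := xi _ _; lra.
rewrite /shifted_clock; apply: ler_pM => //.
- by rewrite subr_ge0 clock_int_le // lerDl.
- rewrite ler_expR mulNr -mulrN ler_pM2l //; by rewrite lerNl.
- apply: lerD; first by apply: clock_le_fine => //; exact: addr_ge0.
  rewrite lerN2; apply: clock_int_le => //.
  have -> : m0%:R = T l i0.
    by rewrite /T /i0 /mesh natrM mulfK // pnatr_eq0 expn_eq0.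
  by rewrite /T ler_pM2r ?mesh_gt0 // ler_nat.
Qed.

End Excursions.

Lemma high_incr K m0 l : high K m0 l `<=` high K m0 l.+1.
Proof.
move=> om [i /andP[i1 i2] hi]; exists (i * 2)%N.
  rewrite expnSr !mulnA leq_mul2r /= i1 /= ltn_mul2r /= (leq_trans i2) // leq_mul2r.
  by rewrite leq_add2l leqnSn orbT.
rewrite (_ : T l.+1 (i * 2) = T l i) //.
rewrite /T /mesh expnSr !natrM invfM; field.
by rewrite pnatr_eq0 expn_eq0.
Qed.

Lemma high_mono K m0 : {homo high K m0 : l l' / (l <= l')%N >-> l `<=` l'}.
Proof.
move=> l l'; elim: l' => [|l' IH]; first by rewrite leqn0 => /eqP ->.
rewrite leq_eqVlt ltnS => /orP[/eqP -> //|ll'].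
exact: subset_trans (IH ll') (@high_incr _ _ _).
Qed.

Hypothesis nodrift : ~ {ae Q, forall om, xi t om @[t --> +oo] --> -oo}.

Lemma survived_eq0 : Ex Q (survived 0) = 0.
Proof.
have p0 : 0 <= Ex Q (survived 0).
  apply: Ex_ge0 => om; apply: mulr_ge0; last by have /andP[] := finite_clock_range om.
  by rewrite subr_ge0 -[leRHS]expR0 ler_expR oppr_le0 shifted_clock_ge0.
apply/eqP; rewrite eq_le p0 andbT leNgt; apply/negP => pp; apply: nodrift.
pose F K m0 := \bigcup_l high K m0 l.
have mF K m0 : measurable (F K m0) by apply: bigcup_measurable => l _; exact: measurable_high.
have QF K m0 : fine (Q (F K m0)) * Ex Q (survived 0) <= Ex Q (late (expR (gamma * (K%:R + 1))) m0).
  rewrite (@ler_mulE_pdiv _ _ _ pp) -(Ex_indic Q (mF K m0)).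
  have lc : (fun l => Ex Q (\1_(high K m0 l))) @ \oo --> Ex Q (\1_(F K m0)).
    apply: (Ex_cvg (M := 1)).
    - by move=> l; exact: measurable_indic (measurable_high _ _ _).
    - by move=> l om; rewrite indicE ger0_norm //; case: (_ \in _).
    - move=> om; have [[l _ hl]|no] := pselect (F K m0 om).
        apply: cvg_near_cst; exists l => // l' /= ll'.
        have h1 : high K m0 l' om by exact: high_mono ll' _ hl.
        have h2 : F K m0 om by exists l.
        by rewrite !indicE !mem_set.
      apply: cvg_near_cst; apply: nearW => l; rewrite !indicE !memNset //.
      by move=> h; apply: no; exists l.
  rewrite -(cvg_lim _ lc) //; apply: limr_le; first exact: (cvgP _ lc).
  apply: nearW => l; rewrite Ex_indic; last exact: measurable_high.
  have := high_bound K m0 l; rewrite (@ler_mulE_pdiv _ _ _ pp); exact.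
have QG K : Q (\bigcap_m0 F K m0) = 0%E.
  have mG : measurable (\bigcap_m0 F K m0) by apply: bigcap_measurableType.
  have fG : Q (\bigcap_m0 F K m0) \is a fin_num by exact: fin_num_measure.
  have G0 : 0 <= fine (Q (\bigcap_m0 F K m0)) by exact: fine_ge0.
  suff : fine (Q (\bigcap_m0 F K m0)) * Ex Q (survived 0) <= 0.
    rewrite pmulr_lle0 // => h; rewrite -(fineK fG); congr EFin.
    by apply/eqP; rewrite eq_le h G0.
  have c0 : 0 <= expR (gamma * (K%:R + 1)) by exact: expR_ge0.
  rewrite -[leRHS](cvg_lim _ (Ex_late_cvg c0)) //; apply: limr_ge; first exact: (cvgP _ (Ex_late_cvg c0)).
  apply: nearW => m0; apply: (@le_trans _ _ _ _ _ _ (QF K m0)).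
  have mono : fine (Q (\bigcap_m0 F K m0)) <= fine (Q (F K m0)).
    apply: fine_le => //; first exact: fin_num_measure.
    by apply: le_measure; rewrite ?inE //; exact: bigcap_inf.
  exact: (ler_wpM2r p0 mono).
have : Q.-negligible (\bigcup_K \bigcap_m0 F K m0).
  apply: negligible_bigcup => K; exists (\bigcap_m0 F K m0); split => //.
  - exact: bigcap_measurableType.
  - exact: QG.
move=> neg; apply: (negligibleS _ neg) => om nd; apply: contrapT => no; apply: nd.
(* A value above $-K$ at an arbitrary time persists for a while by right continuity, so it is seen
   at some dyadic time as well. *)
have H K : exists m0 : nat, forall t, m0%:R <= t -> xi t om <= - K%:R.
  have : ~ (\bigcap_m0 F K m0) om by move=> h; apply: no; exists K.
  move=> /existsNP[m0 /not_implyP[_ nF]]; exists m0 => t tm; rewrite leNgt; apply/negP => hx.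
  have t0 : 0 <= t by apply: le_trans tm.
  have e0 : 0 < xi t om + K%:R by move: hx; set q := xi _ _; lra.
  have [dl dl0 hd] := cadlag_right (xi_cadlag om) t0 e0.
  near \oo => l.
  have l1 : t + 1 <= l%:R by near: l; exact: nbhs_infty_ger.
  have l2 : (Num.min dl 1)^-1 < (2 ^ l)%:R.
    apply: (@lt_le_trans _ _ (l%:R)); last by rewrite ler_nat ltnW // ltn_expl.
    near: l; exact: nbhs_infty_gtr.
  have hl : mesh l < Num.min dl 1 by rewrite /mesh invf_plt // posrE ?ltr0n ?expn_gt0 // lt_min dl0 ltr01.
  have p2 : 0 < ((2 ^ l)%:R : R) by rewrite ltr0n expn_gt0.
  pose i := (Num.truncn (t * (2 ^ l)%:R)).+1.
  have /andP[j1 j2] := truncn_itv (mulr_ge0 t0 (ltW p2)).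
  have i1 : t < T l i by rewrite /T /mesh ltr_pdivlMr.
  have i2 : T l i <= t + mesh l.
    rewrite /T /i -natr1 mulrDl mul1r lerD2r /mesh ler_pdivrMr //.
  move: hl; rewrite lt_min => /andP[hl1 hl2].
  apply: nF; exists l => //; exists i; last first.
    have := hd (T l i); rewrite (ltW i1) (le_lt_trans i2) ?ltrD2l // => /(_ isT).
    by rewrite ler_norml => /andP[]; set q := xi (T l i) om; lra.
  apply/andP; split.
    by rewrite -(ler_nat R) natrM -ler_pdivlMr // (le_trans tm) // ltW.
  rewrite -(ltr_nat R) natrM -ltr_pdivrMr // natrD.
  apply: (le_lt_trans i2); have : 0 <= (m0%:R : R) by [].
  by move: l1 hl2; set q := l%:R; lra.
apply/cvgrNyPle => A; have [m0 hm] := H (Num.truncn (- A)).+1.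
exists m0%:R; split; first exact: num_real.
move=> t /ltW/hm h; apply: (le_trans h); rewrite lerNl; exact: ltW (truncnS_gt _).
Unshelve. all: by end_near. Qed.

(** Where the clock is finite, [survived 0] is positive because the clock at time 1 is. The
    exceptional set can thus be a level set of a measurable function with zero mean. *)
Lemma infinite_clock : exists A, [/\ measurable A, Q A = 0%E &
  forall om, ~ A om -> lamperti_Iinf gamma (xi ^~ om) = +oo%E].
Proof.
have [_ [bs _]] := survived_past_future 0 (j := 0) (cfun_cst 1 1).
rewrite /T mul0r in bs.
have s0 om : 0 <= survived 0 om.
  apply: mulr_ge0; last by have /andP[] := finite_clock_range om.
  by rewrite subr_ge0 -[leRHS]expR0 ler_expR oppr_le0 shifted_clock_ge0.
exists [set om | 0 < survived 0 om].
have mA : measurable [set om | 0 < survived 0 om].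
  rewrite (_ : [set om | _] = survived 0 @^-1` `]0, +oo[%classic).
    by rewrite -[X in measurable X]setTI; apply: bs.1.
  by apply/seteqP; split => om /=; rewrite in_itv /= andbT.
split => //.
- have fA : Q [set om | 0 < survived 0 om] \is a fin_num by exact: fin_num_measure.
  rewrite -(fineK fA) -(Ex_indic Q mA); congr EFin.
  have lc : (fun k : nat => Ex Q (fun om => Num.min 1 (k%:R * survived 0 om))) @ \oo --> Ex Q (\1_[set om | 0 < survived 0 om]).
    apply: (Ex_cvg (M := 1)).
    - by move=> k; apply: measurable_minr => //; apply: measurable_funM => //; exact: bs.1.
    - move=> k om; rewrite ger0_norm; first by rewrite ge_min lexx.
      by rewrite le_min ler01 mulr_ge0.
    - move=> om; have := s0 om; rewrite le_eqVlt => /orP[/eqP E|sp].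
        apply: cvg_near_cst; apply: nearW => k; rewrite -E mulr0 min_r // indicE memNset //=.
        by rewrite -E ltxx.
      apply: cvg_near_cst; near=> k; rewrite indicE mem_set //= min_l // -ler_pdivrMr // div1r.
      by near: k; exact: nbhs_infty_ger.
  apply/eqP; rewrite eq_le; apply/andP; split; last by apply: Ex_ge0 => om; rewrite indicE.
  rewrite -(cvg_lim _ lc) //; apply: limr_le; first exact: (cvgP _ lc).
  apply: nearW => k.
  have : Ex Q (fun om => Num.min 1 (k%:R * survived 0 om)) <= k%:R * Ex Q (survived 0).
    rewrite -ExZ //; apply: Ex_le.
    - split; first by apply: measurable_minr => //; apply: measurable_funM => //; exact: bs.1.
      by exists 1 => om; rewrite ger0_norm ?ge_min ?lexx // le_min ler01 mulr_ge0.
    - exact: bmfunZ.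
    - by move=> om; rewrite ge_min lexx orbT.
  by rewrite survived_eq0 mulr0.
- move=> om nA; apply/eqP; rewrite -leye_eq leNgt; apply/negP => fI; apply: nA => /=.
  rewrite survivedE /Iinf fI subr_gt0 -[ltRHS]expR0 ltr_expR oppr_lt0.
  rewrite /shifted_clock mulr_gt0 ?expR_gt0 // subr_gt0 add0r.
  exact: clock_int_lt.
Unshelve. all: by end_near. Qed.

End DriftDichotomy.

(** * Regularized functionals *)

Section NullModification.
Context d (T : measurableType d) (R : realType) (P : probability T R).
Variables (A : set T) (f g : T -> R) (M : R).
Hypothesis mA : measurable A.
Hypothesis PA : P A = 0%E.
Hypothesis fM : forall x, `|f x| <= M.
Hypothesis bg : bounded_mfun g.

Import HBNNSimple.

(* [f] need not be measurable: it is arbitrary on the null set [A]. *)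
Lemma ge0_integral_off_null : (forall x, ~ A x -> f x = g x) -> (forall x, A x -> g x = 0) ->
  (forall x, 0 <= f x) -> (\int[P]_x (f x)%:E = (Ex P g)%:E)%E.
Proof.
move=> fg gA f0; have g0 x : 0 <= g x by have [/gA ->|/fg <-] := pselect (A x).
(* Being a supremum over simple functions below the integrand, the integral of nonnegative functions
   is monotone without any measurability. *)
have mono (u v : T -> R) : (forall x, 0 <= u x) -> (forall x, u x <= v x) ->
    (\int[P]_x (u x)%:E <= \int[P]_x (v x)%:E)%E.
  move=> u0 uv; rewrite !ge0_integralTE; last 2 first.
  - by move=> x; rewrite lee_fin (le_trans (u0 x)).
  - by move=> x; rewrite lee_fin.
  apply: ereal_sup_le => _ /= [h hu <-]; exists h => // x.
  by rewrite (le_trans (hu x)) // lee_fin.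
have bA := bmfunZ M (bmfun_indic R mA).
have bgA := bmfunD bg bA.
apply/eqP; rewrite eq_le; apply/andP; split.
  have -> : Ex P g = Ex P (fun x => g x + M * \1_A x).
    by rewrite ExD // ExZ ?Ex_indic ?PA ?mulr0 ?addr0 //; exact: bmfun_indic.
  rewrite ExE //; apply: mono => // x; have [Ax|nA] := pselect (A x).
    by rewrite gA // add0r indicE mem_set // mulr1 (le_trans (ler_norm _)).
  by rewrite fg // indicE memNset // mulr0 addr0.
rewrite ExE //; apply: mono => // x.
by have [/gA ->|/fg <-] := pselect (A x).
Qed.

End NullModification.

Lemma integral_off_null d (T : measurableType d) (R : realType) (P : probability T R)
    (A : set T) (f g : T -> R) (M : R) : measurable A -> P A = 0%E ->
  (forall x, `|f x| <= M) -> bounded_mfun g ->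
  (forall x, ~ A x -> f x = g x) -> (forall x, A x -> g x = 0) ->
  (\int[P]_x (f x)%:E = (Ex P g)%:E)%E.
Proof.
move=> mA PA fM bg fg gA.
have part (s : R -> R) : continuous s -> s 0 = 0 -> (forall x, 0 <= s x <= `|x|) ->
    bounded_mfun (fun x => s (g x)) /\ (\int[P]_x (s (f x))%:E = (Ex P (fun x => s (g x)))%:E)%E.
  move=> cs s0 sx; have bsg : bounded_mfun (fun x => s (g x)).
    have [mg [N gN]] := bg; split.
      by apply: measurableT_comp mg; exact: continuous_measurable_fun.
    by exists N => x; have /andP[h1 h2] := sx (g x); rewrite ger0_norm // (le_trans h2).
  split => //; apply: (@ge0_integral_off_null _ _ _ _ A _ _ M) => //.
  - by move=> x; have /andP[h1 h2] := sx (f x); rewrite ger0_norm // (le_trans h2).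
  - by move=> x /fg ->.
  - by move=> x /gA ->.
  - by move=> x; have /andP[] := sx (f x).
have [bp ip] : bounded_mfun (fun x => Num.max (g x) 0) /\
    (\int[P]_x (Num.max (f x) 0)%:E = (Ex P (fun x => Num.max (g x) 0))%:E)%E.
  apply: (part (fun x => Num.max x 0)).
  - by move=> x; apply: continuous_maxr => y; [exact: cvg_id|exact: cvg_cst].
  - by rewrite maxxx.
  - by move=> x; rewrite le_max lexx orbT ge_max ler_norm normr_ge0.
have [bn inn] : bounded_mfun (fun x => Num.max (- g x) 0) /\
    (\int[P]_x (Num.max (- f x) 0)%:E = (Ex P (fun x => Num.max (- g x) 0))%:E)%E.
  apply: (part (fun x => Num.max (- x) 0)).
  - move=> x; apply: continuous_maxr => y; last exact: cvg_cst.
    by apply: cvgN; exact: cvg_id.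
  - by rewrite oppr0 maxxx.
  - by move=> x; rewrite le_max lexx orbT ge_max normr_ge0 -normrN ler_norm.
rewrite integralE.
rewrite (_ : (fun x => _)^\+%E = fun x => (Num.max (f x) 0)%:E); last first.
  by apply/funext => x; rewrite funeposE -EFin_max.
rewrite (_ : (fun x => _)^\-%E = fun x => (Num.max (- f x) 0)%:E); last first.
  by apply/funext => x; rewrite funenegE -EFinN -EFin_max.
rewrite ip inn -EFinB -ExB //; congr EFin; apply: eq_Ex => x /=.
have [h|] := boolP (0 <= g x); first by rewrite (max_l h) max_r ?subr0 // oppr_le0.
rewrite -ltNge => /ltW h; rewrite (max_r h) max_l ?oppr_ge0 //; ring.
Qed.

(** * Measurability of functionals of the chain *)

Section JumpPaths.
Variables (R : realType) (c : R).
Hypothesis c_gt0 : 0 < c.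

Lemma jump_path_cadlag (y : nat -> R) : cadlag (fun t => y (Num.truncn (c * t))).
Proof.
move=> t t0; have ct0 : 0 <= c * t by rewrite mulr_ge0 // ltW.
have /andP[h1 h2] := truncn_itv ct0; set m := Num.truncn (c * t) in h1 h2 *.
split.
  apply: cvg_near_cst; near=> x; congr y; apply: truncn_def.
  have tx : t < x by near: x; exact: nbhs_right_gt.
  have xm : x < m.+1%:R / c.
    by near: x; apply: nbhs_right_lt; rewrite ltr_pdivlMr // mulrC.
  apply/andP; split; first by rewrite (le_trans h1) // ler_pM2l // ltW.
  by move: xm; rewrite ltr_pdivlMr // mulrC.
move=> tp; have ctp : 0 < c * t by exact: mulr_gt0.
have [k k1 k2] : exists2 k : nat, k%:R < c * t & c * t <= k.+1%:R.
  move: h1; rewrite le_eqVlt => /orP[/eqP E|h1]; last by exists m => //; exact: ltW.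
  have m0 : (0 < m)%N by rewrite -(ltr_nat R) E.
  by exists m.-1; rewrite ?prednK // -E // ltr_nat prednK.
apply/cvg_ex; exists (y k); apply: cvg_near_cst; near=> x; congr y; apply: truncn_def.
have xt : x < t by near: x; exact: nbhs_left_lt.
have kx : k%:R / c < x.
  by near: x; apply: nbhs_left_gt; rewrite ltr_pdivrMr // mulrC.
apply/andP; split; first by move: kx; rewrite ltr_pdivrMr // mulrC => /ltW.
by rewrite (lt_le_trans _ k2) // ltr_pM2l.
Unshelve. all: by end_near. Qed.

Lemma stopped_path_cvg (y : nat -> R) :
  J1_cvg (fun k t => y (minn (Num.truncn (c * t)) k)) (fun t => y (Num.truncn (c * t))).
Proof.
exists (fun=> id); split; first by move=> k; exact: time_change_id.
split.
  by move=> e e0; apply: nearW => k t _; rewrite subrr normr0 ltW.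
move=> T e e0; exists (Num.truncn (c * T)) => // k /= Tk t /andP[t0 tT].
rewrite (minn_idPl _) ?subrr ?normr0 ?(ltW e0) //.
apply: leq_trans Tk; by apply: le_truncn; rewrite ler_pM2l.
Qed.

End JumpPaths.

Section ChainFunctional.
Context d (Om : measurableType d) (R : realType) (P : probability Om R).
Variables (p : nat -> nat -> R) (X : nat -> nat -> Om -> nat).
Hypothesis mc : markov_chains P p X.
Variable n : nat.
Hypothesis n_gt0 : (0 < n)%N.

Lemma bmfun_path (U : seq nat -> R) M k : (forall s, `|U s| <= M) ->
  bounded_mfun (fun om => U (X n 0%N om :: trail X n k om)).
Proof.
move=> UM; split; last by exists M.
move=> _ Y mY; rewrite setTI.
rewrite (_ : _ @^-1` Y = \bigcup_i ([set om | X n 0%N om = i] `&` [set om | Y (U (i :: trail X n k om))])).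
  apply: bigcup_measurable => i _; apply: measurableI; first exact: (measurable_X mc).
  exact: (measurable_trail mc n (fun s => U (i :: s)) k Y).
by apply/seteqP; split => [om /= h|om [i _ /= [-> h]]] //; exists (X n 0%N om).
Qed.

(** Measurability comes from the continuity of [F]: the path frozen after [k] steps depends on a
    history with countably many values, and it converges in $J_1$ to the whole path. *)
Lemma bmfun_chain (F : (R -> R) -> R) c : 0 < c -> J1_bounded_continuous F ->
  bounded_mfun (fun om => F (fun t => (X n (Num.truncn (c * t)) om)%:R / n%:R)).
Proof.
move=> c0 [[M FM] [_ Fc]].
pose y om j : R := (X n j om)%:R / n%:R.
pose U k s := F (fun t => (nth 0%N s (minn (Num.truncn (c * t)) k))%:R / n%:R).
have UE k om : U k (X n 0%N om :: trail X n k om) = F (fun t => y om (minn (Num.truncn (c * t)) k)).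
  rewrite /U; congr F; apply/funext => t; rewrite /y; congr (_%:R / _).
  have : (minn (Num.truncn (c * t)) k <= k)%N by exact: geq_minr.
  case: (minn _ _) => [//|j] jk /=.
  by rewrite (set_nth_default n) ?size_trail // nth_trail.
apply: (bmfun_cvg (f_ := fun k om => U k (X n 0%N om :: trail X n k om)) (M := M)).
- by move=> k; apply: (bmfun_path k (M := M) (U := U k) _).1 => s; exact: FM.
- by move=> k om; exact: FM.
- move=> om; under eq_fun do rewrite UE.
  apply: Fc; last exact: stopped_path_cvg.
    move=> k; exact: (jump_path_cadlag c0 (fun j => y om (minn j k))).
  exact: (jump_path_cadlag c0 (y om)).
Qed.

End ChainFunctional.

Lemma near_forall_leq (T : Type) (D : set_system T) (FD : Filter D) (Pr : nat -> T -> Prop) K :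
  (forall j, (j <= K)%N -> \forall x \near D, Pr j x) -> \forall x \near D, forall j, (j <= K)%N -> Pr j x.
Proof.
elim: K => [|K IH] H.
  by apply: filterS (H 0%N (leqnn _)) => x h j; rewrite leqn0 => /eqP ->.
have h1 := IH (fun j jK => H j (leqW jK)); have h2 := H K.+1 (leqnn _).
apply: filterS2 h1 h2 => x g1 g2 j; rewrite leq_eqVlt ltnS => /orP[/eqP -> //|]; exact: g1.
Qed.

(** * Functionals of the sampled path *)

Section StepFunctional.
Context {R : realType}.
Implicit Types (x y : nat -> R).

Definition ramp (r c : R) := Num.max 0 (Num.min 1 (c - r)).

Lemma ramp01 r c : 0 <= ramp r c <= 1.
Proof. by rewrite /ramp le_max lexx /= ge_max ler01 ge_min lexx. Qed.

Lemma ramp0 r c : c <= r -> ramp r c = 0.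
Proof. by move=> cr; rewrite /ramp max_l // ge_min; apply/orP; right; rewrite subr_le0. Qed.

Lemma ramp1 r c : r + 1 <= c -> ramp r c = 1.
Proof. by move=> cr; rewrite /ramp min_l ?max_r // lerBrDl. Qed.

Lemma ramp_lip r c c' : `|ramp r c - ramp r c'| <= `|c - c'|.
Proof.
have key u v : u <= v -> 0 <= ramp r v - ramp r u <= v - u.
  move=> uv; rewrite /ramp; set p := u - r; set q := v - r.
  have -> : v - u = q - p by rewrite /p /q; ring.
  have : p <= q by rewrite lerD2r.
  move: p q => p q pq; case: (leP 1 p) => h1; case: (leP 1 q) => h2;
    case: (leP 0 p) => h3; case: (leP 0 q) => h4; rewrite ?(max_r ler01); apply/andP; split; lra.
have [cc|cc] := leP c c'.
  have /andP[h1 h2] := key _ _ cc; rewrite distrC ger0_norm //.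
  by rewrite distrC ger0_norm ?subr_ge0.
have /andP[h1 h2] := key _ _ (ltW cc); rewrite ger0_norm //.
by rewrite ger0_norm ?subr_ge0 // ltW.
Qed.

Variables (F : (R -> R) -> R) (M k gamma h r : R) (K : nat).
Hypothesis F0 : forall w, 0 <= F w.
Hypothesis FM : forall w, F w <= M.
Hypothesis k0 : 0 <= k.
Hypothesis Mk : M <= k.
Hypothesis gamma_gt0 : 0 < gamma.
Hypothesis h_gt0 : 0 < h.

(** The ramp discards, continuously, samples whose clock has not passed [r]. It will be used with
    the horizon [r = e^-1], short of which a step path cannot be compared with the chain. *)
Definition step_fct (z : nat -> R) :=
  lipreg F M k (lamperti_step gamma h K z) * ramp r (step_clock gamma h z K).

Lemma step_fct_ge0 z : 0 <= step_fct z.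
Proof. by rewrite mulr_ge0 ?lipreg_ge0 //; have /andP[] := ramp01 r (step_clock gamma h z K). Qed.

Lemma step_fct_le_lipreg z : step_fct z <= lipreg F M k (lamperti_step gamma h K z).
Proof.
have /andP[h1 h2] := ramp01 r (step_clock gamma h z K).
by rewrite -[leRHS]mulr1 ler_wpM2l ?lipreg_ge0.
Qed.

Lemma step_fct_leM z : step_fct z <= M.
Proof. by rewrite (le_trans (step_fct_le_lipreg z)) // lipreg_leM. Qed.

Lemma step_fct_modulus e z z' : 0 < e ->
  (forall j, (j <= K)%N -> `|step_clock gamma h z j - step_clock gamma h z' j| <= e) ->
  (forall j, (j < K)%N -> `|expR (z j) - expR (z' j)| <= e) ->
  `|step_fct z - step_fct z'| <= (k + M) * e.
Proof.
move=> e0 he he'; have c1 := lamperti_step_close e0 h_gt0 he he'.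
have c2 : close_paths e (lamperti_step gamma h K z') (lamperti_step gamma h K z).
  by apply: lamperti_step_close => // j jK; rewrite distrC; [exact: he|exact: he'].
have := lipreg_lip F0 FM k0 Mk e0 c1; have := lipreg_lip F0 FM k0 Mk e0 c2.
have := le_trans (ramp_lip r (step_clock gamma h z K) (step_clock gamma h z' K)) (he K (leqnn _)).
have := ramp01 r (step_clock gamma h z K); have := ramp01 r (step_clock gamma h z' K).
have := lipreg_ge0 F0 FM (lamperti_step gamma h K z) k0; have := lipreg_leM F0 FM (lamperti_step gamma h K z) k0.
have := lipreg_ge0 F0 FM (lamperti_step gamma h K z') k0; have := lipreg_leM F0 FM (lamperti_step gamma h K z') k0.
rewrite /step_fct; set a := lipreg F M k (lamperti_step gamma h K z).
set b := lipreg F M k (lamperti_step gamma h K z').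
set s := ramp r (step_clock gamma h z K); set t := ramp r (step_clock gamma h z' K).
clearbody a b s t => bM b0 aM a0 /andP[t0 t1] /andP[s0 s1] st ab ba.
have -> : a * s - b * t = (a - b) * s + b * (s - t) by ring.
apply: (le_trans (ler_normD _ _)); rewrite [leRHS]mulrDl !normrM; apply: lerD.
  rewrite -[leRHS]mulr1; apply: ler_pM => //; last by rewrite ger0_norm.
  by rewrite ler_norml; apply/andP; split; lra.
by rewrite (ger0_norm b0); apply: ler_pM.
Qed.

Lemma step_fct_cont B e : 0 <= B -> 0 < e -> exists2 dl, 0 < dl &
  forall z z', (forall j, (j <= K)%N -> `|z j| <= B) ->
  (forall j, (j <= K)%N -> `|z j - z' j| <= dl) -> `|step_fct z - step_fct z'| <= e.
Proof.
move=> B0 e0; have M0 : 0 <= M by exact: le_trans (F0 (fun=> 0)) (FM _).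
have q0 : 0 < k + M + 1 by rewrite ltr_wpDl // addr_ge0.
pose e1 := e / (k + M + 1); have e10 : 0 < e1 by exact: divr_gt0.
have hK0 : 0 <= h * K%:R by rewrite mulr_ge0 // ltW.
pose e2 := e1 / (h * K%:R + 1).
have hK1 : 0 < h * K%:R + 1 by exact: ltr_wpDl.
have e20 : 0 < e2 by exact: divr_gt0.
have [d1 d10 H1] := expR_osc B e10; have [d2 d20 H2] := expR_osc (gamma * B) e20.
exists (Num.min d1 (d2 / gamma)); first by rewrite lt_min d10 divr_gt0.
move=> z z' zB zz; apply: le_trans (step_fct_modulus e10 _ _) _; last first.
- by rewrite /e1 mulrA ler_pdivrMr // mulrC ler_wpM2l ?(ltW e0) // lerDl.
- move=> j jK; have := zz j (ltnW jK); rewrite le_min => /andP[h1 _].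
  by rewrite distrC; apply: H1 => //; exact: zB (ltnW jK).
- move=> j jK; rewrite /step_clock -sumrB; apply: (le_trans (ler_norm_sum _ _ _)).
  apply: (@le_trans _ _ (\sum_(0 <= i < j) h * e2)).
    apply: ler_sum_nat => i /andP[_ ij]; have iK : (i <= K)%N by exact: leq_trans (ltnW ij) jK.
    rewrite -mulrBr normrM (gtr0_norm h_gt0) ler_pM2l // distrC.
    apply: H2; first by rewrite normrM (gtr0_norm gamma_gt0) ler_pM2l // zB.
    rewrite -mulrBr normrM (gtr0_norm gamma_gt0) -ler_pdivlMl // mulrC.
    by have := zz i iK; rewrite le_min => /andP[].
  rewrite sumr_const_nat subn0 -mulr_natr mulrAC.
  apply: (@le_trans _ _ (h * K%:R * e2)).
    by rewrite ler_pM2r // ler_pM2l // ler_nat.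
  by rewrite /e2 mulrA ler_pdivrMr // mulrC ler_wpM2l ?(ltW e10) // lerDl.
Qed.

Lemma cfun_step_fct : cfun K (fun x => step_fct (walk x)).
Proof.
have bound x : exists2 B, 0 <= B & forall j, (j <= K)%N -> `|walk x j| <= B.
  exists (\sum_(0 <= j < K.+1) `|walk x j|); first by apply: sumr_ge0.
  move=> j jK; rewrite big_mkord (bigD1 (Ordinal (jK : (j < K.+1)%N))) //= lerDl.
  exact: sumr_ge0.
split.
- move=> x y xy; apply/eqP; rewrite -subr_eq0 -normr_le0; apply/ler_addgt0Pr => e e0; rewrite add0r.
  have [B B0 xB] := bound x; have [dl dl0 H] := step_fct_cont B0 e0.
  by apply: H => // j jK; rewrite (walk_local xy jK) subrr normr0 ltW.
- by exists M => x; rewrite ger0_norm ?step_fct_ge0 // step_fct_leM.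
- move=> xs x xx; apply/cvgrPdist_le => e e0.
  have [B B0 xB] := bound x; have [dl dl0 H] := step_fct_cont B0 e0.
  have : \forall m \near \oo, forall j, (j <= K)%N -> `|walk x j - walk (xs m) j| <= dl.
    apply: near_forall_leq => j jK; have := walk_cvg xx jK.
    by move=> /cvgrPdist_le/(_ _ dl0).
  by apply: filterS => m hm; apply: H.
Qed.

Lemma step_fct_unif ell e : 0 <= ell -> 0 < e -> exists2 dl, 0 < dl &
  forall x y : nat -> R, (forall i, (i < K)%N -> [/\ `|x i| <= ell, `|y i| <= ell & `|x i - y i| <= dl]) ->
    `|step_fct (walk x) - step_fct (walk y)| <= e.
Proof.
move=> l0 e0; have B0 : 0 <= K%:R * ell by exact: mulr_ge0.
have [dl dl0 H] := step_fct_cont B0 e0; exists (dl / K.+1%:R); first by rewrite divr_gt0.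
have sb (u : nat -> R) c j : 0 <= c -> (j <= K)%N -> (forall i, (i < K)%N -> `|u i| <= c) -> `|walk u j| <= K%:R * c.
  move=> c0 jK uc; apply: (le_trans (ler_norm_sum _ _ _)).
  apply: (@le_trans _ _ (\sum_(0 <= i < j) c)).
    by apply: ler_sum_nat => i /andP[_ ij]; apply: uc; exact: leq_trans jK.
  by rewrite sumr_const_nat subn0 -(mulr_natl c) ler_wpM2r // ler_nat.
move=> x y xy; apply: H => j jK; first by apply: sb => // i /xy[].
rewrite /walk -sumrB; apply: le_trans (sb (fun i => x i - y i) (dl / K.+1%:R) j _ jK _) _.
- by rewrite divr_ge0 // ltW.
- by move=> i /xy[].
- rewrite mulrA ler_pdivrMr ?ltr0n // mulrC ler_wpM2l ?(ltW dl0) // ler_nat; exact: leqnSn.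
Qed.

End StepFunctional.

(** * The step functionals along refining grids *)

Section LevyLimit.
Context (R : realType) d (Om : measurableType d) (Q : probability Om R).
Variables (xi : R -> Om -> R) (gamma : R).
Hypothesis gamma_gt0 : 0 < gamma.
Hypothesis xi_meas : forall t, measurable_fun setT (xi t).
Hypothesis xi0 : forall om, xi 0 om = 0.
Hypothesis xi_cadlag : forall om, cadlag (xi ^~ om).

Lemma walk_incr0 h om : walk (incr xi h 0 om) = fun i => xi (i%:R * h) om.
Proof. by apply/funext => i; rewrite walk_incr add0n mul0r xi0 subr0. Qed.

Lemma mesh_lt (dl : R) : 0 < dl -> \forall m \near \oo, mesh m < dl.
Proof.
move=> dl0; near=> m; rewrite /mesh invf_plt ?posrE ?ltr0n ?expn_gt0 //.
apply: (@lt_le_trans _ _ (m%:R)); last by rewrite ler_nat ltnW // ltn_expl.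
by near: m; exact: nbhs_infty_gtr.
Unshelve. all: by end_near. Qed.

Lemma mesh_le m m' : (m <= m')%N -> mesh m' <= mesh m :> R.
Proof.
move=> mm; rewrite /mesh lef_pV2 ?posrE ?ltr0n ?expn_gt0 //.
by rewrite ler_nat leq_exp2l.
Qed.

Lemma mesh_mulr U m : (U * 2 ^ m)%:R * mesh m = U%:R :> R.
Proof. by rewrite /mesh natrM mulfK // pnatr_eq0 expn_eq0. Qed.

(** The bound is uniform in the mesh, because all these events force the supremum of $|\xi|$ over
    $[0,U]$ above [l]. Uniformity is essential: the range is chosen before the mesh in
    [chain_lower]. *)
Lemma out_of_range_small U e : 0 < e -> exists l0 : nat, forall l m, l0%:R <= l ->
  fine (Q [set om | exists2 i, (i <= U * 2 ^ m)%N & l < `|xi (i%:R * mesh m) om|]) <= e.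
Proof.
move=> e0; pose out m l := [set om | exists2 i, (i <= U * 2 ^ m)%N & l < `|xi (i%:R * mesh m) om|].
have mout m l : measurable (out m l).
  rewrite (_ : out m l = \bigcup_(i in [set i | (i <= U * 2 ^ m)%N]) [set om | l < `|xi (i%:R * mesh m) om|]).
    apply: bigcup_measurable => i _.
    rewrite (_ : [set om | _] = (fun om => `|xi (i%:R * mesh m) om|) @^-1` `]l, +oo[%classic).
      by rewrite -[X in measurable X]setTI; apply: measurableT_comp.
    by apply/seteqP; split => om /=; rewrite in_itv /= andbT.
  by apply/seteqP; split => om /= [i ir hi]; exists i.
pose E (l : nat) := \bigcup_m out m l%:R.
have mE l : measurable (E l) by apply: bigcup_measurable => m _; exact: mout.
have lc : (fun l => Ex Q (\1_(E l))) @ \oo --> (0 : R).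
  rewrite -(Ex_cst Q 0); apply: (Ex_cvg (M := 1)).
  - by move=> l; exact: measurable_indic (mE l).
  - by move=> l om; rewrite indicE ger0_norm //; case: (_ \in _).
  - move=> om; have [B B0 hB] := cadlag_bounded (xi_cadlag om) U%:R.
    apply: cvg_near_cst; near=> l; rewrite indicE memNset // => -[m _ [i iU]].
    apply/negP; rewrite -leNgt; apply: (@le_trans _ _ B); last by near: l; exact: nbhs_infty_ger.
    apply: hB; rewrite mulr_ge0 ?(ltW (mesh_gt0 _)) //= -(mesh_mulr U m).
    by rewrite ler_pM2r ?mesh_gt0 // ler_nat.
have /cvgrPdist_le/(_ _ e0) [l0 _ hl] := lc; exists l0 => l m ll.
have := hl l0 (leqnn _); rewrite /= sub0r normrN Ex_indic // ger0_norm ?fine_ge0 //.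
apply: le_trans; apply: fine_le.
- by apply: fin_num_measure; exact: mout.
- exact: fin_num_measure.
apply: le_measure; rewrite ?inE //; first exact: mout.
by move=> om [i iU h]; exists m => //; exists i => //; exact: le_lt_trans h.
Unshelve. all: by end_near. Qed.

Variable A : set Om.
Hypothesis mA : measurable A.
Hypothesis QA : Q A = 0%E.
Hypothesis clock_infty : forall om, ~ A om -> lamperti_Iinf gamma (xi ^~ om) = +oo%E.

Lemma Ex_off_null f : bounded_mfun f -> Ex Q (fun om => \1_(~` A) om * f om) = Ex Q f.
Proof.
move=> bf; have [mf [B fB]] := bf; have b1 := bmfun_indic R mA.
have bA := bmfunM b1 bf.
have bC := bmfunM (bmfun_indic R (measurableC mA)) bf.
have -> : Ex Q f = Ex Q (fun om => \1_(~` A) om * f om) + Ex Q (fun om => \1_A om * f om).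
  rewrite -ExD //; apply: eq_Ex => om; rewrite -mulrDl !indicE in_setC.
  by case: (om \in A); rewrite /= ?add0r ?addr0 mul1r.
suff -> : Ex Q (fun om => \1_A om * f om) = 0 by rewrite addr0.
apply/eqP; rewrite -normr_le0.
have h1 : Ex Q (fun om => B * \1_A om) = 0 by rewrite ExZ // Ex_indic // QA mulr0.
have i0 om : 0 <= (\1_A om : R) by rewrite indicE.
have fb om : - (B * \1_A om) <= \1_A om * f om <= B * \1_A om.
  by rewrite -ler_norml normrM mulrC ler_pM // ger0_norm.
rewrite ler_norml oppr0 -{1}oppr0 -h1 -ExN; last exact: bmfunZ.
apply/andP; split; apply: Ex_le => //; try exact: bmfunZ.
- exact/bmfunN/bmfunZ.
- by move=> om; have /andP[] := fb om.
- by move=> om; have /andP[] := fb om.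
Qed.

Variables (F : (R -> R) -> R) (M : R).
Hypothesis F0 : forall w, 0 <= F w.
Hypothesis FM : forall w, F w <= M.
Hypothesis F_J1 : J1_bounded_continuous F.

Let M0 : 0 <= M. Proof. exact: le_trans (F0 (fun=> 0)) (FM _). Qed.

Section Sampling.
Variables (k r : R) (ms : nat -> nat).
Hypothesis Mk : M <= k.
Hypothesis msi : forall i, (i <= ms i)%N.
Let k0 : 0 <= k. Proof. exact: le_trans Mk. Qed.

Lemma step_fct_cvg om : ~ A om ->
  (fun i => step_fct F M k gamma (mesh (ms i)) r (i * 2 ^ ms i) (fun j => xi (j%:R * mesh (ms i)) om)) @ \oo -->
  lipreg F M k (lamperti gamma (xi ^~ om)).
Proof.
move=> nA; apply/cvgrPdist_le => e e0.
have k1 : 0 < k + 1 by exact: ltr_wpDl.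
have r1 : 0 < `|r| + 1 by exact: ltr_wpDl.
(* The first bound makes the Lipschitz error [k * e1] at most [e]; the second puts the horizon
   [e1^-1] beyond [r + 1], where the ramp equals 1. *)
pose e1 := Num.min (e / (k + 1)) (`|r| + 1)^-1.
have e10 : 0 < e1 by rewrite lt_min divr_gt0 // invr_gt0.
have [T [dl [dl0 T0 H]]] := step_close (xi_cadlag om) gamma_gt0 e10 (clock_infty nA).
near=> i.
have [] := H (mesh (ms i)) (i * 2 ^ ms i)%N.
- rewrite mesh_gt0 (le_lt_trans (mesh_le (msi i))) //.
  by near: i; exact: mesh_lt.
- by rewrite mesh_mulr; near: i; exact: nbhs_infty_ger.
move=> c1 c2 cl; rewrite /step_fct ramp1 ?mulr1; last first.
  apply: le_trans (ltW cl); apply: (@le_trans _ _ (`|r| + 1)); first by rewrite lerD2r ler_norm.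
  by rewrite -[leLHS]invrK lef_pV2 ?posrE ?invr_gt0 // ge_min lexx orbT.
have h1 := lipreg_lip F0 FM k0 Mk e10 c1; have h2 := lipreg_lip F0 FM k0 Mk e10 c2.
have ke : k * e1 <= e.
  apply: (@le_trans _ _ (k * (e / (k + 1)))); first by rewrite ler_wpM2l // ge_min lexx.
  by rewrite mulrA ler_pdivrMr // mulrC ler_wpM2l ?(ltW e0) // lerDl.
move: h1 h2; set u := lipreg _ _ _ (lamperti _ _); set v := lipreg _ _ _ _.
by clearbody u v => h1 h2; rewrite ler_norml; apply/andP; split; lra.
Unshelve. all: by end_near. Qed.

Lemma Ex_step_fct_cvg :
  bounded_mfun (fun om => \1_(~` A) om * lipreg F M k (lamperti gamma (xi ^~ om))) /\
  (fun i => Ex Q (fun om => step_fct F M k gamma (mesh (ms i)) r (i * 2 ^ ms i)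
     (walk (incr xi (mesh (ms i)) 0 om)))) @ \oo -->
  Ex Q (fun om => \1_(~` A) om * lipreg F M k (lamperti gamma (xi ^~ om))).
Proof.
pose f i om := step_fct F M k gamma (mesh (ms i)) r (i * 2 ^ ms i) (walk (incr xi (mesh (ms i)) 0 om)).
have bf i : bounded_mfun (f i).
  apply: (bmfun_incr Q xi_meas (mesh (ms i)) 0 (g := fun x => step_fct F M k gamma (mesh (ms i)) r (i * 2 ^ ms i) (walk x))).
  exact: cfun_step_fct (mesh_gt0 _).
have bC := bmfun_indic R (measurableC mA).
have mg i : measurable_fun setT (fun om => \1_(~` A) om * f i om) by have [] := bmfunM bC (bf i).
have gM i om : `|\1_(~` A) om * f i om| <= M.
  have f0 : 0 <= f i om by exact: step_fct_ge0.
  have fM : f i om <= M by exact: step_fct_leM.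
  rewrite ger0_norm; last by rewrite mulr_ge0 // indicE.
  rewrite -[leRHS]mul1r; apply: ler_pM => //.
have gc om : (fun i => \1_(~` A) om * f i om) @ \oo --> \1_(~` A) om * lipreg F M k (lamperti gamma (xi ^~ om)).
  rewrite indicE; have [nA|yA] := pselect (A om).
    rewrite memNset; last by move=> /(_ nA).
    by rewrite mul0r; under eq_fun do rewrite mul0r; exact: cvg_cst.
  rewrite mem_set // mul1r; under eq_fun do rewrite mul1r.
  have -> : f ^~ om = fun i => step_fct F M k gamma (mesh (ms i)) r (i * 2 ^ ms i)
      (fun j => xi (j%:R * mesh (ms i)) om).
    by apply/funext => i; rewrite /f walk_incr0.
  exact: step_fct_cvg.
split; first exact: (bmfun_cvg mg gM gc).
have -> : (fun i => Ex Q (f i)) = fun i => Ex Q (fun om => \1_(~` A) om * f i om).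
  by apply/funext => i; rewrite Ex_off_null.
exact: Ex_cvg mg gM gc.
Qed.

End Sampling.

Lemma Ex_lipreg_cvg :
  bounded_mfun (fun om => \1_(~` A) om * F (lamperti gamma (xi ^~ om))) /\
  (fun k => Ex Q (fun om => \1_(~` A) om * lipreg F M k.+1%:R (lamperti gamma (xi ^~ om)))) @ \oo -->
  Ex Q (fun om => \1_(~` A) om * F (lamperti gamma (xi ^~ om))).
Proof.
(* The index is shifted so that [M <= k] holds throughout, the condition under which [lipreg] is
   Lipschitz. *)
pose N := (Num.truncn M).+1; have NM : M <= N%:R by exact: ltW (truncnS_gt _).
pose f k om := \1_(~` A) om * lipreg F M (N + k).+1%:R (lamperti gamma (xi ^~ om)).
have Mk k : M <= (N + k).+1%:R by rewrite (le_trans NM) // ler_nat leqW // leq_addr.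
have mf k : measurable_fun setT (f k).
  by have [[]] := Ex_step_fct_cvg 0 (Mk k) (fun i => leqnn i).
have fM k om : `|f k om| <= M.
  have l0 := lipreg_ge0 F0 FM (lamperti gamma (xi ^~ om)) (ler0n R (N + k).+1).
  have lM := lipreg_leM F0 FM (lamperti gamma (xi ^~ om)) (ler0n R (N + k).+1).
  rewrite /f indicE; case: (_ \in _); rewrite ?mul0r ?mul1r ?normr0 //.
  by rewrite ger0_norm.
have fc om : f ^~ om @ \oo --> \1_(~` A) om * F (lamperti gamma (xi ^~ om)).
  rewrite /f indicE; have [nA|yA] := pselect (A om).
    rewrite memNset; last by move=> /(_ nA).
    by rewrite mul0r; under eq_fun do rewrite mul0r; exact: cvg_cst.
  rewrite mem_set // mul1r; under eq_fun do rewrite mul1r.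
  have cl : cadlag (lamperti gamma (xi ^~ om)) by apply: lamperti_cadlag => //; exact: clock_infty.
  have := lipreg_cvg F0 FM F_J1 cl.
  by rewrite -(cvg_shiftn N); under eq_fun do rewrite addnC.
split; first exact: (bmfun_cvg mf fM fc).
rewrite -(cvg_shiftn N); under eq_fun do rewrite addnC.
exact: Ex_cvg mf fM fc.
Qed.

End LevyLimit.

(** * Lower bound for the chain *)

Lemma cvg_ge_near (R : realType) (u : nat -> R) (l e : R) N : u @ \oo --> l -> 0 < e ->
  exists2 k, (N <= k)%N & l - e <= u k.
Proof.
move=> ul e0; move/cvgrPdist_le: ul => /(_ _ e0)[K _ hK].
exists (maxn N K); first exact: leq_maxl.
have := hK (maxn N K) (leq_maxr _ _); rewrite /= ler_norml => /andP[_]; lra.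
Qed.

Section ChainLower.
Context (R : realType) d (Om : measurableType d) (P : probability Om R).
Context d' (Om' : measurableType d') (Q : probability Om' R).
Variables (p : nat -> nat -> R) (a : nat -> R) (re im : R -> R) (xi : R -> Om' -> R).
Variable X : nat -> nat -> Om -> nat.
Variable gamma : R.
Hypothesis p_ge0 : forall i j, 0 <= p i j.
Hypothesis p_sum1 : forall i, (0 < i)%N ->
  (fun m => \sum_(1 <= j < m) p i j) @ \oo --> (1 : R).
Hypothesis a_gt0 : forall n, 0 < a n.
Hypothesis gamma_gt0 : 0 < gamma.
Hypothesis a_rv : forall x, 0 < x ->
     (fun n => a (Num.truncn (x * n%:R)) / a n) @ \oo --> powR x gamma.
Hypothesis nu_re : forall lam, nu p a n (fun x => cos (lam * x) - 1) @[n --> \oo] --> re lam.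
Hypothesis nu_im : forall lam, nu p a n (fun x => sin (lam * x)) @[n --> \oo] --> im lam.
Hypothesis lyap_bounded : forall l : R, 0 < l -> exists2 C : R, 0 < C &
  \forall m \near \oo, forall z, nu p a m (lyap_jump_fct l z) <= C.
Hypothesis lyap_small : forall e : R, 0 < e -> exists2 l0 : R, 1 <= l0 & forall l, l0 <= l ->
  \forall m \near \oo, forall z, nu p a m (lyap_jump_fct l z) <= e.
Hypothesis xi_meas : forall t, measurable_fun setT (xi t).
Hypothesis xi0 : forall om, xi 0 om = 0.
Hypothesis xi_cadlag : forall om, cadlag (xi ^~ om).
Hypothesis xi_cos : forall t lam, 0 <= t ->
  Ex Q (fun om => cos (lam * xi t om)) = expR (t * re lam) * cos (t * im lam).
Hypothesis xi_sin : forall t lam, 0 <= t ->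
  Ex Q (fun om => sin (lam * xi t om)) = expR (t * re lam) * sin (t * im lam).
Hypothesis xi_ind : forall (k : nat) (t : nat -> R) (B : nat -> set R),
     0 <= t 0%N -> (forall j, (j < k)%N -> t j < t j.+1) ->
     (forall j, measurable (B j)) ->
     fine (Q [set om | forall j, (j < k)%N -> xi (t j.+1) om - xi (t j) om \in B j])
     = \prod_(j < k) fine (Q [set om | xi (t j.+1) om - xi (t j) om \in B j]).
Hypothesis xi_stat : forall s t (B : set R), 0 <= s -> 0 <= t -> measurable B ->
     Q [set om | xi (t + s) om - xi t om \in B] = Q [set om | xi s om \in B].
Hypothesis mc : markov_chains P p X.

(** [rv_uniform] gives the rate at the position [i] itself; passing to the nearby position [j] costs
    the modulus of continuity of the exponential. The third in [q] leaves room for both errors. *)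
Lemma local_regularity (ell kap e : R) : 0 < ell -> 0 < kap -> 0 < e ->
  exists eta N, 0 < eta /\ forall n, (N <= n)%N -> (0 < n)%N ->
    (forall x, `|@logjump R n x| <= ell -> (N <= x)%N /\ (0 < x)%N) ->
    forall i j, `|@logjump R n i| <= ell -> `|@logjump R n j| <= ell ->
      `|@logjump R n i - logjump n j| <= 2 * eta ->
      `|a i / a n - expR (gamma * logjump n j)| <= kap * expR (gamma * logjump n j) /\
      `|i%:R / n%:R - expR (logjump n j)| <= e.
Proof.
move=> l0 kap0 e0; pose q := Num.min kap 1 / 3.
have q0 : 0 < q by rewrite divr_gt0 // lt_min kap0 ltr01.
have q3 : 3 * q <= 1 by rewrite mulrC divfK // ge_min lexx orbT.
have qk : 3 * q <= kap by rewrite mulrC divfK // ge_min lexx.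
have [d1 d10 H1] := expR_osc ell e0; have [d2 d20 H2] := expR_osc 0 q0.
have El : 1 <= expR ell by rewrite -[leLHS]expR0 ler_expR ltW.
have [N HN] := rv_uniform a_gt0 a_rv q0 El.
exists (Num.min d1 (d2 / gamma) / 2), N; split.
  by rewrite divr_gt0 // lt_min d10 divr_gt0.
move=> n Nn n0 big i j il jl; rewrite mulrC divfK // le_min => /andP[ij1 ij2].
have [Ni i0] := big i il.
have nR0 : 0 < (n%:R : R) by rewrite ltr0n.
have iR0 : 0 < (i%:R : R) by rewrite ltr0n.
have iE : i%:R / n%:R = expR (@logjump R n i).
  by rewrite -ln_ratio // lnK // posrE divr_gt0.
split; last by rewrite iE; apply: H1 => //; rewrite distrC.
have in1 : i%:R <= expR ell * n%:R.
  rewrite -ler_pdivrMr // iE ler_expR; exact: le_trans (ler_norm _) il.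
have in2 : n%:R <= expR ell * i%:R.
  rewrite -ler_pdivrMr // (_ : n%:R / i%:R = (i%:R / n%:R)^-1); last by rewrite invf_div.
  rewrite iE -expRN ler_expR; apply: le_trans (ler_norm _) _; by rewrite normrN.
have h1 := HN n i Nn Ni n0 i0 in2 in1.
have h2 : `|expR (gamma * (logjump n i - logjump n j)) - 1| <= q.
  rewrite -[X in _ - X]expR0; apply: H2; first by rewrite normr0.
  rewrite sub0r normrN normrM (gtr0_norm gamma_gt0) -ler_pdivlMl // mulrC; exact: ij2.
have v0 : 0 < expR (gamma * @logjump R n j) by exact: expR_gt0.
have uE : expR (gamma * @logjump R n i) =
    expR (gamma * logjump n j) * expR (gamma * (logjump n i - logjump n j)).
  by rewrite -expRD; congr expR; ring.
move: h1 h2 v0; rewrite uE; set v := expR (gamma * logjump n j); set w := expR _; set A := a i / a n.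
clearbody v w A; move=> h1 h2 v0.
have h3 : `|A - v| <= `|A - v * w| + v * `|w - 1|.
  have -> : v * `|w - 1| = `|v * (w - 1)| by rewrite normrM (gtr0_norm v0).
  apply: le_trans (ler_normD _ _).
  by rewrite (_ : A - v * w + v * (w - 1) = A - v) //; ring.
have w2 : w <= 1 + q by move: h2; rewrite ler_norml => /andP[]; lra.
have h4 : q * (v * w) <= q * (v * (1 + q)) by rewrite !ler_wpM2l // ltW.
have h5 : v * `|w - 1| <= v * q by rewrite ler_wpM2l // ltW.
apply: (le_trans h3); apply: (@le_trans _ _ (v * (3 * q))); last by rewrite mulrC ler_wpM2r // ltW.
have h6 : q * (v * (1 + q)) <= q * (v * 2) by rewrite !ler_wpM2l ?(ltW q0) ?(ltW v0) //; lra.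
by move: (le_trans h1 (le_trans h4 h6)) h5; set B := `|_|; set D := v * `|_|; lra.
Qed.

Lemma smp_head n K h eta ell s : nth n (smp (run a n K h eta ell s)) 0 = n.
Proof.
suff [t ->] : exists t, smp (run a n K h eta ell s) = n :: t by [].
apply: (@run_ind R a n K h eta ell (fun st => exists t, smp st = n :: t)); first by exists [::].
move=> st x [t E] _; rewrite /update; case: ifP => _; first by exists t.
case: ifP => _ /=; first by exists t.
case: ifP => _ /=; first by exists (rcons t x); rewrite E.
by case: ifP => _ /=; exists t.
Qed.

Lemma walk_dsmp n K h eta ell s : (0 < n)%N ->
  let st := run a n K h eta ell s in walk (dsmp n st) = zsmp n st.
Proof.
move=> n0 st; apply/funext => k; have z0 : zsmp n st 0 = 0.
  by rewrite /zsmp smp_head /logjump subrr.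
elim: k => [|k IH]; first by rewrite /walk big_geq.
by rewrite /walk big_nat_recr //= -/(walk _ _) IH /dsmp; ring.
Qed.

Section TestFunction.
Variables (F : (R -> R) -> R) (M : R).
Hypothesis F0 : forall w, 0 <= F w.
Hypothesis FM : forall w, F w <= M.
Hypothesis F_J1 : J1_bounded_continuous F.

Let M0 : 0 <= M. Proof. exact: le_trans (F0 (fun=> 0)) (FM _). Qed.

(** A pathwise comparison. Runs with two exits in a cell, or with too many exits, are charged to the
    last term, which is then at least [M]. The coefficient of [nex] is such that all other runs
    leave [e / 2] for the displaced boundaries in [chain_close], next to [e / 4] for the rates and
    [e / 4] for the overshoots. *)
Lemma step_fct_le_chain k e n K h eta ell o kap (x : nat -> nat) k0 : M <= k -> 0 < e ->
  0 < h -> 0 < eta -> 0 < ell -> 0 <= o -> o < h -> (0 < n)%N -> 0 <= kap ->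
  small_steps a n ell o -> x 0%N = n ->
  (forall i j, `|@logjump R n i| <= ell -> `|@logjump R n j| <= ell ->
      `|@logjump R n i - logjump n j| <= 2 * eta ->
      `|a i / a n - expR (gamma * logjump n j)| <= kap * expR (gamma * logjump n j) /\
      `|i%:R / n%:R - expR (logjump n j)| <= e) ->
  expR (gamma * ell) * (kap * (K%:R * h + o)) <= e / 4 ->
  expR (gamma * ell) * (2 * (K%:R * o)) <= e / 4 ->
  let st := run a n K h eta ell (trace x k0) in
  (completed K st)%:R * step_fct F M k gamma h e^-1 K (walk (dsmp n st)) <=
  F (fun t => (x (Num.truncn (a n * t)))%:R / n%:R) + k * e +
  M * ((h + o) * (4 * expR (gamma * ell) / e) * (nex st)%:R + 1 * (1 < phs st)%N%:R).
Proof.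
move=> Mk e0 h0 eta0 l0 o0 oh n0 kap0 ss x0 reg b1 b2; lazy zeta.
set st := run a n K h eta ell (trace x k0).
have k00 : 0 <= k by exact: le_trans Mk.
have E0 : 0 < expR (gamma * ell) by exact: expR_gt0.
set Y := fun t => _.
have ke0 : 0 <= k * e by rewrite mulr_ge0 // ltW.
have al0 : 0 <= (h + o) * (4 * expR (gamma * ell) / e).
  by rewrite mulr_ge0 ?addr_ge0 ?(ltW h0) // divr_ge0 ?(ltW e0) // mulr_ge0 // ltW.
have bad0 : 0 <= (h + o) * (4 * expR (gamma * ell) / e) * (nex st)%:R + 1 * (1 < phs st)%N%:R.
  by rewrite addr_ge0 // mulr_ge0.
have triv : 0 <= F Y + k * e by rewrite addr_ge0.
have rhs0 : 0 <= F Y + k * e + M * ((h + o) * (4 * expR (gamma * ell) / e) * (nex st)%:R + 1 * (1 < phs st)%N%:R).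
  by rewrite addr_ge0 // mulr_ge0.
have [cst|_] := boolP (completed K st); last by rewrite mul0r.
rewrite (mul1r (step_fct _ _ _ _ _ _ _ _)) walk_dsmp // -/st; set G := step_fct _ _ _ _ _ _ _ _.
have GM : G <= M by exact: step_fct_leM.
have big : 1 <= (h + o) * (4 * expR (gamma * ell) / e) * (nex st)%:R + 1 * (1 < phs st)%N%:R ->
    G <= F Y + k * e + M * ((h + o) * (4 * expR (gamma * ell) / e) * (nex st)%:R + 1 * (1 < phs st)%N%:R).
  move=> h1; apply: (le_trans GM); apply: (@le_trans _ _ (M * ((h + o) * (4 * expR (gamma * ell) / e) * (nex st)%:R + 1 * (1 < phs st)%N%:R))).
    by rewrite -[leLHS]mulr1 ler_wpM2l.
  by rewrite lerDr.
have [ph|ph] : (1 < phs st)%N \/ (phs st <= 1)%N by case: (ltnP 1 (phs st)) => _; [left|right].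
  by apply: big; rewrite ph mulr1 lerDr mulr_ge0.
have [nx|nx] := leP 1 ((h + o) * (4 * expR (gamma * ell) / e) * (nex st)%:R).
  by apply: big; rewrite (le_trans nx) // lerDl mulr_ge0.
have [cl|cl] := leP (step_clock gamma h (zsmp n st) K) e^-1.
  by rewrite /G /step_fct ramp0 // mulr0.
apply: le_trans (_ : F Y + k * e <= _); last by rewrite lerDl mulr_ge0.
apply: le_trans; first exact: step_fct_le_lipreg.
have cY : cadlag Y by exact: (jump_path_cadlag (a_gt0 n) (fun j => (x j)%:R / n%:R)).
apply: le_trans (_ : lipreg F M k Y + k * e <= _); last by rewrite lerD2r lipreg_le.
apply: lipreg_lip => //.
have sz : size (smp st) = K.+1.
  have [_ _ _ /andP[_ i5] _] := inv0_run K eta a_gt0 h0 o0 oh ss (trace x k0).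
  by apply/eqP; rewrite eqn_leq i5.
apply: (chain_close a_gt0 h0 eta0 l0 o0 oh ss x0 gamma_gt0 kap0 e0 _ _ sz) => //.
- by move=> i j il jl ij; have [] := reg i j il jl ij.
- by move=> i j il jl ij; have [] := reg i j il jl ij.
- rewrite -/st; move: b1 b2 nx; set E := expR _; set N := (nex st)%:R; set A := K%:R * h + o; set B := K%:R * o.
  have E0' : 0 < E by [].
  clearbody E N A B => b1 b2.
  rewrite (_ : (h + o) * (4 * E / e) * N = 4 * (E * (N * (h + o))) / e); last by field; rewrite gt_eqF.
  rewrite ltr_pdivrMr // mul1r => nx.
  rewrite (_ : E * (kap * A + 2 * (N * (h + o) + B)) = E * (kap * A) + 2 * (E * (N * (h + o))) + E * (2 * B)); last by ring.
  by move: b1 b2 nx; set u := E * (kap * A); set v := E * (N * _); set w := E * (2 * B); lra.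
Qed.

(** The order of the choices matters: the range [ell], then [kap] and [eta] from regular variation
    on this range, then the drift bound [C] at scale [eta], the mesh, the overshoot [o], and finally
    [n]. Each constant depends only on the earlier ones. *)
Lemma chain_lower k e eps U : M <= k -> 0 < e -> 0 < eps -> exists m0, forall m, (m0 <= m)%N ->
  \forall n \near \oo,
  Ex Q (fun om => step_fct F M k gamma (mesh m) e^-1 (U * 2 ^ m) (walk (incr xi (mesh m) 0 om)))
    - k * e - eps <= Ex P (fun om => F (fun t => (X n (Num.truncn (a n * t)) om)%:R / n%:R)).
Proof.
move=> Mk e0 eps0; have k00 : 0 <= k by exact: le_trans Mk.
have M1 : 0 < M + 1 by exact: ltr_wpDl.
have U1 : 0 < U%:R + 1 :> R by exact: ltr_wpDl.
have a_cvgy := rv_cvgy a_gt0 gamma_gt0 a_rv.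
(* [e1] and [e2] are chosen so that each of the four losses is at most [eps / 4]: the approximation
   error [e3], bad exits, and leaving the range for the chain and for [xi]. *)
pose e1 := eps / (16 * (M + 1) * (U%:R + 1)).
have e10 : 0 < e1 by rewrite divr_gt0 // !mulr_gt0.
pose e2 := eps / (4 * (M + 1)); have e20 : 0 < e2 by rewrite divr_gt0 // mulr_gt0.
have [l1 Hl1] := out_of_range_small Q xi_meas xi_cadlag U e20.
have [l2 l21 Hl2] := lyap_small e10.
pose ell := Num.max l1%:R l2.
have ell1 : l1%:R <= ell by rewrite le_max lexx.
have ell2 : l2 <= ell by rewrite le_max lexx orbT.
have ell0 : 0 < ell by apply: lt_le_trans ell2; apply: lt_le_trans l21.
have [N1 _ HN1] := Hl2 ell ell2.
set E := expR (gamma * ell); have E0 : 0 < E by exact: expR_gt0.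
pose kap := e / (4 * E * (U%:R + 1)).
have kap0 : 0 < kap by rewrite divr_gt0 // !mulr_gt0.
have [eta [N2 [eta0 HN2]]] := local_regularity ell0 kap0 e0.
have [C C0 [N3 _ HN3]] := lyap_bounded eta0.
(* As [o <= h], the weight [al] is at most [8 * E * h / e] and [kap] of [exit_estimate] at most
   [4 * C * h], while [K.+1 * h <= U + 1]. The estimate is then at most [h * D], which [m0] makes
   smaller than [e2]. *)
pose D := (8 * E / e + 4 * C) * (4 * C) * (U%:R + 1).
have D0 : 0 < D.
  by rewrite !mulr_gt0 // addr_gt0 // ?divr_gt0 // mulr_gt0.
have [m0 _ Hm0] := mesh_lt (divr_gt0 e20 D0).
exists m0 => m m0m; have hD : mesh m < e2 / D by exact: Hm0.
set h := mesh m; set K := (U * 2 ^ m)%N.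
have h0 : 0 < h by exact: mesh_gt0.
have h1 : h <= 1.
  by rewrite /h /mesh invf_le1 ?ltr0n ?expn_gt0 // ler1n expn_gt0.
have Kh : K%:R * h = U%:R by exact: mesh_mulr.
pose o := Num.min (h / 2) (e / (8 * E * (K%:R + 1))).
have K10 : 0 < K%:R + 1 :> R by exact: ltr_wpDl.
have o0 : 0 < o by rewrite lt_min divr_gt0 // divr_gt0 // !mulr_gt0.
have oh2 : o <= h / 2 by rewrite ge_min lexx.
have oh : o < h by apply: (le_lt_trans oh2); rewrite ltr_pdivrMr // ltr_pMr // ltr1n.
have o1 : o <= 1 by exact: le_trans (ltW oh) h1.
have oe : E * (2 * (K%:R * o)) <= e / 4.
  apply: (@le_trans _ _ (2 * E * (K%:R + 1) * o)).
    rewrite (_ : E * _ = 2 * E * K%:R * o); last by ring.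
    by rewrite ler_pM2r // ler_wpM2l ?mulr_ge0 ?(ltW E0) // lerDl.
  apply: (@le_trans _ _ (2 * E * (K%:R + 1) * (e / (8 * E * (K%:R + 1))))).
    by rewrite ler_pM2l ?mulr_gt0 // ge_min lexx orbT.
  by rewrite le_eqVlt; apply/orP; left; apply/eqP; field; rewrite !gt_eqF.
have kape : E * (kap * (K%:R * h + o)) <= e / 4.
  rewrite Kh; apply: (@le_trans _ _ (E * (kap * (U%:R + 1)))).
    by rewrite !ler_pM2l // lerD2l.
  by rewrite le_eqVlt; apply/orP; left; apply/eqP; rewrite /kap; field; rewrite !gt_eqF.
pose e3 := Num.min (eps / 4) 1; have e30 : 0 < e3 by rewrite lt_min ltr01 divr_gt0.
pose G := fun x => step_fct F M k gamma h e^-1 K (walk x).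
have G0 x : 0 <= G x by exact: step_fct_ge0.
have GM x : G x <= M by exact: step_fct_leM.
have cG : cfun K G by exact: cfun_step_fct.
have Gu e' : 0 < e' -> exists2 dl, 0 < dl & forall x y : nat -> R,
   (forall i, (i < K)%N -> [/\ `|x i| <= 2 * ell, `|y i| <= 2 * ell & `|x i - y i| <= dl]) -> `|G x - G y| <= e'.
  by apply: step_fct_unif => //; rewrite mulr_ge0 // ltW.
have [N4 _ HN4] := fdd_lower p_ge0 p_sum1 a_gt0 a_cvgy nu_re nu_im xi_meas xi0 xi_cos xi_sin xi_ind xi_stat mc
  h0 ell0 G0 GM cG Gu e30.
near=> n.
have n0 : (0 < n)%N by near: n; exists 1%N.
have nN2 : (N2 <= n)%N by near: n; exists N2.
have nN4 : (N4 <= n)%N by near: n; exists N4.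
have [ss big] : small_steps a n ell o /\ forall x, `|logjump n x| <= ell -> (maxn (maxn N1 N2) N3 <= x)%N.
  by near: n; exact: near_small_steps.
have [k0 stops] := run_stops K eta a_gt0 n0 h0 (ltW o0) oh ss.
pose rn om := run a n K h eta ell (trail X n k0 om).
have nr om : ~~ running n K ell (rn om) by apply: stops; rewrite size_trail.
have fddn : Ex Q (fun om => G (incr xi h 0 om)) - e3
    - M * fine (Q [set om | exists2 i, (i <= K)%N & ell < `|xi (i%:R * h) om|])
    - M * (1 + e3) * Ex P (fun om => (ell < `|@logjump R n (pos (rn om))|)%R%:R)
    <= Ex P (fun om => (completed K (rn om))%:R * G (dsmp n (rn om))).
  exact: HN4 nN4 eta k0 eta0 nr.
have outP : Ex P (fun om => (ell < `|@logjump R n (pos (rn om))|)%R%:R) <= 2 * (e1 * (U%:R + 1)).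
  have := range_estimate K eta p_ge0 p_sum1 a_gt0 n0 h0 ell0 (ltW o0) oh ss mc k0 (ltW e10).
  rewrite Kh => re'; apply: (@le_trans _ _ (2 * (e1 * (U%:R + o)))); last first.
    by rewrite !ler_pM2l // lerD2l.
  have bl : bounded_mfun (fun om => lyap (@logjump R n (pos (rn om)) / ell)).
    apply: (bmfun_run mc (W := fun st => lyap (logjump n (pos st) / ell)) (M := 1) k0) => s.
    by rewrite ger0_norm ?lyap_ge0 // lyap_le1.
  apply: le_trans (_ : 2 * Ex P (fun om => lyap (@logjump R n (pos (rn om)) / ell)) <= _); last first.
    rewrite ler_pM2l //; apply: re' => x y xl; apply: HN1 => /=.
    by have := big x xl; rewrite !geq_max => /andP[/andP[]].
  rewrite -ExZ //; apply: Ex_le; last 2 first.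
  - exact: bmfunZ.
  - move=> om; case: ltP => hl /=; last by rewrite mulr_ge0 // lyap_ge0.
    have h3 : 1 <= `|@logjump R n (pos (rn om)) / ell|.
      by rewrite normrM normfV (gtr0_norm ell0) ler_pdivlMr // mul1r ltW.
    by have := lyap_ge h3; rewrite ler_pdivrMr // mulrC.
  - apply: (bmfun_run mc (W := fun st => (ell < `|logjump n (pos st)|)%R%:R) (M := 1) k0) => s.
    by rewrite ger0_norm //; case: (_ < _).
have outQ : fine (Q [set om | exists2 i, (i <= K)%N & ell < `|xi (i%:R * h) om|]) <= e2 by exact: Hl1.
pose al := (h + o) * (4 * E / e).
have al0 : 0 <= al by rewrite mulr_ge0 ?addr_ge0 ?(ltW h0) ?(ltW o0) // divr_ge0 ?(ltW e0) // mulr_ge0 // ltW.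
have exits : Ex P (fun om => al * (nex (rn om))%:R + 1 * (1 < phs (rn om))%N%:R) <= e2.
  have lyC x y : `|@logjump R n x| <= ell -> nu p a x (lyap_jump_fct eta y) <= C.
    by move=> xl; apply: HN3 => /=; have := big x xl; rewrite !geq_max => /andP[].
  apply: le_trans (exit_estimate K p_ge0 p_sum1 a_gt0 n0 h0 eta0 (ltW o0) oh ss mc (ltW C0) lyC al0 ler01 k0) _.
  have hb : h + o <= 2 * h by rewrite mulr_natl mulr2n lerD2l ltW.
  have ho0 : 0 <= h + o by rewrite addr_ge0 // ltW.
  have q1 : al <= h * (8 * E / e).
    rewrite (_ : h * _ = 2 * h * (4 * E / e)); last by field; rewrite gt_eqF.
    by rewrite ler_wpM2r // divr_ge0 ?(ltW e0) // mulr_ge0 // ltW.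
  have q2 : 2 * C * (h + o) <= h * (4 * C).
    rewrite (_ : h * (4 * C) = 2 * C * (2 * h)); last by ring.
    by rewrite ler_wpM2l // mulr_ge0 // ltW.
  have C2 : 0 <= 2 * C * (h + o) by rewrite !mulr_ge0 // ltW.
  apply: (@le_trans _ _ (h * D)); last by rewrite -ler_pdivlMr // ltW.
  apply: (@le_trans _ _ (h * (8 * E / e + 4 * C) * (h * (4 * C)) * K.+1%:R)).
    apply: ler_wpM2r => //; apply: ler_pM => //; first by rewrite mul1r addr_ge0.
    by rewrite (mul1r (2 * C * (h + o))) [leRHS]mulrDr lerD.
  rewrite (_ : _ * _ * _ = h * ((8 * E / e + 4 * C) * (4 * C) * (K.+1%:R * h))); last by ring.
  rewrite ler_pM2l // /D ler_wpM2l.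
  - by [].
  - have C4 : 0 <= 4 * C by rewrite mulr_ge0 // ltW.
    have E8 : 0 <= 8 * E / e by apply: divr_ge0 (ltW e0); rewrite mulr_ge0 // ltW.
    exact: (mulr_ge0 (addr_ge0 E8 C4) C4).
  - by rewrite -natr1 mulrDl mul1r Kh lerD2l.
have bF : bounded_mfun (fun om => F (fun t => (X n (Num.truncn (a n * t)) om)%:R / n%:R)).
  exact: (bmfun_chain mc n (a_gt0 n) F_J1).
have mX0 : measurable [set om | X n 0%N om = n] by exact: (measurable_X mc).
have bX0 := bmfun_indic R (measurableC mX0).
have X00 : Ex P (\1_(~` [set om | X n 0%N om = n])) = 0.
  rewrite Ex_indic; last exact: measurableC.
  by rewrite probability_setC // (X0_ae mc n0) -EFinB subrr.
have bnex : bounded_mfun (fun om => al * (nex (rn om))%:R + 1 * (1 < phs (rn om))%N%:R).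
  apply: (bmfun_run mc (W := fun st => al * (nex st)%:R + 1 * (1 < phs st)%N%:R) (M := al * K.+2%:R + 1) k0) => s.
  have [_ _ _ /andP[_ i5] i6] := inv0_run K eta a_gt0 h0 (ltW o0) oh ss s.
  rewrite ger0_norm; last by apply: addr_ge0; exact: mulr_ge0.
  apply: lerD.
    rewrite ler_wpM2l // ler_nat (leq_trans (ltnW i6)) // -addn1 leq_add //.
    by case: (_ != _).
  by rewrite mul1r; case: (_ < _)%N.
have cb (b : bool) x : 0 <= b%:R * G x <= M.
  by move: (G0 x) (GM x); case: b => g0 gM; rewrite ?mul1r ?mul0r ?g0 ?lexx.
have bMG : bounded_mfun (fun om => (completed K (rn om))%:R * G (dsmp n (rn om))).
  apply: (bmfun_run mc (W := fun st => (completed K st)%:R * G (dsmp n st)) (M := M) k0) => s.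
  by have /andP[g0 gM] := cb (completed K (run a n K h eta ell s)) (dsmp n (run a n K h eta ell s)); rewrite ger0_norm.
have upper : Ex P (fun om => (completed K (rn om))%:R * G (dsmp n (rn om))) <=
   Ex P (fun om => F (fun t => (X n (Num.truncn (a n * t)) om)%:R / n%:R)) + k * e + M * e2.
  pose V om := F (fun t => (X n (Num.truncn (a n * t)) om)%:R / n%:R) + k * e +
     M * (al * (nex (rn om))%:R + 1 * (1 < phs (rn om))%N%:R) + M * \1_(~` [set om | X n 0%N om = n]) om.
  have bV1 := bmfunD bF (bmfun_cst Om (k * e)).
  have bV2 := bmfunZ M bnex.
  have bV3 := bmfunZ M bX0.
  have bV12 := bmfunD bV1 bV2.
  have bV : bounded_mfun V by exact: bmfunD.
  apply: (@le_trans _ _ (Ex P V)).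
    apply: Ex_le => // om; rewrite /V.
    have [x0|x0] := pselect (X n 0%N om = n).
      have le1 := step_fct_le_chain (K := K) (x := fun j => X n j om) k0 Mk e0 h0 eta0 ell0 (ltW o0) oh n0 (ltW kap0) ss x0
        _ kape oe.
      apply: le_trans (le1 _) _ => [i j il jl ij|].
        apply: (HN2 n nN2 n0) => // x xl.
        have [ssx _] := ss x xl; split => //.
        by have := big x xl; rewrite !geq_max => /andP[/andP[]].
      by rewrite lerDl mulr_ge0 // indicE.
    rewrite indicE mem_set // mulr1.
    apply: (@le_trans _ _ M); first by have /andP[] := cb (completed K (rn om)) (dsmp n (rn om)).
    rewrite lerDr; apply: addr_ge0.
      by apply: addr_ge0; rewrite ?F0 // mulr_ge0 // ltW.
    by apply: mulr_ge0 => //; apply: addr_ge0; exact: mulr_ge0.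
  rewrite /V ExD // ExZ // X00 mulr0 addr0 ExD // ExZ // ExD //; last exact: bmfun_cst.
  by rewrite Ex_cst lerD2l ler_wpM2l.
have e3eps : e3 <= eps / 4 by rewrite ge_min lexx.
have e31 : e3 <= 1 by rewrite ge_min lexx orbT.
have Me2 : M * e2 <= eps / 4.
  apply: (@le_trans _ _ ((M + 1) * e2)); first by rewrite ler_pM2r // lerDl.
  by rewrite le_eqVlt; apply/orP; left; apply/eqP; rewrite /e2; field; rewrite !gt_eqF.
have Mq : M * fine (Q [set om | exists2 i, (i <= K)%N & ell < `|xi (i%:R * h) om|]) <= eps / 4.
  by apply: le_trans Me2; rewrite ler_wpM2l.
have Mp : M * (1 + e3) * Ex P (fun om => (ell < `|@logjump R n (pos (rn om))|)%R%:R) <= eps / 4.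
  apply: (@le_trans _ _ (M * 2 * (2 * (e1 * (U%:R + 1))))).
    apply: ler_pM => //.
    - by rewrite mulr_ge0 // addr_ge0 // ltW.
    - exact: Ex_ge0.
    - by rewrite ler_wpM2l // -[2]/(1 + 1) lerD2l.
  apply: (@le_trans _ _ ((M + 1) * 2 * (2 * (e1 * (U%:R + 1))))).
    have eU : 0 <= e1 * (U%:R + 1) by exact: (mulr_ge0 (ltW e10) (ltW U1)).
    by apply: ler_wpM2r; [exact: mulr_ge0|rewrite ler_pM2r // lerDl].
  by rewrite le_eqVlt; apply/orP; left; apply/eqP; rewrite /e1; field; rewrite !gt_eqF.
move: fddn upper Mq Mp Me2; rewrite /G.
set q1 := Ex Q _; set q2 := fine (Q _); set q3 := Ex P _; set q4 := Ex P _; set q5 := Ex P _.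
set u1 := M * q2; set u2 := M * _ * q3; set u3 := k * e; set u4 := M * e2.
by clearbody q1 q4 q5 u1 u2 u3 u4 => g1 g2 g3 g4 g5; lra.
Unshelve. all: by end_near. Qed.

End TestFunction.

Variable A : set Om'.
Hypothesis mA : measurable A.
Hypothesis QA : Q A = 0%E.
Hypothesis clock_infty : forall om, ~ A om -> lamperti_Iinf gamma (xi ^~ om) = +oo%E.

Lemma Ex_chain_ge (F : (R -> R) -> R) M eps : (forall w, 0 <= F w) -> (forall w, F w <= M) ->
  J1_bounded_continuous F -> 0 < eps -> \forall n \near \oo,
  Ex Q (fun om => \1_(~` A) om * F (lamperti gamma (xi ^~ om))) - eps <=
  Ex P (fun om => F (fun t => (X n (Num.truncn (a n * t)) om)%:R / n%:R)).
Proof.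
move=> F0 FM FJ eps0; have eps4 : 0 < eps / 4 by rewrite divr_gt0.
have [bL cL] := Ex_lipreg_cvg gamma_gt0 xi_meas xi0 xi_cadlag mA QA clock_infty F0 FM FJ.
have [k0 k0M hk] := cvg_ge_near (Num.truncn M) cL eps4.
pose k : R := k0.+1%:R; have k_gt0 : 0 < k by rewrite ltr0n.
have Mk : M <= k by apply: (le_trans (ltW (truncnS_gt M))); rewrite ler_nat ltnS.
pose e := eps / 4 / k; have e0 : 0 < e by rewrite divr_gt0.
have ke : k * e = eps / 4 by rewrite /e mulrC divfK // gt_eqF.
have low U := chain_lower F0 FM FJ U Mk e0 eps4.
have [m0 hm0] := choice low.
(* A diagonal choice: the horizon [i] is paired with a mesh fine enough for [chain_lower], and
   horizon and refinement both tend to infinity. *)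
pose ms i := maxn i (m0 i); have msi i : (i <= ms i)%N by exact: leq_maxl.
have [_ cS] := Ex_step_fct_cvg gamma_gt0 xi_meas xi0 xi_cadlag mA QA clock_infty F0 FM e^-1 Mk msi.
have [i _ hi] := cvg_ge_near 0 cS eps4.
apply: filterS (hm0 i (ms i) (leq_maxr _ _)) => n; apply: le_trans.
move: hk hi; rewrite ke -/k; set q1 := Ex Q _; set q2 := Ex Q _; set q3 := Ex Q _.
by clearbody q1 q2 q3; lra.
Qed.

End ChainLower.

(** * Convergence *)

Lemma J1_bounded_continuous_affine (R : realType) (F : (R -> R) -> R) (s c : R) :
  J1_bounded_continuous F -> J1_bounded_continuous (fun w => c + s * F w).
Proof.
move=> [[M FM] [Fe Fc]]; split; [|split].
- exists (`|c| + `|s| * M) => w; apply: (le_trans (ler_normD _ _)).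
  by rewrite lerD2l normrM ler_wpM2l.
- by move=> w w' ww; rewrite (Fe w w').
- move=> wk w cwk cw j1; have c1 := Fc wk w cwk cw j1.
  apply: cvgD; first exact: cvg_cst.
  by apply: cvgM; [exact: cvg_cst|exact: c1].
Qed.

Theorem theorem1 (R : realType)
  (p : nat -> nat -> R) (a : nat -> R) (gamma : R)
  (Pi : {measure set R -> \bar R}) (b sigma2 : R)
  (d : measure_display) (Om : measurableType d) (P : probability Om R)
  (X : nat -> nat -> Om -> nat)
  (d' : measure_display) (Om' : measurableType d') (Q : probability Om' R)
  (xi : R -> Om' -> R) :
  (* transition probabilities on N = {1,2,...} *)
  (forall i j, 0 <= p i j) ->
  (forall i, (0 < i)%N -> (fun m => \sum_(1 <= j < m) p i j) @ \oo --> (1 : R)) ->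
  (* a regularly varying with index gamma > 0 *)
  (forall n, 0 < a n) -> 0 < gamma ->
  (forall x, 0 < x ->
     (fun n => a (Num.truncn (x * n%:R)) / a n) @ \oo --> powR x gamma) ->
  (* the Levy measure Pi on R \ {0} *)
  Pi [set 0] = 0%E -> Pi [set -1; 1] = 0%E ->
  (\int[Pi]_x (Num.min 1 (x ^+ 2))%:E < +oo)%E ->
  (* (A1) *)
  (forall f : R -> R,
     {within `[0, +oo[, continuous f} -> cvg (f x @[x --> +oo]) ->
     (exists2 e, 0 < e & forall x, `|x - 1| < e -> f x = 0) ->
     (fun n => a n * psum p n (fun k => f (k%:R / n%:R))) @ \oo
       --> Rintegral Pi setT (fun x => f (expR x))) ->
  (* (A2) *)
  0 <= sigma2 ->
  (fun n => a n * psum p n (fun k =>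
       if `|@logjump R n k| <= 1 then @logjump R n k else 0)) @ \oo --> b ->
  (fun n => a n * psum p n (fun k =>
       if `|@logjump R n k| <= 1 then @logjump R n k ^+ 2 else 0)) @ \oo
     --> sigma2 + Rintegral Pi `[-1, 1] (fun x => x ^+ 2) ->
  (* the chains and the Levy process *)
  markov_chains P p X ->
  levy_process Q xi Pi b sigma2 ->
  (* xi does not drift to -oo *)
  ~ {ae Q, forall om, xi t om @[t --> +oo] --> -oo} ->
  (* convergence in distribution in D(R_+, R) with the J1 topology *)
  forall F : (R -> R) -> R, J1_bounded_continuous F ->
    (fun n => \int[P]_om
        (F (fun t => (X n (Num.truncn (a n * t)) om)%:R / n%:R))%:E)%E @ \oo
    --> (\int[Q]_om (F (lamperti gamma (xi ^~ om)))%:E)%E.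
Proof.
move=> p_ge0 p_sum1 a_gt0 gamma_gt0 a_rv _ Pi1 Pi_fin A1 sigma2_ge0 A2b A2s mc.
move=> [xi_meas [xi0 [xi_cadlag [xi_ind [xi_stat xi_cf]]]]] nodrift F FJ.
have [A [mA QA clock_infty]] :=
  infinite_clock gamma_gt0 xi_meas xi0 xi_cadlag xi_ind xi_stat nodrift.
have bcos t lam : bounded_mfun (fun om => cos (lam * xi t om)).
  apply: (bmfun_comp (g := cos) (M := 1)) => //.
  - by apply: continuous_measurable_fun; exact: continuous_cos.
  - by move=> y; rewrite ler_norml cos_geN1 cos_le1.
  - exact: measurable_funM.
have bsin t lam : bounded_mfun (fun om => sin (lam * xi t om)).
  apply: (bmfun_comp (g := sin) (M := 1)) => //.
  - by apply: continuous_measurable_fun; exact: continuous_sin.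
  - by move=> y; rewrite ler_norml sin_geN1 sin_le1.
  - exact: measurable_funM.
have xi_cos t lam : 0 <= t -> Ex Q (fun om => cos (lam * xi t om)) =
    expR (t * RePhi Pi sigma2 lam) * cos (t * ImPhi Pi b lam).
  by move=> t0; have [+ _] := xi_cf t lam t0; rewrite -(ExE Q (bcos t lam)) => -[].
have xi_sin t lam : 0 <= t -> Ex Q (fun om => sin (lam * xi t om)) =
    expR (t * RePhi Pi sigma2 lam) * sin (t * ImPhi Pi b lam).
  by move=> t0; have [_ +] := xi_cf t lam t0; rewrite -(ExE Q (bsin t lam)) => -[].
have low (F' : (R -> R) -> R) M eps : (forall w, 0 <= F' w) -> (forall w, F' w <= M) ->
    J1_bounded_continuous F' -> 0 < eps -> \forall n \near \oo,
    Ex Q (fun om => \1_(~` A) om * F' (lamperti gamma (xi ^~ om))) - eps <=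
    Ex P (fun om => F' (fun t => (X n (Num.truncn (a n * t)) om)%:R / n%:R)).
  apply: (@Ex_chain_ge _ _ _ P _ _ Q p a (RePhi Pi sigma2) (ImPhi Pi b)) => //.
  - by apply: nu_cos.
  - exact: (nu_sin p_ge0 p_sum1 a_gt0 Pi1 Pi_fin A1 sigma2_ge0 A2b A2s).
  - exact: (nu_lyap_bounded p_ge0 p_sum1 a_gt0 Pi1 Pi_fin A1 sigma2_ge0 A2b A2s).
  - exact: (nu_lyap_small p_ge0 p_sum1 a_gt0 Pi1 Pi_fin A1 sigma2_ge0 A2b A2s).
have [[B FB] _] := FJ.
(* [Ex_lipreg_cvg] is about nonnegative functionals; it is applied to [B + F], and the constant is
   subtracted afterwards. *)
have [bFL _] : bounded_mfun (fun om => \1_(~` A) om * F (lamperti gamma (xi ^~ om))) /\ True.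
  have [bg _] := Ex_lipreg_cvg (M := B + B) gamma_gt0 xi_meas xi0 xi_cadlag mA QA clock_infty
    (F := fun w => B + 1 * F w)
    (fun w => ltac:(have := FB w; rewrite ler_norml => /andP[]; lra))
    (fun w => ltac:(have := FB w; rewrite ler_norml => /andP[]; lra))
    (J1_bounded_continuous_affine 1 B FJ).
  have bA := bmfunZ B (bmfun_indic R (measurableC mA)).
  split => //; have := bmfunB bg bA; congr bounded_mfun; apply/funext => om; ring.
pose L := Ex Q (fun om => \1_(~` A) om * F (lamperti gamma (xi ^~ om))).
(* On [A] the clock may be finite and nothing is known about the Lamperti path; the integrand is
   replaced there by 0. *)
rewrite (@integral_off_null _ _ _ Q A _ (fun om => \1_(~` A) om * F (lamperti gamma (xi ^~ om))) B) //; last 2 first.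
- by move=> om nA; rewrite indicE mem_set // mul1r.
- by move=> om yA; rewrite indicE memNset ?mul0r // => /(_ yA).
have bY n : bounded_mfun (fun om => F (fun t => (X n (Num.truncn (a n * t)) om)%:R / n%:R)).
  exact: (bmfun_chain mc n (a_gt0 n) FJ).
pose Y n := Ex P (fun om => F (fun t => (X n (Num.truncn (a n * t)) om)%:R / n%:R)).
rewrite (_ : (fun n => _) = fun n => (Y n)%:E); last by apply/funext => n; rewrite -ExE.
apply: cvg_EFin; first exact: nearW.
suff : Y @ \oo --> L by [].
have aff s (eps : R) : `|s| = 1 -> 0 < eps -> \forall n \near \oo, s * L - eps <= s * Y n.
  move=> s1 eps0; have sF w : - B <= s * F w <= B by rewrite -ler_norml normrM s1 mul1r.
  have F0 w : 0 <= B + s * F w by have /andP[] := sF w; lra.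
  have FM w : B + s * F w <= B + B by have /andP[] := sF w; lra.
  have := low _ _ _ F0 FM (J1_bounded_continuous_affine s B FJ) eps0.
  have -> : Ex Q (fun om => \1_(~` A) om * (B + s * F (lamperti gamma (xi ^~ om)))) = B + s * L.
    rewrite -[X in X + _](Ex_cst Q) -(Ex_off_null mA QA (bmfun_cst _ B)) -ExZ // -ExD.
    - by apply: eq_Ex => om; ring.
    - exact: (bmfunM (bmfun_indic R (measurableC mA)) (bmfun_cst _ B)).
    - exact: bmfunZ.
  apply: filterS => n.
  rewrite (ExD P (bmfun_cst _ B) (bmfunZ s (bY n))) Ex_cst ExZ // -/(Y n); lra.
apply/cvgrPdist_le => eps eps0; near=> n.
have h1 : 1 * L - eps <= 1 * Y n by near: n; apply: aff => //; rewrite normr1.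
have h2 : - 1 * L - eps <= - 1 * Y n by near: n; apply: aff => //; rewrite normrN1.
by rewrite ler_norml; apply/andP; split; lra.
Unshelve. all: by end_near. Qed.
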